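(* Let $N\ge1$ and let $\phi,\psi$ be norms on $\mathbb{R}^{N+1}$. For every $e\in\mathbb{S}^{N-1}$ there exists a complete graphical translator $\partial E$ (with $\partial E_t=\partial E+t\,e_{N+1}$) for the anisotropic mean curvature flow with surface tension $\phi$ and mobility $\psi$, given by the graph of a function $v_e(x):=u_e(x\cdot e)$, where $u_e:I\to\mathbb{R}$ is a convex function and $I$ is an interval.
   Context: Points of $\mathbb{R}^{N+1}$ are written $(x,z)$, $x\in\mathbb{R}^N$, $z\in\mathbb{R}$; $e_{N+1}=(0,1)$; $\mathbb{S}^{N-1}$ is the unit sphere of $\mathbb{R}^N$. The function $v_e$ is defined on $\{x\in\mathbb{R}^N: x\cdot e\in I\}$. A norm $\varphi$ on $\mathbb{R}^{N+1}$ is called regular if $\varphi\in C^2(\mathbb{R}^{N+1}\setminus\{0\})$ and $\varphi^2$ is uniformly convex, i.e. $\nabla^2(\varphi^2)\ge\lambda\,\mathrm{Id}$ away from $0$ for some $\lambda>0$. Flow: the anisotropic mean curvature flow is $\partial_t p\cdot\nu(p)=-\psi(\nu(p))H_\phi(p,E_t)$, $p\in\partial E_t$, with $\nu$ the unit normal and anisotropic mean curvature $H_\phi(p,E)=\mathrm{div}_\tau(\nabla\phi(\nu(p)))$ if $\phi$ is regular, and $H_\phi(p,E)\in\mathrm{div}_\tau(\partial\phi(\nu(p)))$ ($\partial\phi$ the subdifferential, $\mathrm{div}_\tau$ the tangential divergence) in general. For regular $\phi$ and $C^2$ functions $v$, the graph of $v$ translates with velocity $e_{N+1}$ iff $-\psi(-\nabla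 v,1)\,\mathrm{div}(\nabla_x\phi(-\nabla v,1))=1$. Notion of solution (level set sense): for a uniformly continuous $U_0:\mathbb{R}^{N+1}\to\mathbb{R}$, let $U$ be the unique continuous (distributional) solution of $U_t=\psi(\nabla U)\,\mathrm{div}(\nabla\phi(\nabla U))$, $U(\cdot,0)=U_0$; it is known that it exists and coincides with the locally uniform limit of the viscosity solutions of $\partial_tU_n=\psi(\nabla U_n)\,\mathrm{div}(\nabla\phi_n(\nabla U_n))$, $U_n(\cdot,0)=U_0$, for any regular norms $\phi_n\to\phi$ locally uniformly (if $\phi$ is regular, $U$ is itself the viscosity solution). A family of hypersurfaces $\partial E_t$, $t\ge0$, is a solution to the flow if there is a uniformly continuous $U_0$ with $E_0=\{U_0\le0\}$, $\partial E_0=\{U_0=0\}$, and $\partial E_t=\{U(\cdot,t)=0\}$ for all $t\ge0$. A complete graphical translator is a solution of the form $\partial E_t=\partial E_0+ct\,e_{N+1}$, $c\in\mathbb{R}$, where $\partial E_0$ is a complete hypersurface which is the graph of a function on an open set $\Omega\subseteq\mathbb{R}^N$; the normalization $c=1$ is used. Here ''graph of the convex function $v_e$'' is understood as the boundary of the closure of the epigraph $\{(x,z): x\cdot e\in I,\ z\ge v_e(x)\}$, so that if $u_e$ stays bounded at an endpoint of $I$ (as may happen for nonregular $\phi$), vertical half-hyperplanes above the corresponding boundary are included. *)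

(* Defs.v *)
From HB Require Import structures.
From mathcomp Require Import all_boot all_order all_algebra.
From mathcomp Require Import all_classical all_reals all_analysis.

Set Implicit Arguments.
Unset Strict Implicit.
Unset Printing Implicit Defensive.

Import Order.TTheory GRing.Theory Num.Theory.
Import numFieldNormedType.Exports.

Local Open Scope classical_set_scope.
Local Open Scope ring_scope.

Section calculus.
Context {R : realType}.

Definition dot n (v w : 'rV[R]_n) : R := \sum_(i < n) v 0 i * w 0 i.

(* In finite dimension, continuity of all directional derivatives is the usual
   C^1 condition, and implies Frechet differentiability. *)
Definition is_C1 (V : normedModType R) (A : set V) (f : V -> R^o) :=
  forall p, A p -> forall v : V,
    derivable f p v /\ {for p, continuous (fun q => 'D_v f q : R^o)}.

Definition is_C2 (V : normedModType R) (A : set V) (f : V -> R^o) :=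
  is_C1 A f /\ forall v : V, is_C1 A (fun q => 'D_v f q).

Definition grad n (f : 'rV[R]_n -> R^o) (p : 'rV[R]_n) : 'rV[R]_n :=
  \row_(i < n) 'D_(delta_mx 0 i) f p.

Definition hess n (f : 'rV[R]_n -> R^o) (p : 'rV[R]_n) : 'M[R]_n :=
  \matrix_(i < n, j < n)
    'D_(delta_mx 0 j) (fun q => 'D_(delta_mx 0 i) f q : R^o) p.

Definition is_norm n (phi : 'rV[R]_n -> R) :=
  [/\ forall p, phi p = 0 -> p = 0,
      forall (a : R) p, phi (a *: p) = `|a| * phi p &
      forall p q, phi (p + q) <= phi p + phi q].

Definition regular_norm n (phi : 'rV[R]_n -> R) :=
  [/\ is_norm phi,
      is_C2 [set p | p != 0] phi &
      exists2 lambda : R, 0 < lambda & forall p xi : 'rV[R]_n, p != 0 ->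
        lambda * dot xi xi <= dot (xi *m hess (fun q => phi q ^+ 2) p) xi].

End calculus.

Section level_set_flow.
Context {R : realType} {n : nat}.
Implicit Types (phi psi : 'rV[R]_n -> R) (U : 'rV[R]_n * R -> R).

(* By the chain rule,
   flow_operator phi psi (grad f p, hess f p)
     = psi (grad f p) * div (grad phi (grad f)) p   when grad f p != 0. *)
Definition flow_operator phi psi (pX : 'rV[R]_n * 'M[R]_n) : \bar R :=
  (psi pX.1 * \tr (hess phi pX.1 *m pX.2))%:E.

(* The operator is undefined at zero gradient: viscosity solutions are defined
   through its semicontinuous envelopes, which agree with it elsewhere. *)
Definition usc_operator phi psi (pX : 'rV[R]_n * 'M[R]_n) : \bar R :=
  limf_esup (flow_operator phi psi) (within [set qY | qY.1 != 0] (nbhs pX)).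

Definition lsc_operator phi psi (pX : 'rV[R]_n * 'M[R]_n) : \bar R :=
  limf_einf (flow_operator phi psi) (within [set qY | qY.1 != 0] (nbhs pX)).

Definition spatial_jet (eta : 'rV[R]_n * R -> R) (p : 'rV[R]_n) (t : R) :=
  (grad (fun q => eta (q, t)) p, hess (fun q => eta (q, t)) p).

Definition viscosity_subsolution phi psi U :=
  forall eta : 'rV[R]_n * R -> R, is_C2 setT eta ->
  forall (p : 'rV[R]_n) (t : R), 0 < t ->
  (\forall q \near (p, t), U q - eta q <= U (p, t) - eta (p, t)) ->
  ((derive1 (fun s => eta (p, s) : R^o) t)%:E
     <= usc_operator phi psi (spatial_jet eta p t))%E.

Definition viscosity_supersolution phi psi U :=
  forall eta : 'rV[R]_n * R -> R, is_C2 setT eta ->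
  forall (p : 'rV[R]_n) (t : R), 0 < t ->
  (\forall q \near (p, t), U (p, t) - eta (p, t) <= U q - eta q) ->
  (lsc_operator phi psi (spatial_jet eta p t)
     <= (derive1 (fun s => eta (p, s) : R^o) t)%:E)%E.

Definition nonneg_times : set ('rV[R]_n * R) := [set q | 0 <= q.2].

(* Values of U at negative times are irrelevant. *)
Definition viscosity_solution phi psi (U0 : 'rV[R]_n -> R) U :=
  [/\ {within nonneg_times, continuous U},
      forall p, U (p, 0) = U0 p,
      viscosity_subsolution phi psi U &
      viscosity_supersolution phi psi U].

(* For a general norm phi the equation is singular, and its solution is the
   locally uniform limit of the viscosity solutions associated with arbitrary
   regular norms converging to phi. *)
Definition level_set_solution phi psi (U0 : 'rV[R]_n -> R) U :=
  [/\ {within nonneg_times, continuous U},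
      forall p, U (p, 0) = U0 p &
      forall phi_ : nat -> 'rV[R]_n -> R,
        (forall k, regular_norm (phi_ k)) ->
        {family compact, phi_ @ \oo --> phi} ->
        exists U_ : nat -> 'rV[R]_n * R -> R,
          (forall k, viscosity_solution (phi_ k) psi U0 (U_ k)) /\
          (forall K, compact K -> K `<=` nonneg_times ->
             {uniform K, U_ @ \oo --> U})].

Definition bd (A : set 'rV[R]_n) : set 'rV[R]_n := closure A `\` interior A.

Definition is_flow phi psi (E : R -> set 'rV[R]_n) :=
  exists (U0 : 'rV[R]_n -> R) (U : 'rV[R]_n * R -> R),
    [/\ unif_continuous U0,
        E 0 = [set p | U0 p <= 0],
        bd (E 0) = [set p | U0 p = 0],
        level_set_solution phi psi U0 U &
        forall t, 0 <= t -> bd (E t) = [set p | U (p, t) = 0]].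

(* Nonempty, without boundary, locally the graph of a continuous function over
   a hyperplane {q | dot q w = 0}; completeness amounts to being closed. *)
Definition complete_hypersurface (S : set 'rV[R]_n) :=
  [/\ S !=set0, closed S &
      forall p, S p -> exists (w : 'rV[R]_n) (g : 'rV[R]_n -> R),
        dot w w = 1 /\
        \forall q \near p,
          {for q - dot q w *: w, continuous g} /\
          (S q <-> dot q w = g (q - dot q w *: w))].

End level_set_flow.

Section translators.
Context {R : realType} {N : nat}.

(* R^(N+1) = R^N x R, with point x z for (x, z). *)
Definition point (x : 'rV[R]_N) (z : R) : 'rV[R]_(N + 1) := row_mx x z%:M.

Definition epigraph (Omega : set 'rV[R]_N) (v : 'rV[R]_N -> R) :
    set 'rV[R]_(N + 1) :=
  [set p | exists x z, [/\ p = point x z, Omega x & v x <= z]].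

(* When v stays bounded at a boundary point of Omega, this contains the
   vertical half-line above it. *)
Definition full_graph (Omega : set 'rV[R]_N) (v : 'rV[R]_N -> R) :
    set 'rV[R]_(N + 1) :=
  bd (closure (epigraph Omega v)).

(* Only the values of v on Omega matter; the speed is normalized to 1. *)
Definition complete_graphical_translator (phi psi : 'rV[R]_(N + 1) -> R)
    (Omega : set 'rV[R]_N) (v : 'rV[R]_N -> R)
    (E : R -> set 'rV[R]_(N + 1)) :=
  [/\ is_flow phi psi E,
      forall t, 0 <= t -> bd (E t) = [set p + point 0 t | p in bd (E 0)],
      complete_hypersurface (bd (E 0)),
      open Omega &
      bd (E 0) = full_graph Omega v].

End translators.

(* Main.v *)
From HB Require Import structures.
Require Import Defs.
From mathcomp Require Import all_boot all_order all_algebra.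
From mathcomp Require Import all_classical all_reals all_analysis.
From mathcomp Require Import ring lra.

Set Implicit Arguments.
Unset Strict Implicit.
Unset Printing Implicit Defensive.

Import Order.TTheory GRing.Theory Num.Theory.
Import numFieldNormedType.Exports.

Local Open Scope classical_set_scope.
Local Open Scope ring_scope.

(** With [s = x.e], the translator is the boundary of [{p s - z <= h p for all p}],
  where [h] is determined by [h'' p = psi (- p e, 1) g'' p],
  [g p = phi (- p e, 1)], understood as a limit over regular norms. The level
  sets of [lam (x, t) = min {lam >= 1/2 : p s - z <= lam (h p) - t / lam for all p}]
  are rescaled translators. For a regular approximation of [phi], functions of
  the same form are sub- and supersolutions trapping [lam]; damping the
  curvature by the factor [1 + eta sqrt (1 + p^2)] makes harmless the part of
  [h''] that escapes to infinity in [p]. Perron's method between these barriers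
  produces the viscosity solutions, with no need for a comparison principle. *)

(** Curvature scales like an inverse length, so the translator dilated by [lam] moves up with speed
    [1 / lam]: this is the origin of the term [t / lam], and it makes each level set of [lam (x, t)]
    a solution by itself. Only the level 1 matters in the end; the floor 1/2 keeps [1 / lam]
    bounded, hence [lam] Lipschitz in time. The obstacle is that [h''] is only a limit of measures.
    The profiles of regular norms tending to [phi] converge locally uniformly, but a fixed amount of
    [h''] may drift off to infinity in [p], whereas a comparison of levels needs an error small
    relative to [1 + |p|] for all [p] at once. The mobility grows at most linearly, so after damping
    the second derivative is at most a multiple of [g''], and near infinity [g'] has almost nothing
    left to gain, for every regular norm close enough to [phi]. The notion of solution asks for some
    viscosity solution for each regular norm, so one may choose solutions that are trapped between
    explicit functions tending to [lam]. *)

Section quadratic_forms.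
Context {R : realType}.
Implicit Type n : nat.

Lemma dotE n (v w : 'rV[R]_n) : dot v w = (v *m w^T) 0 0.
Proof. by rewrite /dot mxE; apply: eq_bigr => i _; rewrite mxE. Qed.

Lemma dotC n (v w : 'rV[R]_n) : dot v w = dot w v.
Proof. by apply: eq_bigr => i _; rewrite mulrC. Qed.

Lemma dotDl n (u v w : 'rV[R]_n) : dot (u + v) w = dot u w + dot v w.
Proof. by rewrite !dotE mulmxDl mxE. Qed.

Lemma dotZl n a (v w : 'rV[R]_n) : dot (a *: v) w = a * dot v w.
Proof. by rewrite !dotE -scalemxAl mxE. Qed.

Lemma dotDr n (u v w : 'rV[R]_n) : dot u (v + w) = dot u v + dot u w.
Proof. by rewrite ![dot u _]dotC dotDl. Qed.

Lemma dotZr n a (v w : 'rV[R]_n) : dot v (a *: w) = a * dot v w.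
Proof. by rewrite ![dot v _]dotC dotZl. Qed.

Lemma dotNl n (v w : 'rV[R]_n) : dot (- v) w = - dot v w.
Proof. by rewrite -scaleN1r dotZl mulN1r. Qed.

Lemma dotNr n (v w : 'rV[R]_n) : dot v (- w) = - dot v w.
Proof. by rewrite -scaleN1r dotZr mulN1r. Qed.

Lemma dotBl n (u v w : 'rV[R]_n) : dot (u - v) w = dot u w - dot v w.
Proof. by rewrite dotDl dotNl. Qed.

Lemma dotBr n (u v w : 'rV[R]_n) : dot u (v - w) = dot u v - dot u w.
Proof. by rewrite dotDr dotNr. Qed.

Lemma dot0l n (v : 'rV[R]_n) : dot 0 v = 0.
Proof. by rewrite dotE mul0mx mxE. Qed.

Lemma dot0r n (v : 'rV[R]_n) : dot v 0 = 0.
Proof. by rewrite dotC dot0l. Qed.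

Lemma dot_ge0 n (v : 'rV[R]_n) : 0 <= dot v v.
Proof. by apply: sumr_ge0 => i _; rewrite -expr2 sqr_ge0. Qed.

Lemma dot_eq0 n (v : 'rV[R]_n) : (dot v v == 0) = (v == 0).
Proof.
apply/idP/eqP => [|->]; last by rewrite dot0l.
rewrite psumr_eq0; last by move=> i _; rewrite -expr2 sqr_ge0.
move=> /allP v0; apply/rowP => i; rewrite mxE; apply/eqP.
by have := v0 i; rewrite mem_index_enum /= -expr2 sqrf_eq0; exact.
Qed.

Lemma dot_gt0 n (v : 'rV[R]_n) : v != 0 -> 0 < dot v v.
Proof. by move=> v0; rewrite lt_neqAle dot_ge0 eq_sym dot_eq0 v0. Qed.

Lemma dot_delta n (v : 'rV[R]_n) i : dot v (delta_mx 0 i) = v 0 i.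
Proof.
rewrite /dot (bigD1 i) //= mxE !eqxx mulr1 big1 ?addr0// => j ji.
by rewrite mxE (negbTE ji) andbF mulr0.
Qed.

Lemma dot_mulmx n (X : 'M[R]_n) (v w : 'rV[R]_n) :
  dot (v *m X) w = dot v (w *m X^T).
Proof. by rewrite !dotE trmx_mul trmxK mulmxA. Qed.

Lemma dot_row_mx m n (a c : 'rV[R]_m) (b d : 'rV[R]_n) :
  dot (row_mx a b) (row_mx c d) = dot a c + dot b d.
Proof. by rewrite !dotE tr_row_mx mul_row_col mxE. Qed.

(** * Quadratic forms and Gram factorization of semidefinite matrices *)

Definition qd n (X : 'M[R]_n) (v : 'rV[R]_n) : R := dot (v *m X) v.

Lemma qdD n (X Y : 'M[R]_n) v : qd (X + Y) v = qd X v + qd Y v.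
Proof. by rewrite /qd mulmxDr dotDl. Qed.

Lemma qdZ n a (X : 'M[R]_n) v : qd (a *: X) v = a * qd X v.
Proof. by rewrite /qd -scalemxAr dotZl. Qed.

Lemma qdN n (X : 'M[R]_n) v : qd (- X) v = - qd X v.
Proof. by rewrite -scaleN1r qdZ mulN1r. Qed.

Lemma qd0 n (v : 'rV[R]_n) : qd 0 v = 0.
Proof. by rewrite /qd mulmx0 dot0l. Qed.

Lemma qdZv n (X : 'M[R]_n) a v : qd X (a *: v) = a ^+ 2 * qd X v.
Proof. by rewrite /qd -scalemxAl dotZl dotZr mulrA expr2. Qed.

Lemma qd_scalar n a (v : 'rV[R]_n) : qd a%:M v = a * dot v v.
Proof. by rewrite /qd mul_mx_scalar dotZl. Qed.

Lemma qd_addv n (X : 'M[R]_n) v w : X^T = X ->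
  qd X (v + w) = qd X v + 2 * dot (v *m X) w + qd X w.
Proof.
move=> sX; rewrite /qd mulmxDl dotDl !dotDr.
have -> : dot (w *m X) v = dot (v *m X) w by rewrite dot_mulmx sX dotC.
ring.
Qed.

Definition psd n (A : 'M[R]_n) := forall v, 0 <= qd A v.

(** Cholesky factorization by induction on the size: either the top left entry vanishes, and
    positivity then kills its whole row, or the Schur complement is again positive semidefinite. *)
Lemma psd_gram n (A : 'M[R]_n) : A^T = A -> psd A ->
  exists C : 'M[R]_n, A = C^T *m C.
Proof.
elim: n A => [|n IH] A sA pA.
  by exists 0; apply/matrixP => -[].
rewrite -[n.+1]/(1 + n)%N in A sA pA *.
pose al := A 0 0; pose u : 'rV[R]_n := ursubmx A; pose D := drsubmx A.
have Aul : ulsubmx A = al%:M.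
  by rewrite [LHS]mx11_scalar !mxE; congr (A _ _)%:M; apply/val_inj.
have Adl : dlsubmx A = u^T by rewrite /u trmx_ursub sA.
have sD : D^T = D by rewrite /D trmx_drsub sA.
have AE : A = block_mx al%:M u u^T D by rewrite -(submxK A) Aul Adl.
have qE t (w : 'rV[R]_n) :
    qd A (row_mx t%:M w) = t ^+ 2 * al + 2 * t * dot u w + qd D w.
  have d1 (a b : 'rV[R]_1) : dot a b = a 0 0 * b 0 0 by rewrite /dot big_ord1.
  have dw : (w *m u^T) 0 0 = dot u w by rewrite dotC dotE.
  rewrite {1}AE /qd mul_row_block dot_row_mx !mul_mx_scalar !mul_scalar_mx.
  rewrite dotDl dotZl (dotDl (t *: u)) dotZl !d1 dw !mxE eqxx !mulr1n; ring.
have al0 : 0 <= al.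
  have := pA (row_mx 1%:M 0); rewrite qE dot0r expr1n mul1r mulr0 addr0.
  by rewrite /qd mul0mx dot0l addr0.
have [al00|aln0] := eqVneq al 0.
  have u0 : u = 0.
    apply/rowP => j; rewrite [RHS]mxE; apply/eqP/negPn/negP => uj.
    pose w : 'rV[R]_n := delta_mx 0 j.
    have uw : dot u w = u 0 j by rewrite dot_delta.
    (* With [al = 0] the form is affine in the first coordinate; this value of the coordinate makes
       the form equal to -1. *)
    have := pA (row_mx (- (qd D w + 1) / (2 * u 0 j))%:M w).
    rewrite qE al00 uw mulr0 add0r.
    rewrite (_ : 2 * _ * _ = - (qd D w + 1)); last by field.
    lra.
  have [|C CE] := IH D sD.
    move=> w; have := pA (row_mx 0%:M w); rewrite qE u0 dot0l.
    by rewrite expr2 !(mul0r,mulr0,add0r).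
  exists (block_mx (0 : 'M[R]_1) 0 0 C).
  rewrite tr_block_mx mulmx_block AE u0 CE al00 !trmx0.
  by rewrite !(mul0mx,mulmx0,addr0,add0r) raddf0.
have algt : 0 < al by rewrite lt_neqAle eq_sym aln0.
pose D' := D - al^-1 *: (u^T *m u).
have [|w|C CE] := IH D'.
- by rewrite /D' linearB /= sD linearZ /= trmx_mul trmxK.
(* This first coordinate minimizes the form for fixed [w]; the minimum is the Schur complement. *)
- have := pA (row_mx (- dot u w / al)%:M w); rewrite qE.
  rewrite /D' qdD qdN qdZ.
  have -> : qd (u^T *m u) w = dot u w ^+ 2.
    rewrite /qd mulmxA dotE -mulmxA [w *m u^T]mx11_scalar mul_scalar_mx mxE.
    by rewrite -!dotE dotC expr2.
  suff -> : (- dot u w / al) ^+ 2 * al + 2 * (- dot u w / al) * dot u w =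
    - (al^-1 * dot u w ^+ 2) by lra.
  by field.
pose s := Num.sqrt al.
have s2 : s * s = al by rewrite -expr2 sqr_sqrtr.
have s0 : s != 0 by rewrite sqrtr_eq0 -ltNge.
exists (block_mx s%:M (s^-1 *: u) 0 C).
rewrite tr_block_mx mulmx_block AE tr_scalar_mx trmx0 !linearZ /=.
rewrite !(mul0mx,mulmx0,addr0,add0r) -scalar_mxM s2.
rewrite mul_scalar_mx -scalemxAl mul_mx_scalar !scalerA mulVf// !scale1r.
by rewrite -scalemxAl scalerA -invfM s2 -CE /D' addrC subrK.
Qed.

Lemma trace_gram n (C X : 'M[R]_n) :
  \tr (C^T *m C *m X) = \sum_i qd X (row i C).
Proof.
rewrite -mulmxA mxtrace_mulC /mxtrace; apply: eq_bigr => i _.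
rewrite mxE /qd /dot; apply: eq_bigr => j _.
by rewrite -row_mul [C^T j i]mxE [row i C 0 j]mxE [in RHS]mxE.
Qed.

Lemma qd_gram n (C : 'M[R]_n) v :
  qd (C^T *m C) v = \sum_i dot (row i C) v ^+ 2.
Proof.
rewrite /qd mulmxA dot_mulmx {1}/dot; apply: eq_bigr => i _.
rewrite expr2; have -> : (v *m C^T) 0 i = dot (row i C) v.
  by rewrite mxE; apply: eq_bigr => j _; rewrite !mxE mulrC.
by [].
Qed.

Lemma psd_trace_ge0 n (A X : 'M[R]_n) : A^T = A -> psd A -> psd X ->
  0 <= \tr (A *m X).
Proof.
move=> sA pA pX; have [C ->] := psd_gram sA pA.
by rewrite trace_gram sumr_ge0.
Qed.

(* If [nu] is in the kernel of [A], only the values of [X] on the orthogonal of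
   [nu] matter in [tr (A X)]. *)
Lemma trace_ge_tangent n (A X : 'M[R]_n) nu w k : A^T = A -> psd A ->
  qd A nu = 0 -> (forall v, dot v nu = 0 -> k * dot v w ^+ 2 <= qd X v) ->
  k * qd A w <= \tr (A *m X).
Proof.
move=> sA pA; have [C ->] := psd_gram sA pA => /eqP.
rewrite trace_gram !qd_gram psumr_eq0; last by move=> i _; exact: sqr_ge0.
move=> /allP An kX; rewrite mulr_sumr; apply: ler_sum => i _; apply: kX.
by have := An i; rewrite mem_index_enum sqrf_eq0 => /(_ isT)/eqP.
Qed.

End quadratic_forms.

(** * Continuity, derivatives and the mean value theorem in epsilon-delta form *)

Section epsilon_delta.
Context {R : realType}.

Lemma near_normP (V : normedModType R) (p : V) (P : V -> Prop) :
  (\forall q \near p, P q) <->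
  exists2 r : R, 0 < r & forall q, `|q - p| < r -> P q.
Proof.
split=> [/nbhs_normP[r /= r0 rP]|[r r0 rP]].
  by exists r => // q qp; apply: rP; rewrite /ball_ /= distrC.
by apply/nbhs_normP; exists r => //= q /=; rewrite distrC; exact: rP.
Qed.

Lemma cont_normP (V : normedModType R) (f : V -> R) p :
  {for p, continuous f} <->
  forall e : R, 0 < e -> exists2 r : R, 0 < r &
    forall q, `|q - p| < r -> `|f q - f p| < e.
Proof.
split=> [/(@cvgrPdist_lt R R) fp e e0|fp].
  have /near_normP[r r0 rP] := fp _ e0.
  by exists r => // q qp; rewrite distrC; exact: rP.
apply/(@cvgrPdist_lt R R) => e e0; apply/near_normP.
by have [r r0 rP] := fp _ e0; exists r => // q qp; rewrite distrC; exact: rP.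
Qed.

(** Multiplying the difference quotient by [h] gives an inequality that also holds at [h = 0], so
    later arguments avoid punctured neighbourhoods. *)
Lemma is_derive_normP (V : normedModType R) (f : V -> R) p v l :
  is_derive p v (f : V -> R^o) l <->
  forall e : R, 0 < e -> exists2 d : R, 0 < d &
    forall h : R, `|h| < d -> `|f (p + h *: v) - f p - h * l| <= e * `|h|.
Proof.
pose q h := h^-1 *: ((f \o shift p) (h *: v) - f p).
have qE h : h != 0 -> f (p + h *: v) - f p - h * l = h * (q h - l).
  by move=> h0; rewrite /q /= [h *: v + p]addrC mulrBr mulVKf.
split=> [[df dl] e e0|H].
  have : q h @[h --> 0^'] --> l by rewrite -dl; exact: df.
  move/(@cvgrPdist_le R R)/(_ _ e0); rewrite near_withinE.
  move=> /near_normP[d d0 dP]; exists d => // h hd.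
  have [->|h0] := eqVneq h 0.
    by rewrite scale0r addr0 subrr mul0r subrr normr0 mulr0.
  rewrite qE// normrM mulrC ler_wpM2r// distrC dP//.
  by rewrite subr0.
have ql : q h @[h --> 0^'] --> l.
  apply/(@cvgrPdist_le R R) => e e0; rewrite near_withinE.
  apply/(@near_normP R^o).
  have [d d0 dP] := H _ e0; exists d => // h; rewrite subr0 => hd h0.
  have := dP _ hd; rewrite qE// normrM mulrC ler_pM2r ?normr_gt0//.
  by rewrite distrC.
split; first by apply/cvg_ex; exists l.
by apply: (@cvg_lim R^o).
Qed.

Lemma derivable_cont (f : R -> R) (p l : R) : is_derive p 1 f l ->
  {for p, continuous f}.
Proof.
move=> [df _]; exact: (differentiable_continuous ((derivable1_diffP _ _).1 df)).
Qed.

Lemma MVT_fwd (f f' : R -> R) (a b : R) : a <= b ->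
  (forall x, a <= x <= b -> is_derive x 1 f (f' x)) ->
  exists2 c : R, a <= c <= b & f b - f a = f' c * (b - a).
Proof.
move=> ab df; have [||c] := MVT_segment ab (f := f) (df := f').
- move=> x; rewrite in_itv /= => /andP[/ltW ax /ltW xb].
  by apply: df; rewrite ax xb.
- apply: continuous_in_subspaceT => x; rewrite inE /= in_itv /= => /df.
  exact: derivable_cont.
- by rewrite in_itv; exists c.
Qed.

Lemma ler_of_derive (f f' : R -> R) (a b : R) : a <= b ->
  (forall x, a <= x <= b -> is_derive x 1 f (f' x)) ->
  (forall x, a <= x <= b -> 0 <= f' x) -> f a <= f b.
Proof.
move=> ab df f0; have [c cab fE] := MVT_fwd ab df.
by rewrite -subr_ge0 fE mulr_ge0 ?f0 ?subr_ge0.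
Qed.

Lemma is_derive_line (V : normedModType R) (f : V -> R) p v s l :
  is_derive (p + s *: v) v (f : V -> R^o) l ->
  is_derive s 1 (fun s => f (p + s *: v)) l.
Proof.
move=> /is_derive_normP H; apply/(@is_derive_normP R) => e e0.
have [d d0 dP] := H _ e0; exists d => // h hd.
by rewrite /= scaler1 scalerDl addrA dP.
Qed.

Lemma is_deriveZv (V : normedModType R) (f : V -> R) p v c l :
  is_derive p v (f : V -> R^o) l -> is_derive p (c *: v) (f : V -> R^o) (c * l).
Proof.
move=> /is_derive_normP H; apply/is_derive_normP => e e0.
have c1 : 0 < `|c| + 1 by rewrite ltr_wpDl.
have [d d0 dP] := H (e / (`|c| + 1)) (divr_gt0 e0 c1).
exists (d / (`|c| + 1)); first exact: divr_gt0.
move=> h; rewrite ltr_pdivlMr// => hd.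
have hc : `|h * c| <= `|h| * (`|c| + 1).
  by rewrite normrM ler_wpM2l// lerDl.
rewrite scalerA mulrA; apply: (le_trans (dP _ (le_lt_trans hc hd))).
rewrite mulrAC ler_pdivrMr// -mulrA ler_wpM2l//; exact: ltW.
Qed.

(** Go from [p] to [p + h u] and then to [p + h u + h v]: the mean value theorem and the continuity
    of the derivative along [v] control the second leg. *)
Lemma is_deriveDv (V : normedModType R) (f : V -> R) p u v :
  derivable (f : V -> R^o) p u ->
  (\forall q \near p, derivable (f : V -> R^o) q v) ->
  {for p, continuous (fun q => 'D_v (f : V -> R^o) q : R)} ->
  is_derive p (u + v) (f : V -> R^o)
    ('D_u (f : V -> R^o) p + 'D_v (f : V -> R^o) p).
Proof.
move=> /derivableP/is_derive_normP fu /near_normP[r r0 fv] /cont_normP cv.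
apply/is_derive_normP => e e0; have e2 : 0 < e / 2 by lra.
have [d d0 dP] := fu _ e2; have [d' d0' dP'] := cv _ e2.
pose M := `|u| + `|v| + 1; have M0 : 0 < M by rewrite /M ltr_wpDl// addr_ge0.
pose m := Num.min r d' / M; have m0 : 0 < m by rewrite divr_gt0// lt_min r0 d0'.
exists (Num.min d m); first by rewrite lt_min d0 m0.
move=> h; rewrite lt_min => /andP[hd hm].
pose g s := f (p + h *: u + s *: (h *: v)).
have dist (s : R) : 0 <= s <= 1 -> `|p + h *: u + s *: (h *: v) - p| < Num.min r d'.
  move=> /andP[s0 s1].
  rewrite [_ - p]addrC !addrA addNr add0r scalerA; apply: le_lt_trans (ler_normD _ _) _.
  rewrite !normrZ; have : `|s * h| <= `|h|.
    by rewrite normrM (ger0_norm s0) ler_piMl.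
  move=> sh; apply: le_lt_trans (_ : `|h| * M < _).
    rewrite /M !mulrDr mulr1 -[leLHS]addr0 lerD// lerD//; first by rewrite ler_wpM2r// -normrM.
  by move: hm; rewrite /m ltr_pdivlMr.
have dg (s : R) : 0 <= s <= 1 ->
    is_derive s 1 g (h * 'D_v (f : V -> R^o) (p + h *: u + s *: (h *: v))).
  move=> s01; apply: is_derive_line; apply: is_deriveZv; apply/derivableP/fv.
  by have := dist _ s01; rewrite lt_min => /andP[].
have [c c01] := MVT_fwd ler01 dg.
rewrite subr0 mulr1 /g scale0r addr0 scale1r => gE.
rewrite scalerDr addrA (_ : _ - _ - _ = (f (p + h *: u) - f p -
  h * 'D_u (f : V -> R^o) p) + h * ('D_v (f : V -> R^o) (p + h *: u + c *:
  (h *: v)) - 'D_v (f : V -> R^o) p)); last by rewrite mulrBr -gE; ring.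
apply: le_trans (ler_normD _ _) _.
rewrite [e in leRHS]splitr mulrDl lerD//; first exact: dP.
rewrite normrM mulrC ler_wpM2r// ltW// dP'//.
by have := dist _ c01; rewrite lt_min => /andP[].
Qed.

End epsilon_delta.

(** * Derivative rules for real functions, with explicit values *)

Section pointwise_derivatives.
Context {R : realType}.
Implicit Types f g : R -> R.
Implicit Types a b c s : R.

Lemma derD f g a b s : is_derive s 1 f a -> is_derive s 1 g b ->
  is_derive s 1 (fun x => f x + g x) (a + b).
Proof. by move=> df dg; exact: (@is_deriveD R R^o R^o). Qed.

Lemma derB f g a b s : is_derive s 1 f a -> is_derive s 1 g b ->
  is_derive s 1 (fun x => f x - g x) (a - b).
Proof. by move=> df dg; exact: (@is_deriveB R R^o R^o). Qed.

Lemma derM f g a b s : is_derive s 1 f a -> is_derive s 1 g b ->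
  is_derive s 1 (fun x => f x * g x) (a * g s + f s * b).
Proof.
move=> df dg; have := @is_deriveM _ _ f g s 1 a b df dg.
by congr (is_derive _ _ _ _); rewrite /GRing.scale /= addrC [g s * _]mulrC.
Qed.

Lemma derZ f a c s : is_derive s 1 f a -> is_derive s 1 (fun x => c * f x) (c * a).
Proof. by move=> df; exact: (@is_deriveZ R R^o R^o). Qed.

Lemma der_cst c s : is_derive s 1 (fun=> c) (0 : R).
Proof. exact: (@is_derive_cst R R^o R^o). Qed.

Lemma der_id s : is_derive s 1 (fun x : R => x) (1 : R).
Proof. exact: (@is_derive_id R R^o). Qed.

Lemma der_eq f a b s : is_derive s 1 f a -> a = b -> is_derive s 1 f b.
Proof. by move=> + <-. Qed.

Lemma der_aff a b s : is_derive s 1 (fun x => a + b * x) b.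
Proof.
apply: der_eq (derD (der_cst a s) (derZ b (der_id s))) _.
by rewrite add0r mulr1.
Qed.

Lemma der_comp f g a b s : is_derive (g s) 1 f a -> is_derive s 1 g b ->
  is_derive s 1 (fun x => f (g x)) (a * b).
Proof. exact: is_derive1_comp. Qed.

Lemma der_mulr f a c s : is_derive (s * c) 1 f a ->
  is_derive s 1 (fun x => f (x * c)) (c * a).
Proof.
move=> df.
apply: der_eq (der_comp (g := fun x => x * c) df
  (derM (der_id s) (der_cst c s))) _.
by rewrite mul1r mulr0 addr0 mulrC.
Qed.

End pointwise_derivatives.

(** * Gradient, symmetry of the Hessian and Taylor bound *)

Section C2_functions.
Context {R : realType}.

Lemma C1_is_derive (V : normedModType R) (A : set V) (f : V -> R^o) p v :
  is_C1 A f -> A p -> is_derive p v f ('D_v f p).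
Proof. by move=> cf Ap; apply/derivableP; have [] := cf _ Ap v. Qed.

(** Expand [v] in the standard basis and add one coordinate direction at a time with
    [is_deriveDv]. *)
Lemma C1_grad n (A : set 'rV[R]_n) (f : 'rV[R]_n -> R^o) p v :
  open A -> is_C1 A f -> A p -> is_derive p v f (dot (grad f p) v).
Proof.
move=> oA cf Ap.
suff H (s : seq 'I_n) : is_derive p (\sum_(i <- s) v 0 i *: delta_mx 0 i) f
    (\sum_(i <- s) v 0 i * 'D_(delta_mx 0 i) f p).
  have := H (index_enum 'I_n); rewrite -row_sum_delta.
  congr (is_derive _ _ _ _).
  by apply: eq_bigr => i _; rewrite mxE mulrC.
elim: s => [|i s [ds Ds]].
  by rewrite !big_nil; apply/is_derive0.
rewrite !big_cons addrC [X in is_derive _ _ _ X]addrC -Ds.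
have di : is_derive p (v 0 i *: delta_mx 0 i) f
    (v 0 i * 'D_(delta_mx 0 i) f p).
  by apply: is_deriveZv; exact: C1_is_derive cf Ap.
have [_ <-] := di; apply: is_deriveDv.
- by [].
- apply: (@filterS _ _ _ A); last exact: open_nbhs_nbhs.
  by move=> q Aq; exact: (cf _ Aq (v 0 i *: delta_mx 0 i)).1.
- exact: (cf _ Ap (v 0 i *: delta_mx 0 i)).2.
Qed.

Lemma qdE n (X : 'M[R]_n) v :
  qd X v = \sum_i \sum_j v 0 i * v 0 j * X i j.
Proof.
rewrite /qd /dot exchange_big /=; apply: eq_bigr => j _.
by rewrite mxE mulr_suml; apply: eq_bigr => i _; rewrite mulrAC.
Qed.

Lemma C2_line1 n (A : set 'rV[R]_n) (f : 'rV[R]_n -> R^o) p v (s : R) :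
  open A -> is_C2 A f -> A (p + s *: v) ->
  is_derive s 1 (fun s => f (p + s *: v)) (dot (grad f (p + s *: v)) v).
Proof.
move=> oA [cf _] Ap.
by apply: is_derive_line; exact: C1_grad oA cf Ap.
Qed.

Lemma C2_line2 n (A : set 'rV[R]_n) (f : 'rV[R]_n -> R^o) p v (s : R) :
  open A -> is_C2 A f -> A (p + s *: v) ->
  is_derive s 1 (fun s => dot (grad f (p + s *: v)) v)
    (qd (hess f (p + s *: v)) v).
Proof.
move=> oA [_ cDf] Ap.
have -> : (fun s => dot (grad f (p + s *: v)) v) =
    \sum_(i < n) (fun s : R => v 0 i * 'D_(delta_mx 0 i) f (p + s *: v)).
  apply/funext => x; rewrite fct_sumE; apply: eq_bigr => i _.
  by rewrite mxE mulrC.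
rewrite qdE; apply: is_derive_sum => i.
have -> : \sum_j v 0 i * v 0 j * hess f (p + s *: v) i j =
    v 0 i * dot (grad ('D_(delta_mx 0 i) f : _ -> R^o) (p + s *: v)) v.
  rewrite mulr_sumr; apply: eq_bigr => j _.
  by rewrite !mxE -mulrA [v 0 j * _]mulrC.
have := is_derive_line (C1_grad v oA (cDf (delta_mx 0 i)) Ap).
by move=> H; exact: (@is_deriveZ _ _ _ _ _ _ _ _ H).
Qed.

(** Mean value theorem applied twice, in the direction [u] and then in the direction [v]. *)
Lemma mixed_difference (V : normedModType R) (A : set V) (f : V -> R^o)
    p u v (h r : R) :
  is_C2 A f -> (forall q, `|q - p| < r -> A q) ->
  0 < h -> h * (`|u| + `|v|) < r ->
  exists2 q, `|q - p| < r &
    f (p + h *: u + h *: v) - f (p + h *: u) - f (p + h *: v) + f p =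
    h * h * 'D_v ('D_u f : V -> R^o) q.
Proof.
move=> [cf cDf] rA h0 hr.
have dist (s k : R) : 0 <= s <= h -> 0 <= k <= h ->
    `|p + s *: u + k *: v - p| < r.
  move=> /andP[s0 sh] /andP[k0 kh]; rewrite [_ - p]addrC !addrA addNr add0r.
  apply: le_lt_trans (ler_normD _ _) _; apply: le_lt_trans hr.
  by rewrite !normrZ !ger0_norm// mulrDr lerD// ler_wpM2r.
have hh : 0 <= h <= h by rewrite ltW/=.
have h00 : 0 <= (0 : R) <= h by rewrite lexx ltW.
have [s|s1 s1h] := MVT_fwd (ltW h0) (f := fun s => f (p + h *: v + s *: u) -
    f (p + s *: u)) (f' := fun s => 'D_u f (p + h *: v + s *: u) -
    'D_u f (p + s *: u)).
  move=> s0h; apply: (@is_deriveB R R^o R^o).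
    apply: is_derive_line; apply: (C1_is_derive _ cf); apply: rA.
    by rewrite [p + h *: v + _]addrAC; exact: dist.
  apply: is_derive_line; apply: (C1_is_derive _ cf); apply: rA.
  by have := dist _ _ s0h h00; rewrite scale0r addr0.
rewrite subr0 scale0r !addr0 => E1.
have [k|k1 k1h] := MVT_fwd (ltW h0) (f := fun k => 'D_u f (p + s1 *: u + k *: v))
    (f' := fun k => 'D_v ('D_u f : V -> R^o) (p + s1 *: u + k *: v)).
  move=> k0h; apply: (is_derive_line (f := 'D_u f)).
  by apply: (C1_is_derive _ (cDf _)); apply: rA; exact: dist.
rewrite subr0 scale0r !addr0 => E2.
exists (p + s1 *: u + k1 *: v); first exact: dist.
rewrite -mulrA [h * 'D_v _ _]mulrC -E2.
rewrite [p + s1 *: u + h *: v]addrAC mulrC -E1 [p + h *: v + _]addrAC; ring.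
Qed.

(** Schwarz: the mixed difference is symmetric in [u] and [v], so the two mixed derivatives take a
    common value at two points close to [p]. *)
Lemma C2_symmetric (V : normedModType R) (A : set V) (f : V -> R^o) p u v :
  open A -> is_C2 A f -> A p ->
  'D_v ('D_u f : V -> R^o) p = 'D_u ('D_v f : V -> R^o) p.
Proof.
have key (a b c d e : R) : `|a - b| < e / 2 -> `|c - d| < e / 2 -> a = c ->
    `|b - d| <= e.
  by move=> + + ac; rewrite ac !ltr_norml ler_norml; lra.
move=> oA cf Ap; apply/eqP; rewrite -subr_eq0 -normr_le0; apply/ler_addgt0Pl.
move=> e e0; rewrite addr0; have e2 : 0 < e / 2 by lra.
have [_ cDf] := cf.
have /near_normP[r rgt rA] : \forall q \near p, A q by exact: open_nbhs_nbhs.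
have [_ /cont_normP/(_ _ e2)[r1 r10 r1P]] := cDf u _ Ap v.
have [_ /cont_normP/(_ _ e2)[r2 r20 r2P]] := cDf v _ Ap u.
pose m := Num.min r (Num.min r1 r2).
have m0 : 0 < m by rewrite !lt_min rgt r10 r20.
pose h := m / (`|u| + `|v| + 1).
have M0 : 0 < `|u| + `|v| + 1 by rewrite ltr_wpDl// addr_ge0.
have h0 : 0 < h by exact: divr_gt0.
have hm : h * (`|u| + `|v|) < m.
  by rewrite /h mulrAC ltr_pdivrMr// ltr_pM2l// ltrDl.
have mA q : `|q - p| < m -> A q by rewrite lt_min => /andP[/rA].
have [q1 q1p E1] := mixed_difference cf mA h0 hm.
rewrite addrC in hm *.
have [q2 q2p E2] := mixed_difference cf mA h0 hm.
have qE : 'D_v ('D_u f : V -> R^o) q1 = 'D_u ('D_v f : V -> R^o) q2.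
  have hh0 : h * h != 0 by rewrite mulf_neq0 ?gt_eqF.
  apply: (mulfI hh0); apply: etrans (esym E1) _; apply: etrans E2.
  rewrite [p + h *: u + _]addrAC.
  by move: (f _) (f _) (f _) (f p) => a b c d; congr (_ + _); rewrite addrAC.
move: q1p q2p; rewrite !lt_min => /and3P[_ /r1P q1p _] /and3P[_ _ /r2P q2p].
exact: key q1p q2p qE.
Qed.

Lemma hess_sym n (A : set 'rV[R]_n) (f : 'rV[R]_n -> R^o) p :
  open A -> is_C2 A f -> A p -> (hess f p)^T = hess f p.
Proof.
by move=> oA cf Ap; apply/matrixP => i j; rewrite !mxE; exact: C2_symmetric oA cf Ap.
Qed.

Lemma qd_le_norm n (X : 'M[R]_n) (d : R) v : (forall i j, `|X i j| <= d) ->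
  qd X v <= n%:R * d * dot v v.
Proof.
move=> Xd; rewrite qdE.
apply: (@le_trans _ _ (\sum_i \sum_j (v 0 i ^+ 2 + v 0 j ^+ 2) / 2 * d)).
  apply: ler_sum => i _; apply: ler_sum => j _.
  apply: le_trans (ler_norm _) _; rewrite normrM; apply: ler_pM => //.
  rewrite ler_norml; apply/andP; split.
    have := sqr_ge0 (v 0 i + v 0 j); rewrite sqrrD; lra.
  by have := sqr_ge0 (v 0 i - v 0 j); rewrite sqrrB; lra.
under eq_bigr do rewrite -mulr_suml -mulr_suml big_split /= sumr_const card_ord.
have dv : dot v v = \sum_(i < n) v 0 i ^+ 2.
  by apply: eq_bigr => i _; rewrite expr2.
rewrite dv; set S := \sum_(i < n) v 0 i ^+ 2.
rewrite -mulr_suml -mulr_suml big_split/= sumrMnl -/S sumr_const card_ord.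
by rewrite -[S *+ n]mulr_natl le_eqVlt; apply/orP; left; apply/eqP; field.
Qed.

Lemma taylor_le (g g' g'' : R -> R) (K : R) :
  (forall s : R, 0 <= s <= 1 -> is_derive s 1 g (g' s)) ->
  (forall s : R, 0 <= s <= 1 -> is_derive s 1 g' (g'' s)) ->
  (forall s : R, 0 <= s <= 1 -> g'' s <= K) ->
  g 1 <= g 0 + g' 0 + K / 2.
Proof.
move=> dg dg' gK.
have le1 (s : R) : 0 <= s <= 1 -> g' s <= g' 0 + K * s.
  move=> /andP[s0 s1].
  have [|c /andP[c0 cs] E] := MVT_fwd s0 (f := g') (f' := g'').
    by move=> x /andP[x0 xs]; apply: dg'; rewrite x0 (le_trans xs).
  have := gK c; rewrite c0 (le_trans cs)// => /(_ isT) cK.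
  by rewrite -lerBlDl E subr0 ler_wpM2r.
have := @ler_of_derive _ (fun s => g' 0 * s + K / 2 * (s * s) - g s)
  (fun s => g' 0 + K * s - g' s) 0 1 ler01.
rewrite !mulr1 !mulr0 add0r => H.
suff : 0 - g 0 <= g' 0 + K / 2 - g 1 by lra.
apply: H => s s01; last by have := le1 _ s01; lra.
apply: der_eq (derB (derD (derZ (g' 0) (der_id s))
  (derZ (K / 2) (derM (der_id s) (der_id s)))) (dg _ s01)) _.
by field.
Qed.

(** Near [p] the entries of the Hessian vary by at most [d], which costs at most [n d] times
    [dot v v] in the quadratic form. *)
Lemma C2_taylor n (A : set 'rV[R]_n) (f : 'rV[R]_n -> R^o) p (e : R) :
  open A -> is_C2 A f -> A p -> 0 < e ->
  exists2 r : R, 0 < r & forall v, `|v| < r ->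
  f (p + v) <= f p + dot (grad f p) v + qd (hess f p) v / 2 + e * dot v v.
Proof.
move=> oA cf Ap e0; pose d := e / (n%:R + 1).
have n1 : 0 < n%:R + 1 :> R by rewrite ltr_wpDl.
have d0 : 0 < d by exact: divr_gt0.
have nd : n%:R * d <= e.
  by rewrite /d mulrA ler_pdivrMr// mulrC ler_pM2l// lerDl.
have : \forall q \near p, A q /\ forall ij : 'I_n * 'I_n,
    `|(hess f q - hess f p) ij.1 ij.2| < d.
  apply: filterI; first exact: open_nbhs_nbhs.
  apply: (@filter_forall _ _
    (fun ij q => `|(hess f q - hess f p) ij.1 ij.2| < d) _
    (nbhs_filter p)) => -[i j] /=.
  have [_ /cont_normP/(_ _ d0)[r r0 rP]] :=
    cf.2 (delta_mx 0 i) _ Ap (delta_mx 0 j).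
  by apply/(@near_normP _ _ p); exists r => // q /rP; rewrite !mxE.
move=> /near_normP[r r0 rP]; exists r => // v vr.
have Ps (s : R) : 0 <= s <= 1 -> `|p + s *: v - p| < r.
  move=> /andP[s0 s1]; rewrite addrC addKr normrZ ger0_norm//.
  by apply: le_lt_trans vr; rewrite ler_piMl.
have /= := @taylor_le (fun s => f (p + s *: v))
  (fun s => dot (grad f (p + s *: v)) v)
  (fun s => qd (hess f (p + s *: v)) v) (qd (hess f p) v + e * dot v v).
rewrite scale1r scale0r addr0 => H; apply: le_trans (H _ _ _) _.
- by move=> s /Ps/rP[As _]; exact: C2_line1 oA cf As.
- by move=> s /Ps/rP[As _]; exact: C2_line2 oA cf As.
- move=> s /Ps/rP[_ hs]; rewrite -lerBlDl -qdN -qdD addrC.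
  rewrite addrC; apply: le_trans (qd_le_norm (d := d) _ _) _.
    by move=> i j; apply/ltW/(hs (i, j)).
  by rewrite ler_wpM2r// dot_ge0.
by have := dot_ge0 v; nra.
Qed.

End C2_functions.

(** * Parabolic Taylor expansion of test functions *)

Section C2_test_functions.
Context {R : realType} {n : nat}.
Implicit Types eta : 'rV[R]_n * R -> R^o.

Lemma pair_norm (x : 'rV[R]_n) (s : R) : `|(x, s)| = Num.max `|x| `|s|.
Proof. by []. Qed.

Lemma slice_is_derive eta (p v : 'rV[R]_n) (t l : R) :
  is_derive (p, t) (v, 0) eta l <->
  is_derive p v (fun q => eta (q, t) : R^o) l.
Proof.
rewrite !is_derive_normP; have E h : (p, t) + h *: (v, 0) = (p + h *: v, t).
  by congr (_, _); rewrite /= scaler0 addr0.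
by split=> H e /H[d d0 dP]; exists d => // h /dP; rewrite E.
Qed.

Lemma slice_C1 eta t : is_C1 setT eta ->
  is_C1 setT (fun q => eta (q, t) : R^o).
Proof.
move=> ce p _ v; have [de ve] := ce (p, t) I (v, 0).
have D q : is_derive q v (fun q => eta (q, t) : R^o) ('D_(v, 0) eta (q, t)).
  by apply/slice_is_derive; exact: C1_is_derive ce _.
have DE q : 'D_v (fun q => eta (q, t) : R^o) q = 'D_(v, 0) eta (q, t).
  by have [] := D q.
split; first by have [] := D p.
move/cont_normP in ve; apply/cont_normP => e /ve[r r0 rP].
exists r => // q qp; rewrite !DE.
apply: rP; rewrite (_ : _ - _ = (q - p, 0)); last by congr (_, _); exact: subrr.
by rewrite pair_norm normr0 max_l.
Qed.

Lemma slice_C2 eta t : is_C2 setT eta ->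
  is_C2 setT (fun q => eta (q, t) : R^o).
Proof.
move=> [ce cde]; split=> [|v]; first exact: slice_C1.
rewrite (_ : 'D_v _ = fun q => 'D_(v, 0) eta (q, t)); last first.
  apply/funext => q.
  by have [] := (slice_is_derive eta q v t _).1 (C1_is_derive (v, 0) ce I).
exact: (@slice_C1 ('D_(v, 0) eta) t (cde _)).
Qed.

Definition tdir : 'rV[R]_n * R := (0, 1).

Lemma time_line eta (x : 'rV[R]_n) (t s : R) : is_C1 setT eta ->
  is_derive s 1 (fun s => eta (x, t + s)) ('D_tdir eta (x, t + s)).
Proof.
move=> ce; have /is_derive_normP H := C1_is_derive tdir ce (I : setT (x, t + s)).
apply/(@is_derive_normP R) => e /H[d d0 dP]; exists d => // h /dP.
rewrite scaler1 (_ : _ + h *: tdir = (x, t + (s + h))) //.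
by congr (_, _); rewrite /= ?scaler0 ?addr0// addrA; congr (_ + _); exact: mulr1.
Qed.

Lemma time_is_derive eta (p : 'rV[R]_n) (t : R) : is_C1 setT eta ->
  derive1 (fun s => eta (p, s) : R^o) t = 'D_tdir eta (p, t).
Proof.
move=> ce; rewrite derive1E; have := time_line p 0 t ce; rewrite add0r => -[_ <-].
by congr ('D_1 _ t); apply/funext => s; rewrite add0r.
Qed.

Lemma grad_bounded k p : is_C1 [set: 'rV[R]_n] k ->
  exists r B : R, [/\ 0 < r, 0 <= B & forall q, `|q - p| < r ->
    dot (grad k q) (grad k q) <= B].
Proof.
move=> ck; pose b i := `|'D_(delta_mx 0 i) k p| + 1.
have : \forall q \near p, forall i : 'I_n, `|grad k q 0 i| < b i.
  apply: (@filter_forall _ _ (fun i q => `|grad k q 0 i| < b i) _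
    (nbhs_filter p)) => i.
  have [_ /cont_normP/(_ _ ltr01)[r r0 rP]] := ck p I (delta_mx 0 i).
  apply/(@near_normP _ _ p); exists r => // q /rP; rewrite mxE /b => qp.
  rewrite -[X in `|X|](subrK ('D_(delta_mx 0 i) k p)) addrC.
  by apply: le_lt_trans (ler_normD _ _) _; rewrite ltrD2l.
move=> /near_normP[r r0 rP]; exists r, (\sum_i b i ^+ 2); split => //.
  by apply: sumr_ge0 => i _; exact: sqr_ge0.
move=> q /rP gb; apply: ler_sum => i _.
rewrite -expr2 -real_normK ?num_real// ler_sqr ?nnegrE ?addr_ge0//; exact: ltW.
Qed.

Lemma young (g v : 'rV[R]_n) (s e : R) : 0 < e ->
  s * dot g v <= e * dot v v + s ^+ 2 * dot g g / (4 * e).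
Proof.
move=> e0; have := dot_ge0 ((2 * e) *: v - s *: g).
rewrite dotBl !dotBr !dotZl !dotZr (dotC v g) => H.
have -> : e * dot v v + s ^+ 2 * dot g g / (4 * e) = s * dot g v +
  (2 * e * (2 * e * dot v v) - 2 * e * (s * dot g v) -
  (s * (2 * e * dot g v) - s * (s * dot g g))) / (4 * e).
  by field; rewrite gt_eqF.
by rewrite lerDl divr_ge0// mulr_ge0// ltW.
Qed.

(** First order in time, second order in space. The mixed term is of order [tau xi]; Young's
    inequality splits it into a small multiple of [dot xi xi] and a multiple of [tau ^ 2]. Hence the
    term in [tau ^ 2], with arbitrary coefficient, in the test polynomials [quad]. *)
Lemma C2_parabolic_taylor eta p t (e : R) : is_C2 setT eta -> 0 < e ->
  exists r C : R, 0 < r /\ forall xi tau, `|xi| < r -> `|tau| < r ->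
  eta (p + xi, t + tau) <= eta (p, t) +
    (derive1 (fun s => eta (p, s) : R^o) t * tau +
     dot (grad (fun q => eta (q, t)) p) xi +
     qd (hess (fun q => eta (q, t)) p) xi / 2 + e * dot xi xi + C * tau ^+ 2).
Proof.
have key1 (a b : R) : `|a - b| < 1 -> a <= `|b| + 1.
  by rewrite ltr_norml; have := ler_norm b; lra.
have key2 (z0 z1 z2 a1 a tau dd l q e' BB KK : R) :
    z2 <= z1 + tau * a1 + tau ^+ 2 * KK / 2 ->
    tau * a1 <= tau * a + e' / 2 * dd + tau ^+ 2 * BB / (2 * e') ->
    z1 <= z0 + l + q / 2 + e' / 2 * dd ->
    z2 <= z0 + (a * tau + l + q / 2 + e' * dd + (KK / 2 + BB / (2 * e')) * tau ^+ 2).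
  by rewrite mulrDl [_ * BB / _]mulrAC -mulrA [_ / _ * BB]mulrC; nra.
move=> ce e0; have e2 : 0 < e / 2 by lra.
have [r1 r10 T1] := C2_taylor openT (slice_C2 t ce) (p := p) I e2.
pose et := 'D_tdir eta : _ -> R^o.
have cet : is_C1 setT et by exact: ce.2.
have [r2 [B [r20 B0 gB]]] := grad_bounded p (slice_C1 t cet).
pose ett := 'D_tdir et.
have [_ /cont_normP/(_ _ ltr01)[r3 r30 ettB]] := cet (p, t) I tdir.
pose K := `|ett (p, t)| + 1.
have eK q : `|q - (p, t)| < r3 -> ett q <= K.
  by move=> /ettB; exact: key1.
exists (Num.min r1 (Num.min r2 r3)), (K / 2 + B / (2 * e)).
split; first by rewrite !lt_min r10 r20 r30.
move=> xi tau; rewrite !lt_min => /and3P[x1 x2 x3] /and3P[t1 t2 t3].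
have H1 : eta (p + xi, t + tau) <= eta (p + xi, t) + tau * et (p + xi, t) +
    tau ^+ 2 * K / 2.
  have /= := @taylor_le _ (fun s => eta (p + xi, t + s * tau))
    (fun s => tau * et (p + xi, t + s * tau))
    (fun s => tau * (tau * ett (p + xi, t + s * tau))) (tau ^+ 2 * K).
  rewrite mul1r mul0r addr0; apply => s /andP[s0 s1].
  - exact: der_mulr (time_line (p + xi) t (s * tau) ce.1).
  - exact: derZ (der_mulr (time_line (p + xi) t (s * tau) cet)).
  - rewrite mulrA -expr2 ler_wpM2l ?sqr_ge0//; apply: eK.
    rewrite (_ : _ - _ = (xi, s * tau)); last first.
      by congr (_, _); rewrite /= addrC addKr.
    rewrite pair_norm gt_max x3 normrM ger0_norm//.
    by apply: le_lt_trans t3; rewrite ler_piMl.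
have H2 : tau * et (p + xi, t) <= tau * et (p, t) + e / 2 * dot xi xi +
    tau ^+ 2 * B / (2 * e).
  have [s|s /andP[s0 s1]] := MVT_fwd ler01 (f := fun s => et (p + s *: xi, t))
    (f' := fun s => dot (grad (fun q => et (q, t) : R^o) (p + s *: xi)) xi).
    move=> _; apply: (is_derive_line (f := fun q => et (q, t))).
    exact: (C1_grad _ openT (slice_C1 t cet)).
  rewrite scale1r scale0r addr0 subr0 mulr1 => Es.
  have gs := gB (p + s *: xi); rewrite addrC addKr normrZ ger0_norm// in gs.
  have {}gs := gs (le_lt_trans (ler_piMl (normr_ge0 _) s1) x2).
  have := young (grad (fun q => et (q, t) : R^o) (p + s *: xi)) xi tau e2.
  rewrite -Es mulrBr lerBlDl addrA => Y; apply: le_trans Y _; rewrite lerD2l.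
  rewrite (_ : 4 * (e / 2) = 2 * e); last by field.
  apply: ler_wpM2r; first by rewrite invr_ge0 mulr_ge0// ltW.
  exact: (ler_wpM2l (sqr_ge0 tau)).
rewrite (time_is_derive _ _ ce.1).
exact: key2 H1 H2 (T1 _ x1).
Qed.

End C2_test_functions.

(** * The sup norm on row vectors against the scalar product *)

Section sup_norm.
Context {R : realType} {n : nat}.
Implicit Types q v : 'rV[R]_n.

Lemma coord_le_norm q i : `|q 0 i| <= `|q|.
Proof.
rewrite [leRHS]/Num.norm /= mx_normrE.
exact: (le_bigmax _ (fun ij => `|q ij.1 ij.2|) (0, i)).
Qed.

Lemma norm_le_coord q M : 0 <= M -> (forall i, `|q 0 i| <= M) -> `|q| <= M.
Proof.
move=> M0 qM; rewrite [leLHS]/Num.norm /= mx_normrE; apply/bigmax_leP.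
by split=> // -[i j] _ /=; rewrite ord1.
Qed.

Lemma sqr_norm_le_dot q : `|q| ^+ 2 <= dot q q.
Proof.
rewrite -[leRHS]sqr_sqrtr ?dot_ge0// ler_sqr ?nnegrE ?sqrtr_ge0//.
apply: norm_le_coord => [|i]; first exact: sqrtr_ge0.
rewrite -sqrtr_sqr ler_wsqrtr// /dot (bigD1 i)//= -expr2 lerDl sumr_ge0// => j _.
by rewrite -expr2 sqr_ge0.
Qed.

Lemma abs_dot_le q v : `|dot q v| <= n%:R * `|q| * `|v|.
Proof.
apply: le_trans (ler_norm_sum _ _ _) _.
apply: (@le_trans _ _ (\sum_(i < n) `|q| * `|v|)).
  by apply: ler_sum => i _; rewrite normrM ler_pM// coord_le_norm.
by rewrite -mulrA mulr_natl sumr_const card_ord.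
Qed.

Lemma closed_sphere_compact : compact [set q : 'rV[R]_n | `|q| = 1].
Proof.
apply: bounded_closed_compact.
  by exists 1; split=> // x x1 q /= ->; exact: ltW.
rewrite (_ : [set _ | _] = (fun q : 'rV[R]_n => `|q|) @^-1` [set 1]).
  apply: closed_comp; first by move=> q _; exact: norm_continuous.
  exact: (@closed_eq R 1).
by apply/seteqP; split.
Qed.

End sup_norm.

(** * Elementary properties of norms *)

Section norms.
Context {R : realType} {n : nat} (f : 'rV[R]_n -> R) (hf : is_norm f).

Lemma norm_eq0 p : f p = 0 -> p = 0. Proof. by have [] := hf; auto. Qed.
Lemma normZ a p : f (a *: p) = `|a| * f p. Proof. by have [] := hf; auto. Qed.
Lemma norm_triangle p q : f (p + q) <= f p + f q.
Proof. by have [] := hf; auto. Qed.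

Lemma norm_at0 : f 0 = 0.
Proof. by rewrite -(scale0r 0) normZ normr0 mul0r. Qed.

Lemma norm_opp p : f (- p) = f p.
Proof. by rewrite -scaleN1r normZ normrN normr1 mul1r. Qed.

Lemma norm_ge0 p : 0 <= f p.
Proof. have := norm_triangle p (- p); rewrite subrr norm_at0 norm_opp; lra. Qed.

Lemma norm_gt0 p : p != 0 -> 0 < f p.
Proof.
move=> p0; rewrite lt_neqAle norm_ge0 andbT eq_sym; apply: contra_neq p0.
exact: norm_eq0.
Qed.

Lemma norm_dist p q : `|f p - f q| <= f (p - q).
Proof.
have := norm_triangle (p - q) q; have := norm_triangle (q - p) p.
by rewrite !subrK -(norm_opp (q - p)) opprB ler_norml; lra.
Qed.

Lemma norm_le_bound : exists2 C : R, 0 < C & forall q, f q <= C * `|q|.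
Proof.
exists (\sum_i f (delta_mx 0 i) + 1).
  by rewrite ltr_wpDl// sumr_ge0// => i _; exact: norm_ge0.
move=> q; rewrite mulrDl mul1r -[leLHS]addr0 lerD// mulr_suml {1}(row_sum_delta q).
elim/big_ind2: _ => [|x1 x2 y1 y2 h1 h2|i _]; first by rewrite norm_at0.
  by apply: le_trans (norm_triangle _ _) _; exact: lerD.
by rewrite normZ mulrC ler_wpM2l ?norm_ge0// coord_le_norm.
Qed.

End norms.

(** * Regular norms: convexity and homogeneity of the Hessian *)

Section regular_norms.
Context {R : realType} {n : nat} (phi : 'rV[R]_n -> R).
Hypothesis rphi : regular_norm phi.

Let hphi : is_norm phi. Proof. by have [] := rphi. Qed.
Let C2phi : is_C2 [set p : 'rV[R]_n | p != 0] (phi : _ -> R^o).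
Proof. by have [] := rphi. Qed.

Lemma open_neq0 : open [set p : 'rV[R]_n | p != 0].
Proof.
rewrite openE => p p0; apply/(@near_normP _ _ p); exists `|p|.
  by rewrite normr_gt0.
by move=> q; apply: contraTneq => ->; rewrite sub0r normrN ltxx.
Qed.

Lemma regular_hess_sym q : q != 0 -> (hess phi q)^T = hess phi q.
Proof. by move=> q0; exact: hess_sym open_neq0 C2phi q0. Qed.

(** The triangle inequality makes [phi (q + s v) + phi (q - s v) - 2 phi q] nonnegative, and the
    Taylor bounds at [q + s v] and [q - s v] turn this into a lower bound for the form, up to an
    arbitrarily small error. *)
Lemma regular_hess_psd q : q != 0 -> psd (hess phi q).
Proof.
move=> q0 v; apply/ler_addgt0Pr => e e0.
pose M := dot v v + 1; have M0 : 0 < M by rewrite ltr_wpDl// dot_ge0.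
have eM : 0 < e / (2 * M) by rewrite divr_gt0// mulr_gt0.
have [r r0 T] := C2_taylor open_neq0 C2phi q0 eM.
pose s := r / (2 * (`|v| + 1)).
have v1 : 0 < `|v| + 1 by rewrite ltr_wpDl.
have s0 : 0 < s by rewrite divr_gt0// mulr_gt0.
have sv : `|s *: v| < r.
  rewrite normrZ gtr0_norm// /s mulrAC ltr_pdivrMr ?mulr_gt0// ltr_pM2l//.
  by have := normr_ge0 v; lra.
have := T _ sv; have := T (- (s *: v)); rewrite normrN => /(_ sv).
have -> : qd (hess phi q) (- (s *: v)) = qd (hess phi q) (s *: v).
  by rewrite /qd mulNmx dotNl dotNr opprK.
have := norm_triangle hphi (q + s *: v) (q - s *: v).
rewrite addrACA subrr addr0 -mulr2n -scaler_nat normZ// ger0_norm//.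
rewrite dotNr dotNl dotNr opprK !qdZv !dotZr !dotZl => H1 H2 H3.
have : 0 <= s ^+ 2 * (qd (hess phi q) v + 2 * (e / (2 * M)) * dot v v).
  move: H1 H2 H3; set X := qd _ _; set Y := dot v v; set G := dot _ v.
  set E := e / _; lra.
rewrite pmulr_rge0 ?exprn_gt0// => H; apply: le_trans H _.
rewrite lerD2l (_ : 2 * _ = e / M); last by field; rewrite gt_eqF.
by rewrite mulrAC ler_pdivrMr// ler_pM2l// lerDl.
Qed.

(** Differentiates the identity [f (c x) = k f x], assumed only near [p] so that it applies to the
    derivatives of [phi], which are controlled away from 0. *)
Lemma is_derive_homogeneous (f : 'rV[R]_n -> R) p v (c k l r : R) : c != 0 ->
  0 < r -> (forall x, `|x - p| < r -> f (c *: x) = k * f x) ->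
  is_derive p v (f : _ -> R^o) l ->
  is_derive (c *: p) v (f : _ -> R^o) (k / c * l).
Proof.
move=> c0 r0 fk /is_derive_normP df; apply/is_derive_normP => e e0.
have k1 : 0 < `|k| + 1 by rewrite ltr_wpDl.
have cn0 : 0 < `|c| by rewrite normr_gt0.
have [d d0 dP] := df (e * `|c| / (`|k| + 1)) (divr_gt0 (mulr_gt0 e0 cn0) k1).
have v1 : 0 < `|v| + 1 by rewrite ltr_wpDl.
exists (`|c| * Num.min d (r / (`|v| + 1))).
  by rewrite mulr_gt0// lt_min d0 divr_gt0.
move=> h; rewrite -ltr_pdivrMl// -normfV -normrM lt_min => /andP[hd hr].
rewrite mulrC in hd hr.
have -> : c *: p + h *: v = c *: (p + (h / c) *: v).
  by rewrite scalerDr scalerA mulrC divfK.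
rewrite fk; last first.
  rewrite addrC addKr normrZ; move: hr; rewrite ltr_pdivlMr//.
  by apply: le_lt_trans; rewrite ler_wpM2l// lerDl.
rewrite fk ?subrr ?normr0// (_ : _ - _ = k * (f (p + (h / c) *: v) - f p - h / c * l)).
  rewrite normrM; apply: le_trans (ler_wpM2l (normr_ge0 k) (dP _ hd)) _.
  rewrite normrM normfV.
  rewrite (_ : _ * _ = (`|k| / (`|k| + 1)) * (e * `|h|)); last first.
    by field; rewrite !gt_eqF.
  apply: ler_piMl; first by rewrite mulr_ge0// ltW.
  by rewrite ler_pdivrMr// mul1r lerDl.
by field.
Qed.

Lemma scale_neq0 (c : R) (q : 'rV[R]_n) : c != 0 -> q != 0 -> c *: q != 0.
Proof. by move=> c0 q0; rewrite scaler_eq0 negb_or c0. Qed.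

Lemma regular_derive_scale q v (c : R) : c != 0 -> q != 0 ->
  'D_v (phi : _ -> R^o) (c *: q) = `|c| / c * 'D_v (phi : _ -> R^o) q.
Proof.
move=> c0 q0; have D := C1_is_derive v C2phi.1 q0.
have H x : `|x - q| < 1 -> phi (c *: x) = `|c| * phi x.
  by move=> _; exact: normZ.
by have [_ ->] := is_derive_homogeneous c0 ltr01 H D.
Qed.

Lemma regular_hess_scale q (c : R) : c != 0 -> q != 0 ->
  hess phi (c *: q) = `|c|^-1 *: hess phi q.
Proof.
move=> c0 q0; apply/matrixP => i j; rewrite !mxE.
set f := fun q => _; have D := C1_is_derive (delta_mx 0 j) (C2phi.2 (delta_mx 0 i)) q0.
have /near_normP[r r0 rP] : \forall x \near q, x != 0.
  exact: (open_nbhs_nbhs (conj open_neq0 q0)).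
have H x : `|x - q| < r -> f (c *: x) = `|c| / c * f x.
  by move=> /rP x0; exact: regular_derive_scale.
have [_ ->] := is_derive_homogeneous c0 r0 H D.
congr (_ * _); rewrite -mulrA -invfM -expr2 -[c ^+ 2]real_normK ?num_real//.
by rewrite expr2 invfM mulrA divff ?mul1r// normr_eq0.
Qed.

End regular_norms.

Lemma for_continuous_sum (R : realType) (V : normedModType R) (I : Type)
    (s : seq I) (f : I -> V -> R) p :
  (forall i, {for p, continuous (f i)}) ->
  {for p, continuous (fun q => \sum_(i <- s) f i q)}.
Proof.
move=> cf; elim: s => [|i s IH].
  rewrite (_ : (fun q => _) = fun=> 0); first exact: cst_continuous.
  by apply/funext => q; rewrite big_nil.
rewrite (_ : (fun q => _) = fun q => f i q + \sum_(i <- s) f i q); last first.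
  by apply/funext => q; rewrite big_cons.
exact: (continuousD (cf i) IH).
Qed.

(** * The curvature operator and its symmetries *)

Section flow.
Context {R : realType} {n : nat} (phi psi : 'rV[R]_n -> R).
Hypothesis rphi : regular_norm phi.
Hypothesis hpsi : is_norm psi.

Let hphi : is_norm phi. Proof. by have [] := rphi. Qed.
Let C2phi : is_C2 [set p : 'rV[R]_n | p != 0] (phi : _ -> R^o).
Proof. by have [] := rphi. Qed.

(** Euler: the gradient of [phi] is constant along rays. *)
Lemma regular_hess_kernel q : q != 0 -> qd (hess phi q) q = 0.
Proof.
move=> q0; have q00 : q + (0 : R) *: q != 0 by rewrite scale0r addr0.
have := C2_line2 open_neq0 C2phi q00; rewrite scale0r addr0.
move=> /(is_derive_normP (V := R)) H; apply/eqP; rewrite -normr_le0.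
apply/ler_addgt0Pr => e e0; rewrite add0r.
have [d d0 dP] := H _ e0; pose h := Num.min d 1 / 2.
have m0 : 0 < Num.min d 1 by rewrite lt_min d0 ltr01.
have h0 : 0 < h by rewrite divr_gt0.
have hd : `|h| < d.
  rewrite gtr0_norm// ltr_pdivrMr//; have : Num.min d 1 <= d by rewrite ge_min lexx.
  lra.
have := dP _ hd; rewrite scaler1 add0r scale0r addr0.
have -> : grad phi (q + h *: q) = grad phi q.
  apply/rowP => i; rewrite !mxE -[X in X + _]scale1r -scalerDl.
  have h1 : 0 < 1 + h by rewrite addr_gt0.
  by rewrite (regular_derive_scale rphi) ?gt_eqF// gtr0_norm// divff ?mul1r// gt_eqF.
by rewrite subrr sub0r normrN normrM (mulrC `|h|) ler_pM2r// normr_gt0 gt_eqF.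
Qed.

Definition flow (q : 'rV[R]_n) (X : 'M[R]_n) : R :=
  psi q * \tr (hess phi q *m X).

Lemma flow_le q X Y : q != 0 -> (forall v, qd X v <= qd Y v) ->
  flow q X <= flow q Y.
Proof.
move=> q0 XY; rewrite ler_wpM2l ?(norm_ge0 hpsi)// -subr_ge0 -linearB /=.
rewrite -mulmxBr psd_trace_ge0 ?(regular_hess_sym rphi)//.
  exact: (regular_hess_psd rphi).
by move=> v; rewrite qdD qdN subr_ge0.
Qed.

Lemma flowZ q a X : flow q (a *: X) = a * flow q X.
Proof. by rewrite /flow -scalemxAr linearZ /= mulrCA. Qed.

Lemma flow0 q : flow q 0 = 0.
Proof. by rewrite /flow mulmx0 linear0 mulr0. Qed.

(** [psi] has degree 1 and the Hessian of [phi] has degree -1: the flow is geometric. *)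
Lemma flow_scale q c X : 0 < c -> q != 0 -> flow (c *: q) X = flow q X.
Proof.
move=> c0 q0; rewrite /flow (regular_hess_scale rphi) ?gt_eqF// (normZ hpsi).
rewrite -scalemxAl linearZ /= gtr0_norm// [c * _]mulrC -mulrA mulVKf//.
by rewrite gt_eqF.
Qed.

Lemma flow_opp q X : q != 0 -> flow (- q) (- X) = - flow q X.
Proof.
move=> q0; rewrite -scaleN1r /flow (regular_hess_scale rphi) ?oppr_eq0 ?oner_eq0//.
rewrite (normZ hpsi) normrN normr1 invr1 scale1r mul1r mulmxN linearN /=.
by rewrite mulrN.
Qed.

(** The Hessian of [phi] at [q] annihilates [q], so a lower bound for [X] on the tangent space of
    the level set is enough. *)
Lemma flow_ge_tangent q X w k : q != 0 ->
  (forall v, dot v q = 0 -> k * dot v w ^+ 2 <= qd X v) ->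
  psi q * (k * qd (hess phi q) w) <= flow q X.
Proof.
move=> q0 kX; rewrite ler_wpM2l ?(norm_ge0 hpsi)//.
apply: trace_ge_tangent kX; first exact: (regular_hess_sym rphi).
  exact: (regular_hess_psd rphi).
exact: regular_hess_kernel.
Qed.

(** Degree 0 reduces the bound to the compact unit sphere. The constant fixes the speed of the
    paraboloids used as initial barriers. *)
Lemma flow_scalar_bounded : exists2 C : R, 0 <= C &
  forall q, q != 0 -> 0 <= flow q 1%:M <= C.
Proof.
have key (x y z M : R) : x <= M -> 0 <= x -> 0 <= y -> y <= z -> x * y <= M * `|z|.
  by move=> xM x0 y0 yz; apply: ler_pM => //; exact: le_trans yz (ler_norm _).
have [M M0 psiM] := norm_le_bound hpsi.
pose S := [set q : 'rV[R]_n | `|q| = 1].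
have trc : {within S, continuous (fun q => \tr (hess phi q))}.
  apply: continuous_in_subspaceT => q; rewrite inE /= => q1.
  have q0 : q != 0 by rewrite -normr_gt0 q1.
  have -> : (fun q => \tr (hess phi q)) = fun q => \sum_(i < n)
      'D_(delta_mx 0 i) ('D_(delta_mx 0 i) (phi : _ -> R^o) : _ -> R^o) q.
    by apply/funext => x; apply: eq_bigr => i _; rewrite mxE.
  apply: (for_continuous_sum (V := 'rV[R]_n)) => i.
  by have [] := C2phi.2 (delta_mx 0 i) _ q0 (delta_mx 0 i).
have ge0 q : q != 0 -> 0 <= flow q 1%:M.
  move=> q0; rewrite -(flow0 q); apply: flow_le => // v.
  by rewrite qd0 qd_scalar mul1r dot_ge0.
have [[q Sq]|S0] := pselect (exists q, S q); last first.
  exists 0 => // q q0; exfalso; apply: S0; exists (`|q|^-1 *: q).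
  by rewrite /S /= normrZ normfV normr_id mulVf// normr_eq0.
have Sn0 : S !=set0 by exists q.
have [c cS cmax] := compact_EVT_max Sn0 closed_sphere_compact trc.
exists (M * `|\tr (hess phi c)|); first by rewrite mulr_ge0// ltW.
move=> p p0; rewrite ge0//= -(flow_scale (c := `|p|^-1))//; last first.
  by rewrite invr_gt0 normr_gt0.
have pS : `| (`|p|^-1 *: p) | = 1.
  by rewrite normrZ normfV normr_id mulVf// normr_eq0.
have s0 : `|p|^-1 *: p != 0 by rewrite -normr_gt0 pS.
have tr0 : 0 <= \tr (hess phi (`|p|^-1 *: p)).
  have := psd_trace_ge0 (regular_hess_sym rphi s0) (regular_hess_psd rphi s0)
    (X := 1%:M).
  by rewrite mulmx1; apply => v; rewrite qd_scalar mul1r dot_ge0.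
have trle : \tr (hess phi (`|p|^-1 *: p)) <= \tr (hess phi c).
  by apply: cmax; rewrite inE.
have := psiM (`|p|^-1 *: p); rewrite pS mulr1 => px.
have px0 := norm_ge0 hpsi (`|p|^-1 *: p).
by rewrite /flow mulmx1; exact: key px px0 tr0 trle.
Qed.

End flow.

Lemma limf_esup_ge (R : realType) (T : choiceType) (X : filteredType T)
    (g : X -> R) (F : set_system X) (a : R) : Filter F ->
  (forall c, (\forall x \near F, g x <= c) -> a <= c) ->
  (a%:E <= limf_esup (fun x => (g x)%:E) F)%E.
Proof.
move=> FF H; rewrite limf_esupE; apply: le_ereal_inf_tmp => _ [V /= FV <-].
rewrite leNgt; apply/negP => Sa.
have gV x c : ereal_sup [set (g x)%:E | x in V] = c -> V x -> ((g x)%:E <= c)%E.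
  by move=> <- Vx; apply: ereal_sup_ubound; exists x.
move: Sa; case E : ereal_sup => [c| |] Sa.
- suff : a <= c by rewrite leNgt -lte_fin Sa.
  by apply: H; apply: (@filterS _ F FF _ _ _ FV) => x /(gV _ _ E); rewrite lee_fin.
- by [].
- suff : a <= a - 1 by rewrite lerBrDr gerDl ler10.
  by apply: H; apply: (@filterS _ F FF _ _ _ FV) => x /(gV _ _ E).
Qed.

(** * Viscosity inequalities tested with quadratic polynomials *)

Section polynomial_tests.
Context {R : realType} {n : nat} (phi psi : 'rV[R]_n -> R).
Implicit Types (a c r t tau C : R) (p q xi : 'rV[R]_n) (X : 'M[R]_n).
Implicit Types w : 'rV[R]_n -> R -> R.

Local Notation flow := (flow phi psi).

(* [a <= F^*(q, X)], with [F^*] the upper semicontinuous envelope. *)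
Definition sub_ineq a q X := forall c r, 0 < r ->
  (forall y Z, `|y - q| < r -> `|Z - X| < r -> y != 0 -> flow y Z <= c) ->
  a <= c.

Definition quad a q X C xi tau :=
  a * tau + dot q xi + qd X xi / 2 + C * tau ^+ 2.

Definition touches w p t a q X C r := [/\ X^T = X, 0 < r &
  forall xi tau, `|xi| < r -> `|tau| < r ->
  w (p + xi) (t + tau) <= w p t + quad a q X C xi tau].

Definition sub_at w p t := forall a q X C r,
  touches w p t a q X C r -> sub_ineq a q X.

(** The operator is odd in gradient and Hessian together, so one notion serves for both kinds of
    solutions. *)
Definition super_at w p t := sub_at (fun p t => - w p t) p t.

(** The relaxed inequality passes to limits in [X]. This absorbs the error of Taylor expansions and
    the strictness added to test polynomials. *)
Lemma sub_ineq_perturb a q X :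
  (forall e, 0 < e -> sub_ineq a q (X + e%:M)) -> sub_ineq a q X.
Proof.
move=> H c r r0 Fc; pose M := `|1%:M : 'M[R]_n| + 1.
have M0 : 0 < M by rewrite ltr_wpDl.
pose e := r / (2 * M); have e0 : 0 < e by rewrite divr_gt0// mulr_gt0.
have r2 : 0 < r / 2 by lra.
have eM : `|e%:M : 'M[R]_n| <= r / 2.
  rewrite -scalemx1 normrZ gtr0_norm// (_ : r / 2 = e * M); last first.
    by rewrite /e; field; rewrite gt_eqF.
  by rewrite ler_pM2l// lerDl.
apply: (H _ e0 c (r / 2) r2) => y Z yq Zq y0; apply: Fc => //; first by lra.
have -> : Z - X = Z - (X + e%:M) + e%:M by rewrite opprD addrA subrK.
by apply: le_lt_trans (ler_normD _ _) _; lra.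
Qed.

(** Near the contact point a C2 test function lies below its parabolic Taylor polynomial with
    Hessian increased by [e]. *)
Lemma sub_at_C2 w (eta : 'rV[R]_n * R -> R^o) p t : is_C2 setT eta ->
  sub_at w p t ->
  (\forall z \near (p, t), w z.1 z.2 - eta z <= w p t - eta (p, t)) ->
  sub_ineq (derive1 (fun s => eta (p, s) : R^o) t)
    (spatial_jet eta p t).1 (spatial_jet eta p t).2.
Proof.
move=> ce sw /(@near_normP _ _ (p, t))[r r0 rP].
apply: sub_ineq_perturb => e e0; have e2 : 0 < e / 2 by lra.
have [s [C [s0 T]]] := C2_parabolic_taylor p t ce e2.
apply: (sw _ _ _ C (Num.min r s)); split.
- rewrite linearD /= tr_scalar_mx; congr (_ + _).
  exact: (hess_sym openT (slice_C2 t ce) I).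
- by rewrite lt_min r0.
- move=> xi tau; rewrite !lt_min => /andP[xr xs] /andP[tr ts].
  have := rP (p + xi, t + tau); rewrite (_ : _ - _ = (xi, tau)); last first.
    by congr (_, _); rewrite /= addrC addKr.
  rewrite pair_norm gt_max xr tr => /(_ isT) /= H.
  have := T _ _ xs ts; rewrite /quad qdD qd_scalar.
  move: H; move: (w _ _) (w p t) (eta _) (eta (p, t)) => x y z u.
  set A := derive1 _ _; set q := grad _ _; set X := hess _ _.
  set dq := dot _ _; set Q := qd _ _; lra.
Qed.

Lemma sub_at_viscosity w : (forall p t, 0 < t -> sub_at w p t) ->
  viscosity_subsolution phi psi (fun z => w z.1 z.2).
Proof.
move=> sw eta ce p t t0 wmax; have H := sub_at_C2 ce (sw p t t0) wmax.
apply: limf_esup_ge => c.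
rewrite near_withinE => /(@near_normP _ _ (spatial_jet eta p t))[s s0 sP].
apply: (H c s s0) => y Z yq ZX y0; apply: (sP (y, Z)) => //.
by rewrite (_ : _ - _ = (y - (spatial_jet eta p t).1, Z - (spatial_jet eta p t).2)) //
  /Num.norm /= gt_max yq.
Qed.

Lemma C1_opp (V : normedModType R) (f : V -> R^o) : is_C1 setT f ->
  (forall v, 'D_v (fun x => - f x : R^o) = fun x => - 'D_v f x) /\
  is_C1 setT (fun x => - f x : R^o).
Proof.
move=> cf; have D v : 'D_v (fun x => - f x : R^o) = fun x => - 'D_v f x.
  by apply/funext => x; rewrite (deriveN (f := f))//; have [] := cf x I v.
split=> // x _ v; have [df cDf] := cf x I v; rewrite D; split.
  exact: (derivableN (f := f)).
exact: continuousN.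
Qed.

Lemma super_at_viscosity w : regular_norm phi -> is_norm psi ->
  (forall p t, 0 < t -> super_at w p t) ->
  viscosity_supersolution phi psi (fun z => w z.1 z.2).
Proof.
move=> rphi hpsi sw eta ce p t t0 wmin.
have [D1 ce1] := C1_opp ce.1.
have ceN : is_C2 setT (fun z => - eta z : R^o).
  split; first exact: ce1.
  move=> v; exact: (eq_ind_r (is_C1 setT) (C1_opp (ce.2 v)).2 (D1 v)).
have wmax : \forall z \near (p, t),
    - w z.1 z.2 - - eta z <= - w p t - - eta (p, t).
  by apply: filterS wmin => z /=; lra.
have := sub_at_C2 ceN (sw p t t0) wmax.
have -> : derive1 (fun s => - eta (p, s) : R^o) t =
    - derive1 (fun s => eta (p, s) : R^o) t.
  rewrite (time_is_derive _ _ ce.1); apply: etrans (time_is_derive p t ce1) _.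
  exact: (congr1 (fun f => f (p, t)) (D1 tdir)).
have [D2 _] := C1_opp (slice_C1 t ce.1).
have -> : spatial_jet (fun z => - eta z) p t =
    (- (spatial_jet eta p t).1, - (spatial_jet eta p t).2).
  congr (_, _).
    by apply/rowP => i; rewrite !mxE; exact: (congr1 (fun f => f p) (D2 _)).
  apply/matrixP => i j; rewrite !mxE.
  have [D3 _] := C1_opp ((slice_C2 t ce).2 (delta_mx 0 i)).
  apply: etrans (congr1 (fun f => f p) (D3 (delta_mx 0 j))).
  exact: (congr1 (fun f : 'rV[R]_n -> R^o => 'D_(delta_mx 0 j) f p) (D2 _)).
move=> H; rewrite /lsc_operator /limf_einf -leeN2 oppeK.
apply: (@limf_esup_ge _ _ _ (fun qX => - flow qX.1 qX.2)) => c.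
rewrite near_withinE => /(@near_normP _ _ (spatial_jet eta p t))[s s0 sP].
apply: (H c s s0) => y Z /= yq ZX y0.
have y0N : - y != 0 by rewrite oppr_eq0.
rewrite -(opprK y) -(opprK Z) (flow_opp rphi hpsi)//.
apply: (sP (- y, - Z)) => //.
rewrite (_ : _ - _ = (- y - (spatial_jet eta p t).1, - Z - (spatial_jet eta p t).2)) //.
move: yq ZX; rewrite !opprK => yq ZX.
by rewrite /Num.norm /= gt_max -!opprD !normrN; apply/andP.
Qed.

End polynomial_tests.

(** * Operations on subsolutions: minorants, shifts, maxima *)

Section perron_tools.
Context {R : realType} {n : nat} (phi psi : 'rV[R]_n -> R).
Hypothesis rphi : regular_norm phi.
Hypothesis hpsi : is_norm psi.
Implicit Types (a c r t tau C : R) (p q xi : 'rV[R]_n) (X : 'M[R]_n).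
Implicit Types w : 'rV[R]_n -> R -> R.

Local Notation flow := (flow phi psi).
Local Notation sub_ineq := (sub_ineq phi psi).
Local Notation sub_at := (sub_at phi psi).

Lemma quadratic_ge0 a C r : 0 < r ->
  (forall s, `|s| < r -> 0 <= a * s + C * s ^+ 2) -> a = 0.
Proof.
move=> r0 H; apply/eqP; rewrite -normr_le0; apply/ler_addgt0Pr => e e0.
rewrite add0r; pose s := Num.min (r / 2) (e / (`|C| + 1)).
have C1 : 0 < `|C| + 1 by rewrite ltr_wpDl.
have s0 : 0 < s by rewrite lt_min !divr_gt0.
have sr : `|s| < r.
  by rewrite gtr0_norm//; have : s <= r / 2 by [rewrite ge_min lexx|]; lra.
have sC : C * s <= e.
  apply: (@le_trans _ _ ((`|C| + 1) * s)).
    by rewrite ler_wpM2r ?(ltW s0)//; have := ler_norm C; lra.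
  by rewrite mulrC -ler_pdivlMr// ge_min lexx orbT.
have := H _ sr; have := H (- s); rewrite normrN => /(_ sr).
rewrite sqrrN expr2 mulrN !mulrA -!mulNr -!mulrDl !pmulr_lge0// => h1 h2.
by rewrite ler_norml; lra.
Qed.

Lemma small_scale (v : 'rV[R]_n) r s : 0 < r -> `|s| < r / (`|v| + 1) ->
  `|s *: v| < r.
Proof.
move=> r0; have v1 : 0 < `|v| + 1 by rewrite ltr_wpDl.
rewrite ltr_pdivlMr// normrZ; apply: le_lt_trans.
by rewrite ler_wpM2l// lerDl.
Qed.

Lemma quad_ge0 a q X C r : 0 < r ->
  (forall xi tau, `|xi| < r -> `|tau| < r -> 0 <= quad a q X C xi tau) ->
  [/\ a = 0, q = 0 & psd X].
Proof.
move=> r0 H; have r1 (v : 'rV[R]_n) : 0 < r / (`|v| + 1).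
  by rewrite divr_gt0// ltr_wpDl.
have HS (v : 'rV[R]_n) (s : R) : `|s| < r / (`|v| + 1) ->
    0 <= dot q v * s + qd X v / 2 * s ^+ 2.
  move=> sr; have := H (s *: v) 0 (small_scale r0 sr); rewrite normr0 => /(_ r0).
  by rewrite /quad dotZr qdZv; lra.
have q0 : q = 0.
  by apply/eqP; rewrite -dot_eq0; apply/eqP; exact: (quadratic_ge0 (r1 q) (HS q)).
split=> // [|v].
  apply: (quadratic_ge0 (r := r) (C := C)) => // s sr.
  by have := H 0 s; rewrite normr0 /quad dot0r /qd dot0r => /(_ r0 sr); lra.
pose s := r / (`|v| + 1) / 2; have s0 : 0 < s by rewrite divr_gt0.
have := HS v s; rewrite q0 dot0l mul0r add0r gtr0_norm//.
rewrite pmulr_lge0 ?exprn_gt0// pmulr_lge0 ?invr_gt0//; apply.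
by rewrite /s; have := r1 v; lra.
Qed.

Lemma quad_shift a q X C xi1 tau1 xi tau : X^T = X ->
  quad a q X C (xi1 + xi) (tau1 + tau) = quad a q X C xi1 tau1 +
  quad (a + 2 * C * tau1) (q + xi1 *m X) X C xi tau.
Proof. by move=> sX; rewrite /quad qd_addv// dotDr dotDl; lra. Qed.

Lemma quadB a q X C a' q' X' C' xi tau :
  quad (a - a') (q - q') (X - X') (C - C') xi tau =
  quad a q X C xi tau - quad a' q' X' C' xi tau.
Proof. by rewrite /quad qdD qdN dotBl; lra. Qed.

(** Witness form of the relaxed inequality; the nonzero [y] matters when [q = 0], where the operator
    is undefined. *)
Definition flow_near a q X := forall r, 0 < r -> exists y Z,
  [/\ `|y - q| < r, `|Z - X| < r, y != 0 & a <= flow y Z].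

Lemma flow_near_sub_ineq a q X X' : flow_near a q X ->
  (forall v, qd X v <= qd X' v) -> sub_ineq a q X'.
Proof.
move=> Fa XX' c r r0 Fc; have [y [Z [yq ZX y0 aF]]] := Fa r r0.
apply: (le_trans aF); apply: le_trans (Fc y (Z + (X' - X)) yq _ y0).
  apply: (flow_le rphi hpsi) => // v; rewrite !qdD qdN.
  by have := XX' v; lra.
by rewrite addrCA [X' + _]addrC addrK.
Qed.

(** A polynomial touching [w] from below and a test polynomial touching it from above share time
    derivative and gradient, and their Hessians are ordered. *)
Lemma sub_at_below w p t a q X C r : 0 < r ->
  (forall xi tau, `|xi| < r -> `|tau| < r ->
    w p t + quad a q X C xi tau <= w (p + xi) (t + tau)) ->
  flow_near a q X -> sub_at w p t.
Proof.
move=> r0 wQ Fa a' q' X' C' r' [sX' r'0 H].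
have m0 : 0 < Num.min r r' by rewrite lt_min r0.
have [|a0 q0 pX] := @quad_ge0 (a' - a) (q' - q) (X' - X) (C' - C) _ m0.
  move=> xi tau; rewrite !lt_min => /andP[x1 x2] /andP[t1 t2].
  by rewrite quadB; have := wQ _ _ x1 t1; have := H _ _ x2 t2; lra.
have -> : a' = a by lra.
have -> : q' = q by apply/eqP; rewrite -subr_eq0 q0.
apply: flow_near_sub_ineq Fa _ => v.
by have := pX v; rewrite qdD qdN subr_ge0.
Qed.

Lemma sub_at_le w v p t r : 0 < r ->
  (forall xi tau, `|xi| < r -> `|tau| < r -> w (p + xi) (t + tau) <= v (p + xi) (t + tau)) ->
  v p t = w p t -> sub_at w p t -> sub_at v p t.
Proof.
move=> r0 wv e sw a q X C r' [sX r'0 H].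
apply: (sw a q X C (Num.min r r')); split=> //; first by rewrite lt_min r0.
move=> xi tau; rewrite !lt_min => /andP[x1 x2] /andP[t1 t2].
by rewrite -e; apply: le_trans (wv _ _ x1 t1) (H _ _ x2 t2).
Qed.

Lemma sub_at_shift w p t h s k : sub_at w (p + h) (t + s) ->
  sub_at (fun p t => w (p + h) (t + s) - k) p t.
Proof.
move=> sw a q X C r [sX r0 H]; apply: (sw a q X C r); split=> // xi tau xr tr.
by have := H xi tau xr tr; rewrite addrAC [t + tau + s]addrAC; lra.
Qed.

(** The alternative admits a [v] that is a translate in time, for which no inequality is known where
    the shifted time is not positive. *)
Lemma sub_at_maxl w v p t : sub_at w p t -> sub_at v p t \/ v p t <= w p t ->
  sub_at (fun p t => Num.max (w p t) (v p t)) p t.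
Proof.
move=> sw; have [vw _|wv [sv|//]] := leP (v p t) (w p t).
  apply: sub_at_le sw; first exact: ltr01.
    by move=> *; rewrite le_max lexx.
  by rewrite max_l.
apply: sub_at_le sv; first exact: ltr01.
  by move=> *; rewrite le_max lexx orbT.
by rewrite max_r// ltW.
Qed.

Definition unc w := fun z : 'rV[R]_n * R => w z.1 z.2.

Lemma quad_continuous a q X C p t :
  continuous (unc (fun x s => quad a q X C (x - p) (s - t))).
Proof.
move=> z; rewrite /unc /quad.
have c1 i : {for z, continuous (fun z : 'rV[R]_n * R => (z.1 - p) 0 i)}.
  apply: (continuous_comp (f := fun z : 'rV[R]_n * R => z.1 - p)
    (g := fun x : 'rV[R]_n => x 0 i)); last exact: coord_continuous.
  by apply: continuousB; [exact: cvg_fst|exact: cst_continuous].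
have c2 : {for z, continuous (fun z : 'rV[R]_n * R => z.2 - t)}.
  by apply: continuousB; [exact: cvg_snd|exact: cst_continuous].
have d1 : {for z, continuous (fun z : 'rV[R]_n * R => a * (z.2 - t))}.
  by apply: continuousM => //; exact: cst_continuous.
have d2 : {for z, continuous (fun z : 'rV[R]_n * R => dot q (z.1 - p))}.
  apply: for_continuous_sum => i.
  by apply: continuousM => //; exact: cst_continuous.
have d3 : {for z, continuous (fun z : 'rV[R]_n * R => qd X (z.1 - p) / 2)}.
  apply: continuousM; last exact: cst_continuous.
  rewrite (_ : (fun z => _) = fun z : 'rV[R]_n * R => \sum_i \sum_j
      (z.1 - p) 0 i * (z.1 - p) 0 j * X i j); last first.
    by apply/funext => x; rewrite qdE.
  apply: for_continuous_sum => i; apply: for_continuous_sum => j.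
  by apply: continuousM; [exact: continuousM|exact: cst_continuous].
have d4 : {for z, continuous (fun z : 'rV[R]_n * R => C * (z.2 - t) ^+ 2)}.
  by apply: continuousM; [exact: cst_continuous|exact: continuousM].
exact: (continuousD (continuousD (continuousD d1 d2) d3) d4).
Qed.

End perron_tools.

(** * Suprema of subsolutions *)

Section sup_of_subsolutions.
Context {R : realType} {n : nat} (phi psi : 'rV[R]_n -> R).
Hypothesis rphi : regular_norm phi.
Hypothesis hpsi : is_norm psi.
Implicit Types (a c r t tau C : R) (p q xi : 'rV[R]_n) (X : 'M[R]_n).
Implicit Types w : 'rV[R]_n -> R -> R.

Local Notation flow := (flow phi psi).
Local Notation sub_ineq := (sub_ineq phi psi).
Local Notation sub_at := (sub_at phi psi).

Lemma unc_continuousB w v : continuous (unc w) -> continuous (unc v) ->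
  continuous (unc (fun x s => w x s - v x s)).
Proof. by move=> cw cv z; exact: (continuousB (cw z) (cv z)). Qed.

Lemma quad00 a q X C : quad a q X C 0 0 = 0.
Proof. by rewrite /quad dot0r /qd mul0mx dot0l expr0n /= !mulr0 mul0r !addr0. Qed.

Lemma mulmx_norm_le xi X : `|xi *m X| <= n%:R * `|X| * `|xi|.
Proof.
apply: norm_le_coord => [|j]; first by rewrite !mulr_ge0.
rewrite mxE; apply: le_trans (ler_norm_sum _ _ _) _.
apply: (@le_trans _ _ (\sum_(i < n) `|X| * `|xi|)).
  apply: ler_sum => i _; rewrite normrM mulrC ler_pM// ?coord_le_norm//.
  rewrite [leRHS]/Num.norm /= mx_normrE.
  exact: (le_bigmax _ (fun ij => `|X ij.1 ij.2|) (i, j)).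
by rewrite -mulrA mulr_natl sumr_const card_ord.
Qed.

Lemma box_max w p t b : 0 <= b -> continuous (unc w) ->
  exists xi1 tau1, [/\ `|xi1| <= b, `|tau1| <= b &
    forall xi tau, `|xi| <= b -> `|tau| <= b ->
    w (p + xi) (t + tau) <= w (p + xi1) (t + tau1)].
Proof.
move=> b0 cw.
pose B := [set v : 'rV[R]_n | forall i, `[p 0 i - b, p 0 i + b]%classic (v ord0 i)].
have cB : compact B.
  by apply: (rV_compact (A := fun i => `[p 0 i - b, p 0 i + b]%classic)) => i;
    exact: segment_compact.
pose K := B `*` `[t - b, t + b]%classic.
have cK : compact K by apply: compact_setX => //; exact: segment_compact.
have itvP (y x : R) : `[y - b, y + b]%classic x <-> `|x - y| <= b.
  by rewrite /= in_itv /= ler_norml; lra.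
have KP xi tau : `|xi| <= b -> `|tau| <= b -> K (p + xi, t + tau).
  move=> xb tb; split => [i|]; apply/itvP; rewrite ?mxE [_ - _]addrC addKr//.
  exact: le_trans (coord_le_norm xi i) xb.
have K0 : K !=set0 by exists (p + 0, t + 0); apply: KP; rewrite normr0.
have [[x s] /set_mem [/= Bx /itvP ts] xmax] :=
  compact_EVT_max K0 cK (continuous_subspaceT cw).
exists (x - p), (s - t); split=> //.
  by apply: norm_le_coord => // i; have /itvP := Bx i; rewrite !mxE.
move=> xi tau xb tb; rewrite ![_ + (_ - _)]addrC !subrK.
by have := xmax (p + xi, t + tau); rewrite inE; apply; exact: KP.
Qed.

(** Adding [e / 2] times [dot xi xi + tau ^ 2] to the test polynomial makes the contact strict. A
    member of [S] nearly optimal at [(p, t)] then touches a recentred polynomial at an interior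
    point of a small box, and its inequality is passed to the limit. *)
Lemma sub_at_sup (S : set ('rV[R]_n -> R -> R)) W p t rho : 0 < rho ->
  (forall w, S w -> forall x s, `|x - p| < rho -> `|s - t| < rho ->
     sub_at w x s /\ w x s <= W x s) ->
  (forall w, S w -> continuous (unc w)) ->
  (forall e, 0 < e -> exists2 w, S w & W p t - e < w p t) -> sub_at W p t.
Proof.
move=> rho0 Ssub Scont Ssup a q X C r [sX r0 H].
apply: sub_ineq_perturb => e e0; pose X' := X + e%:M; pose C' := C + e / 2.
have sX' : X'^T = X' by rewrite linearD /= tr_scalar_mx sX.
have quadE xi tau : quad a q X' C' xi tau =
    quad a q X C xi tau + e / 2 * (dot xi xi + tau ^+ 2).
  by rewrite /quad /X' /C' qdD qd_scalar; lra.
move=> c r1 r10 Fc; apply/ler_addgt0Pr => d d0.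
pose M1 := 2 * `|C'| + 1; pose M2 := n%:R * `|X'| + 1.
have M10 : 0 < M1 by rewrite ltr_wpDl// mulr_ge0.
have M20 : 0 < M2 by rewrite ltr_wpDl// mulr_ge0.
(* [s] keeps the box inside both domains and bounds the changes due to recentring: at most [d] for
   the time derivative and [r1 / 2] for the gradient. *)
pose s := Num.min (Num.min r rho) (Num.min (d / M1) (r1 / (2 * M2))).
have s0 : 0 < s by rewrite !lt_min r0 rho0 !divr_gt0// mulr_gt0.
have [sr srho sd sr1] : [/\ s <= r, s <= rho, M1 * s <= d & M2 * s <= r1 / 2].
  split; try by rewrite /s !ge_min lexx ?orbT.
    by rewrite mulrC -ler_pdivlMr// /s !ge_min lexx ?orbT.
  have : s <= r1 / (2 * M2) by rewrite /s !ge_min lexx ?orbT.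
  by rewrite ler_pdivlMr ?mulr_gt0//; lra.
pose b := s / 2; have b0 : 0 < b by rewrite divr_gt0.
have db : 0 < e / 2 * b ^+ 2 by rewrite mulr_gt0 ?exprn_gt0// divr_gt0.
have [w Sw w0] := Ssup _ db.
have cw : continuous (unc (fun x s => w x s - quad a q X' C' (x - p) (s - t))).
  by apply: unc_continuousB; [exact: Scont|exact: quad_continuous].
have [xi1 [tau1 [x1b t1b zmax]]] := box_max p t (ltW b0) cw.
have bs : b < s by rewrite /b; lra.
have in_rho xi tau : `|xi| < s -> `|tau| < s -> sub_at w (p + xi) (t + tau) /\
    w (p + xi) (t + tau) <= W (p + xi) (t + tau).
  move=> xs ts; apply: Ssub => //; rewrite addrC addKr.
    exact: lt_le_trans srho.
  exact: lt_le_trans srho.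
have x1s := le_lt_trans x1b bs; have t1s := le_lt_trans t1b bs.
have eV (x : 'rV[R]_n) : p + x - p = x by rewrite addrC addKr.
have eR (x : R) : t + x - t = x by rewrite addrC addKr.
(* The deficit of [w] at the centre is below the gain [e / 2 * b ^ 2] of the perturbed polynomial on
   the boundary of the box, so the maximum is interior. *)
have small : dot xi1 xi1 + tau1 ^+ 2 < b ^+ 2.
  have e2 : 0 < e / 2 by lra.
  rewrite -(ltr_pM2l e2).
  have := zmax 0 0; rewrite !normr0 !addr0 !subrr => /(_ (ltW b0) (ltW b0)).
  rewrite eV eR.
  have := H _ _ (lt_le_trans x1s sr) (lt_le_trans t1s sr).
  have [_] := in_rho _ _ x1s t1s; rewrite quad00 subr0 quadE; lra.
have x1lt : `|xi1| < b.
  rewrite -ltr_sqr ?nnegrE ?(ltW b0)//; apply: le_lt_trans small.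
  by rewrite -[leLHS]addr0 lerD ?sqr_norm_le_dot// sqr_ge0.
have t1lt : `|tau1| < b.
  rewrite -ltr_sqr ?nnegrE ?(ltW b0)//; apply: le_lt_trans small.
  by rewrite real_normK ?num_real// lerDr dot_ge0.
pose r2 := Num.min (b - `|xi1|) (b - `|tau1|).
have r20 : 0 < r2 by rewrite lt_min !subr_gt0 x1lt.
have tch : touches w (p + xi1) (t + tau1) (a + 2 * C' * tau1) (q + xi1 *m X') X' C' r2.
  split=> // xi tau; rewrite !lt_min => /andP[xb _] /andP[_ tb].
  have xx : `|xi1 + xi| <= b by apply: le_trans (ler_normD _ _) _; lra.
  have tt : `|tau1 + tau| <= b by apply: le_trans (ler_normD _ _) _; lra.
  have := zmax _ _ xx tt; rewrite !eV !eR quad_shift// !addrA; lra.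
have [sw _] := in_rho _ _ x1s t1s.
have r12 : 0 < r1 / 2 by lra.
suff : a + 2 * C' * tau1 <= c.
  have : - (2 * C' * tau1) <= d; last by lra.
  apply: le_trans sd; apply: le_trans (ler_norm _) _; rewrite normrN normrM.
  apply: ler_pM => //; last exact: ltW.
  by rewrite normrM ger0_norm// /M1 lerDl.
apply: (sw _ _ _ _ _ tch c _ r12) => y Z yq ZX y0; apply: Fc => //; last first.
  by apply: lt_le_trans ZX _; lra.
have -> : y - q = y - (q + xi1 *m X') + xi1 *m X' by rewrite opprD addrA subrK.
apply: le_lt_trans (ler_normD _ _) _.
have : `|xi1 *m X'| <= r1 / 2; last by lra.
apply: le_trans sr1; apply: le_trans (mulmx_norm_le _ _) _.
apply: ler_pM; [by rewrite mulr_ge0|by []|by rewrite /M2 lerDl|exact: ltW].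
Qed.

End sup_of_subsolutions.

Lemma addrBl (V : zmodType) (x y : V) : x + y - x = y.
Proof. by rewrite addrC addKr. Qed.

(** * Perron's method *)

Section perron.
Context {R : realType} {n : nat} (phi psi : 'rV[R]_n -> R).
Hypothesis n0 : (0 < n)%N.
Hypothesis rphi : regular_norm phi.
Hypothesis hpsi : is_norm psi.
Implicit Types (a c r t tau C : R) (p q xi : 'rV[R]_n) (X : 'M[R]_n).
Implicit Types w : 'rV[R]_n -> R -> R.

Local Notation flow := (flow phi psi).
Local Notation sub_ineq := (sub_ineq phi psi).
Local Notation sub_at := (sub_at phi psi).
Local Notation super_at := (super_at phi psi).

(** The envelopes of paraboloids used as barriers may move like the square root of time initially;
    hence a bound [sg + M |s - t|] with [M] depending on [sg] instead of a Lipschitz bound in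
    time. *)
Definition modulus (L : R) w :=
  (forall x y s, `|w x s - w y s| <= L * `|x - y|) /\
  forall sg, 0 < sg -> exists2 M, 0 < M &
    forall x s t, `|w x s - w x t| <= sg + M * `|s - t|.

Lemma modulus_continuous L w : modulus L w -> continuous (unc w).
Proof.
move=> [wL wM] [x s]; apply/(cont_normP (unc w)) => e e0.
have e4 : 0 < e / 4 by lra.
have [M M0 wMe] := wM _ e4.
have L1 : 0 < `|L| + 1 by rewrite ltr_wpDl.
exists (Num.min (e / 4 / (`|L| + 1)) (e / 4 / M)).
  by rewrite lt_min !divr_gt0.
move=> [y t]; rewrite /unc /=.
rewrite (_ : _ - _ = (y - x, t - s)) // pair_norm gt_max !lt_min.
move=> /andP[/andP[yx _] /andP[_ ts]].
rewrite ltr_pdivlMr// in yx; rewrite ltr_pdivlMr// in ts.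
have h1 := wL y x t; have h2 := wMe x t s.
have : L * `|y - x| <= e / 4.
  apply: le_trans (ltW yx); rewrite mulrC ler_wpM2l//.
  by have := ler_norm L; lra.
have -> : w y t - w x s = (w y t - w x t) + (w x t - w x s) by rewrite addrA subrK.
have := ler_normD (w y t - w x t) (w x t - w x s).
rewrite mulrC in ts; lra.
Qed.

Lemma unc_continuous_max w v : continuous (unc w) -> continuous (unc v) ->
  continuous (unc (fun x s => Num.max (w x s) (v x s))).
Proof. by move=> cw cv z; exact: (continuous_max (cw z) (cv z)). Qed.

Lemma unc_continuous_shift w h s k : continuous (unc w) ->
  continuous (unc (fun x t => w (x + h) (t + s) - k)).
Proof.
move=> cw [x r]; apply/(cont_normP (unc _)) => e e0.
have /(cont_normP (unc w))/(_ _ e0)[d d0 dP] := cw (x + h, r + s).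
exists d => // -[y t] yd; rewrite /unc /= opprB addrA subrK.
apply: (dP (y + h, t + s)); apply: le_lt_trans yd.
rewrite (_ : _ - _ = (y + h - (x + h), t + s - (r + s))) //.
rewrite (_ : (y, t) - _ = (y - x, t - r)) // !pair_norm.
by rewrite !opprD [y + h + _]addrACA [t + s + _]addrACA !subrr !addr0.
Qed.

Lemma nonzero_near q r : 0 < r -> exists2 y, `|y - q| < r & y != 0.
Proof.
move=> r0; have [q0|q0] := eqVneq q 0; last by exists q; rewrite ?subrr ?normr0.
pose v : 'rV[R]_n := delta_mx 0 (Ordinal n0).
have v0 : v != 0.
  apply/negP => /eqP/rowP/(_ (Ordinal n0)); rewrite !mxE !eqxx => /eqP.
  by rewrite oner_eq0.
pose s := r / (`|v| + 1) / 2.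
have v1 : 0 < r / (`|v| + 1) by rewrite divr_gt0// ltr_wpDl.
have s0 : 0 < s by rewrite divr_gt0.
exists (s *: v); last by rewrite scaler_eq0 negb_or v0 gt_eqF.
by rewrite q0 subr0 small_scale// gtr0_norm// /s; lra.
Qed.

(** Oddness turns an upper bound of the operator near [(q, X)] into a lower bound near [(- q, - X)],
    the form needed for the bump in [perron_super]. *)
Lemma flow_near_neg q X c r : 0 < r ->
  (forall y Z, `|y - q| < r -> `|Z - X| < r -> y != 0 -> flow y Z <= c) ->
  forall a1 q1 X1, `|q1 + q| < r -> `|X1 + X| < r -> a1 <= - c ->
  flow_near phi psi a1 q1 X1.
Proof.
move=> r0 Fc a1 q1 X1 q1q X1X ac s s0.
have m0 : 0 < Num.min s (r - `|q1 + q|) by rewrite lt_min s0 subr_gt0.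
have [y + y0] := nonzero_near q1 m0; rewrite lt_min => /andP[ys yr].
exists y, X1; split; rewrite ?subrr ?normr0//.
have yN : - y != 0 by rewrite oppr_eq0.
apply: (le_trans ac); rewrite -(opprK y) -(opprK X1) (flow_opp rphi hpsi)// lerN2.
apply: Fc => //; last by rewrite -normrN opprD opprK opprK.
rewrite -normrN opprB opprK (_ : q + y = (y - q1) + (q1 + q)); last first.
  by rewrite addrA subrK addrC.
by apply: le_lt_trans (ler_normD _ _) _; lra.
Qed.

Variables (f g : 'rV[R]_n -> R -> R) (U0 : 'rV[R]_n -> R) (L : R).
Hypothesis fL : modulus L f.
Hypothesis gL : modulus L g.
Hypothesis fg : forall x t, f x t <= g x t.
Hypothesis f0 : forall x t, t <= 0 -> f x t = U0 x.
Hypothesis g0 : forall x t, t <= 0 -> g x t = U0 x.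
Hypothesis gmono : forall x s t, s <= t -> g x s <= g x t.
Hypothesis fsub : forall x t, 0 < t -> sub_at f x t.
Hypothesis gsuper : forall x t, 0 < t -> super_at g x t.

Definition perron_class w := [/\ continuous (unc w),
  forall x t, f x t <= w x t <= g x t &
  forall x t, 0 < t -> sub_at w x t].

Definition perron x t := sup [set w x t | w in perron_class].

Lemma perron_class_lower : perron_class f.
Proof.
split; [exact: modulus_continuous fL| |exact: fsub].
by move=> x t; rewrite lexx fg.
Qed.

Lemma perron_ge w x t : perron_class w -> w x t <= perron x t.
Proof.
move=> cw; apply: ub_le_sup; last by exists w.
by exists (g x t) => _ [v [_ vb _] <-]; have /andP[] := vb x t.
Qed.

Lemma perron_le x t c : (forall w, perron_class w -> w x t <= c) ->
  perron x t <= c.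
Proof.
move=> H; apply: ge_sup; first by exists (f x t), f => //; exact: perron_class_lower.
by move=> _ [w cw <-]; exact: H.
Qed.

Lemma perron_bounds x t : f x t <= perron x t <= g x t.
Proof.
rewrite (perron_ge _ _ perron_class_lower)/=; apply: perron_le => w [_ wb _].
by have /andP[] := wb x t.
Qed.

(* A translate of a member of the class, lowered and cut off at [f], is in the
   class; thus the supremum inherits the modulus of continuity of [f] and [g]. *)
Lemma perron_class_shift w h s k : perron_class w ->
  (forall x t, w (x + h) (t + s) - k <= g x t) ->
  (forall x t, t + s <= 0 -> 0 < t -> w (x + h) (t + s) - k <= f x t) ->
  perron_class (fun x t => Num.max (f x t) (w (x + h) (t + s) - k)).
Proof.
move=> [cw wb sw] wg wf; split.
- have cws : continuous (unc (fun x t => w (x + h) (t + s) - k)).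
    exact: unc_continuous_shift.
  exact: unc_continuous_max (modulus_continuous fL) cws.
- by move=> x t; rewrite le_max lexx ge_max fg wg.
- move=> x t t0; apply: sub_at_maxl; first exact: fsub.
  have [ts|ts] := leP (t + s) 0; first by right; exact: wf.
  by left; apply: sub_at_shift; exact: sw.
Qed.

Lemma perron_shift h s k :
  (forall w x t, perron_class w -> w (x + h) (t + s) - k <= g x t) ->
  (forall w x t, perron_class w -> t + s <= 0 -> 0 < t ->
     w (x + h) (t + s) - k <= f x t) ->
  forall x t, perron (x + h) (t + s) - k <= perron x t.
Proof.
move=> wg wf x t; rewrite lerBlDr; apply: perron_le => w cw; rewrite -lerBlDr.
have := perron_ge x t (@perron_class_shift w h s k cw (fun x t => wg w x t cw)
  (fun x t => wf w x t cw)).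
by apply: le_trans; rewrite le_max lexx orbT.
Qed.

Lemma perron_class_init w x t : perron_class w -> t <= 0 -> w x t = U0 x.
Proof.
by move=> [_ /(_ x t) + _] t0; rewrite f0// g0// -eq_le => /eqP.
Qed.

(** A forward shift in time is kept below [g] by the modulus of [g]. A backward shift is below [g]
    because [g] is nondecreasing in time; where the shifted time is not positive it equals the
    initial datum, and the modulus of [f] keeps it below [f]. *)
Lemma perron_modulus : modulus L perron.
Proof.
have [fLip fM] := fL; have [gLip gM] := gL.
have Lip x y s : perron x s - L * `|x - y| <= perron y s.
  have := @perron_shift (x - y) 0 (L * `|x - y|) _ _ y s.
  rewrite addr0 [y + _]addrC subrK; apply=> w z t cw; rewrite addr0; last lra.
  have [_ /(_ (z + (x - y)) t)/andP[_ wg] _] := cw.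
  have := gLip (z + (x - y)) z t; rewrite addrBl ler_norml => /andP[_].
  lra.
split=> [x y s|sg sg0].
  have := Lip x y s; have := Lip y x s; rewrite distrC ler_norml; lra.
have sg2 : 0 < sg / 2 by lra.
have [M1 M10 fM1] := fM _ sg2; have [M2 M20 gM2] := gM _ sg2.
pose M := M1 + M2; exists M; first exact: addr_gt0.
have up x s tau : 0 <= tau -> perron x (s + tau) - (sg + M * tau) <= perron x s.
  move=> tau0; have := @perron_shift 0 tau (sg + M * tau) _ _ x s.
  rewrite addr0; apply=> w z t cw; rewrite addr0; last lra.
  have [_ /(_ z (t + tau))/andP[_ wg] _] := cw.
  have := gM2 z (t + tau) t; rewrite addrBl (ger0_norm tau0) ler_norml.
  have := mulr_ge0 (ltW M10) tau0.
  by rewrite /M mulrDl; lra.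
have down x s tau : 0 <= tau -> perron x (s - tau) - (sg + M * tau) <= perron x s.
  move=> tau0; have := @perron_shift 0 (- tau) (sg + M * tau) _ _ x s.
  have MM := mulr_ge0 (ltW M10) tau0; have MM2 := mulr_ge0 (ltW M20) tau0.
  rewrite addr0; apply=> w z t cw; rewrite addr0.
    have [_ /(_ z (t - tau))/andP[_ wg] _] := cw.
    have : g z (t - tau) <= g z t by apply: gmono; lra.
    rewrite /M mulrDl; lra.
  move=> ttau t0; rewrite (perron_class_init _ cw ttau).
  have := fM1 z t 0; rewrite (f0 z (lexx 0)) subr0 (gtr0_norm t0) ler_norml.
  have : M1 * t <= M1 * tau by rewrite ler_wpM2l ?(ltW M10)//; lra.
  rewrite /M mulrDl; lra.
move=> x s t; wlog st : s t / s <= t => [H|].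
  have [/H//|/ltW/H] := leP s t.
  by rewrite distrC [`|t - s|]distrC.
have ts0 : 0 <= t - s by rewrite subr_ge0.
rewrite [`|s - t|]distrC (ger0_norm ts0).
have := up x s _ ts0; have := down x t _ ts0.
have -> : t - (t - s) = s by lra.
have -> : s + (t - s) = t by lra.
by rewrite ler_norml; lra.
Qed.

Lemma perron_sub x t : 0 < t -> sub_at perron x t.
Proof.
move=> t0; apply: (@sub_at_sup _ _ phi psi perron_class _ x t t t0).
- move=> w cw y s _ st; split; last exact: perron_ge.
  have [_ _] := cw; apply; move: st; rewrite ltr_norml; lra.
- by move=> w [].
- move=> e e0; have hs : has_sup [set w x t | w in perron_class].
    split; first by exists (f x t), f => //; exact: perron_class_lower.
    by exists (g x t) => _ [v [_ vb _] <-]; have /andP[] := vb x t.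
  by have [_ [w cw <-] H] := sup_adherent e0 hs; exists w.
Qed.

Lemma perron_class_perron : perron_class perron.
Proof.
split; [exact: modulus_continuous perron_modulus|exact: perron_bounds|].
by move=> x t; exact: perron_sub.
Qed.

(* A failure of the supersolution property leaves room for a bump above
   [perron] inside the class. *)
Lemma perron_super p0 t0 : 0 < t0 -> super_at perron p0 t0.
Proof.
move=> t0gt a q X C r tch.
(* Where [perron] touches [g] the property is inherited from [g]; elsewhere there is room for a
   bump. *)
have /andP[_] := perron_bounds p0 t0; rewrite le_eqVlt => /predU1P[Wg|Wg].
  have := @sub_at_le _ _ phi psi (fun p t => - g p t) (fun p t => - perron p t)
    p0 t0 1 ltr01.
  rewrite Wg => /(_ _ erefl (@gsuper p0 t0 t0gt)) H; apply: (H _ _ _ _ _ _ tch).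
  by move=> xi tau _ _; rewrite lerN2; have /andP[] := perron_bounds (p0 + xi) (t0 + tau).
have [sX r0 H] := tch.
move=> c r1 r10 Fc; rewrite leNgt; apply/negP => ca.
pose W0 := perron p0 t0; pose d := g p0 t0 - W0.
have d0 : 0 < d by rewrite subr_gt0.
pose M := `|1%:M : 'M[R]_n| + 1; have M0 : 0 < M by rewrite ltr_wpDl.
have [gam gam0 gamM] : exists2 gam : R, 0 < gam & 2 * gam * M < r1.
  exists (r1 / (4 * M)); first by rewrite divr_gt0// mulr_gt0.
  rewrite (_ : 2 * _ * M = r1 / 2); first lra.
  by field; rewrite gt_eqF.
(* Lowering Hessian and time coefficient by multiples of [gam] makes the bump fall below [perron]
   away from the centre, while [gamM] keeps the Hessian in the range of [Fc]. *)
pose X1 : 'M[R]_n := - X - (2 * gam)%:M; pose C1 := - C - gam.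
have sX1 : X1^T = X1 by rewrite linearB linearN /= sX tr_scalar_mx.
have X1X : `|X1 + X| < r1.
  rewrite /X1 addrAC addNr add0r normrN -scalemx1 normrZ gtr0_norm ?mulr_gt0//.
  apply: le_lt_trans gamM; apply: ler_wpM2l; last by rewrite /M lerDl.
  by rewrite mulr_ge0// ltW.
have quadE xi tau : quad (- a) (- q) X1 C1 xi tau =
    - quad a q X C xi tau - gam * (dot xi xi + tau ^+ 2).
  by rewrite /quad /X1 /C1 qdD !qdN qd_scalar dotNl; lra.
have cP : continuous (unc perron) by exact: modulus_continuous perron_modulus.
have cg : continuous (unc g) by exact: modulus_continuous gL.
have d4 : 0 < d / 4 by lra.
have /(cont_normP (unc perron))/(_ _ d4)[rP rP0 HP] := cP (p0, t0).
have /(cont_normP (unc g))/(_ _ d4)[rg rg0 Hg] := cg (p0, t0).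
pose M1 := 2 * `|C1| + 1; pose M2 := n%:R * `|X1| + 1.
have M10 : 0 < M1 by rewrite ltr_wpDl// mulr_ge0.
have M20 : 0 < M2 by rewrite ltr_wpDl// mulr_ge0.
pose rho := Num.min (Num.min r (Num.min rP rg))
  (Num.min t0 (Num.min ((a - c) / M1) (r1 / M2))).
have rho0 : 0 < rho by rewrite !lt_min r0 rP0 rg0 t0gt !divr_gt0// subr_gt0.
have [[rho_r rho_rP rho_rg] [rho_t rho_M1 rho_M2]] :
    [/\ rho <= r, rho <= rP & rho <= rg] /\
    [/\ rho <= t0, M1 * rho <= a - c & M2 * rho <= r1].
  split; split; try by rewrite /rho !ge_min lexx ?orbT.
    by rewrite mulrC -ler_pdivlMr// /rho !ge_min lexx ?orbT.
  by rewrite mulrC -ler_pdivlMr// /rho !ge_min lexx ?orbT.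
(* The height of the bump: small enough to stay below [g], and absorbed by the [gam] terms outside
   half of the box. *)
pose del := Num.min (d / 4) (gam * (rho / 2) ^+ 2).
have del0 : 0 < del by rewrite lt_min d4 mulr_gt0// exprn_gt0// divr_gt0.
pose Q x t := W0 + del + quad (- a) (- q) X1 C1 (x - p0) (t - t0).
pose box x t := (`|x - p0| < rho) && (`|t - t0| < rho).
pose w x t := if box x t then Num.max (perron x t) (Q x t) else perron x t.
have QW x t : box x t -> Q x t <= perron x t + del -
    gam * (dot (x - p0) (x - p0) + (t - t0) ^+ 2).
  move=> /andP[xp tt].
  have := H (x - p0) (t - t0) (lt_le_trans xp rho_r) (lt_le_trans tt rho_r).
  rewrite ![_ + (_ - _)]addrC !subrK /Q quadE -/W0; lra.
have Qout x t : box x t -> (rho / 2 <= `|x - p0|) || (rho / 2 <= `|t - t0|) ->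
    Q x t <= perron x t.
  move=> bxt xt; apply: le_trans (QW _ _ bxt) _.
  suff : del <= gam * (dot (x - p0) (x - p0) + (t - t0) ^+ 2) by lra.
  apply: (@le_trans _ _ (gam * (rho / 2) ^+ 2)); first by rewrite ge_min lexx orbT.
  rewrite ler_wpM2l ?(ltW gam0)//.
  have sq u : rho / 2 <= u -> (rho / 2) ^+ 2 <= u ^+ 2.
    by move=> ru; rewrite ler_sqr// nnegrE; lra.
  case/orP: xt => /sq ru; apply: (le_trans ru).
    by apply: le_trans (sqr_norm_le_dot _) _; rewrite lerDl sqr_ge0.
  by rewrite real_normK ?num_real// lerDr dot_ge0.
have w_le x t : perron x t <= w x t.
  by rewrite /w; case: ifP => // _; rewrite le_max lexx.
have Kw : perron_class w.
  split.
  - have cQ : continuous (unc Q).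
      move=> z; exact: (continuousD (@cst_continuous _ _ (W0 + del) z)
        (@quad_continuous _ _ (- a) (- q) X1 C1 p0 t0 z)).
    move=> [x t]; have [bxt|nb] := boolP (box x t).
      have cm : {for (x, t), continuous
          (unc (fun x s => Num.max (perron x s) (Q x s)))}.
        exact: (unc_continuous_max cP cQ).
      apply/(cont_normP (unc w)) => e e0.
      have /(cont_normP (unc _))/(_ _ e0)[s s0 sP] := cm.
      have /andP[xp tt] := bxt.
      exists (Num.min s (Num.min (rho - `|x - p0|) (rho - `|t - t0|))).
        by rewrite !lt_min s0 !subr_gt0 xp.
      move=> [y u]; rewrite (_ : (y, u) - _ = (y - x, u - t)) // pair_norm.
      rewrite !lt_min !gt_max => /andP[us /andP[/andP[xb _] /andP[_ tb]]].
      have := sP (y, u); rewrite (_ : (y, u) - _ = (y - x, u - t)) // pair_norm gt_max.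
      move=> /(_ us); rewrite /unc /= /w bxt; suff -> : box y u by [].
      rewrite /box -[y - p0](subrKA x) -[u - t0](subrKA t).
      rewrite (le_lt_trans (ler_normD _ _)) /=; last by lra.
      by rewrite (le_lt_trans (ler_normD _ _)) //=; lra.
    apply/(cont_normP (unc w)) => e e0.
    have /(cont_normP (unc perron))/(_ _ e0)[s s0 sP] := cP (x, t).
    exists (Num.min s (rho / 2)); first by rewrite lt_min s0 divr_gt0.
    move=> [y u] yu; have := yu; rewrite lt_min => /andP[/sP + yr].
    rewrite /unc /= {2}/w (negbTE nb) /w; case: ifPn => // byu.
    rewrite max_l//; apply: Qout => //; move: nb yr; rewrite /box negb_and -!leNgt.
    rewrite (_ : (y, u) - _ = (y - x, u - t)) // pair_norm gt_max => + /andP[yx ut].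
    case/orP => h; apply/orP; [left|right].
      have := ler_distD y x p0; rewrite [`|x - y|]distrC; lra.
    have := ler_distD u t t0; rewrite [`|t - u|]distrC; lra.
  - move=> x t; have /andP[fP Pg] := perron_bounds x t.
    rewrite (le_trans fP (w_le x t)) /w; case: ifPn => // bxt.
    rewrite ge_max Pg; apply: le_trans (QW _ _ bxt) _.
    have /andP[xp tt] := bxt.
    have nz : `|(x, t) - (p0, t0)| < rho.
      by rewrite (_ : _ - _ = (x - p0, t - t0)) // pair_norm gt_max xp.
    have := HP (x, t) (lt_le_trans nz rho_rP).
    have := Hg (x, t) (lt_le_trans nz rho_rg).
    rewrite /unc /= !ltr_norml.
    have := mulr_ge0 (ltW gam0) (addr_ge0 (dot_ge0 (x - p0)) (sqr_ge0 (t - t0))).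
    have : del <= d / 4 by rewrite ge_min lexx.
    by rewrite /d /W0; lra.
  - move=> x t tgt; have [bQ|] := boolP (box x t && (perron x t < Q x t)); last first.
      move=> nb; apply: (sub_at_le ltr01 _ _ (@perron_sub x t tgt)).
        by move=> *; exact: w_le.
      rewrite /w; case: ifP nb => // _ /=; rewrite -leNgt => QP.
      by rewrite max_l.
    case/andP: bQ => bxt PQ; have /andP[xp tt] := bxt.
    pose r2 := Num.min (rho - `|x - p0|) (rho - `|t - t0|).
    have r20 : 0 < r2 by rewrite lt_min !subr_gt0 xp.
    apply: (sub_at_below rphi hpsi r20 (q := - q + (x - p0) *m X1)
      (a := - a + 2 * C1 * (t - t0)) (X := X1) (C := C1)).
      move=> xi tau; rewrite !lt_min => /andP[xb _] /andP[_ tb].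
      have bx : box (x + xi) (t + tau).
        rewrite /box addrAC [t + tau - t0]addrAC.
        rewrite (le_lt_trans (ler_normD _ _)) /=; last by lra.
        by rewrite (le_lt_trans (ler_normD _ _)) //=; lra.
      rewrite /w bxt bx max_r ?(ltW PQ)//.
      rewrite le_max; apply/orP; right; rewrite /Q -addrA -quad_shift//.
      by rewrite [x + xi - p0]addrAC [t + tau - t0]addrAC.
    refine (@flow_near_neg q X c r1 r10 Fc _ _ _ _ X1X _).
      rewrite addrAC addNr add0r; apply: le_lt_trans (mulmx_norm_le _ _) _.
      apply: (@le_lt_trans _ _ (M2 * `|x - p0|)).
        by rewrite ler_wpM2r// lerDl.
      by apply: lt_le_trans rho_M2; rewrite ltr_pM2l.
    have : 2 * C1 * (t - t0) <= a - c; last by lra.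
    apply: le_trans (ler_norm _) _; rewrite normrM normrM.
    rewrite (ger0_norm (_ : 0 <= 2))//; apply: le_trans rho_M1.
    by apply: ler_pM; [rewrite mulr_ge0| |rewrite /M1 lerDl|exact: ltW].
have := perron_ge p0 t0 Kw; rewrite /w /box /Q !subrr !normr0 rho0 /= quad00 addr0.
rewrite ge_max -/W0 => /andP[_]; lra.
Qed.

End perron.

(** * Initial barriers: envelopes of descending paraboloids *)

Section barriers.
Context {R : realType} {n : nat} (phi psi : 'rV[R]_n -> R).
Hypothesis n0 : (0 < n)%N.
Hypothesis rphi : regular_norm phi.
Hypothesis hpsi : is_norm psi.
Implicit Types (a c r t tau C sg : R) (p q xi : 'rV[R]_n) (X : 'M[R]_n).

Variables (U0 : 'rV[R]_n -> R) (L M C : R).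
Hypothesis L0 : 0 < L.
Hypothesis M0 : 0 <= M.
Hypothesis C0 : 0 <= C.
Hypothesis FC : forall q, q != 0 -> 0 <= flow phi psi q 1%:M <= C.
Hypothesis ULip : forall x y, `|U0 x - U0 y| <= L * `|x - y|.

(** Since [L r <= L sg / 2 + L r ^ 2 / (2 sg)], it starts below [U0]. Its Hessian is [- L / sg]
    times the identity, so the speed of descent [C L / sg] makes it a subsolution; the additional
    speed [M] puts the envelope below [U0 - M t]. *)
Definition paraboloid q sg (x : 'rV[R]_n) t : R := U0 q - L * sg / 2 -
  L / sg / 2 * dot (x - q) (x - q) - (C * (L / sg) + M) * t.

Definition posp t : R := Num.max t 0.

Definition barrier (x : 'rV[R]_n) t : R :=
  sup [set y | exists q sg, 0 < sg <= 1 /\ y = paraboloid q sg x (posp t)].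

Lemma posp_ge0 t : 0 <= posp t. Proof. by rewrite le_max lexx orbT. Qed.

Lemma paraboloid_le q sg x t : 0 < sg -> 0 <= t ->
  paraboloid q sg x t <= U0 x - M * t.
Proof.
move=> sg0 t0; have := ULip q x; rewrite ler_norml => /andP[_ h1].
pose d := `|q - x|; have d2 := sqr_norm_le_dot (q - x).
have dE : dot (x - q) (x - q) = dot (q - x) (q - x).
  by rewrite -opprB dotNl dotNr opprK.
have k0 : 0 < L / sg by rewrite divr_gt0.
have h2 : L * `|q - x| <= L * sg / 2 + L / sg / 2 * `|q - x| ^+ 2.
  have := mulr_ge0 (ltW k0) (sqr_ge0 (`|q - x| - sg)).
  rewrite sqrrB (_ : L / sg * (_ + _) = L / sg * `|q - x| ^+ 2 -
    2 * L * `|q - x| + L * sg); last by field; rewrite gt_eqF.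
  lra.
have h3 : L / sg / 2 * `|q - x| ^+ 2 <= L / sg / 2 * dot (q - x) (q - x).
  by rewrite ler_wpM2l// divr_ge0// ltW.
have h4 : 0 <= C * (L / sg) * t by rewrite mulr_ge0// mulr_ge0// ltW.
by rewrite /paraboloid dE mulrDl; lra.
Qed.

Lemma barrier_has_sup x t : has_sup
  [set y | exists q sg, 0 < sg <= 1 /\ y = paraboloid q sg x (posp t)].
Proof.
split; first by exists (paraboloid x 1 x (posp t)), x, 1; rewrite ltr01 lexx.
exists (U0 x - M * posp t) => _ [q [sg [/andP[sg0 _] ->]]].
exact: paraboloid_le (posp_ge0 t).
Qed.

Lemma barrier_ge q sg x t : 0 < sg <= 1 ->
  paraboloid q sg x (posp t) <= barrier x t.
Proof.
move=> sg01; apply: (sup_upper_bound (barrier_has_sup x t)).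
by exists q, sg.
Qed.

Lemma barrier_le x t c : (forall q sg, 0 < sg <= 1 ->
  paraboloid q sg x (posp t) <= c) -> barrier x t <= c.
Proof.
move=> H; apply: ge_sup; first by have [] := barrier_has_sup x t.
by move=> _ [q [sg [sg01 ->]]]; exact: H.
Qed.

Lemma barrier_upper x t : 0 <= t -> barrier x t <= U0 x - M * t.
Proof.
move=> t0; apply: barrier_le => q sg /andP[sg0 _].
by have := paraboloid_le q x sg0 (posp_ge0 t); rewrite /posp max_l.
Qed.

Lemma barrier_init x t : t <= 0 -> barrier x t = U0 x.
Proof.
move=> t0; have p0 : posp t = 0 by rewrite /posp max_r.
apply/eqP; rewrite eq_le; apply/andP; split.
  apply: barrier_le => q sg /andP[sg0 _]; rewrite p0.
  by have := paraboloid_le q x sg0 (lexx 0); rewrite mulr0 subr0.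
apply/ler_addgt0Pr => e e0; pose sg := Num.min 1 (e / L).
have sg0 : 0 < sg by rewrite lt_min ltr01 divr_gt0.
have Lsg : L * sg <= e by rewrite mulrC -ler_pdivlMr// ge_min lexx orbT.
have := @barrier_ge x sg x t; rewrite sg0 ge_min lexx /= => /(_ isT).
by rewrite p0 /paraboloid subrr dot0l; lra.
Qed.

Lemma barrier_anti x s t : s <= t -> barrier x t <= barrier x s.
Proof.
move=> st; have pst : posp s <= posp t by rewrite /posp ge_max !le_max st lexx !orbT.
apply: barrier_le => q sg sg01; apply: le_trans (barrier_ge q x s sg01).
have /andP[sg0 _] := sg01; rewrite /paraboloid lerD2l lerN2 ler_wpM2l//.
by rewrite addr_ge0// mulr_ge0// divr_ge0// ltW.
Qed.

Lemma barrier_modulus : modulus L barrier.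
Proof.
have Lip x y s : barrier x s <= barrier y s + L * `|x - y|.
  apply: barrier_le => q sg sg01.
  have := barrier_ge (q + (y - x)) y s sg01; have := ULip (q + (y - x)) q.
  rewrite addrBl [`|y - x|]distrC ler_norml /paraboloid.
  have -> : y - (q + (y - x)) = x - q.
    by rewrite opprD addrCA opprB [y + _]addrC subrK addrC.
  lra.
split=> [x y s|e e0].
  have := Lip x y s; have := Lip y x s; rewrite [`|y - x|]distrC ler_norml; lra.
pose s0 := Num.min 1 (e / L).
have s00 : 0 < s0 by rewrite lt_min ltr01 divr_gt0.
have Ls0 : L * s0 <= e by rewrite mulrC -ler_pdivlMr// ge_min lexx orbT.
pose K := C * (L / s0) + M; have K0 : 0 <= K.
  by rewrite addr_ge0// mulr_ge0// divr_ge0// ltW.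
have down x s t := @barrier_anti x s t.
have up x s t : s <= t -> barrier x s <= barrier x t + (e + K * (t - s)).
  move=> st; apply: barrier_le => q sg /andP[sg0 sg1].
  (* Raising [sg] to at least [s0] costs at most [L s0 <= e] in height and bounds the speed of
     descent by [K]. *)
  pose sg' := Num.max sg s0.
  have sg'01 : 0 < sg' <= 1 by rewrite lt_max sg0 ge_max sg1 ge_min lexx.
  have /andP[sg'0 _] := sg'01.
  have := barrier_ge q x t sg'01; rewrite /paraboloid.
  have i1 : L / sg' <= L / sg by rewrite ler_pM2l// lef_pV2// le_max lexx.
  have i2 : L / sg' <= L / s0 by rewrite ler_pM2l// lef_pV2// le_max lexx orbT.
  have i3 : L * sg' <= L * sg + L * s0.
    rewrite -mulrDr ler_pM2l// ge_max lerDl lerDr !ltW//.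
  have pst : 0 <= posp t - posp s <= t - s.
    rewrite /posp; apply/andP.
    have [t0|t0] := leP t 0; have [s1|s1] := leP s 0; split; lra.
  have /andP[pst0 pst1] := pst.
  have i4 : L / sg' / 2 * dot (x - q) (x - q) <= L / sg / 2 * dot (x - q) (x - q).
    by rewrite ler_wpM2r ?dot_ge0// ler_pM2r// invr_gt0.
  have i5 : (C * (L / sg') + M) * posp s <= (C * (L / sg) + M) * posp s.
    by rewrite ler_wpM2r ?posp_ge0// lerD2r ler_wpM2l.
  have i6 : (C * (L / sg') + M) * (posp t - posp s) <= K * (t - s).
    apply: ler_pM => //; first by rewrite addr_ge0// mulr_ge0// divr_ge0// ltW.
    by rewrite lerD2r ler_wpM2l.
  have -> : (C * (L / sg') + M) * posp t = (C * (L / sg') + M) * posp s +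
    (C * (L / sg') + M) * (posp t - posp s) by rewrite -mulrDr [posp s + _]addrC subrK.
  lra.
exists (K + 1); first by rewrite ltr_wpDl.
move=> x s t; wlog st : s t / s <= t => [H|].
  have [/H//|/ltW/H] := leP s t.
  by rewrite distrC [`|t - s|]distrC.
have ts0 : 0 <= t - s by rewrite subr_ge0.
rewrite [`|s - t|]distrC (ger0_norm ts0) ger0_norm ?subr_ge0 ?down//.
rewrite lerBlDl [(K + 1) * _]mulrDl mul1r addrA addrA.
by apply: le_trans (up x s t st) _; rewrite addrA lerDl.
Qed.

Lemma paraboloid_sub q sg p t : 0 < sg ->
  sub_at phi psi (paraboloid q sg) p t.
Proof.
move=> sg0; pose X : 'M[R]_n := (- (L / sg))%:M.
have PE x s : paraboloid q sg x s = U0 q - L * sg / 2 +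
    quad (- (C * (L / sg) + M)) 0 X 0 (x - q) (s - 0).
  by rewrite /paraboloid /quad dot0l qd_scalar subr0; lra.
apply: (sub_at_below rphi hpsi ltr01 (X := X) (C := 0)
  (a := - (C * (L / sg) + M)) (q := (p - q) *m X)).
  move=> xi tau _ _; rewrite !PE [p + xi - q]addrAC [t + tau - 0]addrAC.
  rewrite [X in _ <= _ + X]quad_shift ?tr_scalar_mx// add0r mulr0 mul0r addr0.
  by rewrite [leRHS]addrA.
move=> r r0; have [y yq y0] := nonzero_near n0 ((p - q) *m X) r0.
exists y, X; split=> //; first by rewrite subrr normr0.
rewrite /X -scalemx1 flowZ mulNr lerN2; have /andP[F0 F1] := FC y0.
have k0 : 0 <= L / sg by rewrite divr_ge0// ltW.
by apply: le_trans (ler_wpM2l k0 F1) _; rewrite mulrC lerDl.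
Qed.

Lemma barrier_sub p t : 0 < t -> sub_at phi psi barrier p t.
Proof.
move=> t0; apply: (@sub_at_sup _ _ phi psi
  [set w | exists q sg, 0 < sg <= 1 /\ w = paraboloid q sg] _ p t t t0).
- move=> _ [q [sg [sg01 ->]]] x s _ st; have /andP[sg0 _] := sg01.
  split; first exact: paraboloid_sub.
  have s0 : 0 <= s by move: st; rewrite ltr_norml; lra.
  by have := barrier_ge q x s sg01; rewrite /posp max_l.
- move=> _ [q [sg [_ ->]]] z.
  have -> : paraboloid q sg = fun x s => U0 q - L * sg / 2 +
      quad (- (C * (L / sg) + M)) 0 (- (L / sg))%:M 0 (x - q) (s - 0).
    apply/funext => x; apply/funext => s.
    by rewrite /paraboloid /quad dot0l qd_scalar subr0; lra.
  exact: (continuousD (@cst_continuous _ _ (U0 q - L * sg / 2) z)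
    (@quad_continuous _ _ _ _ _ _ q 0 z)).
- move=> e e0; have [_ [q [sg [sg01 ->]]] H] := sup_adherent e0 (barrier_has_sup p t).
  exists (paraboloid q sg); first by exists q, sg.
  by move: H; rewrite /barrier /posp max_l// ltW.
Qed.

End barriers.

(** * Second order expansions along a curve *)

Section second_order_limits.
Context {R : realType}.
Implicit Types (G A F : R -> R) (p h : R).

Lemma dnbhs0P (P : R -> Prop) : (\forall h \near 0^', P h) <->
  exists2 d : R, 0 < d & forall h, `|h| < d -> h != 0 -> P h.
Proof.
split=> [/nbhs_ballP[d /= d0 H]|[d d0 H]].
  by exists d => // h hd h0; apply: H => //; rewrite /ball /= sub0r normrN.
apply/nbhs_ballP; exists d => //= h; rewrite /ball /= sub0r normrN => hd h0.
exact: H.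
Qed.

Lemma difference_quotient_cvg (G1 : R -> R) p (G2 : R) : is_derive p 1 G1 G2 ->
  (fun h => (G1 (p + h) - G1 p) / h) @ 0^' --> G2.
Proof.
move=> /(@is_derive_normP R R^o) D; apply/cvgrPdist_le => e e0.
have [d d0 H] := D _ e0; apply/dnbhs0P; exists d => // h hd h0.
have := H h hd; rewrite scaler1 => Hh.
rewrite distrC -(ler_pM2r (x := `|h|)) ?normr_gt0// -normrM mulrBl divfK//.
by rewrite [G2 * h]mulrC.
Qed.

(** The Taylor remainder [r] has a derivative of order [o(h)] between [p] and [p + h], hence an
    increment of order [o(h ^ 2)]. *)
Lemma second_difference_cvg G (G1 : R -> R) p (G2 : R) :
  (forall x : R, is_derive x 1 G (G1 x)) -> is_derive p 1 G1 G2 ->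
  (fun h => (h * G1 (p + h) - (G (p + h) - G p)) / h ^+ 2) @ 0^' --> G2 / 2.
Proof.
move=> dG /(@is_derive_normP R R^o) D; apply/cvgrPdist_le => e e0.
have e2 : 0 < e / 2 by lra.
have [d d0 H] := D _ e2; apply/dnbhs0P; exists d => // h hd h0.
have H' (k : R) : `|k| < d -> `|G1 (p + k) - G1 p - k * G2| <= e / 2 * `|k|.
  by move=> kd; have := H k kd; rewrite scaler1.
pose r x := G x - (G1 p - G2 * p) * x - G2 / 2 * (x * x).
have dr (x : R) : is_derive x 1 r (G1 x - G1 p - (x - p) * G2).
  apply: der_eq (derB (derB (dG x) (derZ _ (der_id x))) (derZ _ (derM (der_id x) (der_id x)))) _.
  by lra.
have rb : `|r (p + h) - r p| <= e / 2 * `|h| * `|h|.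
  have B (c : R) : `|c - p| <= `|h| -> `|G1 c - G1 p - (c - p) * G2| <= e / 2 * `|h|.
    move=> ch; have := H' (c - p) (le_lt_trans ch hd); rewrite [p + _]addrC subrK.
    by move/le_trans; apply; rewrite ler_wpM2l// ltW.
  have [hp|hn] := leP 0 h.
    have [|c /andP[c1 c2] ->] := @MVT_fwd R r _ p (p + h) _ (fun x _ => dr x); first lra.
    rewrite addrBl normrM ler_wpM2r//; apply: B; rewrite (ger0_norm hp) ger0_norm; lra.
  have [|c /andP[c1 c2] E] := @MVT_fwd R r _ (p + h) p _ (fun x _ => dr x); first lra.
  rewrite distrC E (_ : p - (p + h) = - h); last by lra.
  rewrite normrM normrN ler_wpM2r//; apply: B.
  by rewrite (ltr0_norm hn) ler_norml; lra.
have h2 : 0 < h ^+ 2 by rewrite lt_neqAle sqr_ge0 andbT eq_sym sqrf_eq0.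
rewrite distrC -(ler_pM2r h2) -[X in _ * X <= _](gtr0_norm h2) -normrM mulrBl divfK ?gt_eqF//.
have -> : h * G1 (p + h) - (G (p + h) - G p) - G2 / 2 * h ^+ 2 =
  h * (G1 (p + h) - G1 p - h * G2) - (r (p + h) - r p) by rewrite /r; lra.
apply: le_trans (ler_normB _ _) _; rewrite normrM.
have := ler_wpM2l (normr_ge0 h) (H' h hd); rewrite -(real_normK (num_real h)).
by move: rb; lra.
Qed.

(** Dividing by [h] on both sides of 0 gives [b = 0]; then divide by [h ^ 2]. *)
Lemma second_order_sign (b c d : R) A F : A @ 0^' --> c -> F @ 0^' --> d ->
  0 < c -> (\forall h \near 0^', 0 <= b * A h * h + F h * h ^+ 2) ->
  b = 0 /\ 0 <= d.
Proof.
move=> Ac Fd c0 H.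
have b0 : b = 0.
  have K : (fun h => b * A h + F h * h) @ 0^' --> b * c + d * 0.
    apply: cvgD; first by apply: cvgM => //; exact: cvg_cst.
    by apply: cvgM => //; apply: cvg_trans (@nbhs_dnbhs _ _) _.

  have sgn h : 0 <= b * A h * h + F h * h ^+ 2 -> 0 <= (b * A h + F h * h) * h.
    by move=> ?; lra.
  have c1 : 0 <= b * c + d * 0.
    apply: (cvgr_to_ge (cvg_dnbhs_at_right K)).
    move/dnbhs0P: H => [e e0 H]; near=> h.
    have h0 : 0 < h by near: h; exact: nbhs_right_gt.
    rewrite -(pmulr_lge0 _ h0) sgn//; apply: H; rewrite ?gt_eqF ?gtr0_norm//.
  have c2 : b * c + d * 0 <= 0.
    apply: (cvgr_to_le (cvg_dnbhs_at_left K)).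
    move/dnbhs0P: H => [e e0 H]; near=> h.
    have h0 : h < 0 by near: h; exact: nbhs_left_lt.
    rewrite -(nmulr_lge0 _ h0) sgn//; apply: H; rewrite ?lt_eqF ?ltr0_norm ?[- h < e]ltrNl//.
    by near: h; apply: nbhs_left_gt; rewrite oppr_lt0.
  have /eqP : b * c = 0 by lra.
  by rewrite mulf_eq0 (gt_eqF c0) orbF => /eqP.
split=> //; apply: (cvgr_to_ge Fd).
move/dnbhs0P: H => [e e0 H]; apply/dnbhs0P; exists e => // h he h0.
have := H h he h0; rewrite b0 !mul0r add0r pmulr_lge0//.
by rewrite lt_neqAle sqr_ge0 andbT eq_sym sqrf_eq0.
Unshelve. all: by end_near. Qed.

End second_order_limits.

(** * Tests at smooth contact points and at vertical walls *)

Section planar_tests.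
Context {R : realType} {n : nat} (phi psi : 'rV[R]_n -> R).
Hypothesis rphi : regular_norm phi.
Hypothesis hpsi : is_norm psi.
Variables (E Z : 'rV[R]_n).
Hypothesis EE : dot E E = 1.
Hypothesis ZZ : dot Z Z = 1.
Hypothesis EZ : dot E Z = 0.
Implicit Types (a c r t tau C p : R) (q xi v u : 'rV[R]_n) (X : 'M[R]_n).

Local Notation flow := (flow phi psi).
Local Notation sub_ineq := (sub_ineq phi psi).

(** For [E = (e, 0)] and [Z = (0, 1)] this is the upward normal [(- p e, 1)] of a graph of slope
    [p]. *)
Definition nrm p : 'rV[R]_n := Z - p *: E.

Lemma ZE : dot Z E = 0. Proof. by rewrite dotC. Qed.

Lemma nrm_neq0 p : nrm p != 0.
Proof.
apply/eqP => /(congr1 (dot Z)); rewrite dotBr dotZr dot0r ZZ ZE mulr0 subr0.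
by apply/eqP; rewrite oner_eq0.
Qed.

Lemma E_neq0 : E != 0.
Proof. by rewrite -dot_eq0 EE oner_eq0. Qed.

(** For fixed [X] the operator depends only on the line spanned by the gradient; a zero gradient is
    replaced by a small multiple of [nu], as the relaxed inequality allows. *)
Lemma sub_ineq_multiple a c nu X w k : nu != 0 ->
  a <= psi nu * (k * qd (hess phi nu) w) ->
  (forall v, dot v nu = 0 -> k * dot v w ^+ 2 <= qd X v) ->
  sub_ineq a (c *: nu) X.
Proof.
move=> nu0 aF kX; have {}aF := le_trans aF (flow_ge_tangent rphi hpsi nu0 kX).
have flow_mul (b : R) : b != 0 -> flow (b *: nu) X = flow nu X.
  move=> b0; have [bp|bn] := ltP 0 b; first exact: flow_scale.
  have bn' : 0 < - b by rewrite oppr_gt0 lt_neqAle b0.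
  rewrite -[b]opprK scaleNr -[X in flow _ X]opprK.
  rewrite (flow_opp rphi hpsi) ?scale_neq0 ?gt_eqF// (flow_scale rphi hpsi)//.
  by rewrite -[- X]scaleN1r flowZ mulN1r opprK.
move=> b r r0 Fb; pose h := r / (`|nu| + 1) / 2.
have r1 : 0 < r / (`|nu| + 1) by rewrite divr_gt0// ltr_wpDl.
have h0 : 0 < h by rewrite divr_gt0.
pose c' := if c == 0 then h else c.
have c'0 : c' != 0 by rewrite /c'; have [_|//] := eqVneq c 0; rewrite gt_eqF.
rewrite (le_trans aF)// -(flow_mul c' c'0); apply: Fb.
- rewrite -scalerBl; apply: small_scale => //; rewrite /c'; have [->|_] := eqVneq c 0.
    by rewrite subr0 gtr0_norm// /h; lra.
  by rewrite subrr normr0.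
- by rewrite subrr normr0.
- by rewrite scale_neq0.
Qed.

Lemma orthogonal_part v : exists2 u, v = dot v E *: E + dot v Z *: Z + u &
  dot u E = 0 /\ dot u Z = 0.
Proof.
exists (v - (dot v E *: E + dot v Z *: Z)); first by rewrite addrC subrK.
by rewrite !dotBl !dotDl !dotZl EE ZZ EZ ZE; split; lra.
Qed.

Lemma qd_continuous X : continuous (qd X).
Proof.
have -> : qd X = fun v => \sum_i \sum_j v 0 j * X j i * v 0 i.
  apply/funext => v; rewrite /qd /dot; apply: eq_bigr => i _.
  by rewrite mxE mulr_suml.
move=> v; apply: (for_continuous_sum (V := 'rV[R]_n)) => i.
apply: (for_continuous_sum (V := 'rV[R]_n)) => j.
have d1 : {for v, continuous (fun v : 'rV[R]_n => v 0 j)} by exact: coord_continuous.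
have d2 : {for v, continuous (fun v : 'rV[R]_n => v 0 i)} by exact: coord_continuous.
exact: (continuousM (continuousM d1 (@cst_continuous _ _ (X j i) v)) d2).
Qed.

(** First order part of a test along the ray [(s v, - s b)]. *)
Lemma linear_ge0 q X C a v (b r : R) : 0 < r ->
  (forall s : R, 0 < s -> s < r -> 0 <= quad a q X C (s *: v) (- (s * b))) ->
  a * b <= dot q v.
Proof.
move=> r0 H; rewrite -subr_ge0; apply/ler_addgt0Pr => e e0.
pose K := `|qd X v / 2 + C * b ^+ 2| + 1; have K0 : 0 < K by rewrite ltr_wpDl.
pose s := Num.min (r / 2) (e / K).
have s0 : 0 < s by rewrite !lt_min !divr_gt0.
have s2 : s <= r / 2 by rewrite !ge_min lexx.
have s3 : s * K <= e by rewrite -ler_pdivlMr// !ge_min lexx !orbT.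
have := H s s0; rewrite /quad dotZr qdZv sqrrN.
have -> : a * - (s * b) + s * dot q v + s ^+ 2 * qd X v / 2 + C * (s * b) ^+ 2 =
  s * (dot q v - a * b + s * (qd X v / 2 + C * b ^+ 2)) by lra.
rewrite pmulr_rge0// => H1; have {}H1 : 0 <= dot q v - a * b + s * (qd X v / 2 + C * b ^+ 2).
  by apply: H1; lra.
have := ler_wpM2l (ltW s0) (ler_norm (qd X v / 2 + C * b ^+ 2)).
by move: s3; rewrite /K mulrDr mulr1; lra.
Qed.

Lemma segment_ge0 q X C a v r : 0 < r ->
  (forall s : R, `|s *: v| < r -> 0 <= quad a q X C (s *: v) 0) ->
  dot q v = 0 /\ 0 <= qd X v.
Proof.
move=> r0 H; have r1 : 0 < r / (`|v| + 1) by rewrite divr_gt0// ltr_wpDl.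
have H' s : `|s| < r / (`|v| + 1) -> 0 <= dot q v * s + qd X v / 2 * s ^+ 2.
  move=> /(small_scale r0)/H; rewrite /quad dotZr qdZv; lra.
have q0 := quadratic_ge0 r1 H'; split=> //.
pose s := r / (`|v| + 1) / 2; have s0 : 0 < s by rewrite divr_gt0.
have := H' s; rewrite q0 mul0r add0r gtr0_norm// pmulr_lge0 ?exprn_gt0//.
by rewrite pmulr_lge0 ?invr_gt0//; apply; rewrite /s; lra.
Qed.

(* The level set {W = lam} is parametrized by p |-> (G' p, p G' p - G p) in the
   (E, Z)-plane, and translates by tau * V in (past) time. *)
Lemma contact_sub_ineq a q X C r (G G1 : R -> R) (p0 g2 vel d1 : R) :
  X^T = X -> 0 < r -> (forall p, is_derive p 1 G (G1 p)) ->
  is_derive p0 1 G1 g2 -> 0 < g2 ->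
  (forall p u, dot u E = 0 -> dot u Z = 0 ->
    let xi := (G1 p - G1 p0) *: E +
      (p * G1 p - G p - (p0 * G1 p0 - G p0)) *: Z + u in
    `|xi| < r -> 0 <= quad a q X C xi 0) ->
  (forall tau : R, - r < tau <= 0 ->
    let xi := tau *: (- d1 *: E + (vel - p0 * d1) *: Z) in
    `|xi| < r -> 0 <= quad a q X C xi tau) ->
  - dot q Z * vel <= psi (nrm p0) *
    (- dot q Z / g2 * qd (hess phi (nrm p0)) E) ->
  sub_ineq a q X.
Proof.
move=> sX r0 dG dG1 g20 Hc Ht Hv.
pose V := - d1 *: E + (vel - p0 * d1) *: Z.
have Hu u : dot u E = 0 -> dot u Z = 0 -> dot q u = 0 /\ 0 <= qd X u.
  move=> uE uZ; apply: (segment_ge0 (C := C) (a := a) r0) => s sr.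
  have := Hc p0 (s *: u); rewrite !dotZl uE uZ !subrr !scale0r !add0r.
  by rewrite mulr0; apply.
have [bE Xk] : dot q E + p0 * dot q Z = 0 /\
    forall v, dot v (nrm p0) = 0 -> - dot q Z / g2 * dot v E ^+ 2 <= qd X v.
  pose A h := (G1 (p0 + h) - G1 p0) / h.
  pose B h := (h * G1 (p0 + h) - (G (p0 + h) - G p0)) / h ^+ 2.
  have Ac := difference_quotient_cvg dG1.
  have Bc := second_difference_cvg dG dG1.
  have key u : dot u E = 0 -> dot u Z = 0 -> dot q E + p0 * dot q Z = 0 /\
      0 <= dot q Z * (g2 / 2) + qd X (g2 *: E + (p0 * g2 + 0 * (g2 / 2)) *: Z + g2 *: u) / 2.
    (* The increment along the curve is [h w h], with [w h] convergent. The transversal part [g2 u]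
       makes the limit reach, up to scaling, every tangent vector with nonzero [E] component. *)
    move=> uE uZ; pose w h := A h *: E + (p0 * A h + h * B h) *: Z + g2 *: u.
    have wc : w @ 0^' --> g2 *: E + (p0 * g2 + 0 * (g2 / 2)) *: Z + g2 *: u.
      apply: cvgD; last exact: cvg_cst.
      apply: cvgD; apply: cvgZl => //; apply: cvgD.
        by apply: cvgM => //; exact: cvg_cst.
      by apply: cvgM => //; apply: cvg_trans (@nbhs_dnbhs _ _) _.
    apply: (@second_order_sign _ _ g2 _ A (fun h => dot q Z * B h + qd X (w h) / 2)) => //.
      apply: cvgD; first by apply: cvgM => //; exact: cvg_cst.
      apply: cvgM; last exact: cvg_cst.
      exact: (cvg_comp _ _ wc (@qd_continuous X _)).
    have /cvgrPdist_lt/(_ 1 ltr01)/dnbhs0P[d d0 wd] := wc.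
    set W := _ + g2 *: u in wc wd *.
    have W1 : 0 < `|W| + 1 by rewrite ltr_wpDl.
    apply/dnbhs0P; exists (Num.min d (r / (`|W| + 1))).
      by rewrite lt_min d0 divr_gt0.
    move=> h; rewrite lt_min => /andP[hd hr] h0.
    have wE : h *: w h = (G1 (p0 + h) - G1 p0) *: E +
      ((p0 + h) * G1 (p0 + h) - G (p0 + h) - (p0 * G1 p0 - G p0)) *: Z +
      (h * g2) *: u.
      rewrite /w !scalerDr !scalerA; congr (_ *: _ + _ *: _ + _).
        by rewrite /A mulrC divfK.
      by rewrite /A /B; field; rewrite h0.
    have wr : `|h *: w h| < r.
      have wW : `|w h| <= `|W| + 1.
        have := wd h hd h0; have := ler_normD W (w h - W).
        by rewrite addrC subrK distrC; lra.
      rewrite normrZ; apply: le_lt_trans (ler_wpM2l (normr_ge0 h) wW) _.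
      by rewrite -ltr_pdivlMr.
    have := Hc (p0 + h) ((h * g2) *: u); rewrite !dotZl uE uZ !mulr0 -wE.
    move=> /(_ erefl erefl wr); rewrite /quad dotZr qdZv mulr0 add0r expr0n mulr0 addr0.
    rewrite {1}/w !dotDr !dotZr (Hu u uE uZ).1; lra.
  split=> [|v]; first by have [] := key 0 (dot0l _) (dot0l _).
  have [u -> [uE uZ]] := orthogonal_part v.
  set al := dot v E; set ze := dot v Z.
  rewrite /nrm dotBr dotZr !dotDl !dotZl EE ZZ EZ ZE uE uZ => al0.
  have {al0}zE : ze = p0 * al by lra.
  have -> : (al * 1 + ze * 0 + 0) = al by lra.
  have [al0|al0] := eqVneq al 0.
    by rewrite zE al0 mulr0 !scale0r !add0r expr0n mulr0; exact: (Hu u uE uZ).2.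
  have := (key (al^-1 *: u)); rewrite !dotZl uE uZ !mulr0 => /(_ erefl erefl)[_].
  have -> : g2 *: E + (p0 * g2 + 0 * (g2 / 2)) *: Z + g2 *: (al^-1 *: u) =
    (g2 / al) *: (al *: E + ze *: Z + u).
    rewrite !scalerDr !scalerA zE; congr (_ *: _ + _ *: _ + _); first by field.
    by field.
  rewrite qdZv.
  set Q := qd X _ => H.
  have {H}H : 0 <= dot q Z / g2 + Q / al ^+ 2.
    have -> : dot q Z / g2 + Q / al ^+ 2 = (2 / g2 ^+ 2) * (dot q Z * (g2 / 2) + (g2 / al) ^+ 2 * Q / 2).
      by field; rewrite al0 gt_eqF.
    by rewrite mulr_ge0// divr_ge0// sqr_ge0.
  have al2 : 0 < al ^+ 2 by rewrite lt_neqAle sqr_ge0 andbT eq_sym sqrf_eq0.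
  rewrite -ler_pdivlMr//; lra.
(* Following the translation backwards in time tests the time derivative. *)
have velE : a <= - dot q Z * vel.
  have V1 : 0 < r / (`|- V| + 1) by rewrite divr_gt0// ltr_wpDl.
  have := @linear_ge0 q X C a (- V) 1 (Num.min r (r / (`|- V| + 1))).
  rewrite lt_min r0 V1 mulr1 => /(_ isT) H; apply: le_trans (H _) _.
    move=> s s0; rewrite lt_min mulr1 => /andP[sr sV].
    have := Ht (- s); rewrite scalerN -scaleNr -/V scaleNr => H'.
    apply: H'; first by apply/andP; split; lra.
    by rewrite -scalerN; apply: small_scale; rewrite ?gtr0_norm.
  by rewrite dotNr dotDr !dotZr; have := congr1 (fun x => d1 * x) bE; rewrite mulr0; lra.
have qE : q = dot q Z *: nrm p0.
  have [u] := orthogonal_part q; move=> qE [uE uZ].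
  have u0 : u = 0.
    apply/eqP; rewrite -dot_eq0; have := (Hu u uE uZ).1.
    by rewrite {1}qE !dotDl !dotZl ![dot _ u]dotC uE uZ !mulr0 !add0r => ->.
  rewrite {1}qE u0 addr0 /nrm scalerBr scalerA addrC; congr (_ + _).
  by rewrite -scaleNr; congr (_ *: _); lra.
rewrite qE; apply: (sub_ineq_multiple (k := - dot q Z / g2) (w := E)) => //.
  exact: nrm_neq0.
exact: le_trans velE Hv.
Qed.

(** At a vertical wall [q] is a multiple of [E], [a <= 0], and [X] is nonnegative on the orthogonal
    complement of [E], first for [zeta >= 0] and then everywhere because the form is even. The
    inequality therefore holds with [k = 0]. *)
Lemma wall_sub_ineq a q X C r : X^T = X -> 0 < r -> dot q Z = 0 ->
  (forall (zeta tau : R) u, 0 <= zeta -> - r < tau <= 0 -> dot u E = 0 -> dot u Z = 0 ->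
    `|zeta *: Z + u| < r -> 0 <= quad a q X C (zeta *: Z + u) tau) ->
  sub_ineq a q X.
Proof.
move=> sX r0 qZ H; have tau0 : - r < 0 <= (0 : R) by rewrite lexx oppr_lt0 r0.
have a0 : a <= 0.
  have := @linear_ge0 q X C a 0 1 r r0; rewrite mulr1 dot0r; apply=> s s0 sr.
  have := H 0 (- (s * 1)) 0; rewrite scale0r scaler0 addr0 mulr1 normr0 !dot0l.
  by apply=> //; apply/andP; split; lra.
have qu u : dot u E = 0 -> dot u Z = 0 -> dot q u = 0.
  move=> uE uZ; apply: (proj1 (segment_ge0 (X := X) (C := C) (a := a) r0 _)) => s sr.
  have := H 0 0 (s *: u); rewrite scale0r add0r !dotZl uE uZ mulr0.
  exact.
have X0 (zeta : R) u : 0 <= zeta -> dot u E = 0 -> dot u Z = 0 ->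
    0 <= qd X (zeta *: Z + u).
  move=> z0 uE uZ; set v := _ + u.
  have v1 : 0 < r / (`|v| + 1) by rewrite divr_gt0// ltr_wpDl.
  pose s := r / (`|v| + 1) / 2; have s0 : 0 < s by rewrite divr_gt0.
  have vE : s *: v = (s * zeta) *: Z + s *: u by rewrite scalerDr scalerA.
  have := H (s * zeta) 0 (s *: u); rewrite -vE !dotZl uE uZ mulr0.
  have sv : `|s *: v| < r by apply: small_scale; rewrite // gtr0_norm// /s; lra.
  move=> /(_ (mulr_ge0 (ltW s0) z0) tau0 erefl erefl sv).
  have qv : dot q v = 0 by rewrite dotDr dotZr qZ mulr0 qu// addr0.
  rewrite /quad dotZr qv qdZv mulr0 expr0n mulr0 mulr0 add0r add0r addr0.
  by rewrite pmulr_lge0 ?invr_gt0// pmulr_rge0// exprn_gt0.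
have [u qE [uE uZ]] := orthogonal_part q.
have u0 : u = 0.
  apply/eqP; rewrite -dot_eq0; have := qu u uE uZ.
  by rewrite {1}qE !dotDl !dotZl ![dot _ u]dotC uE uZ !mulr0 !add0r => ->.
rewrite qE u0 qZ scale0r !addr0.
apply: (sub_ineq_multiple (k := 0) (w := E)) => //; first exact: E_neq0.
  by rewrite mul0r mulr0.
move=> v vE; rewrite mul0r; have [w -> [wE wZ]] := orthogonal_part v.
rewrite vE scale0r add0r; have [z0|z0] := leP 0 (dot v Z); first exact: X0.
have := X0 (- dot v Z) (- w); rewrite !dotNl wE wZ oppr0 scaleNr -opprD => H1.
have := H1 _ erefl erefl; rewrite -[X in qd _ X]scaleN1r qdZv sqrrN expr1n mul1r; apply.
by rewrite oppr_ge0 ltW.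
Qed.

(** Along [sg E - K Z] the [E] component of the gradient contributes a fixed amount, so large [K]
    excludes a positive [Z] component; moving up excludes a negative one. *)
Lemma wall_slope a q X C r (sg : R) : 0 < r ->
  (forall zeta : R, 0 <= zeta -> `|zeta *: Z| < r -> 0 <= quad a q X C (zeta *: Z) 0) ->
  (forall K : R, 0 < K -> exists2 d, 0 < d & forall s : R, 0 < s -> s < d ->
    0 <= quad a q X C (s *: (sg *: E - K *: Z)) 0) ->
  dot q Z = 0.
Proof.
move=> r0 Hu Hd; apply/eqP; rewrite eq_le; apply/andP; split.
  rewrite leNgt; apply/negP => q0.
  pose K := (`|sg * dot q E| + 1) / dot q Z; have K0 : 0 < K.
    by rewrite divr_gt0// ltr_wpDl.
  have [d d0 H] := Hd K K0.
  have := @linear_ge0 q X C a (sg *: E - K *: Z) 0 d d0; rewrite mulr0 dotBr !dotZr.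
  have -> : K * dot q Z = `|sg * dot q E| + 1 by rewrite divfK// gt_eqF.
  have := ler_norm (sg * dot q E) => h1 h2.
  suff : (0 : R) <= sg * dot q E - (`|sg * dot q E| + 1) by lra.
  by apply: h2 => s s0 sd; rewrite mulr0 oppr0; exact: H.
have Z1 : 0 < r / (`|Z| + 1) by rewrite divr_gt0// ltr_wpDl.
have := @linear_ge0 q X C a Z 0 _ Z1; rewrite mulr0; apply => s s0 sr.
rewrite mulr0 oppr0; apply: Hu; first exact: ltW.
by apply: small_scale; rewrite ?gtr0_norm.
Qed.

End planar_tests.

(** * The level function: existence, monotonicity, Lipschitz bounds *)

Section level_function.
Context {R : realType} (a d : R -> R) (c D : R).
Hypothesis c0 : 0 < c.
Hypothesis D0 : 0 <= D.
Hypothesis ac : forall p, c * (1 + `|p|) <= a p.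
Hypothesis dD : forall p, 0 <= d p <= D * (1 + `|p|).
Implicit Types s z t lam p : R.

(** The constraints of a convex set dilated by [lam], the one of slope [p] moving up with speed
    [d p / lam]. Exact translators have [d = 1]; a speed depending on the slope will give
    supersolutions. *)
Definition feas s z t lam := forall p, p * s - z <= lam * a p - t / lam * d p.

Definition level s z t := inf [set lam | 2^-1 <= lam /\ feas s z t lam].

Lemma profile_ge0 p : 0 <= a p.
Proof. by apply: le_trans (ac p); rewrite mulr_ge0 ?addr_ge0// ltW. Qed.

Lemma profile_gt0 p : 0 < a p.
Proof. by apply: lt_le_trans (ac p); rewrite mulr_gt0// ltr_wpDr. Qed.

Lemma speed_ge0 p : 0 <= d p. Proof. by have /andP[] := dD p. Qed.

Lemma feas_le s z t lam mu : 0 <= t -> 0 < lam -> lam <= mu ->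
  feas s z t lam -> feas s z t mu.
Proof.
move=> t0 l0 lm H p; apply: le_trans (H p) _.
have m0 : 0 < mu by exact: lt_le_trans lm.
apply: lerB; first by rewrite ler_wpM2r ?profile_ge0.
by rewrite ler_wpM2r ?speed_ge0// ler_wpM2l// lef_pV2.
Qed.

Lemma level_has_inf s z t : 0 <= t ->
  has_inf [set lam | 2^-1 <= lam /\ feas s z t lam].
Proof.
move=> t0; split; last by exists 2^-1 => l [].
pose m := (`|s| + `|z| + 2 * t * D) / c.
have m0 : 0 <= m.
  by rewrite divr_ge0 ?(ltW c0)// !addr_ge0// mulr_ge0// mulr_ge0.
exists (2^-1 + m); split; first by rewrite lerDl.
move=> p; have h0 : (0 : R) < 2^-1 by rewrite invr_gt0.
have l0 : 0 < 2^-1 + m by rewrite ltr_wpDr.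
have mc : m * c = `|s| + `|z| + 2 * t * D by rewrite divfK// gt_eqF.
have h1 : m * (c * (1 + `|p|)) <= (2^-1 + m) * a p.
  by apply: ler_pM => //; rewrite ?mulr_ge0 ?lerDr ?ltW// addr_ge0.
have h2 : t / (2^-1 + m) * d p <= 2 * t * (D * (1 + `|p|)).
  have /andP[dp0 dp1] := dD p; apply: ler_pM => //.
    by rewrite divr_ge0// ltW.
  rewrite mulrC; apply: ler_wpM2r => //.
  by rewrite -[leRHS]invrK lef_pV2 ?posrE// lerDl.
have h3 : p * s - z <= (1 + `|p|) * (`|s| + `|z|).
  have := ler_norm (p * s); have := ler_normB (p * s) z; rewrite normrM.
  have := ler_norm (p * s - z); have := mulr_ge0 (normr_ge0 p) (normr_ge0 z).
  have := normr_ge0 s; lra.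
have : m * (c * (1 + `|p|)) = (`|s| + `|z| + 2 * t * D) * (1 + `|p|).
  by rewrite mulrA mc.
lra.
Qed.

Lemma level_le s z t lam : 0 <= t -> 2^-1 <= lam -> feas s z t lam ->
  level s z t <= lam.
Proof. by move=> t0 l0 H; apply: ge_inf => //; have [] := level_has_inf s z t0. Qed.

Lemma level_ge_half s z t : 0 <= t -> 2^-1 <= level s z t.
Proof.
by move=> t0; apply: lb_le_inf; [have [] := level_has_inf s z t0|move=> l []].
Qed.

Lemma level_gt0 s z t : 0 <= t -> 0 < level s z t.
Proof. by move/(level_ge_half s z); apply: lt_le_trans; rewrite invr_gt0. Qed.

(** Feasibility of [l + m] leaves an error of at most [m k] in the constraint of slope [p] for
    [l]. *)
Lemma level_feas s z t : 0 <= t -> feas s z t (level s z t).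
Proof.
move=> t0 p; set l := level s z t; have l0 : 0 < l := level_gt0 s z t0.
apply/ler_addgt0Pr => e e0.
pose k := a p + t / l ^+ 2 * d p + 1.
have k0 : 0 < k.
  by rewrite ltr_wpDl// addr_ge0 ?profile_ge0// mulr_ge0 ?speed_ge0// divr_ge0 ?sqr_ge0.
pose m := e / k; have m0 : 0 < m by rewrite divr_gt0.
have [mu [mu1 muF] mul] := inf_adherent m0 (level_has_inf s z t0).
have mu0 : 0 < mu by apply: lt_le_trans mu1; rewrite invr_gt0.
have := feas_le t0 mu0 (ltW mul) muF p; rewrite -/(level s z t) -/l.
have lm0 : 0 < l + m by rewrite addr_gt0.
have h : t / l - t / l ^+ 2 * m <= t / (l + m).
  rewrite -subr_ge0.
  have -> : t / (l + m) - (t / l - t / l ^+ 2 * m) = t * m ^+ 2 / (l ^+ 2 * (l + m)).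
    by field; rewrite !gt_eqF.
  by apply: divr_ge0; apply: mulr_ge0; rewrite ?sqr_ge0 ?(ltW lm0).
have := ler_wpM2r (speed_ge0 p) h; have : m * k = e by rewrite divfK// gt_eqF.
rewrite /k; lra.
Qed.

Lemma feas_of_level s z t lam : 0 <= t -> level s z t <= lam -> feas s z t lam.
Proof. by move=> t0 /feas_le; apply => //; [exact: level_gt0|exact: level_feas]. Qed.

Lemma level_ge s z t lam p : 0 <= t -> 0 < lam ->
  lam * a p - t / lam * d p <= p * s - z -> lam <= level s z t.
Proof.
move=> t0 l0 H; rewrite leNgt; apply/negP => lt; have l1 := level_gt0 s z t0.
have := level_feas s z t0 p; have : level s z t * a p < lam * a p.
  by rewrite ltr_pM2r ?profile_gt0.
have : t / lam * d p <= t / level s z t * d p.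
  by rewrite ler_wpM2r ?speed_ge0// ler_wpM2l// lef_pV2 ?posrE// ltW.
lra.
Qed.

(** By coercivity of [a], an increase of the level pays for any perturbation of the constraints
    proportional to [1 + |p|]; the factor 2 bounds [1 / lam]. *)
Lemma level_lipschitz s z t s' z' t' : 0 <= t -> 0 <= t' ->
  level s' z' t' <= level s z t + (`|s - s'| + `|z - z'| + 2 * D * `|t - t'|) / c.
Proof.
move=> t0 t'0; set l := level s z t; have l0 : 0 < l := level_gt0 s z t0.
set m := (_ / c); have m0 : 0 <= m.
  by rewrite divr_ge0 ?(ltW c0)// !addr_ge0// mulr_ge0// mulr_ge0.
have mc : m * c = `|s - s'| + `|z - z'| + 2 * D * `|t - t'|.
  by rewrite divfK// gt_eqF.
apply: level_le => //; first by rewrite ler_wpDr// level_ge_half.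
move=> p; have := level_feas s z t0 p; rewrite -/l => H.
have h1 : m * (c * (1 + `|p|)) <= m * a p by rewrite ler_wpM2l.
have h2 : t' / (l + m) * d p <= t / l * d p + 2 * `|t - t'| * (D * (1 + `|p|)).
  have /andP[dp0 dp1] := dD p.
  have li : l^-1 <= 2.
    by rewrite -[leRHS]invrK lef_pV2 ?posrE ?invr_gt0// level_ge_half.
  have li0 : 0 <= l^-1 by rewrite invr_ge0 ltW.
  have e1 : t' / (l + m) <= t' / l by rewrite ler_wpM2l// lef_pV2 ?posrE ?lerDl// ltr_wpDr.
  have e2 : t' / l <= t / l + 2 * `|t - t'|.
    have := ler_norm (t' - t); rewrite distrC => e3.
    have := ler_wpM2r li0 e3; have := ler_wpM2r (normr_ge0 (t - t')) li; lra.
  have e4 := ler_wpM2r dp0 (le_trans e1 e2); apply: le_trans e4 _.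
  by rewrite mulrDl lerD2l ler_wpM2l// mulr_ge0.
have h3 : p * s' - z' <= p * s - z + (1 + `|p|) * (`|s - s'| + `|z - z'|).
  have := ler_norm (p * (s' - s)); rewrite normrM [`|s' - s|]distrC.
  have := ler_norm (z - z'); have := mulr_ge0 (normr_ge0 p) (normr_ge0 (z - z')).
  have := normr_ge0 (s - s'); lra.
have : m * (c * (1 + `|p|)) = (`|s - s'| + `|z - z'| + 2 * D * `|t - t'|) * (1 + `|p|).
  by rewrite mulrA mc.
lra.
Qed.

Lemma level_mono s z t t' : 0 <= t -> t <= t' -> level s z t <= level s z t'.
Proof.
move=> t0 tt'; have t'0 := le_trans t0 tt'.
have l0 := level_gt0 s z t'0; apply: level_le => //; first exact: level_ge_half.
move=> p; apply: le_trans (level_feas s z t'0 p) _.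
rewrite lerD2l lerN2; apply: ler_wpM2r; first exact: speed_ge0.
by apply: ler_wpM2r => //; rewrite invr_ge0 ltW.
Qed.

End level_function.

(** * Strictly convex functions of the slope *)

Section strictly_convex.
Context {R : realType} (f f1 f2 : R -> R).
Hypothesis df : forall p : R, is_derive p 1 f (f1 p).
Hypothesis df1 : forall p : R, is_derive p 1 f1 (f2 p).
Hypothesis f2_gt0 : forall p, 0 < f2 p.
Implicit Types p q : R.

Lemma slope_incr p q : p < q -> f1 p < f1 q.
Proof.
move=> pq; rewrite -subr_gt0.
have [c _ ->] := MVT_fwd (ltW pq) (fun x _ => df1 x).
by rewrite mulr_gt0// subr_gt0.
Qed.

Lemma tangent_le p q : f p + f1 p * (q - p) <= f q.
Proof.
have incr x y : x <= y -> f1 x <= f1 y.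
  by rewrite le_eqVlt => /predU1P[->//|/slope_incr/ltW].
have [pq|/ltW qp] := leP p q.
  have [c /andP[pc cq] E] := MVT_fwd pq (fun x _ => df x).
  have : f1 p * (q - p) <= f1 c * (q - p) by rewrite ler_wpM2r ?subr_ge0// incr.
  lra.
have [c /andP[qc cp] E] := MVT_fwd qp (fun x _ => df x).
have : f1 c * (p - q) <= f1 p * (p - q) by rewrite ler_wpM2r ?subr_ge0// incr.
lra.
Qed.

(** The infimum of [f] sits at a finite slope, at plus infinity or at minus infinity; the infinite
    cases will be the vertical walls. *)
Lemma slope_cases : [\/ exists p, f1 p = 0, forall p, f1 p < 0 | forall p, 0 < f1 p].
Proof.
have cf : continuous f1 by move=> p; exact: derivable_cont (df1 p).
have ivt p q : f1 p <= 0 -> 0 <= f1 q -> exists x, f1 x = 0.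
  move=> fp fq; have pq : p <= q.
    by rewrite leNgt; apply/negP => /slope_incr; lra.
  have [||x _ fx] := IVT (f := f1) (v := 0) pq; last by exists x.
    exact: continuous_subspaceT.
  by rewrite ge_min le_max fp fq orbT.
have [f0|f0] := leP (f1 0) 0.
  have [[q fq]|H] := pselect (exists q, 0 <= f1 q); first by constructor 1; exact: (ivt 0 q).
  constructor 2 => p; rewrite ltNge; apply/negP => fp; apply: H.
  by exists p.
have [[q fq]|H] := pselect (exists q, f1 q <= 0).
  by constructor 1; exact: (ivt q 0 fq (ltW f0)).
by constructor 3 => p; rewrite ltNge; apply/negP => fp; apply: H; exists p.
Qed.

(** The minimum at [p0] is positive, and the slopes at [p0 + 1] and [p0 - 1] have strict signs,
    which gives linear growth on both sides. *)
Lemma critical_slack p0 : f1 p0 = 0 -> 0 < f p0 ->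
  exists2 mu : R, 0 < mu & forall p, mu * (1 + `|p|) <= f p.
Proof.
move=> f10 fp0.
have a1 : 0 < f1 (p0 + 1) by rewrite -f10; apply: slope_incr; rewrite ltrDl.
have a2 : f1 (p0 - 1) < 0 by rewrite -f10; apply: slope_incr; lra.
pose k := Num.min (f1 (p0 + 1)) (- f1 (p0 - 1)).
have k0 : 0 < k by rewrite lt_min a1 oppr_gt0.
have k1 : k <= f1 (p0 + 1) by rewrite ge_min lexx.
have k2 : k <= - f1 (p0 - 1) by rewrite ge_min lexx orbT.
have fm p : f p0 <= f p by have := tangent_le p0 p; rewrite f10; lra.
have fk p : f p0 + k * (`|p - p0| - 1) <= f p.
  have [h|h] := leP `|p - p0| 1.
    have : k * (`|p - p0| - 1) <= 0 by rewrite pmulr_rle0// subr_le0.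
    by have := fm p; lra.
  move: h; have [pp|pp] := leP p0 p.
    have := tangent_le (p0 + 1) p; have := fm (p0 + 1).
    rewrite ger0_norm ?subr_ge0// => h1 h2 h3.
    have : k * (p - p0 - 1) <= f1 (p0 + 1) * (p - p0 - 1) by rewrite ler_wpM2r//; lra.
    lra.
  have := tangent_le (p0 - 1) p; have := fm (p0 - 1).
  rewrite ltr0_norm ?subr_lt0// => h1 h2 h3.
  have : k * (- (p - p0) - 1) <= - f1 (p0 - 1) * (- (p - p0) - 1) by rewrite ler_wpM2r//; lra.
  lra.
pose m := Num.min k (f p0 / (`|p0| + 2)).
have p2 : 0 < `|p0| + 2 by rewrite ltr_wpDl.
have m0 : 0 < m by rewrite lt_min k0 divr_gt0.
have mk : m <= k by rewrite ge_min lexx.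
have mf : m * (`|p0| + 2) <= f p0 by rewrite -ler_pdivlMr// ge_min lexx orbT.
exists m => // p; have pp : `|p| <= `|p - p0| + `|p0|.
  by have := ler_normD (p - p0) p0; rewrite subrK.
have h1 := ler_wpM2l (ltW m0) pp.
have [h|h] := leP `|p - p0| 1.
  have : m * `|p - p0| <= m * 1 by rewrite ler_wpM2l// ltW.
  by have := fm p; lra.
have : m * (`|p - p0| - 1) <= k * (`|p - p0| - 1) by rewrite ler_wpM2r// subr_ge0 ltW.
by have := fk p; lra.
Qed.

End strictly_convex.

(** * Viscosity tests for the level function *)

Section level_tests.
Context {R : realType} {n : nat} (phi psi : 'rV[R]_n -> R).
Hypothesis rphi : regular_norm phi.
Hypothesis hpsi : is_norm psi.
Variables (E Z : 'rV[R]_n).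
Hypothesis EE : dot E E = 1.
Hypothesis ZZ : dot Z Z = 1.
Hypothesis EZ : dot E Z = 0.
Variables (a a1 a2 d d1 d2 : R -> R) (c D A T : R).
Hypothesis c0 : 0 < c.
Hypothesis D0 : 0 <= D.
Hypothesis ac : forall p, c * (1 + `|p|) <= a p.
Hypothesis aA : forall p, a p <= A * (1 + `|p|).
Hypothesis dD : forall p, 0 <= d p <= D * (1 + `|p|).
Hypothesis da : forall p : R, is_derive p 1 a (a1 p).
Hypothesis da1 : forall p : R, is_derive p 1 a1 (a2 p).
Hypothesis dd : forall p : R, is_derive p 1 d (d1 p).
Hypothesis dd1 : forall p : R, is_derive p 1 d1 (d2 p).
Hypothesis conv : forall lam t p : R, 2^-1 <= lam -> 0 <= t -> t <= T ->
  0 < lam * a2 p - t / lam * d2 p.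
Implicit Types (s z t lam p tau : R) (x q xi u : 'rV[R]_n) (X : 'M[R]_n).

Local Notation sub_ineq := (sub_ineq phi psi).
Local Notation nrm := (nrm E Z).

Definition level_at x t := level a d (dot x E) (dot x Z) t.

Local Notation W := level_at.

Definition comb (f g : R -> R) lam t p := lam * f p - t / lam * g p.

Lemma comb_derive (f f' g g' : R -> R) lam t p :
  is_derive p 1 f (f' p) -> is_derive p 1 g (g' p) ->
  is_derive p 1 (comb f g lam t) (comb f' g' lam t p).
Proof. by move=> df dg; apply: derB; exact: derZ. Qed.

Lemma slack_derive (f f' : R -> R) s z p : is_derive p 1 f (f' p) ->
  is_derive p 1 (fun p => f p - p * s + z) (f' p - s).
Proof.
move=> df; apply: der_eq (derD (derB df (derM (der_id p) (der_cst s p))) (der_cst z p)) _.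
by lra.
Qed.

Lemma slope_derive (f f' : R -> R) s p : is_derive p 1 f (f' p) ->
  is_derive p 1 (fun p => f p - s) (f' p).
Proof. by move=> df; apply: der_eq (derB df (der_cst s p)) _; rewrite subr0. Qed.

Lemma feasE s z t lam : feas a d s z t lam <->
  forall p, 0 <= comb a d lam t p - p * s + z.
Proof. by split=> H p; have := H p; rewrite /comb; lra. Qed.

(** On the envelope of the lines the constraint of slope [p] is active, and by convexity its tangent
    implies the other ones. *)
Lemma level_on_curve lam t p : 2^-1 <= lam -> 0 <= t -> t <= T ->
  level a d (comb a1 d1 lam t p) (p * comb a1 d1 lam t p - comb a d lam t p) t = lam.
Proof.
move=> l2 t0 tT; have l0 : 0 < lam by apply: lt_le_trans l2; rewrite invr_gt0.
apply/eqP; rewrite eq_le; apply/andP; split.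
  apply: (level_le c0 D0 ac dD) => //; apply/feasE => q.
  have := tangent_le (fun p => comb_derive lam t (da p) (dd p))
    (fun p => comb_derive lam t (da1 p) (dd1 p)) (fun p => conv p l2 t0 tT) p q.
  by lra.
by apply: (level_ge c0 D0 ac dD (p := p)) => //; rewrite /comb; lra.
Qed.

(** Used at the floor 1/2 of the level function and where all constraints are slack. *)
Lemma flat_test b q X C r : X^T = X -> 0 < r ->
  (forall xi tau, `|xi| < r -> - r < tau -> tau <= 0 -> 0 <= quad b q X C xi tau) ->
  sub_ineq b q X.
Proof.
move=> sX r0 H; have rr : - r < 0 by rewrite oppr_lt0.
apply: (wall_sub_ineq rphi hpsi EE ZZ EZ sX r0).
  by apply: (proj1 (segment_ge0 (X := X) (C := C) (a := b) r0 _)) => k kr; exact: H.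
by move=> zeta tau u _ /andP[tr ta] _ _ xr; exact: H.
Qed.

Section test.
Variables (x : 'rV[R]_n) (t : R) (b : R) (q : 'rV[R]_n) (X : 'M[R]_n) (C r : R).
Hypothesis t0 : 0 < t.
Hypothesis tT : t <= T.
Hypothesis sX : X^T = X.
Hypothesis r0 : 0 < r.
Hypothesis rt : r <= t.

Let s := dot x E.
Let z := dot x Z.
Let lam := W x t.

Lemma lam_ge : 2^-1 <= lam.
Proof. exact: (level_ge_half c0 D0 ac dD _ _ (ltW t0)). Qed.

Lemma lam_gt0 : 0 < lam.
Proof. by apply: lt_le_trans lam_ge; rewrite invr_gt0. Qed.

(** Slack of the constraint of slope [p] at the tested point. *)
Let f p := comb a d lam t p - p * s + z.
Let f1 p := comb a1 d1 lam t p - s.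

Let df p : is_derive p 1 f (f1 p).
Proof. exact: (slack_derive _ _ (comb_derive _ _ (da p) (dd p))). Qed.
Let df1 p : is_derive p 1 f1 (comb a2 d2 lam t p).
Proof. exact: (slope_derive _ (comb_derive _ _ (da1 p) (dd1 p))). Qed.
Let f2_gt0 p : 0 < comb a2 d2 lam t p.
Proof. exact: conv lam_ge (ltW t0) tT. Qed.

Let f_ge0 p : 0 <= f p.
Proof. by apply: (feasE _ _ _ _).1; exact: (level_feas c0 D0 ac dD _ _ (ltW t0)). Qed.

(** The tested point lies on the smooth part of its level set, with normal [nrm p0]. In the past the
    point of the curve with the same slope [p0] is followed, so the level stays [lam]. *)
Lemma contact_test p0 : f1 p0 = 0 -> f p0 = 0 ->
  (forall xi tau, `|xi| < r -> - r < tau -> tau <= 0 -> W (x + xi) (t + tau) = lam ->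
    0 <= quad b q X C xi tau) ->
  - dot q Z * (d p0 / lam) <= psi (nrm p0) *
    (- dot q Z / comb a2 d2 lam t p0 * qd (hess phi (nrm p0)) E) ->
  sub_ineq b q X.
Proof.
rewrite /f1 /f => f10 f0 H Hv; have sE : s = comb a1 d1 lam t p0 by lra.
have zE : z = p0 * comb a1 d1 lam t p0 - comb a d lam t p0 by rewrite -sE; lra.
have rr : - r < 0 by rewrite oppr_lt0.
have ZE := ZE EZ.
apply: (contact_sub_ineq rphi hpsi EE ZZ EZ (G := comb a d lam t)
  (G1 := comb a1 d1 lam t) (p0 := p0) (g2 := comb a2 d2 lam t p0)
  (vel := d p0 / lam) (d1 := d1 p0 / lam) (C := C) sX r0 _ _ _ _ _ Hv).
- exact: f2_gt0.
- move=> p u uE uZ xi xr; apply: H => //; rewrite addr0.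
  rewrite /W !dotDl !dotZl EE ZZ ZE EZ uE uZ -/s -/z !mulr0 !mulr1 !addr0 add0r.
  rewrite -zE -sE [s + _]addrC [z + _]addrC !subrK.
  exact: level_on_curve lam_ge (ltW t0) tT.
move=> tau /andP[tr ta] xi xr; apply: H => //.
rewrite /W /xi !dotDl !(dotZl tau) !dotDl !dotZl EE ZE ZZ EZ !mulr0 addr0 add0r !mulr1 -/s -/z.
have -> : s + tau * - (d1 p0 / lam) = comb a1 d1 lam (t + tau) p0.
  by rewrite sE /comb; lra.
have -> : z + tau * (d p0 / lam - p0 * (d1 p0 / lam)) =
    p0 * comb a1 d1 lam (t + tau) p0 - comb a d lam (t + tau) p0.
  by rewrite zE /comb; lra.
by apply: level_on_curve; [exact: lam_ge|move: tr rt; lra|move: tT ta; lra].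
Qed.

Lemma shift_coords (zeta : R) u : dot u E = 0 -> dot u Z = 0 ->
  dot (x + (zeta *: Z + u)) E = s /\ dot (x + (zeta *: Z + u)) Z = z + zeta.
Proof.
by move=> uE uZ; rewrite !dotDl !dotZl (ZE EZ) ZZ uE uZ mulr0 mulr1 !addr0.
Qed.

(** The condition on [comb a2 d2] says that the translation speed [1 / lam] does not exceed the
    speed given by the curvature, at any slope. *)
Lemma sub_test : (forall p, d p = 1) ->
  (forall p, comb a2 d2 lam t p <= lam * (psi (nrm p) * qd (hess phi (nrm p)) E)) ->
  (forall xi tau, `|xi| < r -> - r < tau -> tau <= 0 ->
    W (x + xi) (t + tau) <= lam + quad b q X C xi tau) ->
  sub_ineq b q X.
Proof.
move=> d_1 speed H; have rr : - r < 0 by rewrite oppr_lt0.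
have l0 := lam_gt0.
(* If the slack does not grow along some slopes tending to infinity, no level below [lam] is
   feasible at the abscissa [s], at any height and time: lowering the level loses a multiple of
   [|p|]. *)
have wall : (forall K : R, exists2 p, K <= `|p| & f p <= f 0) -> sub_ineq b q X.
  move=> fK.
  have Wall (z' t' : R) : 0 <= t' -> lam <= level a d s z' t'.
    move=> t'0; rewrite leNgt; apply/negP => lt.
    have m0 := level_gt0 c0 D0 ac dD s z' t'0.
    have F := (feasE _ _ _ _).1 (level_feas c0 D0 ac dD s z' t'0).
    set m := level _ _ _ _ _ in lt m0 F.
    have lm : 0 < lam - m by rewrite subr_gt0.
    have lmc : 0 < (lam - m) * c by rewrite mulr_gt0.
    pose K := (`|f 0| + `|z'| + `|z| + t / lam) / ((lam - m) * c).
    have [p Kp fp] := fK K.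
    have h1 : `|f 0| + `|z'| + `|z| + t / lam <= (lam - m) * c * `|p|.
      by rewrite [leRHS]mulrC -ler_pdivrMr.
    have h2 := ler_wpM2l (ltW lm) (ac p); have h3 := F p.
    have h4 : 0 <= t' / m by rewrite divr_ge0// ltW.
    move: fp h3; rewrite {1}/f /comb d_1.
    have := ler_norm (f 0); have := ler_norm (- z); have := ler_norm z'.
    rewrite normrN;    move: h1 h2 h4; lra.
  have ge0 (zeta tau : R) u : dot u E = 0 -> dot u Z = 0 -> `|zeta *: Z + u| < r ->
      - r < tau -> tau <= 0 -> 0 <= quad b q X C (zeta *: Z + u) tau.
    move=> uE uZ ur tr ta; have := H _ _ ur tr ta; have [cE cZ] := shift_coords zeta uE uZ.
    have tt : 0 <= t + tau by move: tr rt; lra.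
    by rewrite {1}/W cE cZ; have := Wall (z + zeta) (t + tau) tt; lra.
  apply: (wall_sub_ineq rphi hpsi EE ZZ EZ (C := C) (a := b) sX r0).
    apply: (proj1 (segment_ge0 (X := X) (C := C) (a := b) r0 _)) => k kr.
    by have := ge0 k 0 0; rewrite !addr0; apply => //; rewrite dot0l.
  by move=> zeta tau u _ /andP[tr ta] uE uZ xr; exact: ge0.
have [[p0 f10]|fneg|fpos] := slope_cases df1 f2_gt0.
- have [fz|fz] := eqVneq (f p0) 0.
    apply: (contact_test f10 fz) => [xi tau xr tr ta WE|].
      by have := H xi tau xr tr ta; rewrite WE; lra.
    have qZ : 0 <= - dot q Z.
      have Z1 : 0 < r / (`|- Z| + 1) by rewrite divr_gt0// ltr_wpDl.
      have := @linear_ge0 _ _ q X C b (- Z) 0 _ Z1; rewrite mulr0 dotNr; apply => k k0 kr.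
      have kZ : `|k *: (- Z)| < r by apply: small_scale; rewrite ?gtr0_norm.
      rewrite mulr0 oppr0; have := H (k *: - Z) 0 kZ rr (lexx 0); rewrite addr0.
      have [cE cZ] := @shift_coords (- k) 0 (dot0l _) (dot0l _).
      rewrite {1}/W; move: cE cZ; rewrite addr0 scaleNr -scalerN => -> ->.
      suff : lam <= level a d s (z - k) t by lra.
      apply: (level_le c0 D0 ac dD (ltW t0)).
        exact: (level_ge_half c0 D0 ac dD _ _ (ltW t0)).
      by move=> p; have := level_feas c0 D0 ac dD s (z - k) (ltW t0) p; rewrite -/s -/z; lra.
    rewrite d_1 [leRHS]mulrCA -!mulrA ler_wpM2l// mul1r.
    rewrite [leRHS]mulrC ler_pdivlMr ?f2_gt0// [leLHS]mulrC ler_pdivrMr//.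
    by rewrite [leRHS]mulrC.
  have fp0 : 0 < f p0 by rewrite lt_neqAle eq_sym fz f_ge0.
  have [mu mu0 fmu] := critical_slack df df1 f2_gt0 f10 fp0.
  have [l2|l2] := leP lam 2^-1.
    have lE : lam = 2^-1 by apply/eqP; rewrite eq_le l2 lam_ge.
    apply: (flat_test sX r0) => xi tau xr tr ta; have := H xi tau xr tr ta.
    have tt : 0 <= t + tau by move: tr rt; lra.
    have := level_ge_half c0 D0 ac dD (dot (x + xi) E) (dot (x + xi) Z) tt.
    by rewrite -/(W _ _) lE; lra.
  (* Above the floor, a slack of at least [mu (1 + |p|)] contradicts minimality, because [lam - k]
     is still feasible; [4 t] comes from the bound 2 for both [1 / lam] and [1 / (lam - k)]. *)
  exfalso.
  pose k := Num.min (lam - 2^-1) (mu / (`|A| + 4 * t + 1)).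
  have A1 : 0 < `|A| + 4 * t + 1 by move: t0 (normr_ge0 A); lra.
  have k0 : 0 < k by rewrite lt_min subr_gt0 l2 divr_gt0.
  have k1 : k <= lam - 2^-1 by rewrite ge_min lexx.
  have k2 : k * (`|A| + 4 * t + 1) <= mu by rewrite -ler_pdivlMr// ge_min lexx orbT.
  have : lam <= lam - k.
    apply: (level_le c0 D0 ac dD (ltW t0)); first by move: k1; lra.
    have lk0 : 2^-1 <= lam - k by move: k1; lra.
    move=> p; have := fmu p; rewrite /f /comb d_1 !mulr1 => h1.
    have h2 : k * a p <= k * (`|A| * (1 + `|p|)).
      rewrite ler_pM2l//; apply: le_trans (aA p) _; apply: ler_wpM2r (ler_norm A).
      by rewrite addr_ge0.
    have h3 : t / (lam - k) <= t / lam + k * (4 * t).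
      have lk : 0 < lam - k by apply: lt_le_trans lk0; rewrite invr_gt0.
      have -> : t / (lam - k) = t / lam + k * (t * ((lam - k)^-1 * lam^-1)).
        by field; rewrite !gt_eqF.
      rewrite lerD2l ler_pM2l// mulrC ler_pM2r// (_ : 4 = 2 * 2); last by lra.
      have inv2 y : 2^-1 <= y -> y^-1 <= 2 :> R.
        by move=> y2; rewrite -[leRHS]invrK lef_pV2 ?posrE ?invr_gt0// (lt_le_trans _ y2) ?invr_gt0.
      by apply: ler_pM; rewrite ?invr_ge0 ?(ltW lk) ?(ltW l0) ?inv2 ?lam_ge.
    have := ler_wpM2r (normr_ge0 p) k2; have : 0 <= k * (4 * t) * `|p|.
      by rewrite mulr_ge0// mulr_ge0 ?(ltW k0)// mulr_ge0// ltW.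
    have := mulr_ge0 (ltW k0) (normr_ge0 p).
    move: h1 h2 h3 k2; rewrite -/s -/z; lra.
  by move: k0; lra.
- apply: wall => K; exists (Num.max K 0).
    by rewrite ger0_norm le_max lexx// orbT.
  have := tangent_le df df1 f2_gt0 (Num.max K 0) 0.
  have : 0 <= Num.max K 0 by rewrite le_max lexx orbT.
  move: (Num.max K 0) => y y0; have := mulr_ge0_le0 y0 (ltW (fneg y)); lra.
- apply: wall => K; exists (- Num.max K 0).
    by rewrite normrN ger0_norm le_max lexx// orbT.
  have := tangent_le df df1 f2_gt0 (- Num.max K 0) 0.
  have : 0 <= Num.max K 0 by rewrite le_max lexx orbT.
  move: (Num.max K 0) => y y0; have := mulr_ge0 y0 (ltW (fpos (- y))); lra.
Qed.

(** The speed condition is reversed. Going back in time relaxes every constraint, which reduces the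
    wall and slack cases to tests at the fixed time [t]. *)
Lemma super_test :
  (forall p, lam * (psi (nrm p) * qd (hess phi (nrm p)) E) <=
    d p * comb a2 d2 lam t p) ->
  (forall xi tau, `|xi| < r -> - r < tau -> tau <= 0 ->
    lam - W (x + xi) (t + tau) <= quad b q X C xi tau) ->
  sub_ineq b q X.
Proof.
move=> speed H; have rr : - r < 0 by rewrite oppr_lt0.
have l0 := lam_gt0.
have below xi tau : (forall p, 0 <= f p - p * dot xi E + dot xi Z) ->
    `|xi| < r -> - r < tau -> tau <= 0 -> 0 <= quad b q X C xi tau.
  move=> F xr tr ta; apply: le_trans (H xi tau xr tr ta); rewrite subr_ge0.
  have tt : 0 <= t + tau by move: tr rt; lra.
  apply: (level_le c0 D0 ac dD tt lam_ge) => p; have := F p.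
  rewrite /f /comb !dotDl -/s -/z => F1.
  have : (t + tau) / lam * d p <= t / lam * d p.
    apply: ler_wpM2r; first exact: speed_ge0 dD p.
    apply: ler_wpM2r.
      by rewrite invr_ge0 ltW.
    by move: ta; lra.
  lra.
have up (zeta tau : R) u : 0 <= zeta -> dot u E = 0 -> dot u Z = 0 ->
    `|zeta *: Z + u| < r -> - r < tau -> tau <= 0 -> 0 <= quad b q X C (zeta *: Z + u) tau.
  move=> z0 uE uZ; apply: below => p.
  rewrite !dotDl !dotZl (ZE EZ) ZZ uE uZ mulr0 mulr1 !addr0 mulr0 subr0.
  by rewrite addr_ge0.
have upZ (zeta : R) : 0 <= zeta -> `|zeta *: Z| < r -> 0 <= quad b q X C (zeta *: Z) 0.
  move=> z0 zr; have := up zeta 0 0 z0 (dot0l _) (dot0l _); rewrite addr0.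
  exact.
(* Next to a wall, steps [e (sg E - K Z)] remain feasible for every [K] once [e] is small: the
   constraints tightened by such a step have enough slack. *)
have wall (sg : R) : (forall K : R, 0 < K -> exists2 k : R, 0 < k &
    forall e p : R, 0 < e -> e < k -> 0 <= f p - p * (e * sg) - e * K) -> sub_ineq b q X.
  move=> HK; apply: (wall_sub_ineq rphi hpsi EE ZZ EZ (C := C) (a := b) sX r0).
    apply: (wall_slope (a := b) (X := X) (C := C) (sg := sg) (E := E) r0 upZ) => K K0.
    have [k k0 Hk] := HK K K0; set v := _ - _ *: Z.
    have v1 : 0 < r / (`|v| + 1) by rewrite divr_gt0// ltr_wpDl.
    exists (Num.min k (r / (`|v| + 1))); first by rewrite lt_min k0.
    move=> e e0; rewrite lt_min => /andP[ek er]; apply: below => //.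
      move=> p; rewrite !dotZl !dotBl !dotZl EE ZZ EZ (ZE EZ) !mulr0 !mulr1.
      by have := Hk e p e0 ek; lra.
    by apply: small_scale; rewrite ?gtr0_norm.
  by move=> zeta tau u z0 /andP[tr ta] uE uZ ur; exact: up.
have [[p0 f10]|fneg|fpos] := slope_cases df1 f2_gt0.
- have [fz|fz] := eqVneq (f p0) 0.
    apply: (contact_test f10 fz) => [xi tau xr tr ta WE|].
      by have := H xi tau xr tr ta; rewrite WE; lra.
    have qZ : 0 <= dot q Z.
      have Z1 : 0 < r / (`|Z| + 1) by rewrite divr_gt0// ltr_wpDl.
      have := @linear_ge0 _ _ q X C b Z 0 _ Z1; rewrite mulr0; apply => k k0 kr.
      rewrite mulr0 oppr0; apply: upZ; first exact: ltW.
      by apply: small_scale; rewrite ?gtr0_norm.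
    rewrite [leRHS]mulrCA -!mulrA mulNr [leRHS]mulNr lerN2 ler_wpM2l//.
    rewrite [leLHS]mulrC ler_pdivrMr ?f2_gt0// mulrAC ler_pdivlMr//.
    by rewrite mulrC.
  have fp0 : 0 < f p0 by rewrite lt_neqAle eq_sym fz f_ge0.
  have [mu mu0 fmu] := critical_slack df df1 f2_gt0 f10 fp0.
  pose B := n%:R * `|E| + n%:R * `|Z| + 1; have B0 : 0 < B.
    by rewrite ltr_wpDl// addr_ge0// mulr_ge0.
  have m0 : 0 < Num.min r (mu / B) by rewrite lt_min r0 divr_gt0.
  apply: (flat_test sX m0 (C := C)) => xi tau; rewrite lt_min => /andP[xr xB].
  move=> tr ta; have {}tr : - r < tau.
    by apply: le_lt_trans tr; rewrite lerN2 ge_min lexx.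
  apply: below => // p; have := fmu p.
  have {}xB : `|xi| * B <= mu by rewrite -ler_pdivlMr// ltW.
  have h1 := ler_wpM2r (_ : 0 <= 1 + `|p|) xB.
  have h2 : `|p * dot xi E| <= `|p| * (n%:R * `|xi| * `|E|).
    by rewrite normrM ler_wpM2l// abs_dot_le.
  have h3 := abs_dot_le xi Z; have := ler_norm (p * dot xi E).
  have := ler_norm (- dot xi Z); rewrite normrN.
  have h4 : 0 <= `|p| * `|xi| by rewrite mulr_ge0.
  have h5 : 0 <= n%:R * `|xi| * `|E| by rewrite !mulr_ge0.
  have h6 : 0 <= `|p| * (n%:R * `|xi| * `|Z|) by rewrite !mulr_ge0.
  have := h1 (addr_ge0 ler01 (normr_ge0 p)); have := normr_ge0 xi.
  rewrite /B; move: h2 h3 h4 h5 h6; lra.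
- apply: (wall (-1)) => K K0; exists (- f1 K); first by rewrite oppr_gt0.
  move=> e p e0 ek; have [pK|/ltW pK] := leP K p.
    by have := f_ge0 p; have := ler_wpM2l (ltW e0) pK; lra.
  have := tangent_le df df1 f2_gt0 K p; have := f_ge0 K.
  have : e * (K - p) <= - f1 K * (K - p) by rewrite ler_wpM2r ?subr_ge0// ltW.
  lra.
- apply: (wall 1) => K K0; exists (f1 (- K)); first exact: fpos.
  move=> e p e0 ek; have [pK|/ltW pK] := leP p (- K).
    by have := f_ge0 p; have := ler_wpM2l (ltW e0) pK; lra.
  have := tangent_le df df1 f2_gt0 (- K) p; have := f_ge0 (- K).
  have : e * (p + K) <= f1 (- K) * (p + K) by apply: ler_wpM2r; [move: pK; lra|exact: ltW].
  lra.
Qed.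

End test.
End level_tests.

(** * The smooth weight [sqrt (1 + p ^ 2)] *)

Section smooth_modulus.
Context {R : realType}.
Implicit Types p : R.

Definition rho p : R := Num.sqrt (1 + p ^+ 2).

Lemma rho_sqr p : rho p ^+ 2 = 1 + p ^+ 2.
Proof. by rewrite sqr_sqrtr// addr_ge0// sqr_ge0. Qed.

Lemma rho_ge1 p : 1 <= rho p.
Proof. by rewrite -[X in X <= _]sqrtr1 ler_sqrt ?lerDl ?sqr_ge0// addr_ge0// sqr_ge0. Qed.

Lemma rho_gt0 p : 0 < rho p. Proof. exact: lt_le_trans (rho_ge1 p). Qed.

Lemma rho_ge p : `|p| <= rho p.
Proof.
by rewrite -sqrtr_sqr ler_sqrt ?lerDr// addr_ge0// sqr_ge0.
Qed.

Lemma rho_le p : rho p <= 1 + `|p|.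
Proof.
rewrite -[leRHS]ger0_norm ?addr_ge0// -sqrtr_sqr ler_sqrt ?sqr_ge0//.
by rewrite sqrrD expr1n real_normK ?num_real// mul1r lerD2r lerDl mulrn_wge0.
Qed.

Lemma rho_derive p : is_derive p 1 rho (p / rho p).
Proof.
have p2 : 0 < 1 + p ^+ 2 by rewrite ltr_wpDr// sqr_ge0.
have d1 : is_derive p 1 (fun x : R => 1 + x ^+ 2) (2 * p).
  apply: der_eq (derD (der_cst 1 p) (derM (der_id p) (der_id p))) _; lra.
have d2 : is_derive p 1 rho ((2 * rho p)^-1 * (2 * p)).
  exact: (der_comp (f := @Num.sqrt R) (g := fun x => 1 + x ^+ 2) (is_derive1_sqrt p2) d1).
apply: der_eq d2 _.
by rewrite -/(rho p); field; rewrite gt_eqF ?rho_gt0.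
Qed.

Lemma rho_derive2 p : is_derive p 1 (fun p => p / rho p) ((rho p)^-1 ^+ 3).
Proof.
have r0 : rho p != 0 by rewrite gt_eqF ?rho_gt0.
have d1 : is_derive p 1 (fun x => (rho x)^-1) (- (rho p ^- 2) * (p / rho p)).
  exact: (is_deriveV r0 (rho_derive p)).
apply: der_eq (derM (der_id p) d1) _.
rewrite mul1r; have := rho_sqr p => rE.
have -> : p * (- rho p ^- 2 * (p / rho p)) = - (p ^+ 2) * (rho p)^-1 ^+ 3 by field.
have -> : p ^+ 2 = rho p ^+ 2 - 1 by lra.
by field.
Qed.

End smooth_modulus.

(** * Lower and upper level functions for a regular norm *)

Section scaled_levels.
Context {R : realType} {n : nat} (phi psi : 'rV[R]_n -> R).
Hypothesis rphi : regular_norm phi.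
Hypothesis hpsi : is_norm psi.
Variables (E Z : 'rV[R]_n).
Hypothesis EE : dot E E = 1.
Hypothesis ZZ : dot Z Z = 1.
Hypothesis EZ : dot E Z = 0.
Implicit Types (s z t lam p tau : R) (x q xi u : 'rV[R]_n) (X : 'M[R]_n).

Local Notation sub_ineq := (sub_ineq phi psi).
Local Notation sub_at := (sub_at phi psi).
Local Notation super_at := (super_at phi psi).

Definition curvature p := psi (nrm E Z p) * qd (hess phi (nrm E Z p)) E.

Lemma sub_ineqZ (k b : R) q X : 0 < k ->
  sub_ineq b q X -> sub_ineq (k * b) (k *: q) (k *: X).
Proof.
move=> k0 H c r r0 Fc; rewrite mulrC -ler_pdivlMr//.
apply: (H _ (r / k)) => [|y Y yq YX y0]; first by rewrite divr_gt0.
rewrite ler_pdivlMr// mulrC -flowZ.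
rewrite -(flow_scale rphi hpsi _ k0 y0); apply: Fc.
- by rewrite -scalerBr normrZ gtr0_norm// mulrC -ltr_pdivlMr.
- by rewrite -scalerBr normrZ gtr0_norm// mulrC -ltr_pdivlMr.
- by rewrite scale_neq0// gt_eqF.
Qed.

Lemma quadZ (k b : R) q X (C : R) xi tau :
  quad (k * b) (k *: q) (k *: X) (k * C) xi tau = k * quad b q X C xi tau.
Proof. by rewrite /quad dotZl qdZ; lra. Qed.

Lemma level_modulus a d (c D k : R) (ti : R -> R) (M : R) : 0 < c -> 0 <= D -> 0 <= k ->
  (forall p, c * (1 + `|p|) <= a p) -> (forall p, 0 <= d p <= D * (1 + `|p|)) ->
  (forall t, 0 <= ti t) -> 0 <= M -> (forall s t, `|ti s - ti t| <= M * `|s - t|) ->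
  modulus (k * (n%:R * `|E| + n%:R * `|Z|) / c)
    (fun x t => k * level_at E Z a d x (ti t) - 1).
Proof.
move=> c0 D0 k0 ac dD ti0 M0 tiM.
have lip x y s t : `|level_at E Z a d x (ti s) - level_at E Z a d y (ti t)| <=
    (n%:R * `|E| + n%:R * `|Z|) / c * `|x - y| + 2 * D * M / c * `|s - t|.
  wlog H : x y s t / level_at E Z a d y (ti t) <= level_at E Z a d x (ti s) => [W|].
    have [/W//|/ltW/W] := leP (level_at E Z a d y (ti t)) (level_at E Z a d x (ti s)).
    by rewrite distrC [`|y - x|]distrC [`|t - s|]distrC.
  rewrite ger0_norm ?subr_ge0// lerBlDl.
  have := level_lipschitz c0 D0 ac dD (dot y E) (dot y Z) (dot x E) (dot x Z) (ti0 t) (ti0 s).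
  move=> /le_trans; apply; rewrite lerD2l.
  rewrite ![_ / c * _]mulrAC -mulrDl ler_pM2r ?invr_gt0//.
  rewrite -!dotBl; have e1 := abs_dot_le (y - x) E; have e2 := abs_dot_le (y - x) Z.
  have e3 := tiM t s; have D2 : 0 <= 2 * D by rewrite mulr_ge0.
  have := ler_wpM2l D2 e3; rewrite [`|t - s|]distrC; rewrite [`|y - x|]distrC in e1 e2 *.
  by move: e1 e2; lra.
split=> [x y s|sg sg0].
  have := lip x y s s; rewrite subrr normr0 mulr0 addr0 => H.
  rewrite opprB addrA subrK -mulrBr normrM (ger0_norm k0).
  by apply: le_trans (ler_wpM2l k0 H) _; rewrite !mulrA.
exists (k * (2 * D * M / c) + 1).
  by rewrite ltr_wpDl// mulr_ge0// divr_ge0 ?(ltW c0)// !mulr_ge0.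
move=> x s t; have := lip x x s t; rewrite subrr normr0 mulr0 add0r => H.
rewrite opprB addrA subrK -mulrBr normrM (ger0_norm k0).
apply: le_trans (ler_wpM2l k0 H) _; rewrite mulrDl mulrA mul1r.
by have := normr_ge0 (s - t); lra.
Qed.

Variables (h h1 : R -> R) (eta c A : R).
Hypothesis eta0 : 0 < eta.
Hypothesis c0 : 0 < c.
Hypothesis hc : forall p, c * (1 + `|p|) <= h p.
Hypothesis hA : forall p, h p <= A * (1 + `|p|).
Hypothesis kappa_gt0 : forall p, 0 < curvature p.
Hypothesis dh : forall p : R, is_derive p 1 h (h1 p).
Hypothesis dh1 : forall p : R, is_derive p 1 h1 (curvature p / (1 + eta * rho p)).

Let weight_gt1 p : 1 < 1 + eta * rho p.
Proof. by rewrite ltrDl mulr_gt0// rho_gt0. Qed.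

Let weight_gt0 p : 0 < 1 + eta * rho p.
Proof. exact: lt_trans (weight_gt1 p). Qed.

Definition lower_level (k : R) x t := k * level_at E Z h (cst 1) x (posp t) - 1.

(** The second derivative of the damped profile is at most [curvature], so [sub_test] applies with
    unit speed. *)
Lemma lower_level_sub (k : R) x t : 0 < k -> 0 < t -> sub_at (lower_level k) x t.
Proof.
move=> k0 t0 b q X C r [sX r0 H].
have one1 (p : R) : (0 : R) <= cst (1 : R) p <= 1 * (1 + `|p|).
  by rewrite /= ler01 mul1r lerDl normr_ge0.
have D1 (p : R) : is_derive p 1 (cst (1 : R)) ((cst (0 : R)) p) by exact: der_cst.
have D2 (p : R) : is_derive p 1 (cst (0 : R)) ((cst (0 : R)) p) by exact: der_cst.
have -> : b = k * (k^-1 * b) by rewrite mulVKf// gt_eqF.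
have -> : q = k *: (k^-1 *: q) by rewrite scalerA divff ?scale1r// gt_eqF.
have -> : X = k *: (k^-1 *: X) by rewrite scalerA divff ?scale1r// gt_eqF.
apply: sub_ineqZ => //.
have m0 : 0 < Num.min r t by rewrite lt_min r0.
have mt : Num.min r t <= t by rewrite ge_min lexx orbT.
have conv (lam v p : R) : 2^-1 <= lam -> 0 <= v -> v <= t ->
    0 < lam * (curvature p / (1 + eta * rho p)) - v / lam * cst (0 : R) p.
  move=> l2 _ _; rewrite /= mulr0 subr0; apply: mulr_gt0; last exact: divr_gt0.
  by apply: lt_le_trans l2; rewrite invr_gt0.
have l0 : 0 < level_at E Z h (cst 1) x t := level_gt0 c0 ler01 hc one1 _ _ (ltW t0).
apply: (sub_test rphi hpsi EE ZZ EZ c0 ler01 hc hA one1 dh dh1 D1 D2 conv t0 (lexx t)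
  (x := x) (C := k^-1 * C) _ m0 mt).
- by rewrite linearZ /= sX.
- by [].
- move=> p; rewrite /comb /= mulr0 subr0; apply: ler_wpM2l; first exact: ltW.
  by rewrite ler_pdivrMr// ler_peMr ?(ltW (kappa_gt0 p)) ?(ltW (weight_gt1 p)).
move=> xi tau xr tr ta; have {}xr : `|xi| < r by apply: lt_le_trans xr _; rewrite ge_min lexx.
have tt : 0 <= t + tau by move: tr mt; lra.
have tau_r : `|tau| < r.
  have : Num.min r t <= r by rewrite ge_min lexx.
  by move: tr ta; rewrite ltr_norml => *; apply/andP; split; lra.
have := H xi tau xr tau_r; rewrite /lower_level /posp !max_l ?(ltW t0)//.
move=> H1; rewrite quadZ -lerBlDl ler_pdivlMl//; move: H1; lra.
Qed.

Variables (T ell : R).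
Hypothesis T0 : 0 < T.
Hypothesis ellE : ell = 4 * eta * T.

(** Raising the speed by the factor that damps the curvature balances the supersolution condition.
    The raised speed could spoil the convexity of [lam a - t / lam d], by at most [2 T eta rho''];
    since [lam >= 1/2], the term [ell rho] with [ell = 4 eta T] makes up for it. *)
Definition upper_profile p := h p + ell * rho p.
Definition upper_speed p := 1 + eta * rho p.

(** Convexity is guaranteed up to time [T] only. Afterwards the level function is frozen and raised
    at a rate [M] that dominates its time derivative. *)
Definition upper_level (k M : R) x t :=
  k * level_at E Z upper_profile upper_speed x (Num.min (posp t) T) - 1 + M * posp (t - T).

Lemma upper_profile_ge p : c * (1 + `|p|) <= upper_profile p.
Proof.
apply: le_trans (hc p) _; rewrite lerDl mulr_ge0 ?(ltW (rho_gt0 p))// ellE.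
by apply: mulr_ge0 (ltW T0); rewrite mulr_ge0// ltW.
Qed.

Lemma upper_speed_bounds p : 0 <= upper_speed p <= (1 + eta) * (1 + `|p|).
Proof.
rewrite (ltW (weight_gt0 p)) /= /upper_speed.
by have := normr_ge0 p; have := ler_wpM2l (ltW eta0) (rho_le p); lra.
Qed.

Lemma upper_level_super (k M : R) x t : 0 < k -> k * (2 * (1 + eta)) / c <= M ->
  0 < t -> super_at (upper_level k M) x t.
Proof.
move=> k0 Mk t0 b q X C r [sX r0 H].
have D0 : 0 <= 1 + eta by rewrite addr_ge0// ltW.
have D1 (p : R) : is_derive p 1 upper_profile (h1 p + ell * (p / rho p)).
  by apply: derD => //; apply: derZ; exact: rho_derive.
have D2 (p : R) : is_derive p 1 (fun p => h1 p + ell * (p / rho p))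
    (curvature p / (1 + eta * rho p) + ell * (rho p)^-1 ^+ 3).
  by apply: derD => //; apply: derZ; exact: rho_derive2.
have D3 (p : R) : is_derive p 1 upper_speed (eta * (p / rho p)).
  apply: der_eq (derD (der_cst 1 p) (derZ eta (rho_derive p))) _.
  by rewrite add0r.
have D4 (p : R) : is_derive p 1 (fun p => eta * (p / rho p)) (eta * (rho p)^-1 ^+ 3).
  by apply: derZ; exact: rho_derive2.
have excess (lam v p : R) : 2^-1 <= lam -> 0 <= v -> v <= T ->
    lam * (curvature p / (1 + eta * rho p)) <=
    lam * (curvature p / (1 + eta * rho p) + ell * (rho p)^-1 ^+ 3) -
      v / lam * (eta * (rho p)^-1 ^+ 3).
  move=> l2 v0 vT; have l0 : 0 < lam by apply: lt_le_trans l2; rewrite invr_gt0.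
  have w0 : 0 <= (rho p)^-1 ^+ 3 by rewrite exprn_ge0// invr_ge0 ltW// rho_gt0.
  move: (_ ^+ 3) w0 => w w0.
  rewrite mulrDr -addrA lerDl !mulrA -mulrBl; apply: mulr_ge0 => //.
  have l2i : lam^-1 <= 2 by rewrite -[leRHS]invrK lef_pV2 ?posrE ?invr_gt0.
  rewrite subr_ge0 ellE; have e1 : v * lam^-1 * eta <= T * 2 * eta.
    by rewrite ler_pM2r//; apply: ler_pM; rewrite // invr_ge0 ltW.
  apply: le_trans e1 _; have : 2^-1 * (4 * eta * T) <= lam * (4 * eta * T).
    by apply: ler_wpM2r l2; rewrite mulr_ge0 ?(ltW T0)// mulr_ge0// ltW.
  by rewrite !mulrA; lra.
have conv (lam v p : R) : 2^-1 <= lam -> 0 <= v -> v <= T ->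
    0 < lam * (curvature p / (1 + eta * rho p) + ell * (rho p)^-1 ^+ 3) -
      v / lam * (eta * (rho p)^-1 ^+ 3).
  move=> l2 v0 vT; apply: lt_le_trans (excess lam v p l2 v0 vT).
  apply: mulr_gt0; last exact: divr_gt0.
  by apply: lt_le_trans l2; rewrite invr_gt0.
pose t1 := Num.min t T.
have t10 : 0 < t1 by rewrite lt_min t0.
have t1T : t1 <= T by rewrite ge_min lexx orbT.
have t1t : t1 <= t by rewrite ge_min lexx.
pose W := level_at E Z upper_profile upper_speed.
pose m := Num.min r t1; have m0 : 0 < m by rewrite lt_min r0.
have mr : m <= r by rewrite ge_min lexx.
have mt : m <= t1 by rewrite ge_min lexx orbT.
(* After [T] the time derivative of the test must be that of the rising term; with the Lipschitz
   bound in time, the test becomes one in the past of [T]. *)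
have [C' past] : exists C', forall xi tau, `|xi| < m -> - m < tau -> tau <= 0 ->
    k * (W x t1 - W (x + xi) (t1 + tau)) <= quad b q X C' xi tau.
  have [tT|tT] := leP t T.
    have t1E : t1 = t by rewrite /t1 min_l.
    exists C => xi tau xm tm ta.
    have tau_r : `|tau| < r by rewrite ltr_norml; apply/andP; split; lra.
    have := H xi tau (lt_le_trans xm mr) tau_r; rewrite /upper_level.
    have tt : 0 <= t + tau by move: tm mt; rewrite t1E; lra.
    have -> : posp (t + tau) = t + tau by rewrite /posp max_l.
    have -> : posp t = t by rewrite /posp max_l// ltW.
    have -> : posp (t + tau - T) = 0 by rewrite /posp max_r//; lra.
    have -> : posp (t - T) = 0 by rewrite /posp max_r//; lra.
    have -> : Num.min (t + tau) T = t + tau by rewrite min_l//; lra.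
    by rewrite (min_l tT) t1E /W; lra.
  have t1E : t1 = T by rewrite /t1 min_r// ltW.
  pose e := Num.min r (t - T); have e0 : 0 < e by rewrite lt_min r0 subr_gt0.
  have er : e <= r by rewrite ge_min lexx.
  have eT : e <= t - T by rewrite ge_min lexx orbT.
  have ULE y tau : `|tau| < e -> upper_level k M y (t + tau) =
      k * W y T - 1 + M * (t + tau - T).
    rewrite ltr_norml => /andP[te1 te2]; rewrite /upper_level /posp.
    have -> : Num.max (t + tau) 0 = t + tau by rewrite max_l//; lra.
    have -> : Num.max (t + tau - T) 0 = t + tau - T by rewrite max_l//; lra.
    by rewrite min_r//; lra.
  have UL0 := ULE x 0; rewrite normr0 addr0 in UL0.
  have bM : b + M = 0.
    apply: (quadratic_ge0 (C := C) e0) => tau te.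
    have := H 0 tau; rewrite normr0 addr0 => /(_ r0 (lt_le_trans te er)).
    by rewrite ULE// UL0// /quad dot0r /qd mul0mx dot0r; lra.
  exists 0 => xi tau xm tm ta; have := H xi 0 (lt_le_trans xm mr).
  rewrite normr0 => /(_ r0).
  rewrite ULE ?normr0// UL0// /quad mulr0 expr0n mulr0 mul0r !addr0 add0r => H1.
  have tt : 0 <= T + tau by move: tm mt; rewrite t1E; lra.
  have := level_lipschitz c0 D0 upper_profile_ge upper_speed_bounds
    (dot (x + xi) E) (dot (x + xi) Z) (dot (x + xi) E) (dot (x + xi) Z) tt (ltW T0).
  rewrite !subrr normr0 !add0r [T + tau]addrC addrK -/(W (x + xi) T).
  rewrite [tau + T]addrC -/(W (x + xi) (T + tau)) ler0_norm// => H2.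
  have {}H2 := ler_wpM2l (ltW k0) H2; have tm0 : 0 <= - tau by rewrite oppr_ge0.
  have := ler_wpM2r tm0 Mk.
  have -> : k * (2 * (1 + eta)) / c * - tau = k * (2 * (1 + eta) * - tau / c) by lra.
  have -> : b = - M by lra.
  by rewrite t1E -/(W x T) in H1 *; move: H1 H2; rewrite /W; lra.
have l0 : 0 < W x t1 := level_gt0 c0 D0 upper_profile_ge upper_speed_bounds _ _ (ltW t10).
have -> : b = k * (k^-1 * b) by rewrite mulVKf// gt_eqF.
have -> : q = k *: (k^-1 *: q) by rewrite scalerA divff ?scale1r// gt_eqF.
have -> : X = k *: (k^-1 *: X) by rewrite scalerA divff ?scale1r// gt_eqF.
apply: sub_ineqZ => //.
apply: (super_test rphi hpsi EE ZZ EZ c0 D0 upper_profile_ge upper_speed_bounds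
  D1 D2 D3 D4 conv t10 t1T (x := x) (C := k^-1 * C') _ m0 mt).
- by rewrite linearZ /= sX.
- move=> p; have l2 : 2^-1 <= W x t1 :=
    level_ge_half c0 D0 upper_profile_ge upper_speed_bounds _ _ (ltW t10).
  have := excess _ _ p l2 (ltW t10) t1T.
  rewrite /comb /upper_speed -/(curvature p) => e1.
  apply: le_trans (ler_wpM2l (ltW (weight_gt0 p)) e1).
  have -> : (1 + eta * rho p) * (W x t1 * (curvature p / (1 + eta * rho p))) =
      W x t1 * curvature p by field; rewrite gt_eqF.
  exact: lexx.
move=> xi tau xm tm ta; rewrite quadZ ler_pdivlMl//.
exact: past.
Qed.

End scaled_levels.

(** * Viscosity solutions trapped between given barriers *)

Section perron_between.
Context {R : realType} {n : nat} (phi psi : 'rV[R]_n -> R).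
Hypothesis n0 : (0 < n)%N.
Hypothesis rphi : regular_norm phi.
Hypothesis hpsi : is_norm psi.
Implicit Types (x y : 'rV[R]_n) (s t : R) (w v : 'rV[R]_n -> R -> R).

Lemma modulus_opp (L : R) w : modulus L w -> modulus L (fun x t => - w x t).
Proof.
by move=> [w1 w2]; split=> [x y s|e /w2[M M0 H]];
  [rewrite -opprD normrN|exists M => // x s t; rewrite -opprD normrN].
Qed.

Lemma max_dist (a b c d e : R) : `|a - c| <= e -> `|b - d| <= e ->
  `|Num.max a b - Num.max c d| <= e.
Proof.
rewrite !ler_norml => /andP[h1 h2] /andP[h3 h4]; apply/andP.
by have [ab|ab] := leP a b; have [cd|cd] := leP c d; split; lra.
Qed.

Lemma modulus_max (L : R) w v : modulus L w -> modulus L v ->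
  modulus L (fun x t => Num.max (w x t) (v x t)).
Proof.
move=> [w1 w2] [v1 v2]; split=> [x y s|e e0]; first exact: max_dist.
have [M M0 wM] := w2 e e0; have [K K0 vK] := v2 e e0.
exists (Num.max M K) => [|x s t]; first by rewrite lt_max M0.
apply: max_dist; [apply: le_trans (wM x s t) _|apply: le_trans (vK x s t) _];
  by rewrite lerD2l ler_wpM2r// le_max lexx ?orbT.
Qed.

(** [F] and [G] may miss the initial values; the maximum with the envelope of paraboloids, and the
    mirror construction above, attains them. [U] separates the lower functions from the upper
    ones. *)
Lemma perron_between (U0 : 'rV[R]_n -> R) (U F G : 'rV[R]_n -> R -> R) (L M : R) :
  0 < L -> 0 <= M -> (forall x y, `|U0 x - U0 y| <= L * `|x - y|) ->
  (forall x t, t <= 0 -> U x t = U0 x) ->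
  (forall x t, 0 <= t -> U0 x <= U x t <= U0 x + M * t) ->
  (forall x t, F x t <= U x t <= G x t) ->
  modulus L F -> modulus L G -> (forall x s t, s <= t -> G x s <= G x t) ->
  (forall x t, 0 < t -> sub_at phi psi F x t) ->
  (forall x t, 0 < t -> super_at phi psi G x t) ->
  exists w, viscosity_solution phi psi U0 (fun z => w z.1 z.2) /\
    forall x t, F x t <= w x t <= G x t.
Proof.
move=> L0 M0 ULip Uinit Ub FUG FL GL Gmono Fsub Gsuper.
have [C C0 FC] := flow_scalar_bounded rphi hpsi.
have NLip x y : `|(- U0 x) - (- U0 y)| <= L * `|x - y| by rewrite -opprD normrN.
pose bl := barrier U0 L M C; pose bu x t := - barrier (fun x => - U0 x) L M C x t.
pose f x t := Num.max (F x t) (bl x t).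
pose g x t := - Num.max (- G x t) (- bu x t).
have blU x t : bl x t <= U x t.
  have [t0|/ltW t0] := leP t 0.
    by rewrite Uinit// /bl (barrier_init M L0 C0 ULip x t0).
  apply: le_trans (barrier_upper M L0 C0 ULip x t0) _.
  by have := Ub x t t0; have := mulr_ge0 M0 t0; lra.
have Ubu x t : U x t <= bu x t.
  have [t0|/ltW t0] := leP t 0.
    by rewrite Uinit// /bu (barrier_init M L0 C0 NLip x t0) opprK.
  have := barrier_upper M L0 C0 NLip x t0; rewrite /bu.
  by have := Ub x t t0; lra.
have gE x t : g x t = Num.min (G x t) (bu x t).
  by rewrite /g -oppr_min opprK.
have blL : modulus L bl := barrier_modulus L0 M0 C0 ULip.
have buL : modulus L bu := modulus_opp (barrier_modulus L0 M0 C0 NLip).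
have fL : modulus L f by exact: modulus_max.
have gL : modulus L g by apply: modulus_opp; apply: modulus_max; exact: modulus_opp.
have fU x t : f x t <= U x t.
  by rewrite /f ge_max blU; have /andP[->] := FUG x t.
have Ug x t : U x t <= g x t.
  by rewrite gE le_min Ubu; have /andP[_ ->] := FUG x t.
have fg x t : f x t <= g x t by exact: le_trans (fU x t) (Ug x t).
have f0 x t : t <= 0 -> f x t = U0 x.
  move=> t0; have := fU x t; rewrite Uinit// => H; apply/eqP; rewrite eq_le H /=.
  by rewrite /f le_max /bl (barrier_init M L0 C0 ULip x t0) lexx orbT.
have g0 x t : t <= 0 -> g x t = U0 x.
  move=> t0; have := Ug x t; rewrite Uinit// => H; apply/eqP; rewrite eq_le H andbT.
  by rewrite gE ge_min /bu (barrier_init M L0 C0 NLip x t0) opprK lexx orbT.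
have gmono x s t : s <= t -> g x s <= g x t.
  move=> st; rewrite !gE le_min !ge_min Gmono//= lerN2.
  by rewrite (barrier_anti L0 M0 C0 NLip x st) orbT.
have fsub x t : 0 < t -> sub_at phi psi f x t.
  move=> t0; apply: sub_at_maxl; first exact: Fsub.
  by left; apply: (barrier_sub n0 rphi hpsi L0 M0 C0 FC ULip t0).
have gsuper x t : 0 < t -> super_at phi psi g x t.
  move=> t0; rewrite /super_at; have -> : (fun p t => - g p t) =
      fun x t => Num.max (- G x t) (- bu x t).
    by apply/funext => y; apply/funext => s; rewrite /g opprK.
  apply: sub_at_maxl; first exact: Gsuper.
  left; have -> : (fun x t => - bu x t) = barrier (fun x => - U0 x) L M C.
    by apply/funext => y; apply/funext => s; rewrite /bu opprK.
  exact: (barrier_sub n0 rphi hpsi L0 M0 C0 FC NLip t0).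
pose w := perron phi psi f g; exists w; split=> [|x t]; last first.
  have /andP[h1 h2] := perron_bounds fL fg fsub x t.
  rewrite (le_trans _ h1) ?le_max ?lexx// (le_trans h2)// gE ge_min lexx//.
have wC := perron_class_perron fL gL fg f0 g0 gmono fsub.
split.
- apply: continuous_subspaceT.
  exact: (modulus_continuous (perron_modulus fL gL fg f0 g0 gmono fsub)).
- by move=> p; exact: (@perron_class_init _ _ phi psi f g U0 f0 g0 w p 0 wC (lexx 0)).
- apply: sub_at_viscosity => p t t0; exact: (perron_sub fL fg fsub).
apply: (super_at_viscosity rphi hpsi) => p t t0.
exact: (perron_super n0 rphi hpsi fL gL fg f0 g0 gmono fsub gsuper).
Qed.

End perron_between.

(** * Antiderivatives on the whole line *)

Section antiderivative.
Context {R : realType}.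

Lemma antiderivative_right (f : R -> R) (a : R) : continuous f ->
  exists F : R -> R, forall x : R, a < x -> is_derive x 1 F (f x).
Proof.
move=> cf; exists (fun x => (\int[@lebesgue_measure R]_(t in [set` `[a, x]]) (f t))%R).
move=> x ax; have xu : x < x + 1 by rewrite ltrDl.
have intf : (@lebesgue_measure R).-integrable `[a, x + 1] (EFin \o f).
  by apply: continuous_compact_integrable; [exact: segment_compact|exact: continuous_subspaceT].
have [df fE] := continuous_FTC1_closed xu intf ax (cf x).
by apply: DeriveDef => //; rewrite -derive1E fE.
Qed.

Lemma is_derive_near (f g : R -> R) (x l r : R) : 0 < r ->
  (forall y, `|y - x| < r -> f y = g y) -> is_derive x 1 g l -> is_derive x 1 f l.
Proof.
move=> r0 fg /(@is_derive_normP R R^o) H; apply/(@is_derive_normP R R^o) => e e0.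
have [d d0 Hd] := H e e0; exists (Num.min d r); first by rewrite lt_min d0.
move=> h; rewrite lt_min => /andP[hd hr]; rewrite !fg ?subrr ?normr0//; first exact: Hd.
by rewrite scaler1 addrBl.
Qed.

Lemma constant_of_derive0 (f : R -> R) (a b : R) : a <= b ->
  (forall x : R, a <= x <= b -> is_derive x 1 f 0) -> f a = f b.
Proof.
move=> ab H; have [c _ E] := MVT_fwd ab H; apply/eqP; rewrite eq_sym -subr_eq0 E.
by rewrite mul0r.
Qed.

(** Antiderivatives on half lines, normalized at 0, agree on common domains; the base point
    [- (|x| + 1)] lies to the left of both 0 and [x]. *)
Lemma antiderivative (f : R -> R) : continuous f ->
  exists2 F : R -> R, F 0 = 0 & forall x : R, is_derive x 1 F (f x).
Proof.
move=> cf; have /choice[F FD] := fun a : R => antiderivative_right a cf.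
pose G (a x : R) := F a x - F a 0.
have GD (a x : R) : a < x -> is_derive x 1 (G a) (f x).
  by move=> ax; apply: der_eq (derB (FD a x ax) (der_cst (F a 0) x)) _; rewrite subr0.
have same (a b x : R) : a < 0 -> b < 0 -> a < x -> b < x -> G a x = G b x.
  move=> a0 b0 ax bx; pose D y := G a y - G b y.
  have D0 (y : R) : a < y -> b < y -> is_derive y 1 D 0.
    by move=> ay byy; apply: der_eq (derB (GD a y ay) (GD b y byy)) _; rewrite subrr.
  have D00 : D 0 = 0 by rewrite /D /G !subrr.
  apply/eqP; rewrite -subr_eq0 -/(D x) -D00; apply/eqP.
  have [x0|/ltW x0] := leP x 0.
    by apply: constant_of_derive0 => // y /andP[xy _]; apply: D0; exact: lt_le_trans xy.
  apply/esym; apply: constant_of_derive0 => // y /andP[y0 _].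
  by apply: D0; [exact: lt_le_trans y0|exact: lt_le_trans y0].
exists (fun x => G (- (`|x| + 1)) x); first by rewrite /G subrr.
move=> x; have neg (y : R) : - (`|y| + 1) < 0 by rewrite oppr_lt0 ltr_wpDl.
have low (y : R) : - (`|y| + 1) < y by have := ler_norm (- y); rewrite normrN; lra.
pose a := - (`|x| + 2).
have a0 : a < 0 by rewrite /a oppr_lt0 ltr_wpDl.
apply: (is_derive_near (g := G a) ltr01) => [y yx|].
  apply: same => //; move: yx; rewrite /a ltr_norml => /andP[y1 _].
  by have := ler_norm (- x); rewrite normrN; lra.
by apply: GD; have := ler_norm (- x); rewrite normrN /a; lra.
Qed.

End antiderivative.

(** * Strict convexity of a regular norm transversally to its rays *)

Section strict_curvature.
Context {R : realType} {n : nat} (phi psi : 'rV[R]_n -> R).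
Hypothesis rphi : regular_norm phi.
Hypothesis hpsi : is_norm psi.

Let C2phi : is_C2 [set p : 'rV[R]_n | p != 0] (phi : _ -> R^o).
Proof. by have [] := rphi. Qed.

Lemma hess_sqr q : q != 0 -> forall v,
  qd (hess (fun q => phi q ^+ 2) q) v =
  2 * dot (grad phi q) v ^+ 2 + 2 * phi q * qd (hess phi q) v.
Proof.
move=> q0 v.
have key (a b c d : R) : 2 * (a * b + c * d) = 2 * (c * d) + 2 * a * b by lra.
have D1 (i : 'I_n) y : y != 0 -> 'D_(delta_mx 0 i) (fun q => phi q ^+ 2 : R^o) y =
    2 * phi y * 'D_(delta_mx 0 i) (phi : _ -> R^o) y.
  move=> y0; have d1 := C1_is_derive (delta_mx 0 i) C2phi.1 y0.
  have -> : (fun q => phi q ^+ 2 : R^o) = (fun q => (phi q : R^o) * (phi q : R^o)).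
    by apply/funext => z; rewrite expr2.
  rewrite (@derive_val _ _ _ _ _ _ _ (is_deriveM d1 d1)) /GRing.scale /=; lra.
have H i j : hess (fun q => phi q ^+ 2) q i j =
    2 * (grad phi q 0 i * grad phi q 0 j) + 2 * phi q * hess phi q i j.
  rewrite !mxE.
  have d1 := C1_is_derive (delta_mx 0 j) C2phi.1 q0.
  have d2 := C1_is_derive (delta_mx 0 j) (C2phi.2 (delta_mx 0 i)) q0.
  have E : 'D_(delta_mx 0 j) (fun q => 'D_(delta_mx 0 i) (fun q => phi q ^+ 2 : R^o) q : R^o) q =
     'D_(delta_mx 0 j) (fun y => 2 * ((phi y : R^o) * ('D_(delta_mx 0 i) (phi : _ -> R^o) y : R^o)) : R^o) q.
    apply: near_eq_derive; near=> y; rewrite D1 ?mulrA//.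
    by near: y; exact: (open_nbhs_nbhs (conj open_neq0 q0)).
  rewrite E (@derive_val _ _ _ _ _ _ _ (is_deriveZ 2 (is_deriveM d1 d2))).
  exact: key.
rewrite qdE (eq_bigr (fun i => 2 * (\sum_j (grad phi q 0 i * v 0 i) * (grad phi q 0 j * v 0 j))
  + 2 * phi q * \sum_j v 0 i * v 0 j * hess phi q i j)); last first.
  move=> i _; rewrite !mulr_sumr -big_split /=; apply: eq_bigr => j _.
  by rewrite H; lra.
rewrite big_split /= -!mulr_sumr -qdE; congr (2 * _ + _).
rewrite expr2 /dot mulr_suml; apply: eq_bigr => i _.
by rewrite mulr_sumr.
Unshelve. all: by end_near. Qed.

(** A null vector [v] of the Hessian can be made orthogonal to the gradient by subtracting a
    multiple of [q], which is null too. Both terms of [hess_sqr] then vanish, and uniform convexity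
    of the square leaves only the zero vector. *)
Lemma regular_hess_gt0 q v : q != 0 -> (forall c : R, v != c *: q) ->
  0 < qd (hess phi q) v.
Proof.
move=> q0 vq; have pA := regular_hess_psd rphi q0.
have sA := regular_hess_sym rphi q0; have Aq := regular_hess_kernel rphi q0.
rewrite lt_neqAle pA andbT eq_sym; apply/eqP => Av.
have [B AE] := psd_gram sA pA.
have row0 w : qd (hess phi q) w = 0 -> forall i, dot (row i B) w = 0.
  rewrite AE qd_gram => /eqP; rewrite psumr_eq0; last by move=> i _; exact: sqr_ge0.
  by move=> /allP H i; have := H i (mem_index_enum i); rewrite /= sqrf_eq0 => /eqP.
have comb0 (c : R) : qd (hess phi q) (v + c *: q) = 0.
  rewrite AE qd_gram big1// => i _.
  by rewrite dotDr dotZr (row0 _ Av) (row0 _ Aq) mulr0 addr0 expr0n.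
have [_ _ [lam lam0 Hlam]] := rphi.
have absurd w : dot (grad phi q) w = 0 -> qd (hess phi q) w = 0 -> w = 0.
  move=> gw Aw; apply/eqP; rewrite -dot_eq0.
  have := Hlam q w q0; rewrite -/(qd _ _) hess_sqr// gw Aw expr0n !mulr0 addr0.
  by rewrite pmulr_rle0// => h; rewrite eq_le h dot_ge0.
have [g0|g0] := eqVneq (dot (grad phi q) q) 0.
  by move: q0; rewrite (absurd q g0 Aq) eqxx.
pose c := dot (grad phi q) v / dot (grad phi q) q.
have := absurd (v + (- c) *: q); rewrite comb0 dotDr dotZr mulNr divfK// subrr.
move=> /(_ erefl erefl)/eqP; rewrite scaleNr subr_eq0.
by apply/negP; exact: vq.
Qed.

Lemma qd_hess_continuous v q : q != 0 ->
  {for q, continuous (fun q => qd (hess phi q) v)}.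
Proof.
move=> q0; have -> : (fun q => qd (hess phi q) v) = fun q => \sum_i \sum_j v 0 i * v 0 j * hess phi q i j.
  by apply/funext => y; rewrite qdE.
apply: (for_continuous_sum (V := 'rV[R]_n)) => i.
apply: (for_continuous_sum (V := 'rV[R]_n)) => j.
have c1 : {for q, continuous (fun q => hess phi q i j)}.
  have -> : (fun q => hess phi q i j) = fun q =>
      'D_(delta_mx 0 j) (fun q => 'D_(delta_mx 0 i) (phi : _ -> R^o) q : R^o) q.
    by apply/funext => y; rewrite mxE.
  by have [] := C2phi.2 (delta_mx 0 i) _ q0 (delta_mx 0 j).
exact: (continuousM (@cst_continuous _ _ (v 0 i * v 0 j) q) c1).
Qed.

End strict_curvature.

(** * Stability of the profile with respect to the tension *)

Section stability.
Context {R : realType}.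
Implicit Types (p q r t x : R) (g h : R -> R).

Lemma midpoint_le (Q Q1 Q2 : R -> R) p t : 0 <= t ->
  (forall x : R, is_derive x 1 Q (Q1 x)) -> (forall x : R, is_derive x 1 Q1 (Q2 x)) ->
  (forall x, p - t <= x <= p + t -> 0 <= Q2 x) -> 2 * Q p <= Q (p + t) + Q (p - t).
Proof.
move=> t0 dQ dQ1 Q20.
have [|c /andP[c1 c2] E1] := @MVT_fwd R Q Q1 (p - t) p _ (fun x _ => dQ x); first lra.
have [|d /andP[d1 d2] E2] := @MVT_fwd R Q Q1 p (p + t) _ (fun x _ => dQ x); first lra.
have Q1cd : Q1 c <= Q1 d.
  apply: (ler_of_derive (f' := Q2)) => [|x /andP[x1 x2]]; first lra.
  by apply: Q20; apply/andP; split; lra.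
have : Q1 c * t <= Q1 d * t by rewrite ler_wpM2r.
move: E1 E2; have -> : p - (p - t) = t by lra.
rewrite addrBl; lra.
Qed.

Variables (om : R -> R) (L C S B : R).
Hypothesis omL : forall p q, `|om p - om q| <= L * `|p - q|.
Hypothesis omC : forall p, 0 <= om p <= C * (1 + `|p|).

(* g is the tension restricted to the normals (-p e, 1), om the mobility there, and
   h the support function of the translator, up to an affine function. *)
Definition datum g h := exists g1 g2 h1 : R -> R,
  [/\ (forall p : R, is_derive p 1 g (g1 p)) /\
      (forall p : R, is_derive p 1 g1 (g2 p)),
      forall p, 0 < g2 p,
      forall p, 0 <= g p <= S * (1 + `|p|),
      (forall p : R, is_derive p 1 h (h1 p)) /\
      (forall p : R, is_derive p 1 h1 (om p * g2 p)) &
      (forall p, `|h1 p| <= B) /\ h 1 = 0 /\ h (-1) = 0].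

Lemma lipschitz_const_ge0 : 0 <= L.
Proof. by have := omL 1 0; rewrite subr0 normr1 mulr1; exact: le_trans. Qed.

Lemma datum_lipschitz g h p q : datum g h -> `|h p - h q| <= B * `|p - q|.
Proof.
move=> [g1 [g2 [h1 [_ _ _ [dh _] [hB _]]]]].
wlog pq : p q / q <= p => [H|].
  have [/H//|/ltW/H] := leP q p.
  by rewrite distrC [`|q - p|]distrC.
have [c _ ->] := MVT_fwd pq (fun x _ => dh x).
by rewrite normrM ler_wpM2r.
Qed.

(** Closeness of tensions gives no control of their second derivatives, so second differences are
    compared. On [[p - t, p + t]] the mobility differs from [om p] by at most [L t]; convexity of
    [g] and [g'] turns this into the last term. *)
Lemma second_difference_le g h g' h' p t (sg : R) : 0 <= t -> sg = 1 \/ sg = -1 ->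
  datum g h -> datum g' h' ->
  sg * (h (p + t) - h' (p + t) + (h (p - t) - h' (p - t)) - 2 * (h p - h' p)) <=
  sg * om p * (g (p + t) - g' (p + t) + (g (p - t) - g' (p - t)) - 2 * (g p - g' p)) +
  L * t * (g (p + t) + g' (p + t) + (g (p - t) + g' (p - t)) - 2 * (g p + g' p)).
Proof.
move=> t0 sgE [g1 [g2 [h1 [[dg dg1] g20 _ [dh dh1] _]]]].
move=> [k1 [k2 [l1 [[dk dk1] k20 _ [dl dl1] _]]]].
pose Q x := L * t * (g x + g' x) + sg * om p * (g x - g' x) - sg * (h x - h' x).
pose Q1 x := L * t * (g1 x + k1 x) + sg * om p * (g1 x - k1 x) - sg * (h1 x - l1 x).
pose Q2 x := L * t * (g2 x + k2 x) + sg * om p * (g2 x - k2 x) -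
  sg * (om x * g2 x - om x * k2 x).
have dQ (x : R) : is_derive x 1 Q (Q1 x).
  exact: (derB (derD (derZ _ (derD (dg x) (dk x))) (derZ _ (derB (dg x) (dk x)))) (derZ _ (derB (dh x) (dl x)))).
have dQ1 (x : R) : is_derive x 1 Q1 (Q2 x).
  exact: (derB (derD (derZ _ (derD (dg1 x) (dk1 x))) (derZ _ (derB (dg1 x) (dk1 x)))) (derZ _ (derB (dh1 x) (dl1 x)))).
have := midpoint_le t0 dQ dQ1; move=> /(_ p); rewrite /Q => H.
have {}H := H _; suff /H : forall x, p - t <= x <= p + t -> 0 <= Q2 x by lra.
move=> x /andP[x1 x2]; have := omL x p; have xp : `|x - p| <= t.
  by rewrite ler_norml; apply/andP; split; lra.
have := ler_wpM2l lipschitz_const_ge0 xp => h1' h2'.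
have {h1' h2'} : `|om x - om p| <= L * t by exact: le_trans h2' h1'.
rewrite ler_norml => /andP[e1 e2]; rewrite /Q2.
have := g20 x; have := k20 x; move: (g2 x) (k2 x) => a b b0 a0.
have i1 : 0 <= (L * t - (om x - om p)) * a by rewrite mulr_ge0 ?(ltW a0)// subr_ge0.
have i2 : 0 <= (L * t + (om x - om p)) * a by rewrite mulr_ge0 ?(ltW a0)//; lra.
have i3 : 0 <= (L * t - (om x - om p)) * b by rewrite mulr_ge0 ?(ltW b0)// subr_ge0.
have i4 : 0 <= (L * t + (om x - om p)) * b by rewrite mulr_ge0 ?(ltW b0)//; lra.
by case: sgE => ->; lra.
Qed.

(** A discrete maximum principle. [al + be p] interpolates [h - h'] at [P] and [- P]. The terms
    [L t (g + g')] and [K x ^ 2] make second differences of [W] positive, so its maximum over the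
    enlarged interval lies outside [[- P, P]], where the interpolation error is at most [4 B t]. *)
Lemma datum_sign g h g' h' (P t dl sg : R) : 1 <= P -> 0 < t -> t <= 1 -> 0 <= dl ->
  sg = 1 \/ sg = -1 -> datum g h -> datum g' h' ->
  (forall x, `|x| <= P + 1 -> `|g x - g' x| <= dl) ->
  let be := (h P - h' P - (h (- P) - h' (- P))) / (2 * P) in
  let al := (h P - h' P + (h (- P) - h' (- P))) / 2 in
  forall p, `|p| <= P -> sg * (h p - h' p - (al + be * p)) <=
    4 * B * t + L * t * (2 * S * (2 + P)) +
    (2 * (C * (1 + P)) * dl / t ^+ 2 + t) * (P + 1) ^+ 2.
Proof.
move=> P1 t0 t1 dl0 sgE d d' gd be al p pP.
have [g1 [g2 [h1 [[dg dg1] g20 gS [dh dh1] [hB _]]]]] := d.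
have [k1 [k2 [l1 [[dk dk1] k20 kS [dl' dl1] [lB _]]]]] := d'.
have B0 : 0 <= B := le_trans (normr_ge0 _) (hB 0).
have L0 := lipschitz_const_ge0.
(* Chosen so that [2 K t ^ 2] exceeds the error [4 C (1 + P) dl] coming from the tensions. *)
pose K := 2 * (C * (1 + P)) * dl / t ^+ 2 + t.
have CP : 0 <= C * (1 + P).
  by have /andP[w1 w2] := omC P; have := le_trans w1 w2; rewrite ger0_norm//; lra.
have t2 : 0 < t ^+ 2 by rewrite exprn_gt0.
have K0 : 0 < K by rewrite ltr_wpDl// divr_ge0 ?(ltW t2)// mulr_ge0// mulr_ge0.
pose D x := h x - h' x - (al + be * x).
pose W x := sg * D x + L * t * (g x + g' x) + K * (x * x).
have P0 : 0 < P by lra.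
have D_P : D P = 0 by rewrite /D /al /be; field; rewrite gt_eqF.
have D_NP : D (- P) = 0 by rewrite /D /al /be; field; rewrite gt_eqF.
have dD (x : R) : is_derive x 1 D (h1 x - l1 x - be).
  exact: (derB (derB (dh x) (dl' x)) (der_aff al be x)).
have beB : `|be| <= 2 * B.
  have P2 : 0 < 2 * P by rewrite mulr_gt0.
  rewrite /be normrM normfV (gtr0_norm P2) ler_pdivrMr//.
  have := datum_lipschitz P (- P) d; have := datum_lipschitz P (- P) d'.
  rewrite (_ : P - - P = 2 * P) ?(gtr0_norm P2) ?ler_norml; last by lra.
  by move=> /andP[? ?] /andP[? ?]; apply/andP; split; lra.
have D1B x : `|h1 x - l1 x - be| <= 4 * B.
  have := hB x; have := lB x; move: beB; rewrite !ler_norml.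
  by move=> /andP[? ?] /andP[? ?] /andP[? ?]; apply/andP; split; lra.
have DL x y : y <= x -> `|D x - D y| <= 4 * B * (x - y).
  move=> xy; have [c _ ->] := MVT_fwd xy (fun x _ => dD x).
  by rewrite normrM [`|x - y|]ger0_norm ?subr_ge0// ler_wpM2r ?subr_ge0.
have cW : {within `[- P - t, P + t], continuous W}.
  apply: continuous_subspaceT => x.
  have dW : is_derive x 1 W (sg * (h1 x - l1 x - be) + L * t * (g1 x + k1 x) + K * (1 * x + x * 1)).
    exact: (derD (derD (derZ _ (dD x)) (derZ _ (derD (dg x) (dk x)))) (derZ _ (derM (der_id x) (der_id x)))).
  exact: derivable_cont dW.
have [|m] := EVT_max _ cW; first by lra.
rewrite in_itv /= => /andP[m1 m2] mmax.
have mP : P < `|m|.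
  rewrite ltNge; apply/negP => mP; have := mP; rewrite ler_norml => /andP[mP1 mP2].
  have Wp : W (m + t) <= W m by apply: mmax; rewrite in_itv /=; apply/andP; split; lra.
  have Wm : W (m - t) <= W m by apply: mmax; rewrite in_itv /=; apply/andP; split; lra.
  have sgN : - sg = 1 \/ - sg = -1.
    by case: sgE => ->; [right|left; rewrite opprK].
  have := second_difference_le m (ltW t0) sgN d d'.
  have G x : `|x - m| <= t -> `|g x - g' x| <= dl.
    move=> xm; apply: gd; have := ler_normD (x - m) m; rewrite subrK; lra.
  have := G (m + t); rewrite addrBl (ger0_norm (ltW t0)) => /(_ (lexx t)).
  have := G (m - t); rewrite addrBl normrN (ger0_norm (ltW t0)) => /(_ (lexx t)).
  have := G m; rewrite subrr normr0 => /(_ (ltW t0)).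
  rewrite !ler_norml => /andP[a1 a2] /andP[b1 b2] /andP[c1 c2] H.
  pose X := g (m + t) - g' (m + t) + (g (m - t) - g' (m - t)) - 2 * (g m - g' m).
  have /andP[w1 w2] := omC m.
  have w3 : om m <= C * (1 + P).
    apply: le_trans w2 _; have : 0 <= C; last by move=> ?; rewrite ler_wpM2l// lerD2l.
    by move: CP; rewrite pmulr_lge0//; lra.
  have X1 : - sg * om m * X <= C * (1 + P) * (4 * dl).
    have aX : `|X| <= 4 * dl by rewrite ler_norml /X; apply/andP; split; lra.
    apply: le_trans (ler_norm _) _; rewrite !normrM.
    have -> : `|- sg| = 1 by rewrite normrN; case: sgE => ->; rewrite ?normrN normr1.
    by rewrite mul1r (ger0_norm w1); apply: ler_pM.
  have K2 : K * (2 * t ^+ 2) = C * (1 + P) * (4 * dl) + 2 * (t * t ^+ 2).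
    by rewrite /K; field; rewrite gt_eqF.
  have t3 : 0 < t * t ^+ 2 by rewrite mulr_gt0.
  by move: H Wp Wm X1 K2; rewrite /W /D /X; lra.
have Dm : sg * D m <= 4 * B * t.
  apply: (@le_trans _ _ `|D m|).
    by case: sgE => ->; rewrite ?mul1r ?mulN1r; [|rewrite -normrN]; exact: ler_norm.
  move: mP; have [m0|m0] := ger0P m => mP.
    have Pm : P <= m by lra.
    have := DL m P Pm; rewrite D_P subr0 => /le_trans; apply.
    by rewrite ler_wpM2l ?mulr_ge0//; lra.
  have Pm : m <= - P by lra.
  have := DL (- P) m Pm; rewrite D_NP sub0r normrN => /le_trans; apply.
  by rewrite ler_wpM2l ?mulr_ge0//; lra.
have mP2 : `|m| <= P + 1 by rewrite ler_norml; apply/andP; split; lra.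
have Wpm : W p <= W m.
  by apply: mmax; move: pP; rewrite in_itv /= ler_norml => /andP[? ?]; apply/andP; split; lra.
have S0 : 0 <= S.
  by have /andP[s1 s2] := gS 0; have := le_trans s1 s2; rewrite normr0 addr0 mulr1.
have Lt : 0 <= L * t by rewrite mulr_ge0// ltW.
have gm : L * t * (g m + g' m) <= L * t * (2 * S * (2 + P)).
  apply: ler_wpM2l => //; have /andP[_ s1] := gS m; have /andP[_ s2] := kS m.
  have : S * (1 + `|m|) <= S * (2 + P) by apply: ler_wpM2l => //; lra.
  lra.
have gp : 0 <= L * t * (g p + g' p).
  by apply: mulr_ge0 => //; have /andP[s1 _] := gS p; have /andP[s2 _] := kS p; exact: addr_ge0.
have mm : K * (m * m) <= K * (P + 1) ^+ 2.
  apply: ler_wpM2l; first exact: ltW.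
  by rewrite -expr2 -(real_normK (num_real m)) ler_sqr ?nnegrE//; lra.
have pp : 0 <= K * (p * p) by apply: mulr_ge0; [exact: ltW|rewrite -expr2 sqr_ge0].
by move: Wpm Dm gm gp mm pp; rewrite /W -/K /D; lra.
Qed.

End stability.

(** * The limit profile and its properties *)

Section limit_profile.
Context {R : realType}.
Implicit Types (p q r t x : R) (g h : R -> R).
Variables (om : R -> R) (L C S B : R).
Hypothesis omL : forall p q, `|om p - om q| <= L * `|p - q|.
Hypothesis omC : forall p, 0 <= om p <= C * (1 + `|p|).
Hypothesis om_gt0 : forall p, 0 < om p.
Hypothesis C0 : 0 <= C.
Hypothesis S0 : 0 <= S.
Hypothesis B0 : 0 <= B.

Local Notation datum := (datum om S B).

(** First [t] makes the terms of order [t] small, then [dl] is small compared with [t ^ 2]. The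
    normalization at 1 and -1 finally controls the interpolating affine function. *)
Lemma stability (P e : R) : 1 <= P -> 0 < e -> exists2 dl : R, 0 < dl &
  forall g h g' h', datum g h -> datum g' h' ->
  (forall x, `|x| <= P + 1 -> `|g x - g' x| <= dl) ->
  forall p, `|p| <= P -> `|h p - h' p| <= e.
Proof.
move=> P1 e0; have P0 : 0 < P by lra.
have L0 := lipschitz_const_ge0 omL.
pose f := e / (2 * (2 + P)); have P2 : 0 < 2 + P by lra.
have f0 : 0 < f by rewrite divr_gt0// mulr_gt0.
have fe : 2 * f * (2 + P) = e by rewrite /f; field; rewrite gt_eqF.
pose K := 4 * B + L * (2 * S * (2 + P)) + (P + 1) ^+ 2.
have K0 : 0 <= K.
  have h1 : 0 <= 2 * S * (2 + P) by rewrite mulr_ge0 ?(ltW P2)// mulr_ge0.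
  by apply: addr_ge0 (sqr_ge0 _); apply: addr_ge0; apply: mulr_ge0.
pose t := Num.min 1 (f / (K + 1)).
have K1 : 0 < K + 1 by lra.
have t0 : 0 < t by rewrite lt_min ltr01 divr_gt0.
have t1 : t <= 1 by rewrite ge_min lexx.
have tK : t * (K + 1) <= f by rewrite -ler_pdivlMr// ge_min lexx orbT.
pose A := 2 * (C * (1 + P)) * (P + 1) ^+ 2.
have A0 : 0 <= A.
  by rewrite mulr_ge0 ?sqr_ge0// mulr_ge0// mulr_ge0//; lra.
have A1 : 0 < A + 1 by lra.
have t2 : 0 < t ^+ 2 by rewrite exprn_gt0.
pose dl := f * t ^+ 2 / (A + 1).
have dl0 : 0 < dl by rewrite divr_gt0// mulr_gt0.
exists dl => // g h g' h' d d' gd.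
pose be := (h P - h' P - (h (- P) - h' (- P))) / (2 * P).
pose al := (h P - h' P + (h (- P) - h' (- P))) / 2.
have Err : 4 * B * t + L * t * (2 * S * (2 + P)) +
    (2 * (C * (1 + P)) * dl / t ^+ 2 + t) * (P + 1) ^+ 2 <= 2 * f.
  have -> : 4 * B * t + L * t * (2 * S * (2 + P)) +
    (2 * (C * (1 + P)) * dl / t ^+ 2 + t) * (P + 1) ^+ 2 = t * K + A * (dl / t ^+ 2).
    by rewrite /K /A; lra.
  have -> : dl / t ^+ 2 = f / (A + 1) by rewrite /dl; field; rewrite !gt_eqF.
  have : A * (f / (A + 1)) <= f.
    by rewrite mulrA ler_pdivrMr// mulrC ler_pM2l// lerDl.
  by move: tK t0; lra.
have D p : `|p| <= P -> `|h p - h' p - (al + be * p)| <= 2 * f.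
  move=> pP; have D1 := datum_sign omL omC P1 t0 t1 (ltW dl0) (or_introl erefl) d d' gd pP.
  have D2 := datum_sign omL omC P1 t0 t1 (ltW dl0) (or_intror erefl) d d' gd pP.
  have {}D1 := le_trans D1 Err; have {}D2 := le_trans D2 Err.
  rewrite ler_norml; move: D1 D2; rewrite -/al -/be mul1r mulN1r.
  by move=> ? ?; apply/andP; split; lra.
have [h1 hN1] : h 1 = 0 /\ h (-1) = 0 by have [? [? [? [_ _ _ _ [_ ?]]]]] := d.
have [h'1 h'N1] : h' 1 = 0 /\ h' (-1) = 0 by have [? [? [? [_ _ _ _ [_ ?]]]]] := d'.
have := D 1; have := D (-1); rewrite normrN normr1 h1 hN1 h'1 h'N1 => /(_ P1) E1 /(_ P1) E2.
move=> p pP; have E3 := D p pP; rewrite -fe.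
move: E1 E2 E3 pP; rewrite !ler_norml => /andP[a1 a2] /andP[b1 b2] /andP[c1 c2] /andP[p1 p2].
have i1 : 0 <= (2 * f - (al + be)) * (P + p) by rewrite mulr_ge0//; lra.
have i2 : 0 <= (2 * f + (al + be)) * (P + p) by rewrite mulr_ge0//; lra.
have i3 : 0 <= (2 * f - (al - be)) * (P - p) by rewrite mulr_ge0//; lra.
have i4 : 0 <= (2 * f + (al - be)) * (P - p) by rewrite mulr_ge0//; lra.
have i5 : 0 <= (P - 1) * (2 * f - (al + be)) by rewrite mulr_ge0//; lra.
have i6 : 0 <= (P - 1) * (2 * f + (al + be)) by rewrite mulr_ge0//; lra.
have i7 : 0 <= (P - 1) * (2 * f - (al - be)) by rewrite mulr_ge0//; lra.
have i8 : 0 <= (P - 1) * (2 * f + (al - be)) by rewrite mulr_ge0//; lra.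
have bP : `|be * p| <= 2 * f * P.
  rewrite normrM; apply: ler_pM => //; first by rewrite ler_norml; apply/andP; split; lra.
  by rewrite ler_norml p1.
have aB : `|al| <= 2 * f by rewrite ler_norml; apply/andP; split; lra.
move: bP aB; rewrite !ler_norml => /andP[? ?] /andP[? ?].
by apply/andP; split; lra.
Qed.

Definition convex3 (h : R -> R) := forall p q r, p <= q -> q <= r ->
  (h q - h p) * (r - q) <= (h r - h q) * (q - p).

Lemma convex3_derive (h h1 h2 : R -> R) : (forall x : R, is_derive x 1 h (h1 x)) ->
  (forall x : R, is_derive x 1 h1 (h2 x)) -> (forall x, 0 <= h2 x) -> convex3 h.
Proof.
move=> dh dh1 h20 p q r pq qr.
have [c /andP[pc cq] ->] := MVT_fwd pq (fun x _ => dh x).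
have [d /andP[qd dr] ->] := MVT_fwd qr (fun x _ => dh x).
rewrite mulrAC; apply: ler_wpM2r; first by rewrite subr_ge0.
apply: ler_wpM2r; first by rewrite subr_ge0.
by apply: (ler_of_derive (f' := h2)) => [|x _]; [exact: le_trans qd|].
Qed.

Lemma datum_convex g h : datum g h -> convex3 h.
Proof.
move=> [g1 [g2 [h1 [_ g20 _ [dh dh1] _]]]]; apply: convex3_derive dh dh1 _ => x.
by rewrite mulr_ge0 ?(ltW (g20 x)) ?(ltW (om_gt0 x)).
Qed.

Variables (gk hk : nat -> R -> R) (g : R -> R).
Hypothesis dk : forall k, datum (gk k) (hk k).
Hypothesis gkg : forall P e : R, 0 < e -> exists K, forall k, (K <= k)%N ->
  forall x, `|x| <= P -> `|gk k x - g x| <= e.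

(** A lower limit, as the supremum of the eventual lower bounds; by [stability] the sequence
    converges locally uniformly. *)
Definition hhat p := sup [set y | exists K, forall k, (K <= k)%N -> y <= hk k p].

(** The limit is independent of the approximating sequence, so that one translator serves all
    sequences of regular norms. *)
Lemma hhat_close (P e : R) : 1 <= P -> 0 < e -> exists2 dl : R, 0 < dl &
  forall g' h', datum g' h' -> (forall x, `|x| <= P + 1 -> `|g' x - g x| <= dl) ->
  forall p, `|p| <= P -> `|h' p - hhat p| <= e.
Proof.
move=> P1 e0; have [dl dl0 H] := stability P1 e0.
have dl2 : 0 < dl / 2 by lra.
exists (dl / 2) => // g' h' d' g'g p pP.
have [K HK] := gkg (P + 1) dl2.
have near k : (K <= k)%N -> `|h' p - hk k p| <= e.
  move=> Kk; apply: (H g' h' (gk k) (hk k)) => // x xP.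
  have := g'g x xP; have := HK k Kk x xP; rewrite !ler_norml.
  by move=> /andP[? ?] /andP[? ?]; apply/andP; split; lra.
have ub y : (exists K, forall k, (K <= k)%N -> y <= hk k p) -> y <= h' p + e.
  move=> [K' HK']; have := HK' (maxn K K') (leq_maxr _ _).
  have := near (maxn K K') (leq_maxl _ _); rewrite ler_norml => /andP[? ?]; lra.
have low : exists K, forall k, (K <= k)%N -> h' p - e <= hk k p.
  by exists K => k /near; rewrite ler_norml => /andP[? ?]; lra.
rewrite ler_norml; apply/andP; split.
  have : hhat p <= h' p + e by apply: ge_sup => [|y /ub//]; exists (h' p - e).
  lra.
have : h' p - e <= hhat p.
  by apply: ub_le_sup => //; exists (h' p + e) => y /ub.
lra.
Qed.

Lemma hhat_approx (P e : R) : 1 <= P -> 0 < e -> exists k, forall p, `|p| <= P ->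
  `|hk k p - hhat p| <= e /\ `|gk k p - g p| <= e.
Proof.
move=> P1 e0; have [dl dl0 H] := hhat_close P1 e0.
have m0 : 0 < Num.min dl e by rewrite lt_min dl0.
have [K HK] := gkg (P + 1) m0; exists K => p pP.
have G x : `|x| <= P + 1 -> `|gk K x - g x| <= Num.min dl e by exact: HK.
split; last by apply: le_trans (G p _) _; [lra|rewrite ge_min lexx orbT].
apply: (H (gk K) (hk K)) => // x xP.
by apply: le_trans (G x xP) _; rewrite ge_min lexx.
Qed.

Lemma hhat_lipschitz p q : `|hhat p - hhat q| <= B * `|p - q|.
Proof.
apply/ler_addgt0Pr => e e0; have e2 : 0 < e / 2 by lra.
have P1 : 1 <= 1 + `|p| + `|q| by have := normr_ge0 p; have := normr_ge0 q; lra.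
have [k H] := hhat_approx P1 e2.
have [] := H p _; first by have := normr_ge0 q; lra.
have [] := H q _; first by have := normr_ge0 p; lra.
have := datum_lipschitz p q (dk k); rewrite !ler_norml.
by move=> /andP[? ?] /andP[? ?] _ /andP[? ?] _; apply/andP; split; lra.
Qed.

Lemma hhat_convex : convex3 hhat.
Proof.
move=> p q r pq qr; apply/ler_addgt0Pr => e e0.
pose M := 2 * (r - p) + 1; have M0 : 0 < M by rewrite /M; lra.
have eM : 0 < e / M by exact: divr_gt0.
pose P := 1 + `|p| + `|q| + `|r|.
have np := normr_ge0 p; have nq := normr_ge0 q; have nr := normr_ge0 r.
have P1 : 1 <= P by rewrite /P; lra.
have [k H] := hhat_approx P1 eM.
have [] := H p _; first by rewrite /P; lra.
have [] := H q _; first by rewrite /P; lra.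
have [] := H r _; first by rewrite /P; lra.
have := datum_convex (dk k) pq qr; rewrite !ler_norml.
set f := e / M in eM *; have fM : e = f * M by rewrite /f divfK// gt_eqF.
move: (hk k) (hhat) => u v H0 /andP[a1 a2] _ /andP[b1 b2] _ /andP[c1 c2] _.
have rq : 0 <= r - q by lra. have qp : 0 <= q - p by lra.
have i1 : 0 <= (u q - v q + f) * (r - q) by rewrite mulr_ge0//; lra.
have i2 : 0 <= (f - (u p - v p)) * (r - q) by rewrite mulr_ge0//; lra.
have i3 : 0 <= (u q - v q + f) * (q - p) by rewrite mulr_ge0//; lra.
have i4 : 0 <= (f - (u r - v r)) * (q - p) by rewrite mulr_ge0//; lra.
by rewrite fM /M; move: i1 i2 i3 i4 H0; lra.
Qed.

(** With [mu] the minimum of the mobility on [[- P, P]], each [hk - mu gk] is convex there, so the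
    strict midpoint inequality of [g] is inherited. *)
Lemma hhat_nonaffine P : 1 <= P -> 2 * g 0 < g P + g (- P) ->
  2 * hhat 0 < hhat P + hhat (- P).
Proof.
move=> P1 gP; have P0 : 0 <= P by lra.
have com : {within `[- P, P], continuous om}.
  apply: continuous_subspaceT => x; apply/(@cont_normP R R^o) => e e0.
  have L0 := lipschitz_const_ge0 omL; have L1 : 0 < L + 1 by lra.
  exists (e / (L + 1)) => [|y yx]; first by rewrite divr_gt0.
  apply: le_lt_trans (omL y x) _; have := yx; rewrite ltr_pdivlMr// => h.
  by apply: le_lt_trans h; rewrite mulrC ler_wpM2l// lerDl.
have [|m _ mmin] := EVT_min _ com; first by lra.
have m0 := om_gt0 m; set mu := om m in mmin m0.
pose G := g P + g (- P) - 2 * g 0; have G0 : 0 < G by rewrite subr_gt0.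
pose e := Num.min (G / 8) (mu * G / 16).
have e0 : 0 < e by rewrite lt_min !divr_gt0// mulr_gt0.
have e1 : e <= G / 8 by rewrite ge_min lexx.
have e2 : e <= mu * G / 16 by rewrite ge_min lexx orbT.
have [k H] := hhat_approx P1 e0.
have [] := H P _; first by rewrite ger0_norm.
have [] := H (- P) _; first by rewrite normrN ger0_norm.
have [] := H 0 _; first by rewrite normr0.
have [g1 [g2 [h1 [[dg dg1] g20 _ [dh dh1] _]]]] := dk k.
have := @midpoint_le R (fun x => hk k x - mu * gk k x) (fun x => h1 x - mu * g1 x)
  (fun x => om x * g2 x - mu * g2 x) 0 P P0.
rewrite !add0r => H1 a0 b0 aN bN a1 b1.
have {}H1 : 2 * (hk k 0 - mu * gk k 0) <=
    hk k P - mu * gk k P + (hk k (- P) - mu * gk k (- P)).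
  apply: H1 => x xP; rewrite -mulrBl mulr_ge0 ?(ltW (g20 x))// subr_ge0.
  by apply: mmin; rewrite in_itv.
have : mu * (G / 2) <= mu * (gk k P + gk k (- P) - 2 * gk k 0).
  rewrite ler_wpM2l ?(ltW m0)//; move: b0 bN b1; rewrite !ler_norml /G.
  by move=> /andP[? ?] /andP[? ?] /andP[? ?]; move: e1; rewrite /G; lra.
move: a0 aN a1; rewrite !ler_norml => /andP[? ?] /andP[? ?] /andP[? ?].
have := mulr_gt0 m0 G0; move: H1 e2; lra.
Qed.

End limit_profile.

(** * Tension and mobility along the normals of slope [p] *)

Section profile_of_norm.
Context {R : realType} {n : nat} (phi psi : 'rV[R]_n -> R) (E Z : 'rV[R]_n).
Hypothesis rphi : regular_norm phi.
Hypothesis hpsi : is_norm psi.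
Hypothesis EE : dot E E = 1.
Hypothesis ZZ : dot Z Z = 1.
Hypothesis EZ : dot E Z = 0.
Implicit Types (p q x : R).

Let hphi : is_norm phi. Proof. by have [] := rphi. Qed.
Let C2phi : is_C2 [set p : 'rV[R]_n | p != 0] (phi : _ -> R^o).
Proof. by have [] := rphi. Qed.

Local Notation nrm := (nrm E Z).

Lemma nrm_bound (f : 'rV[R]_n -> R) p : is_norm f -> f (nrm p) <= f Z + `|p| * f E.
Proof.
move=> hf; apply: le_trans (norm_triangle hf _ _) _.
by rewrite lerD2l -scaleNr normZ// normrN.
Qed.

Lemma nrm_coercive (f : 'rV[R]_n -> R) p : is_norm f -> `|p| * f E - f Z <= f (nrm p).
Proof.
move=> hf; rewrite lerBlDr -normZ// addrC.
have -> : p *: E = Z - nrm p by rewrite /nrm opprB addrC subrK.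
by apply: le_trans (norm_triangle hf _ _) _; rewrite (norm_opp hf).
Qed.

Lemma nrm_lipschitz (f : 'rV[R]_n -> R) p q : is_norm f ->
  `|f (nrm p) - f (nrm q)| <= f E * `|p - q|.
Proof.
move=> hf; apply: le_trans (norm_dist hf _ _) _.
have -> : nrm p - nrm q = (q - p) *: E.
  by rewrite /nrm opprB addrC addrA subrK scalerBl.
by rewrite normZ// mulrC distrC.
Qed.

Definition tension p : R := phi (nrm p).
Definition mobility p : R := psi (nrm p).
Definition tension1 p : R := dot (grad phi (nrm p)) (- E).
Definition tension2 p : R := qd (hess phi (nrm p)) E.

Lemma nrmE p : nrm p = Z + p *: (- E). Proof. by rewrite /nrm scalerN. Qed.

Lemma tension_derive p : is_derive p 1 tension (tension1 p).
Proof.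
have := @C2_line1 _ _ _ phi Z (- E) p (open_neq0 (n := n)) C2phi.
rewrite -nrmE /tension1 => /(_ (nrm_neq0 ZZ EZ p)).
by congr (is_derive _ _ _ _); apply/funext => x; rewrite /tension nrmE.
Qed.

Lemma tension_derive2 p : is_derive p 1 tension1 (tension2 p).
Proof.
have := @C2_line2 _ _ _ phi Z (- E) p (open_neq0 (n := n)) C2phi.
rewrite -nrmE => /(_ (nrm_neq0 ZZ EZ p)).
have -> : qd (hess phi (nrm p)) (- E) = tension2 p.
  by rewrite -scaleN1r qdZv sqrrN expr1n mul1r.
by congr (is_derive _ _ _ _); apply/funext => x; rewrite /tension1 nrmE.
Qed.

Lemma tension2_gt0 p : 0 < tension2 p.
Proof.
apply: (regular_hess_gt0 rphi (nrm_neq0 ZZ EZ p)) => c; apply/eqP => H.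
have := congr1 (dot Z) H; have := congr1 (dot E) H.
rewrite /nrm !dotZr !dotBr !dotZr EE ZZ EZ (dotC Z) EZ mulr0 mulr1 subr0 mulr1.
move=> H1 c0; move: H1; rewrite -c0 mul0r => /eqP; rewrite oner_eq0.
exact/negP.
Qed.

Lemma mobility_gt0 p : 0 < mobility p.
Proof. exact: (norm_gt0 hpsi (nrm_neq0 ZZ EZ p)). Qed.

Lemma curvatureE p : curvature phi psi E Z p = mobility p * tension2 p.
Proof. by []. Qed.

Lemma curvature_gt0 p : 0 < curvature phi psi E Z p.
Proof. by rewrite curvatureE mulr_gt0 ?mobility_gt0 ?tension2_gt0. Qed.

Lemma curvature_continuous : continuous (curvature phi psi E Z).
Proof.
move=> p; have c1 : {for p, continuous mobility}.
  apply/(@cont_normP R R^o) => e e0; have L1 : 0 < psi E + 1.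
    by rewrite ltr_wpDl// (norm_ge0 hpsi).
  exists (e / (psi E + 1)) => [|y yx]; first by rewrite divr_gt0.
  apply: le_lt_trans (nrm_lipschitz y p hpsi) _; have := yx; rewrite ltr_pdivlMr// => h.
  by apply: le_lt_trans h; rewrite mulrC ler_wpM2l// lerDl.
have c2 : {for p, continuous tension2}.
  have := qd_hess_continuous rphi (v := E) (nrm_neq0 ZZ EZ p).
  move=> /(@cont_normP R 'rV[R]_n) H; apply/(@cont_normP R R^o) => e e0.
  have [r r0 Hr] := H e e0; exists (r / (`|E| + 1)) => [|y yp].
    by rewrite divr_gt0// ltr_wpDl.
  apply: Hr; have -> : nrm y - nrm p = (p - y) *: E.
    by rewrite /nrm opprB addrC addrA subrK scalerBl.
  by apply: small_scale; rewrite // distrC.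
exact: (continuousM c1 c2).
Qed.

Variable S : R.
Hypothesis SE : phi E <= S.
Hypothesis SZ : phi Z <= S.
Let C := psi E + psi Z.

Lemma mobility_bounds p : 0 <= mobility p <= C * (1 + `|p|).
Proof.
rewrite (norm_ge0 hpsi) /=; apply: le_trans (nrm_bound p hpsi) _; rewrite /C.
have := mulr_ge0 (normr_ge0 p) (norm_ge0 hpsi Z); have := norm_ge0 hpsi E; lra.
Qed.

Lemma tension_bounds p : 0 <= tension p <= S * (1 + `|p|).
Proof.
rewrite (norm_ge0 hphi) /=; apply: le_trans (nrm_bound p hphi) _.
have := ler_wpM2l (normr_ge0 p) SE; move: SZ; lra.
Qed.

Lemma tension1_bound p : `|tension1 p| <= phi E.
Proof.
have T := tangent_le tension_derive tension_derive2 tension2_gt0 p.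
have := T (p + 1); have := T (p - 1).
have := nrm_lipschitz (p + 1) p hphi; have := nrm_lipschitz (p - 1) p hphi.
rewrite -!/(tension _) !addrBl normrN normr1 mulr1 !ler_norml.
by move=> /andP[? ?] /andP[? ?] ? ?; apply/andP; split; lra.
Qed.

(** The point is the bound on [h']. Since the mobility is at most [C (1 + |p|)], on the right half
    line [h'] grows no more than [C ((1 + p) g' - g)], which is bounded because [g] stays at bounded
    distance from a line. Each half line contributes [4 C S], and [h'] vanishes between -1 and 1. *)
Lemma datum_exists : exists h, datum mobility S (8 * C * S) tension h.
Proof.
have C0 : 0 <= C by rewrite addr_ge0// (norm_ge0 hpsi).
have [F F0 dF] := antiderivative curvature_continuous.
have cF : continuous F by move=> x; exact: derivable_cont (dF x).
have [H H0 dH] := antiderivative cF.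
pose al := (H 1 + H (-1)) / 2; pose be := (H 1 - H (-1)) / 2.
pose h x := H x - (al + be * x); pose h1 x := F x - be.
have dh (x : R) : is_derive x 1 h (h1 x) by exact: (derB (dH x) (der_aff al be x)).
have dh1 (x : R) : is_derive x 1 h1 (mobility x * tension2 x).
  by apply: der_eq (derB (dF x) (der_cst be x)) _; rewrite subr0.
have h_1 : h 1 = 0 by rewrite /h /al /be; lra.
have h_N1 : h (-1) = 0 by rewrite /h /al /be; lra.
have g2p x : 0 <= tension2 x := ltW (tension2_gt0 x).
have incr x y : x <= y -> h1 x <= h1 y.
  move=> xy; apply: (ler_of_derive (f' := fun x => mobility x * tension2 x)) => // z _.
  by rewrite mulr_ge0 ?(ltW (mobility_gt0 z)).
have right x : 0 <= x -> h1 x - h1 0 <= 4 * C * S.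
  move=> x0; pose Y y := C * ((1 + y) * tension1 y - tension y) - h1 y.
  have dY (y : R) : is_derive y 1 Y (C * ((1 + y) * tension2 y) - mobility y * tension2 y).
    apply: der_eq (derB (derZ C (derB (derM (derD (der_cst 1 y) (der_id y))
      (tension_derive2 y)) (tension_derive y))) (dh1 y)) _; lra.
  have : Y 0 <= Y x.
    apply: (ler_of_derive (f' := fun y => C * ((1 + y) * tension2 y) - mobility y * tension2 y)) => // y.
    move=> /andP[y0 _]; have /andP[_] := mobility_bounds y; rewrite (ger0_norm y0) => m1.
    by rewrite subr_ge0 mulrA ler_wpM2r.
  rewrite /Y addr0 mul1r.
  have := tension1_bound x; have := tension1_bound 0; rewrite !ler_norml.
  move=> /andP[a1 a2] /andP[b1 b2].
  have := nrm_coercive x hphi; rewrite -/(tension x) (ger0_norm x0) => c1.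
  have := nrm_bound 0 hphi; rewrite -/(tension 0) normr0 mul0r addr0 => c2.
  have b3 : (1 + x) * tension1 x <= (1 + x) * phi E by rewrite ler_wpM2l//; lra.
  have : C * ((1 + x) * tension1 x - tension x - (tension1 0 - tension 0)) <= C * (4 * S).
    by rewrite ler_wpM2l//; move: SE SZ; lra.
  lra.
have left x : x <= 0 -> h1 0 - h1 x <= 4 * C * S.
  move=> x0; pose Y y := C * ((1 - y) * tension1 y + tension y) - h1 y.
  have dY (y : R) : is_derive y 1 Y (C * ((1 - y) * tension2 y) - mobility y * tension2 y).
    apply: der_eq (derB (derZ C (derD (derM (derB (der_cst 1 y) (der_id y))
      (tension_derive2 y)) (tension_derive y))) (dh1 y)) _; lra.
  have : Y x <= Y 0.
    apply: (ler_of_derive (f' := fun y => C * ((1 - y) * tension2 y) - mobility y * tension2 y)) => // y.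
    move=> /andP[_ y0]; have /andP[_] := mobility_bounds y; rewrite (ler0_norm y0) => m1.
    by rewrite subr_ge0 mulrA ler_wpM2r.
  rewrite /Y subr0 mul1r.
  have := tension1_bound x; have := tension1_bound 0; rewrite !ler_norml.
  move=> /andP[a1 a2] /andP[b1 b2].
  have := nrm_coercive x hphi; rewrite -/(tension x) (ler0_norm x0) => c1.
  have := nrm_bound 0 hphi; rewrite -/(tension 0) normr0 mul0r addr0 => c2.
  have b3 : (1 - x) * (- phi E) <= (1 - x) * tension1 x by rewrite ler_wpM2l//; lra.
  have : C * (tension1 0 + tension 0 - ((1 - x) * tension1 x + tension x)) <= C * (4 * S).
    by rewrite ler_wpM2l//; move: SE SZ; lra.
  lra.
have near0 x : `|h1 x - h1 0| <= 4 * C * S.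
  have CS : 0 <= 4 * C * S.
    by have := right 0 (lexx 0); rewrite subrr.
  have [x0|/ltW x0] := leP 0 x.
    by rewrite ger0_norm ?right// subr_ge0 incr.
  by rewrite distrC ger0_norm ?left// subr_ge0 incr.
exists h, tension1, tension2, h1; split=> //.
- by split=> p; [exact: tension_derive|exact: tension_derive2].
- exact: tension2_gt0.
- exact: tension_bounds.
split=> // p; have [|c _] := @MVT_fwd R h h1 (-1) 1 _ (fun x _ => dh x); first lra.
rewrite h_1 h_N1 subrr => /esym/eqP; rewrite mulf_eq0 => /orP[/eqP c0|]; last first.
  by rewrite opprK -natr1 (_ : 1 + 1 = 2)// pnatr_eq0.
have := near0 p; have := near0 c; rewrite c0 !ler_norml.
by move=> /andP[? ?] /andP[? ?]; apply/andP; split; lra.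
Qed.

End profile_of_norm.

(** * Damped profiles on a half line *)

Section one_sided_approximation.
Context {R : realType}.
Implicit Types (p q r x : R) (h g u v : R -> R).

(** [sg] is the slope at infinity, obtained as the supremum of unit increments. *)
Lemma convex3_last_slope h (B e : R) : convex3 h ->
  (forall p q, `|h p - h q| <= B * `|p - q|) -> 0 < e ->
  exists sg Q : R, 1 <= Q /\ forall P, Q <= P ->
    sg - e <= h P - h (P - 1) /\ forall p, P <= p -> h p <= h P + sg * (p - P).
Proof.
move=> ch hB e0; pose A := [set h (q + 1) - h q | q in [set: R]].
have hA : has_sup A.
  split; first by exists (h (0 + 1) - h 0), 0.
  exists B => _ [q _ <-]; have := hB (q + 1) q.
  by rewrite addrBl normr1 mulr1; apply: le_trans; exact: ler_norm.
have [_ [q _ <-] qs] := sup_adherent e0 hA.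
exists (sup A), (Num.max 1 (q + 2)); split; first by rewrite le_max lexx.
move=> P; rewrite ge_max => /andP[P1 Pq]; split=> [|p Pp].
  have q1 : q <= q + 1 by lra.
  have q2 : q + 1 <= P by lra.
  have q3 : q + 1 <= P - 1 by lra.
  have q4 : P - 1 <= P by lra.
  have := ch _ _ _ q1 q2; have := ch _ _ _ q3 q4.
  set D := h P - h (P - 1); set a := h (q + 1) - h q => i1 i2.
  have : a * (P - q - 1) <= D * (P - q - 1) by move: i1 i2; rewrite /D /a; lra.
  by rewrite ler_pM2r; move: qs; rewrite -/a; lra.
have p1 : p <= p + 1 by lra.
have := ch _ _ _ Pp p1; rewrite addrBl mulr1 => i1.
have : h (p + 1) - h p <= sup A by apply: sup_upper_bound => //; exists p.
by move=> /(ler_wpM2r (_ : 0 <= p - P)); rewrite subr_ge0 => /(_ Pp); lra.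
Qed.

(** The chord of [g] from 0 to [P - 1] has slope at least [s - 2 z / (P - 1)], and by convexity the
    next unit increment is at least as large. *)
Lemma norm_last_slope g (s z e : R) : convex3 g -> 0 <= z -> 0 < e -> g 0 <= z ->
  (forall p, 0 <= p -> p * s - z <= g p) ->
  exists2 Q : R, 1 <= Q & forall P, Q <= P -> s - (g P - g (P - 1)) <= e.
Proof.
move=> cg z0 e0 g0 gs; exists (2 + 2 * z / e).
  by rewrite ler_wpDr ?divr_ge0 ?mulr_ge0 ?(ltW e0)//; lra.
move=> P QP; have ze : 0 <= 2 * z / e by rewrite divr_ge0 ?mulr_ge0// ltW.
have P1 : 0 <= P - 1 by lra. have P2 : P - 1 <= P by lra.
have := cg _ _ _ P1 P2; have := gs (P - 1) P1.
have -> : P - (P - 1) = 1 by lra.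
rewrite mulr1 subr0 => i1 i2.
have i3 : 2 * z <= e * (P - 1).
  have -> : 2 * z = e * (2 * z / e) by field; rewrite gt_eqF.
  by rewrite ler_pM2l//; lra.
have P3 : 0 < P - 1 by lra.
by rewrite -(ler_pM2r P3); lra.
Qed.

(** [u] is the undamped profile, known to be close to [h] on [[0, P2 + 1]] only. Up to [P1] the
    weight is nearly 1. Beyond [P2] the damped second derivative is at most [2 C / eta] times [g''],
    and the slope of [g] gains so little that the slope of [v] gains at most [e]. Below: at [P1] the
    slope of [v] is within [4 e] of the last slope [sg] of [h]. Above: [v <= u] up to [P2 + 1], and
    then the bound on the tail. *)
Lemma approx_right h (om g g1 g2 u u1 v v1 : R -> R) (B C eta e P1 P2 sg s : R) :
  0 <= B -> 0 <= C -> 0 < eta -> 0 < e -> 1 <= P1 -> P1 <= P2 -> convex3 h ->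
  (forall p, P1 <= p -> h p <= h P1 + sg * (p - P1)) ->
  sg - e <= h P1 - h (P1 - 1) ->
  (forall p, 0 <= om p <= C * (1 + `|p|)) ->
  (forall p : R, is_derive p 1 g (g1 p)) -> (forall p : R, is_derive p 1 g1 (g2 p)) ->
  (forall p, 0 <= g2 p) -> (forall p q, `|g p - g q| <= s * `|p - q|) ->
  (forall p : R, is_derive p 1 u (u1 p)) ->
  (forall p : R, is_derive p 1 u1 (om p * g2 p)) -> (forall p, `|u1 p| <= B) ->
  (forall p : R, is_derive p 1 v (v1 p)) ->
  (forall p : R, is_derive p 1 v1 (om p * g2 p / (1 + eta * rho p))) ->
  v 0 = u 0 -> v1 0 = u1 0 -> eta * (1 + P1) * (2 * B) * P1 <= e ->
  s - (g P2 - g (P2 - 1)) <= e * eta / (2 * C + 1) ->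
  (forall p, 0 <= p -> p <= P2 + 1 -> `|u p - h p| <= e) ->
  forall p, 0 <= p -> `|v p - h p| <= 5 * e * (1 + p).
Proof.
move=> B0 C0 eta0 e0 P11 P12 ch hsg sge omC dg dg1 g20 gs du du1 uB dv dv1 v0 v10 K1 K2 uh.
have w0 p : 0 < 1 + eta * rho p by rewrite ltr_wpDr// mulr_ge0 ?ltW ?rho_gt0.
have og p : 0 <= om p * g2 p by have /andP[? _] := omC p; rewrite mulr_ge0.
have og' p : 0 <= om p * g2 p / (1 + eta * rho p) by rewrite divr_ge0// ltW.
have u1i x y : x <= y -> u1 x <= u1 y.
  by move=> xy; apply: (ler_of_derive (f' := fun p => om p * g2 p)).
have v1i x y : x <= y -> v1 x <= v1 y.
  by move=> xy; apply: (ler_of_derive (f' := fun p => om p * g2 p / (1 + eta * rho p))).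
have g1i x y : x <= y -> g1 x <= g1 y.
  by move=> xy; apply: (ler_of_derive (f' := g2)).
have duv (p : R) : is_derive p 1 (fun p => u p - v p) (u1 p - v1 p) by exact: derB.
have duv1 (p : R) : is_derive p 1 (fun p => u1 p - v1 p)
  (om p * g2 p - om p * g2 p / (1 + eta * rho p)) by exact: derB.
have og2 p : 0 <= om p * g2 p - om p * g2 p / (1 + eta * rho p).
  rewrite subr_ge0 ler_pdivrMr// ler_peMr// lerDl mulr_ge0 ?ltW ?rho_gt0//.
have uv1 p : 0 <= p -> v1 p <= u1 p.
  move=> p0; have : u1 0 - v1 0 <= u1 p - v1 p.
    by apply: (ler_of_derive (f := fun p => u1 p - v1 p)
      (f' := fun p => om p * g2 p - om p * g2 p / (1 + eta * rho p))).
  by rewrite v10; lra.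
have uv p : 0 <= p -> v p <= u p.
  move=> p0; have : u 0 - v 0 <= u p - v p.
    apply: (ler_of_derive (f := fun p => u p - v p) (f' := fun p => u1 p - v1 p)) => // x /andP[x0 _].
    by rewrite subr_ge0 uv1.
  by rewrite v0; lra.
have P10 : 0 < P1 by lra.
pose tau := eta * (1 + P1) * (2 * B).
have tau0 : 0 <= tau by rewrite mulr_ge0 ?mulr_ge0 ?(ltW eta0)//; lra.
have tauP : tau * P1 <= e by [].
have taue : tau <= e by have := ler_wpM2l tau0 P11; lra.
have small p : 0 <= p -> p <= P1 -> u1 p - v1 p <= tau.
  move=> p0 pP; pose Y x := eta * (1 + P1) * u1 x - (u1 x - v1 x).
  have dY (x : R) : is_derive x 1 Y (eta * (1 + P1) * (om x * g2 x) -
      (om x * g2 x - om x * g2 x / (1 + eta * rho x))) by exact: (derB (derZ _ (du1 x)) (duv1 x)).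
  have : Y 0 <= Y p.
    apply: (ler_of_derive (f' := fun x => eta * (1 + P1) * (om x * g2 x) -
      (om x * g2 x - om x * g2 x / (1 + eta * rho x)))) => // x /andP[x0 xp].
    have -> : om x * g2 x - om x * g2 x / (1 + eta * rho x) =
        eta * rho x / (1 + eta * rho x) * (om x * g2 x) by field; rewrite gt_eqF.
    rewrite -mulrBl mulr_ge0// subr_ge0 ler_pdivrMr//.
    have r1 : rho x <= 1 + P1 by apply: le_trans (rho_le x) _; rewrite ger0_norm//; lra.
    have r2 := ler_wpM2l (ltW eta0) r1; apply: le_trans r2 _; rewrite ler_peMr//.
      by rewrite mulr_ge0 ?(ltW eta0)//; lra.
    by rewrite lerDl mulr_ge0 ?ltW ?rho_gt0.
  rewrite /Y v10 subrr subr0.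
  have := uB p; have := uB 0; rewrite !ler_norml => /andP[a1 a2] /andP[b1 b2].
  have : eta * (1 + P1) * (u1 p - u1 0) <= eta * (1 + P1) * (2 * B).
    by rewrite ler_wpM2l//; [rewrite mulr_ge0 ?(ltW eta0)//; lra|lra].
  rewrite -/tau; lra.
have C2e : 0 <= 2 * C / eta by apply: divr_ge0; [exact: mulr_ge0|exact: ltW].
have tail p : P2 <= p -> v1 p - v1 P2 <= e.
  move=> Pp; pose Y x := 2 * C / eta * g1 x - v1 x.
  have dY (x : R) : is_derive x 1 Y (2 * C / eta * g2 x - om x * g2 x / (1 + eta * rho x)).
    exact: (derB (derZ _ (dg1 x)) (dv1 x)).
  have : Y P2 <= Y p.
    apply: (ler_of_derive (f' := fun x => 2 * C / eta * g2 x - om x * g2 x / (1 + eta * rho x))) => // x _.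
    rewrite [om x * g2 x / _]mulrAC -mulrBl mulr_ge0// subr_ge0 ler_pdivrMr//.
    have /andP[_ m2] := omC x; apply: le_trans m2 _.
    have -> : 2 * C / eta * (1 + eta * rho x) = 2 * C / eta + 2 * C * rho x by field; rewrite gt_eqF.
    have := rho_ge x; have := rho_ge1 x => r1 r2.
    have : C * (1 + `|x|) <= C * (2 * rho x) by rewrite ler_wpM2l//; lra.
    move: C2e; lra.
  have gp : g1 p <= s.
    have [|c /andP[c1 c2] E] := @MVT_fwd R g g1 p (p + 1) _ (fun x _ => dg x); first lra.
    have := gs (p + 1) p; rewrite E addrBl normr1 !mulr1 => /(le_trans (ler_norm _)).
    by apply: le_trans; exact: g1i.
  have gP : g P2 - g (P2 - 1) <= g1 P2.
    have [|c /andP[c1 c2] ->] := @MVT_fwd R g g1 (P2 - 1) P2 _ (fun x _ => dg x); first lra.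
    by rewrite (_ : P2 - (P2 - 1) = 1) ?mulr1 ?g1i//; lra.
  have C1 : 0 < 2 * C + 1 by lra.
  have K2' : (g1 p - g1 P2) <= e * eta / (2 * C + 1) by move: K2; lra.
  have : 2 * C / eta * (g1 p - g1 P2) <= e.
    apply: (@le_trans _ _ (2 * C / eta * (e * eta / (2 * C + 1)))).
      by rewrite ler_wpM2l.
    have -> : 2 * C / eta * (e * eta / (2 * C + 1)) = e * (2 * C / (2 * C + 1)).
      by field; rewrite !gt_eqF.
    by rewrite ler_piMr ?(ltW e0)// ler_pdivrMr//; lra.
  rewrite /Y; lra.
move=> p p0; rewrite ler_norml; apply/andP; split.
  have [pP|/ltW pP] := leP p P1.
    have := uh p p0; have pP2 : p <= P2 + 1 by lra.
    move=> /(_ pP2); rewrite ler_norml => /andP[h1 _].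
    have [c /andP[c1 c2] E] := MVT_fwd p0 (fun x _ => duv x).
    have cP : c <= P1 by lra.
    have := ler_wpM2r p0 (small c c1 cP); have := ler_wpM2l tau0 pP.
    have ep : 0 <= e * p by apply: mulr_ge0 => //; exact: ltW.
    by move: E; rewrite v0 subrr !subr0; lra.
  have [c /andP[c1 c2] E] := MVT_fwd pP (fun x _ => dv x).
  have i1 : v1 P1 * (p - P1) <= v1 c * (p - P1) by rewrite ler_wpM2r ?v1i// subr_ge0.
  have i2 := small P1 (ltW P10) (lexx _).
  have [|d /andP[d1 d2] E2] := @MVT_fwd R u u1 (P1 - 1) P1 _ (fun x _ => du x); first lra.
  have i3 := u1i d P1 d2.
  have := uh P1 (ltW P10); have := uh (P1 - 1); rewrite !ler_norml.
  have q1 : 0 <= P1 - 1 by lra. have q2 : P1 - 1 <= P2 + 1 by lra.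
  have q3 : P1 <= P2 + 1 by lra.
  move=> /(_ q1 q2)/andP[a1 a2] /(_ q3)/andP[b1 b2].
  have i4 : sg - 4 * e <= v1 P1.
    by move: E2; rewrite (_ : P1 - (P1 - 1) = 1) ?mulr1; lra.
  have := hsg p pP; have := ler_wpM2r (_ : 0 <= p - P1) i4; rewrite subr_ge0 => /(_ pP) i5 i6.
  have [c' /andP[c1' c2'] E'] := MVT_fwd (ltW P10) (fun x _ => duv x).
  have := ler_wpM2r (ltW P10) (small c' c1' c2').
  have eP : 0 <= e * P1 by apply: mulr_ge0 => //; exact: ltW.
  have ep : 0 <= e * p by apply: mulr_ge0 => //; exact: ltW.
  by move: E' E i1 i5 i6; rewrite v0 subrr !subr0; lra.
have ep : 0 <= e * p by apply: mulr_ge0 => //; exact: ltW.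
have [pP|/ltW pP] := leP p (P2 + 1).
  by have := uh p p0 pP; have := uv p p0; rewrite ler_norml => ? /andP[? ?]; lra.
have P2p : P2 <= p by lra. have P20 : 0 <= P2 by lra.
have [c /andP[c1 c2] E] := MVT_fwd P2p (fun x _ => dv x).
have i1 : v1 c * (p - P2) <= (v1 P2 + e) * (p - P2).
  by rewrite ler_wpM2r ?subr_ge0//; have := tail c c1; lra.
have [|d /andP[d1 d2] E2] := @MVT_fwd R u u1 P2 (P2 + 1) _ (fun x _ => du x); first lra.
have i2 : v1 P2 <= u (P2 + 1) - u P2.
  by rewrite E2 addrBl mulr1; apply: le_trans (uv1 P2 P20) (u1i _ _ d1).
have := uh P2 P20; have := uh (P2 + 1); rewrite !ler_norml.
have q1 : 0 <= P2 + 1 by lra. have q2 : P2 <= P2 + 1 by lra.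
move=> /(_ q1 (lexx _))/andP[a1 a2] /(_ q2)/andP[b1 b2].
have := ch _ _ _ q2 pP; rewrite addrBl mulr1 => i3.
have i4 : (v1 P2 + e) * (p - P2) <= (h (P2 + 1) - h P2 + 3 * e) * (p - P2).
  by rewrite ler_wpM2r ?subr_ge0//; lra.
have eP : 0 <= e * P2 by apply: mulr_ge0 => //; exact: ltW.
have := uv P2 P20; move: E i1 i3 i4 eP; lra.
Qed.

End one_sided_approximation.

(** * Damped profiles on the whole line *)

Section two_sided_approximation.
Context {R : realType}.
Implicit Types (p q x : R) (h g u v : R -> R).

Lemma der_neg (f : R -> R) (x l : R) : is_derive (- x) 1 f l ->
  is_derive x 1 (fun y => f (- y)) (- l).
Proof.
move=> /(@is_derive_normP R R^o) H; apply/(@is_derive_normP R R^o) => e e0.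
have [d d0 Hd] := H e e0; exists d => // h hd.
have := Hd (- h); rewrite normrN => /(_ hd).
by rewrite !scaler1 opprD mulrN mulNr opprK.
Qed.

Lemma der_opp (f : R -> R) (x l : R) : is_derive x 1 f l ->
  is_derive x 1 (fun y => - f y) (- l).
Proof. by move=> df; exact: (@is_deriveN R R^o R^o). Qed.

Lemma rhoN p : rho (- p) = rho p. Proof. by rewrite /rho sqrrN. Qed.

Lemma convex3_opp h : convex3 h -> convex3 (fun p => h (- p)).
Proof.
move=> ch p q r pq qr; have := ch (- r) (- q) (- p); rewrite !lerN2.
by move=> /(_ qr pq); lra.
Qed.

(** The order of choices matters: [P1] from [h], [eta] from [P1], [P2] from [g] and [eta], then
    [dl], all before the approximating data are given. The negative half line follows by
    reflection. *)
Lemma approx_two_sided h g (om : R -> R) (B C s z : R) :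
  0 <= B -> 0 <= C -> 0 <= z -> convex3 h ->
  (forall p q, `|h p - h q| <= B * `|p - q|) -> convex3 g -> g 0 <= z ->
  (forall p, `|p| * s - z <= g p) -> (forall p, 0 <= om p <= C * (1 + `|p|)) ->
  forall e eta0 : R, 0 < e -> 0 < eta0 -> exists eta P dl : R,
  [/\ 0 < eta, eta <= eta0, 1 <= P, 0 < dl &
  forall g' g1 g2 u u1 : R -> R,
  (forall p : R, is_derive p 1 g' (g1 p)) -> (forall p : R, is_derive p 1 g1 (g2 p)) ->
  (forall p, 0 <= g2 p) -> (forall p q, `|g' p - g' q| <= (s + dl) * `|p - q|) ->
  (forall p : R, is_derive p 1 u (u1 p)) ->
  (forall p : R, is_derive p 1 u1 (om p * g2 p)) -> (forall p, `|u1 p| <= B) ->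
  continuous (fun p => om p * g2 p) ->
  (forall p, `|p| <= P -> `|g' p - g p| <= dl /\ `|u p - h p| <= dl) ->
  exists v v1 : R -> R, [/\ forall p : R, is_derive p 1 v (v1 p),
    forall p : R, is_derive p 1 v1 (om p * g2 p / (1 + eta * rho p)) &
    forall p, `|v p - h p| <= 5 * e * (1 + `|p|)]].
Proof.
move=> B0 C0 z0 ch hB cg g0 gs omC e eta0 e0 eta00.
have hBN p q : `|h (- p) - h (- q)| <= B * `|p - q|.
  by have := hB (- p) (- q); rewrite opprK [- p + q]addrC distrC [`|q - p|]distrC distrC.
have [sg [Q [Q1 HQ]]] := convex3_last_slope ch hB e0.
have [sg' [Q' [Q'1 HQ']]] := convex3_last_slope (convex3_opp ch) hBN e0.
pose P1 := Num.max Q Q'; have QP : Q <= P1 by rewrite le_max lexx.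
have QP' : Q' <= P1 by rewrite le_max lexx orbT.
have P11 : 1 <= P1 by exact: le_trans QP.
pose D := (1 + P1) * (2 * B + 1) * P1.
have D0 : 0 < D by rewrite !mulr_gt0//; lra.
pose eta := Num.min eta0 (e / D).
have eta_gt0 : 0 < eta by rewrite lt_min eta00 divr_gt0.
have etaD : eta * D <= e by rewrite -ler_pdivlMr// ge_min lexx orbT.
have K1 : eta * (1 + P1) * (2 * B) * P1 <= e.
  apply: le_trans etaD; rewrite /D -!mulrA ler_pM2l// ler_pM2l; last by lra.
  by lra.
pose f := e * eta / (2 * C + 1) / 2.
have f0 : 0 < f by rewrite divr_gt0// divr_gt0 ?mulr_gt0//; lra.
have gs1 p : 0 <= p -> p * s - z <= g p by move=> p0; have := gs p; rewrite ger0_norm.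
have gs2 p : 0 <= p -> p * s - z <= g (- p).
  by move=> p0; have := gs (- p); rewrite normrN ger0_norm.
have [Qg Qg1 HQg] := norm_last_slope cg z0 f0 g0 gs1.
have [|Qg' Qg'1 HQg'] := norm_last_slope (convex3_opp cg) z0 f0 _ gs2.
  by rewrite oppr0.
pose P2 := Num.max P1 (Num.max Qg Qg').
have P12 : P1 <= P2 by rewrite le_max lexx.
have Qg2 : Qg <= P2 by rewrite !le_max lexx orbT.
have Qg'2 : Qg' <= P2 by rewrite !le_max lexx !orbT.
pose dl := Num.min e (f / 3).
have dl0 : 0 < dl by rewrite lt_min e0 divr_gt0.
have dle : dl <= e by rewrite ge_min lexx.
have dlf : dl <= f / 3 by rewrite ge_min lexx orbT.
exists eta, (P2 + 1), dl; split=> //; first by rewrite ge_min lexx.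
  by lra.
move=> g' g1 g2 u u1 dg dg1 g20 gL du du1 uB cont near.
have w0 p : 0 < 1 + eta * rho p.
  by rewrite ltr_wpDr// mulr_ge0 ?ltW ?rho_gt0.
have cv : continuous (fun p => om p * g2 p / (1 + eta * rho p)).
  move=> p; have c1 : {for p, continuous (fun p => 1 + eta * rho p)}.
    by apply: derivable_cont; exact: (derD (der_cst 1 p) (derZ eta (rho_derive p))).
  by apply: (continuousM (cont p)); apply: continuousV c1; rewrite gt_eqF.
have [V1 V10 dV1] := antiderivative cv.
pose v1 x := u1 0 + V1 x.
have dv1 (x : R) : is_derive x 1 v1 (om x * g2 x / (1 + eta * rho x)).
  by apply: der_eq (derD (der_cst (u1 0) x) (dV1 x)) _; rewrite add0r.
have cv1 : continuous v1 by move=> x; exact: derivable_cont (dv1 x).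
have [V V0 dV] := antiderivative cv1.
pose v x := u 0 + V x.
have dv (x : R) : is_derive x 1 v (v1 x).
  by apply: der_eq (derD (der_cst (u 0) x) (dV x)) _; rewrite add0r.
have v0 : v 0 = u 0 by rewrite /v V0 addr0.
have v10 : v1 0 = u1 0 by rewrite /v1 V10 addr0.
exists v, v1; split=> // p.
have P20 : 0 <= P2 by lra.
have [hsg sge] := (fun H => conj (proj2 H) (proj1 H)) (HQ P1 QP).
have [hsg' sge'] := (fun H => conj (proj2 H) (proj1 H)) (HQ' P1 QP').
have fE : e * eta / (2 * C + 1) = 2 * f by rewrite /f; lra.
have nP x : 0 <= x -> x <= P2 + 1 -> `|x| <= P2 + 1 by move=> x0; rewrite ger0_norm.
have nN x : 0 <= x -> x <= P2 + 1 -> `|- x| <= P2 + 1 by move=> x0; rewrite normrN ger0_norm.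
have q0 : 0 <= P2 - 1 by lra. have q1 : P2 - 1 <= P2 + 1 by lra. have q2 : P2 <= P2 + 1 by lra.
have K2 : s + dl - (g' P2 - g' (P2 - 1)) <= e * eta / (2 * C + 1).
  have [+ _] := near P2 (nP _ P20 q2); have [+ _] := near (P2 - 1) (nP _ q0 q1).
  rewrite fE !ler_norml => /andP[? ?] /andP[? ?]; have := HQg P2 Qg2; lra.
have K2' : s + dl - (g' (- P2) - g' (- (P2 - 1))) <= e * eta / (2 * C + 1).
  have [+ _] := near _ (nN _ P20 q2); have [+ _] := near _ (nN _ q0 q1).
  rewrite fE !ler_norml => /andP[? ?] /andP[? ?]; have := HQg' P2 Qg'2; lra.
have [p0|/ltW p0] := leP 0 p.
  rewrite (ger0_norm p0); apply: (approx_right B0 C0 eta_gt0 e0 P11 P12 ch hsg sge omC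
    dg dg1 g20 gL du du1 uB dv dv1 v0 v10 K1 K2) => // x x0 xP.
  by apply: le_trans dle; have [] := near x (nP x x0 xP).
rewrite (ler0_norm p0); have pN : 0 <= - p by rewrite oppr_ge0.
have := @approx_right R (fun x => h (- x)) (fun x => om (- x)) (fun x => g' (- x))
  (fun x => - g1 (- x)) (fun x => g2 (- x)) (fun x => u (- x)) (fun x => - u1 (- x))
  (fun x => v (- x)) (fun x => - v1 (- x)) B C eta e P1 P2 sg' (s + dl)
  B0 C0 eta_gt0 e0 P11 P12 (convex3_opp ch) hsg' sge'.
have dN2 (F F1 : R -> R) : (forall y : R, is_derive y 1 F (F1 y)) ->
    forall x : R, is_derive x 1 (fun y => - F (- y)) (F1 (- x)).
  by move=> dF x; apply: der_eq (der_opp (der_neg (dF (- x)))) (opprK _).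
have dN1 (F F1 : R -> R) : (forall y : R, is_derive y 1 F (F1 y)) ->
    forall x : R, is_derive x 1 (fun y => F (- y)) (- F1 (- x)).
  by move=> dF x; exact: der_neg (dF (- x)).
move=> /(_ _ (dN1 _ _ dg) (dN2 _ _ dg1) _ _ (dN1 _ _ du) (dN2 _ _ du1) _ (dN1 _ _ dv)).
rewrite !oppr0 v0 v10 => H; have := H _ _ _ _ _ erefl erefl K1 K2' _ (- p) pN.
rewrite opprK; apply => //.
- by move=> x; rewrite -(normrN x).
- by move=> x y; have := gL (- x) (- y); rewrite opprK [- x + y]addrC distrC [`|y - x|]distrC distrC.
- by move=> x; rewrite normrN.
- by move=> x; have := dN2 _ _ dv1 x; rewrite rhoN.
by move=> x x0 xP; apply: le_trans dle; have [] := near (- x) (nN x x0 xP).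
Qed.

End two_sided_approximation.

(** * Level sets of sublinear functions are hypersurfaces *)

Section gauge_hypersurface.
Context {R : realType} {n : nat} (G : 'rV[R]_n -> R) (M : R).
Hypothesis Gadd : forall x y, G (x + y) <= G x + G y.
Hypothesis GZ : forall (a : R) x, 0 <= a -> G (a *: x) = a * G x.
Hypothesis M0 : 0 < M.
Hypothesis GM : forall x, G x <= M * `|x|.
Implicit Types (x y q : 'rV[R]_n) (s t tau : R).

Lemma gauge_lipschitz x y : `|G x - G y| <= M * `|x - y|.
Proof.
have H a b : G a - G b <= M * `|a - b|.
  by have := Gadd (a - b) b; rewrite subrK; have := GM (a - b); lra.
have := H x y; have := H y x; rewrite [`|y - x|]distrC ler_norml.
by move=> ? ?; apply/andP; split; lra.
Qed.

Lemma gauge_continuous : continuous G.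
Proof.
move=> x; apply/(@cont_normP R 'rV[R]_n) => e e0; exists (e / M); first exact: divr_gt0.
move=> y; rewrite ltr_pdivlMr// mulrC; exact: le_lt_trans (gauge_lipschitz y x).
Qed.

Lemma gauge_level_closed : closed [set q | G q = 1].
Proof.
rewrite (_ : [set q | G q = 1] = G @^-1` [set 1])//; apply: closed_comp.
  by move=> x _; exact: gauge_continuous.
exact: closed_eq.
Qed.

Variable p : 'rV[R]_n.
Hypothesis Gp : G p = 1.

Let l := Num.sqrt (dot p p).

Let p_neq0 : p != 0.
Proof.
apply/eqP => p0; have := GM p; rewrite Gp p0 normr0 mulr0.
by rewrite leNgt ltr01.
Qed.

Let l0 : 0 < l. Proof. by rewrite sqrtr_gt0 dot_gt0. Qed.

Let w := l^-1 *: p.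

Let ww : dot w w = 1.
Proof.
rewrite dotZl dotZr -[dot p p]sqr_sqrtr ?dot_ge0// -/l.
by field; rewrite gt_eqF.
Qed.

Let pw : p = l *: w. Proof. by rewrite scalerA divff ?scale1r// gt_eqF. Qed.

Let Gw t : 0 <= t -> G (t *: w) = t / l.
Proof. by move=> t0; rewrite scalerA GZ ?Gp ?mulr1// divr_ge0// ltW. Qed.

(* Convexity applied to (1 + d / l) q = (q + d w) + (d / l) (q - p). *)
Lemma gauge_growth q d : 0 <= d ->
  G q + d / l * (G q - G (q - p)) <= G (q + d *: w).
Proof.
move=> d0; have dl : 0 <= d / l by rewrite divr_ge0// ltW.
have := Gadd (q + d *: w) ((d / l) *: (q - p)).
have -> : q + d *: w + (d / l) *: (q - p) = (1 + d / l) *: q.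
  rewrite scalerDl scale1r scalerBr /w scalerA -/(d / l) addrACA.
  by rewrite subrr addr0.
by rewrite !GZ//; [lra|lra].
Qed.

(** For [y] orthogonal to [w], the place where the line through [y] in the direction of [p] leaves
    the sublevel set. *)
Definition height y := sup [set t | G (y + t *: w) <= 1].

Let height_ub y t : G (y + t *: w) <= 1 -> t <= l * (1 + M * `|y|).
Proof.
move=> H; have My : 0 <= M * `|y| by rewrite mulr_ge0// ltW.
have [t0|t0] := leP 0 t; last first.
  by apply: le_trans (ltW t0) _; rewrite mulr_ge0 ?(ltW l0)//; lra.
have := Gadd (y + t *: w) (- y); rewrite addrBl Gw// => h1.
have := GM (- y); rewrite normrN => h2.
by rewrite mulrC -ler_pdivrMr//; lra.
Qed.

Let height_has_sup y : M * `|y| <= 1 -> has_sup [set t | G (y + t *: w) <= 1].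
Proof.
move=> My; split; last by exists (l * (1 + M * `|y|)) => t; exact: height_ub.
by exists 0; rewrite /= scale0r addr0; exact: le_trans (GM y) My.
Qed.

Let height_attained y : M * `|y| <= 1 -> G (y + height y *: w) <= 1.
Proof.
move=> My; apply/ler_addgt0Pr => e e0; have w1 : 0 < M * (`|w| + 1).
  by rewrite mulr_gt0// ltr_wpDl.
have [t tH ts] := sup_adherent (divr_gt0 e0 w1) (height_has_sup My).
have tS : t <= height y by apply: sup_upper_bound => //; exact: height_has_sup.
have := gauge_lipschitz (y + height y *: w) (y + t *: w).
have -> : y + height y *: w - (y + t *: w) = (height y - t) *: w.
  by rewrite opprD addrACA subrr add0r scalerBl.
rewrite (normrZ (height y - t) w) ger0_norm ?subr_ge0// => H.
have h1 : (height y - t) * (M * (`|w| + 1)) <= e.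
  by rewrite -ler_pdivlMr//; move: ts; rewrite -/(height y); lra.
have h2 : 0 <= (height y - t) * M by rewrite mulr_ge0 ?subr_ge0// ltW.
have := ler_norm (G (y + height y *: w) - G (y + t *: w)).
by move: tH H h1 h2; rewrite /=; lra.
Qed.

Let height_ge y t : M * `|y| <= 1 -> G (y + t *: w) <= 1 -> t <= height y.
Proof. by move=> My H; apply: sup_upper_bound => //; exact: height_has_sup. Qed.

Let height_near y : M * `|y| <= 1 -> `|height y - l| <= l * M * `|y|.
Proof.
move=> My; rewrite ler_norml; apply/andP; split.
  suff : l * (1 - M * `|y|) <= height y by lra.
  have t0 : 0 <= l * (1 - M * `|y|) by rewrite mulr_ge0 ?(ltW l0) ?subr_ge0.
  apply: height_ge => //; apply: le_trans (Gadd _ _) _; rewrite Gw//.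
  have -> : l * (1 - M * `|y|) / l = 1 - M * `|y| by field; rewrite gt_eqF.
  by have := GM y; lra.
by have := height_ub (height_attained My); lra.
Qed.

(** Near [p] the function keeps half of the growth rate [1 / l] that it has along the ray through
    [p]. *)
Let near_growth q d : M * `|q - p| <= 4^-1 -> 0 <= d ->
  G q + d / (2 * l) <= G (q + d *: w).
Proof.
move=> qp d0; apply: le_trans (gauge_growth q d0); rewrite lerD2l.
have -> : d / (2 * l) = d / l * 2^-1 by field; rewrite gt_eqF.
apply: ler_wpM2l; first by rewrite divr_ge0// ltW.
have := gauge_lipschitz q p; rewrite Gp ler_norml => /andP[h1 h2].
by have := GM (q - p); lra.
Qed.

Let c := 1 + `|w| * l * M.
Let c0 : 0 < c.
Proof. by rewrite ltr_wpDr// mulr_ge0 ?mulr_ge0 ?(ltW l0) ?(ltW M0). Qed.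

(** Moving from [y] to [y'] changes [G] by at most [M |y' - y|], which a step of length
    [2 l M |y' - y|] along [w] compensates. *)
Let height_step y y' : M * c * `|y| <= 32^-1 -> M * c * `|y'| <= 32^-1 ->
  height y - 2 * l * M * `|y' - y| <= height y'.
Proof.
have c1 : 1 <= c by rewrite lerDl mulr_ge0 ?mulr_ge0 ?(ltW l0) ?(ltW M0).
move=> hy hy'.
have My (z : 'rV[R]_n) : M * c * `|z| <= 32^-1 -> M * `|z| <= 32^-1.
  move=> /(le_trans _); apply; rewrite mulrAC ler_peMr//.
  by rewrite mulr_ge0// ltW.
have hy1 := My _ hy; have hy'1 := My _ hy'.
have y1 : M * `|y| <= 1 by lra. have y'1 : M * `|y'| <= 1 by lra.
set d := 2 * l * M * `|y' - y|.
have d0 : 0 <= d by rewrite mulr_ge0// mulr_ge0 ?(ltW M0)// mulr_ge0 ?(ltW l0).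
have yy : `|y' - y| <= `|y'| + `|y| by exact: ler_normB.
apply: height_ge => //; rewrite leNgt; apply/negP => H.
set q' := y' + (height y - d) *: w in H.
(* The distance is at most [3 c (|y'| + |y|)], and [6 / 32 <= 1 / 4]. *)
have q'p : M * `|q' - p| <= 4^-1.
  have -> : q' - p = y' + ((height y - l) *: w - d *: w).
    by rewrite /q' {1}pw -addrA -scalerBl -scalerBl; congr (_ + _ *: _); lra.
  have t1 := ler_normD y' ((height y - l) *: w - d *: w).
  have t2 := ler_normB ((height y - l) *: w) (d *: w).
  have n1 : `|(height y - l) *: w| = `|height y - l| * `|w| := normrZ _ _.
  have n2 : `|d *: w| = `|d| * `|w| := normrZ _ _.
  rewrite n1 n2 in t2.
  have t3 := ler_wpM2r (normr_ge0 w) (height_near y1).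
  rewrite (ger0_norm d0) in t2.
  have t4 : `|y' + ((height y - l) *: w - d *: w)| <= 3 * c * (`|y'| + `|y|).
    have e1 : d * `|w| <= 2 * (`|w| * l * M) * (`|y'| + `|y|).
      have -> : d * `|w| = 2 * (`|w| * l * M) * `|y' - y| by rewrite /d; lra.
      by rewrite ler_wpM2l// mulr_ge0// mulr_ge0 ?(ltW M0)// mulr_ge0 ?(ltW l0).
    have e2 : 0 <= `|w| * l * M * `|y'| by rewrite !mulr_ge0 ?(ltW l0) ?(ltW M0).
    have := normr_ge0 y; have := normr_ge0 y'.
    by move: t1 t2 t3 e1 e2; rewrite /c; lra.
  by have := ler_wpM2l (ltW M0) t4; lra.
have := near_growth q'p d0.
have -> : q' + d *: w = y' + height y *: w.
  by rewrite /q' -addrA -scalerDl subrK.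
have -> : d / (2 * l) = M * `|y' - y| by rewrite /d; field; rewrite gt_eqF.
have := gauge_lipschitz (y' + height y *: w) (y + height y *: w).
have -> : y' + height y *: w - (y + height y *: w) = y' - y.
  by rewrite opprD addrACA subrr addr0.
have := height_attained y1; rewrite ler_norml => h1 /andP[_ h2] h3; lra.
Qed.

Lemma gauge_local_graph : exists (w : 'rV[R]_n) (g : 'rV[R]_n -> R),
  dot w w = 1 /\ \forall q \near p,
    {for q - dot q w *: w, continuous g} /\
    (G q = 1 <-> dot q w = g (q - dot q w *: w)).
Proof.
exists w, height; split=> //.
have Mc : 0 < M * c by rewrite mulr_gt0.
pose a := 1 + n%:R * `|w| * `|w|; have a0 : 0 < a.
  by rewrite ltr_wpDr// mulr_ge0// mulr_ge0.
pose r := Num.min (4^-1 / M) (32^-1 / (M * c) / a).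
have r0 : 0 < r by rewrite lt_min !divr_gt0.
apply/(@near_normP _ _ p); exists r => // q qp.
have q1 : M * `|q - p| <= 4^-1.
  rewrite mulrC -ler_pdivlMr//; apply: le_trans (ltW qp) _; rewrite ge_min lexx//.
set y := q - dot q w *: w.
have yE : y = (q - p) - dot (q - p) w *: w.
  have pwl : dot p w = l by rewrite {1}pw dotZl ww mulr1.
  by rewrite dotBl pwl scalerBl -pw opprB addrA subrK.
have ylt : M * c * `|y| < 32^-1.
  rewrite mulrC -ltr_pdivlMr//; apply: le_lt_trans (_ : a * `|q - p| < _); last first.
    rewrite mulrC -ltr_pdivlMr//; apply: lt_le_trans qp _; rewrite ge_min lexx orbT//.
  rewrite yE; apply: le_trans (ler_normB _ _) _; rewrite (normrZ (dot (q - p) w) w).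
  have := ler_wpM2r (normr_ge0 w) (abs_dot_le (q - p) w); rewrite /a; lra.
have y1 : M * `|y| <= 1.
  have c1 : 1 <= c by rewrite lerDl mulr_ge0 ?mulr_ge0 ?(ltW l0) ?(ltW M0).
  have : M * `|y| <= M * c * `|y| by rewrite mulrAC ler_peMr// mulr_ge0// ltW.
  lra.
have qE : q = y + dot q w *: w by rewrite /y subrK.
split.
  apply/(@cont_normP R 'rV[R]_n) => e e0.
  pose k := 2 * l * M; have k0 : 0 < k by rewrite !mulr_gt0.
  exists (Num.min (e / k) ((32^-1 - M * c * `|y|) / (M * c))).
    by rewrite lt_min !divr_gt0// subr_gt0.
  move=> y'; rewrite lt_min => /andP[h1 h2].
  have hy' : M * c * `|y'| <= 32^-1.
    have := ler_normD (y' - y) y; rewrite subrK => h3.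
    move: h2; rewrite ltr_pdivlMr// => h2; have := ler_wpM2l (ltW Mc) h3; lra.
  have s1 := height_step (ltW ylt) hy'; have s2 := height_step hy' (ltW ylt).
  rewrite [`|y - y'|]distrC in s2; move: h1; rewrite ltr_pdivlMr// => h1.
  by rewrite ltr_norml; apply/andP; split; move: s1 s2 h1; rewrite /k; lra.
split=> [Gq|qh].
  apply/eqP; rewrite eq_le; apply/andP; split.
    by apply: height_ge => //; rewrite -qE Gq.
  apply: ge_sup => [|t /= tH]; first by have [] := height_has_sup y1.
  rewrite leNgt; apply/negP => lt; have d0 : 0 <= t - dot q w by rewrite subr_ge0 ltW.
  have := near_growth q1 d0; rewrite Gq.
  have -> : q + (t - dot q w) *: w = y + t *: w.
    by rewrite {1}qE -addrA -scalerDl [dot q w + _]addrC subrK.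
  have : 0 < (t - dot q w) / (2 * l) by rewrite divr_gt0 ?subr_gt0 ?mulr_gt0.
  by move: tH; lra.
have Gq1 : G q <= 1 by rewrite qE qh; exact: height_attained.
apply/eqP; rewrite eq_le Gq1 leNgt /=; apply/negP => lt.
have w1 : 0 < M * (`|w| + 1) by rewrite mulr_gt0// ltr_wpDl.
pose d := (1 - G q) / (M * (`|w| + 1)); have d0 : 0 < d by rewrite divr_gt0 ?subr_gt0.
have : dot q w + d <= height y.
  apply: height_ge => //; rewrite scalerDl addrA -qE.
  have := gauge_lipschitz (q + d *: w) q; rewrite addrBl (normrZ d w) (gtr0_norm d0).
  have : d * (M * (`|w| + 1)) = 1 - G q by rewrite divfK// gt_eqF.
  have := mulr_gt0 M0 d0; have := ler_norm (G (q + d *: w) - G q); lra.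
by rewrite -qh; lra.
Qed.

End gauge_hypersurface.

(** * The translator as a level set of its gauge *)

Section shape.
Context {R : realType} {n : nat} (E Z : 'rV[R]_n) (h : R -> R) (c : R).
Hypothesis EE : dot E E = 1.
Hypothesis ZZ : dot Z Z = 1.
Hypothesis EZ : dot E Z = 0.
Hypothesis c0 : 0 < c.
Hypothesis hc : forall p, c * (1 + `|p|) <= h p.
Implicit Types (x y q : 'rV[R]_n) (p t s z : R).

(** The Minkowski functional of the convex set [{p s - z <= h p for all p}]. The set is unbounded
    upwards, so this is sublinear but not a norm. *)
Definition gauge q := sup [set (p * dot q E - dot q Z) / h p | p in [set: R]].

Let h0 p : 0 < h p.
Proof. by apply: lt_le_trans (hc p); rewrite mulr_gt0// ltr_wpDr. Qed.

Let M := (n%:R * `|E| + n%:R * `|Z| + 1) / c.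

Lemma gauge_const_gt0 : 0 < M.
Proof. by rewrite divr_gt0// ltr_wpDl// addr_ge0// mulr_ge0. Qed.

Let ratio_le q p : (p * dot q E - dot q Z) / h p <= M * `|q|.
Proof.
rewrite ler_pdivrMr//; have Mq : 0 <= M * `|q|.
  by rewrite mulr_ge0// ltW// gauge_const_gt0.
apply: (le_trans _ (ler_wpM2l Mq (hc p))).
have -> : M * `|q| * (c * (1 + `|p|)) = (n%:R * `|E| + n%:R * `|Z| + 1) * `|q| * (1 + `|p|).
  by rewrite /M; field; rewrite gt_eqF.
have i1 := ler_norm (p * dot q E); have i2 := ler_norm (- dot q Z).
have i3 := ler_wpM2l (normr_ge0 p) (abs_dot_le q E); have i4 := abs_dot_le q Z.
rewrite normrM in i1; rewrite normrN in i2.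
have i5 : 0 <= n%:R * `|q| * `|E| by rewrite !mulr_ge0.
have i6 : 0 <= n%:R * `|q| * `|Z| * `|p| by rewrite !mulr_ge0.
have i7 : 0 <= `|q| * `|p| by rewrite mulr_ge0.
by have := normr_ge0 q; lra.
Qed.

Let has_sup_ratio q : has_sup [set (p * dot q E - dot q Z) / h p | p in [set: R]].
Proof.
split; first by exists ((0 * dot q E - dot q Z) / h 0), 0.
by exists (M * `|q|) => _ [p _ <-].
Qed.

Lemma gauge_leP q (k : R) :
  gauge q <= k <-> forall p, p * dot q E - dot q Z <= k * h p.
Proof.
split=> [H p|H].
  rewrite -ler_pdivrMr//; apply: le_trans H.
  by apply: sup_upper_bound => //; exists p.
apply: ge_sup; first by have [] := has_sup_ratio q.
by move=> _ [p _ <-]; rewrite ler_pdivrMr.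
Qed.

Lemma gaugeP q p : p * dot q E - dot q Z <= gauge q * h p.
Proof. exact: (gauge_leP q (gauge q)).1. Qed.

Lemma gauge_add x y : gauge (x + y) <= gauge x + gauge y.
Proof.
apply/gauge_leP => p; rewrite !dotDl mulrDl.
by have := gaugeP x p; have := gaugeP y p; lra.
Qed.

Lemma gaugeZ (k : R) x : 0 <= k -> gauge (k *: x) = k * gauge x.
Proof.
move=> k0; apply/eqP; rewrite eq_le; apply/andP; split.
  apply/gauge_leP => p; rewrite !dotZl.
  by have := ler_wpM2l k0 (gaugeP x p); lra.
have [->|kn] := eqVneq k 0.
  rewrite mul0r scale0r leNgt; apply/negP => lt.
  have := gaugeP 0 0; rewrite !dot0l mulr0 subr0.
  by rewrite leNgt nmulr_rlt0 ?h0.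
have kp : 0 < k by rewrite lt_neqAle eq_sym kn.
rewrite mulrC -ler_pdivlMr//; apply/gauge_leP => p.
have := gaugeP (k *: x) p; rewrite !dotZl => H.
rewrite mulrAC ler_pdivlMr//; lra.
Qed.

Lemma gauge_bound x : gauge x <= M * `|x|.
Proof. by apply: ge_sup => [|_ [p _ <-]]; [have [] := has_sup_ratio x|]. Qed.

Let W q t := level_at E Z h (cst 1) q t.

Let one1 p : (0 : R) <= cst (1 : R) p <= 1 * (1 + `|p|).
Proof. by rewrite /= ler01 mul1r lerDl normr_ge0. Qed.

Let sE q t : dot (q - t *: Z) E = dot q E.
Proof. by rewrite dotBl dotZl (dotC Z) EZ mulr0 subr0. Qed.

Let zE q t : dot (q - t *: Z) Z = dot q Z - t.
Proof. by rewrite dotBl dotZl ZZ mulr1. Qed.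

(** At the level 1 the term [t / lam] is a vertical translation by [t]. *)
Lemma level_le1 q t : 0 <= t -> (W q t <= 1) = (gauge (q - t *: Z) <= 1).
Proof.
move=> t0; apply/idP/idP => [H|/gauge_leP H].
  apply/gauge_leP => p; rewrite sE zE.
  by have := feas_of_level c0 ler01 hc one1 t0 H p; rewrite divr1 /= mulr1; lra.
apply: (level_le c0 ler01 hc one1 t0); first by rewrite invf_le1// ler1n.
by move=> p; have := H p; rewrite sE zE divr1 /= mulr1; lra.
Qed.

(** For the converse a level [1 - k] must be feasible: lowering the level increases [t / lam] by at
    most [2 t k], which [h >= c] pays for. *)
Lemma level_lt1 q t : 0 <= t -> (W q t < 1) = (gauge (q - t *: Z) < 1).
Proof.
move=> t0; apply/idP/idP => [H|H].
  have l0 : 0 < W q t := level_gt0 c0 ler01 hc one1 _ _ t0.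
  have H1 := ltW H; apply: le_lt_trans H; apply/gauge_leP => p; rewrite sE zE.
  have := level_feas c0 ler01 hc one1 (dot q E) (dot q Z) t0 p.
  rewrite -/(level_at E Z h (cst 1) q t) -/(W q t) /= mulr1 => F.
  have : t <= t / W q t by rewrite ler_peMr// -[leLHS]invr1 lef_pV2 ?posrE.
  lra.
pose th := gauge (q - t *: Z); have th1 : 0 < 1 - th by rewrite subr_gt0.
have tc : 0 < 1 + 2 * t / c by rewrite ltr_wpDr// divr_ge0 ?mulr_ge0// ltW.
pose k := Num.min 2^-1 ((1 - th) / (1 + 2 * t / c)).
have k0 : 0 < k by rewrite lt_min invr_gt0 ltr0n divr_gt0.
have k1 : k <= 2^-1 by rewrite ge_min lexx.
have k2 : k * (1 + 2 * t / c) <= 1 - th by rewrite -ler_pdivlMr// ge_min lexx orbT.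
have l2 : 2^-1 <= 1 - k by lra.
have l0 : 0 < 1 - k by lra.
suff : W q t <= 1 - k by move: k0; lra.
apply: (level_le c0 ler01 hc one1 t0 l2) => p; rewrite /= mulr1.
have := gaugeP (q - t *: Z) p; rewrite sE zE -/th => G.
have i1 : t / (1 - k) <= t + 2 * t * k.
  have -> : t / (1 - k) = t + t * (k / (1 - k)) by field; rewrite gt_eqF.
  rewrite lerD2l [2 * t]mulrC -mulrA; apply: ler_wpM2l => //.
  by rewrite ler_pdivrMr//; have := mulr_ge0 (ltW k0) (_ : 0 <= 2^-1 - k); rewrite subr_ge0 => /(_ k1); lra.
have ch : c <= h p.
  by apply: le_trans (hc p); rewrite ler_peMr ?(ltW c0)// lerDl.
have i2 : 2 * t * k <= k * (2 * t / c) * h p.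
  have -> : 2 * t * k = k * (2 * t / c) * c by field; rewrite gt_eqF.
  by apply: ler_wpM2l ch; rewrite mulr_ge0 ?(ltW k0)// divr_ge0 ?mulr_ge0// ltW.
have := ler_wpM2r (ltW (h0 p)) k2; lra.
Qed.

Lemma level_eq1 q t : 0 <= t -> W q t = 1 <-> gauge (q - t *: Z) = 1.
Proof.
move=> t0; split=> H; apply/eqP; rewrite eq_le [X in _ && X]leNgt.
  by rewrite -level_lt1// -level_le1// H lexx ltxx.
by rewrite level_lt1// level_le1// H lexx ltxx.
Qed.

(** A point of gauge 1 is not interior, since dilating it by [1 + k] raises its gauge above 1. *)
Lemma boundary_level t : 0 <= t ->
  bd [set q | W q t <= 1] = [set q | gauge (q - t *: Z) = 1].
Proof.
move=> t0; have M0 := gauge_const_gt0.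
have Lip := gauge_lipschitz gauge_add gauge_bound.
rewrite /bd; apply/seteqP; split=> q.
  move=> [cl ni]; apply/eqP; rewrite eq_le; apply/andP; split.
    apply/ler_addgt0Pr => e e0.
    have nq : nbhs q [set y | `|y - q| < e / M].
      by apply/(@near_normP _ _ q); exists (e / M) => //; exact: divr_gt0.
    have [y [/= + yq]] := cl _ nq; rewrite level_le1// => Gy.
    have := Lip (q - t *: Z) (y - t *: Z); rewrite opprB addrA subrK.
    rewrite [`|q - y|]distrC => h1; have h2 := ler_norm (gauge (q - t *: Z) - gauge (y - t *: Z)).
    by move: yq; rewrite ltr_pdivlMr// mulrC => yq; move: h1 h2 yq Gy; lra.
  rewrite leNgt; apply/negP => lt; apply: ni.
  apply/(@near_normP _ _ q); exists ((1 - gauge (q - t *: Z)) / M).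
    by rewrite divr_gt0// subr_gt0.
  move=> y; rewrite ltr_pdivlMr// => yq; rewrite /= level_le1//.
  have := Lip (y - t *: Z) (q - t *: Z).
  rewrite opprB addrA subrK => h1; have := ler_norm (gauge (y - t *: Z) - gauge (q - t *: Z)).
  by move: h1; rewrite mulrC; lra.
move=> /= G1; split.
  by apply: subset_closure; rewrite /= level_le1// G1.
move=> /(@near_normP _ _ q)[r r0 H]; set v := q - t *: Z in G1.
have v1 : 0 < `|v| + 1 by rewrite ltr_wpDl.
pose k := r / (`|v| + 1) / 2; have k0 : 0 < k by rewrite !divr_gt0.
have := H (q + k *: v); rewrite addrBl.
have kr : `|k *: v| < r.
  by apply: small_scale; rewrite ?gtr0_norm// /k; have := divr_gt0 r0 v1; lra.
move=> /(_ kr); rewrite /= level_le1//.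
have -> : q + k *: v - t *: Z = (1 + k) *: v by rewrite scalerDl scale1r addrAC.
by rewrite gaugeZ ?G1; lra.
Qed.

Lemma boundary_nonempty : [set q | gauge q = 1] !=set0.
Proof.
have GZ1 : 0 < gauge (- Z).
  have := gaugeP (- Z) 0; rewrite !dotNl ZZ mul0r sub0r opprK => H.
  rewrite ltNge; apply/negP => G0; have := lt_le_trans ltr01 H.
  by rewrite pmulr_lgt0// ltNge G0.
exists ((gauge (- Z))^-1 *: (- Z)).
by rewrite /= gaugeZ ?invr_ge0 ?(ltW GZ1)// mulVf// gt_eqF.
Qed.

End shape.

(** * The translator as the graph of a convex function of one variable *)

Section graph.
Context {R : realType} {N : nat} (e : 'rV[R]_N) (h : R -> R) (c : R).
Hypothesis he : dot e e = 1.
Hypothesis c0 : 0 < c.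
Hypothesis hc : forall p, c * (1 + `|p|) <= h p.
Implicit Types (p s z t : R) (x : 'rV[R]_N) (q : 'rV[R]_(N + 1)).

Definition horizontal : 'rV[R]_(N + 1) := row_mx e 0.
Definition vertical : 'rV[R]_(N + 1) := row_mx 0 1%:M.

Local Notation E := horizontal.
Local Notation Z := vertical.

Lemma dot_scalar1 (a b : R) : dot (a%:M : 'rV[R]_1) b%:M = a * b.
Proof. by rewrite /dot big_ord1 !mxE !eqxx !mulr1n. Qed.

Lemma horizontal_unit : dot E E = 1.
Proof. by rewrite dot_row_mx dot0l addr0. Qed.

Lemma vertical_unit : dot Z Z = 1.
Proof. by rewrite dot_row_mx dot0l add0r dot_scalar1 mulr1. Qed.

Lemma horizontal_vertical : dot E Z = 0.
Proof. by rewrite dot_row_mx dot0l dot0r addr0. Qed.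

Lemma dot_horizontal x z : dot (Defs.point x z) E = dot x e.
Proof. by rewrite dot_row_mx dot0r addr0. Qed.

Lemma dot_vertical x z : dot (Defs.point x z) Z = z.
Proof. by rewrite dot_row_mx dot0r add0r dot_scalar1 mulr1. Qed.

Lemma point_vertical t : Defs.point 0 t = t *: Z.
Proof. by rewrite /Defs.point /vertical scale_row_mx scaler0 scale_scalar_mx mulr1. Qed.

Lemma pointP q : exists x z, q = Defs.point x z.
Proof.
exists (lsubmx q), (rsubmx q 0 0); rewrite /Defs.point.
have -> : (rsubmx q 0 0)%:M = rsubmx q.
  by apply/matrixP => i j; rewrite !ord1 !mxE eqxx mulr1n.
by rewrite hsubmxK.
Qed.

(** The interior of the domain of the Legendre transform of [h]: the slack [d |p|] makes it open.
    Endpoints with a finite value are recovered by the closure of the epigraph. *)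
Definition interval_of : set R := [set s | exists d M : R, 0 < d /\
  forall p, p * s + d * `|p| <= h p + M].

Definition profile s := sup [set p * s - h p | p in [set: R]].

Lemma profile_has_sup s : interval_of s -> has_sup [set p * s - h p | p in [set: R]].
Proof.
move=> [d [M [d0 H]]]; split; first by exists (0 * s - h 0), 0.
exists M => _ [p _ <-]; have := H p; have := mulr_ge0 (ltW d0) (normr_ge0 p); lra.
Qed.

Lemma profile_ge s p : interval_of s -> p * s - h p <= profile s.
Proof. by move=> Is; apply: sup_upper_bound; [exact: profile_has_sup|exists p]. Qed.

Lemma profile_le s z : interval_of s -> (forall p, p * s - h p <= z) -> profile s <= z.
Proof.
move=> Is H; apply: ge_sup => [|_ [p _ <-]//].
by have [] := profile_has_sup Is.
Qed.

Lemma interval_ofP : is_interval interval_of.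
Proof.
move=> a b [d [M [d0 Ha]]] [d' [M' [d'0 Hb]]] s /andP[as_ sb].
exists (Num.min d d'), (Num.max M M'); split; first by rewrite lt_min d0.
move=> p; have dm : Num.min d d' <= d by rewrite ge_min lexx.
have dm' : Num.min d d' <= d' by rewrite ge_min lexx orbT.
have Mm : M <= Num.max M M' by rewrite le_max lexx.
have Mm' : M' <= Num.max M M' by rewrite le_max lexx orbT.
have [p0|/ltW p0] := leP 0 p.
  by have := Hb p; have := ler_wpM2l p0 sb; have := ler_wpM2r (normr_ge0 p) dm'; lra.
by have := Ha p; have := ler_wnM2l p0 as_; have := ler_wpM2r (normr_ge0 p) dm; lra.
Qed.

Lemma interval_of_open (s : R) : interval_of s ->
  exists2 r : R, 0 < r & forall s', `|s' - s| < r -> interval_of s'.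
Proof.
move=> [d [M [d0 H]]]; exists (d / 2) => [|s' ss]; first by rewrite divr_gt0.
exists (d / 2), M; split=> [|p]; first by rewrite divr_gt0.
have := H p; have := ler_norm (p * (s' - s)); rewrite normrM.
have := ler_wpM2l (normr_ge0 p) (ltW ss); lra.
Qed.

Lemma profile_convex_combination (k x y : R) : 0 <= k -> k <= 1 ->
  interval_of x -> interval_of y ->
  profile (k * x + (1 - k) * y) <= k * profile x + (1 - k) * profile y.
Proof.
move=> k0 kl Ix Iy; have k1 : 0 <= 1 - k by rewrite subr_ge0.
apply: profile_le => [|p]; last first.
  have := ler_wpM2l k0 (profile_ge p Ix); have := ler_wpM2l k1 (profile_ge p Iy).
  lra.
have [xy|/ltW yx] := leP x y.
  have i1 : k * x <= k * y by rewrite ler_wpM2l.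
  have i2 : (1 - k) * x <= (1 - k) * y by rewrite ler_wpM2l.
  by apply: (interval_ofP Ix Iy); apply/andP; split; lra.
have i1 : k * y <= k * x by rewrite ler_wpM2l.
have i2 : (1 - k) * y <= (1 - k) * x by rewrite ler_wpM2l.
by apply: (interval_ofP Iy Ix); apply/andP; split; lra.
Qed.

Lemma profile_convex : @convex_function R R^o interval_of profile.
Proof.
move=> t x y /set_mem Ix /set_mem Iy.
by apply: profile_convex_combination.
Qed.

(** For the harder inclusion contract [q] towards 0, which satisfies all constraints with slack
    [c (1 + |p|)]: the abscissa of [(1 - k) q] then belongs to [interval_of]. *)
Lemma closure_epigraph :
  closure (epigraph [set x | interval_of (dot x e)] (fun x => profile (dot x e))) =
  [set q | gauge E Z h q <= 1].
Proof.
have G := gauge_leP E Z c0 hc.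
have Lip := gauge_lipschitz (gauge_add E Z c0 hc) (gauge_bound E Z c0 hc).
have M0 := gauge_const_gt0 E Z c0.
set M := (_ / c) in Lip M0; apply/seteqP; split=> q.
  move=> cl; rewrite /=; apply/ler_addgt0Pr => r r0.
  have nq : nbhs q [set y | `|y - q| < r / M].
    by apply/(@near_normP _ _ q); exists (r / M) => //; exact: divr_gt0.
  have [y [[x [z [-> Ix uz]]] /=]] := cl _ nq; rewrite ltr_pdivlMr// => yq.
  have Gy : gauge E Z h (Defs.point x z) <= 1.
    apply/G => p; rewrite dot_horizontal dot_vertical mul1r.
    by have := profile_ge p Ix; lra.
  have := Lip q (Defs.point x z); rewrite [`|q - _|]distrC => h1.
  have := ler_norm (gauge E Z h q - gauge E Z h (Defs.point x z)); move: yq h1 Gy; rewrite mulrC; lra.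
move=> /= /G Gq B /(@near_normP _ _ q)[r r0 HB].
have [x [z qE]] := pointP q.
have q1 : 0 < `|q| + 1 by rewrite ltr_wpDl.
pose k := Num.min 2^-1 (r / (`|q| + 1) / 2).
have k0 : 0 < k by rewrite lt_min invr_gt0 ltr0n !divr_gt0.
have k1 : k <= 2^-1 by rewrite ge_min lexx.
have k2 : k <= r / (`|q| + 1) / 2 by rewrite ge_min lexx orbT.
have Gp p : p * dot x e - z <= h p.
  by have := Gq p; rewrite qE dot_horizontal dot_vertical mul1r.
have Ix : interval_of (dot ((1 - k) *: x) e).
  exists (k * c), ((1 - k) * z); split=> [|p]; first by rewrite mulr_gt0.
  have k3 : 0 <= 1 - k by lra.
  rewrite dotZl; have := ler_wpM2l k3 (Gp p); have := ler_wpM2l (ltW k0) (hc p).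
  by have := mulr_gt0 k0 c0; lra.
exists ((1 - k) *: q); split.
  exists ((1 - k) *: x), ((1 - k) * z); split=> //.
    by rewrite qE /Defs.point scale_row_mx scale_scalar_mx.
  apply: profile_le => // p; rewrite dotZl.
  have k3 : 0 <= 1 - k by lra.
  have := ler_wpM2l k3 (Gp p); have := ler_wpM2l (ltW k0) (hc p).
  have : 0 <= k * (c * (1 + `|p|)) by rewrite !mulr_ge0 ?(ltW k0) ?(ltW c0)// addr_ge0.
  lra.
apply: HB; rewrite scalerBl scale1r addrAC subrr add0r normrN.
apply: small_scale => //; rewrite gtr0_norm//; apply: le_lt_trans k2 _.
by have := divr_gt0 r0 q1; lra.
Qed.

End graph.

(** * Viscosity solutions close to the translating level function *)

Section good_solution.
Context {R : realType} {n : nat} (phi psi : 'rV[R]_n -> R) (E Z : 'rV[R]_n).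
Hypothesis n0 : (0 < n)%N.
Hypothesis rphi : regular_norm phi.
Hypothesis hpsi : is_norm psi.
Hypothesis EE : dot E E = 1.
Hypothesis ZZ : dot Z Z = 1.
Hypothesis EZ : dot E Z = 0.
Implicit Types (p s z t lam : R) (x y : 'rV[R]_n).

Lemma modulus_le (L L' : R) (w : 'rV[R]_n -> R -> R) : L <= L' -> modulus L w -> modulus L' w.
Proof.
move=> LL [w1 w2]; split=> // x y s; apply: le_trans (w1 x y s) _.
by rewrite ler_wpM2r.
Qed.

Lemma modulus_add_time (L M : R) (w : 'rV[R]_n -> R -> R) (ti : R -> R) : 0 <= M ->
  (forall s t, `|ti s - ti t| <= M * `|s - t|) -> modulus L w ->
  modulus L (fun x t => w x t + ti t).
Proof.
move=> M0 tiM [w1 w2]; split=> [x y s|e e0].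
  by rewrite opprD addrACA subrr addr0.
have [K K0 wK] := w2 e e0; exists (K + M) => [|x s t]; first by rewrite ltr_wpDr.
rewrite opprD addrACA mulrDl [leRHS]addrA; apply: le_trans (ler_normD _ _) _.
by apply: lerD; [exact: wK|exact: tiM].
Qed.

Lemma posp_lipschitz s t : `|posp s - posp t| <= `|s - t|.
Proof. by rewrite /posp; apply: max_dist => //; rewrite subrr normr0. Qed.

Lemma min_lipschitz (T : R) s t :
  `|Num.min (posp s) T - Num.min (posp t) T| <= 1 * `|s - t|.
Proof.
have := posp_lipschitz s t; rewrite mul1r; apply: le_trans.
have -> : Num.min (posp s) T = - Num.max (- posp s) (- T) by rewrite -oppr_min opprK.
have -> : Num.min (posp t) T = - Num.max (- posp t) (- T) by rewrite -oppr_min opprK.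
rewrite -opprD normrN; apply: max_dist; last by rewrite subrr normr0.
by rewrite -opprD normrN.
Qed.

Lemma level_compare (a1 a2 d1 d2 : R -> R) (c1 c2 D1 D2 k s z t : R) :
  0 < c1 -> 0 <= D1 -> (forall p, c1 * (1 + `|p|) <= a1 p) ->
  (forall p, 0 <= d1 p <= D1 * (1 + `|p|)) ->
  0 < c2 -> 0 <= D2 -> (forall p, c2 * (1 + `|p|) <= a2 p) ->
  (forall p, 0 <= d2 p <= D2 * (1 + `|p|)) ->
  0 <= t -> 1 <= k ->
  (forall lam p, 2^-1 <= lam ->
    lam * a1 p - t / lam * d1 p <= k * lam * a2 p - t / (k * lam) * d2 p) ->
  level a2 d2 s z t <= k * level a1 d1 s z t.
Proof.
move=> c10 D10 ac1 dD1 c20 D20 ac2 dD2 t0 k1 H.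
have l2 := level_ge_half c10 D10 ac1 dD1 s z t0.
apply: (level_le c20 D20 ac2 dD2 t0).
  by rewrite (le_trans l2)// ler_peMl// (le_trans _ l2)// invr_ge0.
by move=> p; apply: le_trans (level_feas c10 D10 ac1 dD1 s z t0 p) (H _ _ l2).
Qed.

Variables (h : R -> R) (c A : R).
Hypothesis c0 : 0 < c.
Hypothesis hc : forall p, c * (1 + `|p|) <= h p.
Hypothesis hA : forall p, h p <= A * (1 + `|p|).

Definition translating x t := level_at E Z h (cst 1) x (posp t) - 1.

Let one1 p : (0 : R) <= cst (1 : R) p <= 1 * (1 + `|p|).
Proof. by rewrite /= ler01 mul1r lerDl normr_ge0. Qed.

Let c2 : 0 < c / 2. Proof. exact: divr_gt0. Qed.

Let m := n%:R * `|E| + n%:R * `|Z|.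
Let m0 : 0 <= m. Proof. by rewrite addr_ge0// mulr_ge0. Qed.

Lemma translating_time x t : 0 <= t ->
  translating x 0 <= translating x t <= translating x 0 + 2 / c * t.
Proof.
move=> t0; rewrite /translating (_ : posp t = t); last by rewrite /posp max_l.
have -> : posp (0 : R) = 0 by rewrite /posp max_l.
have h1 := level_mono c0 ler01 hc one1 (dot x E) (dot x Z) (lexx 0) t0.
have := level_lipschitz c0 ler01 hc one1 (dot x E) (dot x Z) (dot x E) (dot x Z) (lexx 0) t0.
rewrite !subrr normr0 sub0r normrN (ger0_norm t0) !add0r mulr1 => h2.
by move: h1 h2; rewrite /level_at => h1 h2; apply/andP; split; lra.
Qed.

Lemma translating_lipschitz x y :
  `|translating x 0 - translating y 0| <= m / c * `|x - y|.
Proof.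
have := @level_modulus R n E Z h (cst 1) c 1 1 (@posp R) 1 c0 ler01 ler01 hc one1
  (@posp_ge0 R) ler01 _.
case=> [s t|H _]; first by rewrite mul1r; exact: posp_lipschitz.
have := H x y 0; rewrite /translating !mul1r; exact.
Qed.

(** [dl] bounds the relative error of [v]; with [T = 1 / eps], the bound on [eta] gives
    [ell rho <= dl h]. The factors [k1 = 1 - dl] and [k2 = 1 + 2 dl] put the lower and upper
    functions on the right sides of [translating], and up to time [T] the resulting relative error
    is at most [8 dl = eps]. *)
Lemma good_solution (eps dl eta : R) (v v1 : R -> R) :
  0 < eps -> eps <= 1 -> dl = eps / 8 -> 0 < eta -> eta <= dl * c * eps / 4 ->
  (forall p : R, is_derive p 1 v (v1 p)) ->
  (forall p : R, is_derive p 1 v1 (curvature phi psi E Z p / (1 + eta * rho p))) ->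
  (forall p, `|v p - h p| <= dl * h p) ->
  exists w : 'rV[R]_n -> R -> R, viscosity_solution phi psi (fun x => translating x 0)
      (fun q => w q.1 q.2) /\
    forall x t, 0 <= t -> t <= eps^-1 ->
      `|w x t - translating x t| <= eps * (translating x t + 1).
Proof.
move=> e0 e1 dlE eta0 etale dv dv1 vh.
have dl0 : 0 < dl by rewrite dlE divr_gt0.
have dl8 : dl <= 8^-1 by rewrite dlE; lra.
have h0 p : 0 < h p by apply: lt_le_trans (hc p); rewrite mulr_gt0// ltr_wpDr.
have vl p : (1 - dl) * h p <= v p by have := vh p; rewrite ler_norml => /andP[? ?]; lra.
have vu p : v p <= (1 + dl) * h p by have := vh p; rewrite ler_norml => /andP[? ?]; lra.
have vc p : c / 2 * (1 + `|p|) <= v p.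
  apply: le_trans (vl p); have : 2^-1 * h p <= (1 - dl) * h p.
    by apply: ler_wpM2r; [exact: ltW|lra].
  by have := hc p; lra.
have vA p : v p <= 2 * `|A| * (1 + `|p|).
  apply: le_trans (vu p) _; have : (1 + dl) * h p <= 2 * h p by apply: ler_wpM2r; [exact: ltW|lra].
  have := hA p; have : A * (1 + `|p|) <= `|A| * (1 + `|p|).
    by rewrite ler_wpM2r ?ler_norm// addr_ge0.
  lra.
pose T := eps^-1; have T0 : 0 < T by rewrite invr_gt0.
pose ell := 4 * eta * T.
have etaT : 4 * eta * T <= dl * c.
  by rewrite /T ler_pdivrMr//; lra.
have rh p : ell * rho p <= dl * h p.
  apply: (@le_trans _ _ (dl * c * (1 + `|p|))).
    by apply: ler_pM; rewrite ?rho_le// ?ltW ?rho_gt0// mulr_gt0// mulr_gt0.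
  by rewrite -mulrA ler_wpM2l ?hc// ltW.
have kg := @curvature_gt0 R n phi psi E Z rphi hpsi EE ZZ EZ.
have up_c := @upper_profile_ge R v eta (c / 2) eta0 vc T ell T0 erefl.
have up_d := @upper_speed_bounds R eta eta0.
have D0 : 0 <= 1 + eta by rewrite addr_ge0// ltW.
pose k1 := 1 - dl; pose k2 := 1 + 2 * dl.
have k10 : 0 < k1 by rewrite /k1; lra.
have k20 : 0 < k2 by rewrite /k2; lra.
(* After [T] the upper function rises at the rate [M], which must dominate the time derivatives of
   [translating] and of the upper level function. *)
pose M := Num.max (2 / c) (k2 * (2 * (1 + eta)) / (c / 2)).
have M1 : 2 / c <= M by rewrite le_max lexx.
have M2 : k2 * (2 * (1 + eta)) / (c / 2) <= M by rewrite le_max lexx orbT.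
have c20 : 0 <= 2 / c by rewrite divr_ge0// ltW.
have M0 : 0 <= M by exact: le_trans M1.
pose F := lower_level E Z v k1; pose G := upper_level E Z v eta T ell k2 M.
have lowv t x : 0 <= t -> k1 * level_at E Z v (cst 1) x t <= level_at E Z h (cst 1) x t.
  move=> t0; have := @level_compare h v (cst 1) (cst 1) c (c / 2) 1 1 k1^-1
    (dot x E) (dot x Z) t c0 ler01 hc one1 c2 ler01 vc one1 t0.
  rewrite ler_pdivlMl// ; apply.
    by rewrite -[leLHS]invr1 lef_pV2 ?posrE//; rewrite /k1; lra.
  move=> lam p l2; have l0 : 0 < lam by apply: lt_le_trans l2; rewrite invr_gt0.
  rewrite /= !mulr1; apply: lerB.
    rewrite -mulrA ler_pdivlMl// mulrCA; apply: ler_wpM2l; first exact: ltW.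
    exact: vl.
  apply: ler_wpM2l => //; rewrite lef_pV2 ?posrE ?mulr_gt0 ?invr_gt0//.
  by rewrite ler_pMl// -[leLHS]invr1 lef_pV2 ?posrE// /k1; lra.
have lowh t x : 0 <= t -> level_at E Z h (cst 1) x t <= (1 + dl) * level_at E Z v (cst 1) x t.
  move=> t0; apply: (@level_compare v h (cst 1) (cst 1) (c / 2) c 1 1 (1 + dl)
    (dot x E) (dot x Z) t c2 ler01 vc one1 c0 ler01 hc one1 t0); first by lra.
  move=> lam p l2; have l0 : 0 < lam by apply: lt_le_trans l2; rewrite invr_gt0.
  rewrite /= !mulr1; apply: lerB.
    by have := ler_wpM2l (ltW l0) (vu p); lra.
  apply: ler_wpM2l => //; rewrite lef_pV2 ?posrE ?mulr_gt0//; last by lra.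
  by rewrite ler_pMl//; lra.
have uph t x : 0 <= t -> level_at E Z h (cst 1) x t <=
    k2 * level_at E Z (upper_profile v ell) (upper_speed eta) x t.
  move=> t0; apply: (@level_compare _ h _ (cst 1) (c / 2) c (1 + eta) 1 k2
    (dot x E) (dot x Z) t c2 D0 up_c up_d c0 ler01 hc one1 t0); first by rewrite /k2; lra.
  move=> lam p l2; have l0 : 0 < lam by apply: lt_le_trans l2; rewrite invr_gt0.
  rewrite /= mulr1; apply: lerB.
    have : v p + ell * rho p <= k2 * h p by have := vu p; have := rh p; rewrite /k2; lra.
    by move=> /(ler_wpM2l (ltW l0)); rewrite /upper_profile; lra.
  have kl0 : 0 < k2 * lam by rewrite mulr_gt0.
  apply: (@le_trans _ _ (t / lam)).
    apply: ler_wpM2l => //; rewrite lef_pV2 ?posrE// ler_pMl//; rewrite /k2; lra.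
  rewrite ler_peMr ?divr_ge0 ?(ltW l0)//.
  by rewrite /upper_speed lerDl mulr_ge0 ?ltW ?rho_gt0.
(* One [dl] covers the error of [v], the other one the excess of speed [eta rho]. *)
have upl t x : 0 <= t -> t <= T -> level_at E Z (upper_profile v ell) (upper_speed eta) x t <=
    (1 - 2 * dl)^-1 * level_at E Z h (cst 1) x t.
  move=> t0 tT; have q0 : 0 < 1 - 2 * dl by lra.
  have q1 : 1 <= (1 - 2 * dl)^-1 by rewrite -[leLHS]invr1 lef_pV2 ?posrE//; lra.
  apply: (@level_compare h _ (cst 1) _ c (c / 2) 1 (1 + eta) _
    (dot x E) (dot x Z) t c0 ler01 hc one1 c2 D0 up_c up_d t0 q1).
  move=> lam p l2; have l0 : 0 < lam by apply: lt_le_trans l2; rewrite invr_gt0.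
  set mu := _ * lam; have lmu : lam <= mu by rewrite /mu ler_peMl// ltW.
  have mu0 : 0 < mu by exact: lt_le_trans lmu.
  have muE : mu * (1 - 2 * dl) = lam by rewrite /mu mulrAC mulVf ?mul1r// gt_eqF.
  rewrite /= mulr1 /upper_profile /upper_speed.
  have i1 : t / mu <= t / lam by apply: ler_wpM2l => //; rewrite lef_pV2.
  have mu2 : 2^-1 <= mu by exact: le_trans lmu.
  have i2 : t / mu * (eta * rho p) <= mu * (dl * h p).
    have mui : mu^-1 <= 2 by rewrite -[leRHS]invrK lef_pV2 ?posrE ?invr_gt0.
    have j1 : t / mu <= T * 2 by apply: ler_pM; rewrite ?invr_ge0 ?(ltW mu0).
    have j2 := ler_wpM2r (_ : 0 <= eta * rho p) j1.
    have j3 := j2 (mulr_ge0 (ltW eta0) (ltW (rho_gt0 p))).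
    apply: le_trans j3 _.
    have : 2^-1 * (dl * h p) <= mu * (dl * h p).
      by apply: ler_wpM2r => //; rewrite mulr_ge0// ltW.
    by have := rh p; rewrite /ell; lra.
  have i3 : mu * ((1 - dl) * h p) <= mu * v p by apply: ler_wpM2l; [exact: ltW|exact: vl].
  have i4 : 0 <= mu * (ell * rho p).
    by apply: mulr_ge0; [exact: ltW|rewrite !mulr_ge0 ?ltW ?rho_gt0].
  have i5 : lam * h p = mu * (1 - 2 * dl) * h p by rewrite muE.
  have i6 : t / mu * 1 <= t / lam by rewrite mulr1.
  rewrite i5; move: i1 i2 i3 i4; lra.
have pospE t : 0 <= t -> posp t = t by move=> t0; rewrite /posp max_l.
have FU x t : F x t <= translating x t.
  by rewrite /F /lower_level lerB// lowv// posp_ge0.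
have UG x t : translating x t <= G x t.
  have [tT|tT] := leP t T.
    have -> : G x t = k2 * level_at E Z (upper_profile v ell) (upper_speed eta) x (posp t) - 1.
      have -> : posp t = Num.min (posp t) T.
        by rewrite min_l// /posp ge_max tT ltW.
      by rewrite /G /upper_level /posp [Num.max (t - T) 0]max_r ?mulr0 ?addr0 ?subr_le0.
    by rewrite /translating lerB// uph// posp_ge0.
  have t0 : 0 <= t by apply: le_trans (ltW T0) (ltW tT).
  rewrite /G /upper_level (pospE t t0) (pospE (t - T)) ?subr_ge0 ?(ltW tT)// min_r ?(ltW tT)//.
  rewrite /translating (pospE t t0); have := uph T x (ltW T0).
  have := level_lipschitz c0 ler01 hc one1 (dot x E) (dot x Z) (dot x E) (dot x Z) (ltW T0) t0.
  rewrite !subrr normr0 !add0r mulr1 distrC ger0_norm ?subr_ge0 ?(ltW tT)// => i1 i2.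
  have tT0 : 0 <= t - T by rewrite subr_ge0 ltW.
  by move: i1 i2 (ler_wpM2r tT0 M1); rewrite /level_at; lra.
pose L := 4 * m / c + 4 * m / c + 1.
have mc : 0 <= 4 * m / c by rewrite divr_ge0 ?(ltW c0)// mulr_ge0.
have L0 : 0 < L by rewrite /L; lra.
have ptM (s t : R) : `|posp s - posp t| <= 1 * `|s - t| by rewrite mul1r; exact: posp_lipschitz.
have FL : modulus L F.
  apply: modulus_le (level_modulus E Z c2 ler01 (ltW k10) vc one1 (@posp_ge0 R) ler01 ptM).
  have : k1 * m <= 1 * m by apply: ler_wpM2r => //; rewrite /k1; lra.
  rewrite -/m => i1; have -> : k1 * m / (c / 2) = 2 * (k1 * m) / c by field; rewrite gt_eqF.
  have : 2 * (k1 * m) / c <= 4 * m / c by rewrite ler_pM2r ?invr_gt0//; move: i1 m0; lra.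
  by move: mc; rewrite /L; lra.
have GL : modulus L G.
  apply: (modulus_add_time (M := M)) => // [s t|].
    by rewrite -mulrBr normrM ger0_norm// ler_wpM2l//;
      apply: le_trans (posp_lipschitz _ _) _; rewrite opprB addrA subrK.
  have ti0 t : 0 <= Num.min (posp t) T by rewrite le_min posp_ge0 ltW.
  apply: modulus_le (level_modulus E Z c2 D0 (ltW k20) up_c up_d ti0 ler01 (min_lipschitz T)).
  have : k2 * m <= 2 * m by apply: ler_wpM2r => //; rewrite /k2; lra.
  rewrite -/m => i1; have -> : k2 * m / (c / 2) = 2 * (k2 * m) / c by field; rewrite gt_eqF.
  have : 2 * (k2 * m) / c <= 4 * m / c by rewrite ler_pM2r ?invr_gt0//; move: i1 m0; lra.
  by move: mc; rewrite /L; lra.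
have ULip x y : `|translating x 0 - translating y 0| <= L * `|x - y|.
  apply: le_trans (translating_lipschitz x y) _; apply: ler_wpM2r => //.
  have : m / c <= 4 * m / c by rewrite ler_pM2r ?invr_gt0//; move: m0; lra.
  by move: mc; rewrite /L; lra.
have Uinit x t : t <= 0 -> translating x t = translating x 0.
  by move=> t0; rewrite /translating /posp !max_r.
have FUG x t : F x t <= translating x t <= G x t by rewrite FU UG.
have Gmono x s t : s <= t -> G x s <= G x t.
  move=> st; have ps : posp s <= posp t by rewrite /posp ge_max !le_max st lexx !orbT.
  have psT : posp (s - T) <= posp (t - T).
    by rewrite /posp ge_max !le_max lerD2r st lexx !orbT.
  rewrite /G /upper_level lerD ?lerB ?ler_wpM2l ?(ltW k20)//.
  apply: (level_mono c2 D0 up_c up_d); first by rewrite le_min posp_ge0 ltW.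
  by rewrite le_min !ge_min ps lexx orbT.
have Fsub x t : 0 < t -> sub_at phi psi F x t.
  by move=> t0; exact: (lower_level_sub rphi hpsi EE ZZ EZ eta0 c2 vc vA kg dv dv1).
have Gsup x t : 0 < t -> super_at phi psi G x t.
  move=> t0; exact: (upper_level_super rphi hpsi EE ZZ EZ eta0 c2 vc kg dv dv1 T0 erefl k20 M2 t0).
have [w [ws wb]] := perron_between n0 rphi hpsi L0 c20 ULip Uinit translating_time FUG FL GL Gmono Fsub Gsup.
exists w; split=> // x t t0 tT; have /andP[b1 b2] := wb x t.
have lh : 0 < level_at E Z h (cst 1) x t := level_gt0 c0 ler01 hc one1 _ _ t0.
have e2 := lowh t x t0; have e3 := upl t x t0 tT.
move: b1 b2; rewrite /F /G /lower_level /upper_level /translating (pospE t t0).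
rewrite (min_l tT) [posp (t - T)]/posp max_r ?subr_le0// mulr0 addr0 subrK.
set Lh := level_at E Z h _ x t in lh e2 e3 *.
move: (level_at E Z v _ x t) (level_at E Z (upper_profile v ell) _ x t) e2 e3 => lv lu e2 e3 b1 b2.
have q0 : 0 < 1 - 2 * dl by lra.
move: e3; rewrite ler_pdivlMl// => e3.
have f1 : (1 - 2 * dl) * Lh <= k1 * lv.
  have d1 : 0 < 1 + dl by lra.
  rewrite -(ler_pM2l d1); apply: (@le_trans _ _ (k1 * Lh)).
    rewrite mulrA; apply: ler_wpM2r; first exact: ltW.
    by have := sqr_ge0 dl; rewrite /k1; lra.
  by have := ler_wpM2l (ltW k10) e2; lra.
have f2 : k2 * lu <= (1 + 8 * dl) * Lh.
  rewrite -(ler_pM2l q0); apply: (@le_trans _ _ (k2 * Lh)).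
    by have := ler_wpM2l (ltW k20) e3; lra.
  rewrite mulrA; apply: ler_wpM2r; first exact: ltW.
  by have := ler_wpM2l (ltW dl0) dl8; rewrite /k2; lra.
have dLh : 0 <= dl * Lh by rewrite mulr_ge0 ?ltW.
have -> : eps = 8 * dl by rewrite dlE; lra.
by rewrite ler_norml; apply/andP; split; move: b1 b2 f1 f2 dLh; lra.
Qed.

End good_solution.

(** * Uniform convergence, diagonal selection, coercivity *)

Section uniform_convergence.
Context {R : realType}.

Lemma uniform_seqP (T : choiceType) (K : set T) (f_ : nat -> T -> R) (f : T -> R) :
  {uniform K, f_ @ \oo --> f} <->
  forall e : R, 0 < e -> exists n, forall k, (n <= k)%N ->
    forall x, K x -> `|f_ k x - f x| <= e.
Proof.
split=> [H e e0|H Q /uniform_nbhs[B [/= entB BQ]]].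
  have : nbhs (f : {uniform` K -> R}) [set g : {uniform` K -> R} | forall y, K y -> `|f y - g y| < e].
    apply/uniform_nbhs; exists [set xy : R * R | `|xy.1 - xy.2| < e]; split=> //.
    by rewrite -entourage_ballE; exists e.
  move=> /H [n _ Hn]; exists n => k nk x Kx.
  by rewrite distrC ltW//; exact: Hn.
have [e /= e0 eB] : exists2 e : R, 0 < e & [set xy | ball xy.1 e xy.2] `<=` B.
  by move: entB; rewrite -entourage_ballE => -[e e0 eB]; exists e.
have e2 : 0 < e / 2 by rewrite divr_gt0.
have [n Hn] := H _ e2; exists n => // k nk /=; apply: BQ => x Kx; apply: eB.
by rewrite /ball /= distrC; have := Hn k nk x Kx; lra.
Qed.

Lemma closed_ball_compact n (P : R) : compact [set q : 'rV[R]_n | `|q| <= P].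
Proof.
have [P0|P0] := leP 0 P; last first.
  rewrite (_ : [set q | _] = set0); first exact: compact0.
  by apply/seteqP; split=> // q /= /(le_trans (normr_ge0 q)); rewrite leNgt P0.
apply: bounded_closed_compact.
  by exists P; split=> [|x Px q /= qP]; [exact: num_real|exact: le_trans (ltW Px)].
rewrite (_ : [set q | _] = (fun q : 'rV[R]_n => `|q|) @^-1` [set x | x <= P])//.
apply: closed_comp => [q _|]; [exact: norm_continuous|exact: closed_le].
Qed.

Lemma family_seq n (f_ : nat -> 'rV[R]_n -> R) (f : 'rV[R]_n -> R) :
  {family compact, f_ @ \oo --> f} ->
  forall P e : R, 0 < e -> exists K, forall k, (K <= k)%N ->
    forall q, `|q| <= P -> `|f_ k q - f q| <= e.
Proof.
move=> /fam_cvgP H P e e0.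
by have /uniform_seqP/(_ e e0) := H _ (@closed_ball_compact n P).
Qed.

(* Diagonal selection: w_ k is taken at the finest scale 1 / (j + 1), j <= k,
   available for k. *)
Lemma diagonal_selection (T : Type) (Q : nat -> T -> Prop) (P : R -> T -> Prop) :
  (forall e e' w, 0 < e -> e <= e' -> P e w -> P e' w) ->
  (forall k, exists w, Q k w) ->
  (forall e, 0 < e -> exists K, forall k, (K <= k)%N -> exists w, Q k w /\ P e w) ->
  exists w_ : nat -> T, (forall k, Q k (w_ k)) /\
    forall e, 0 < e -> exists K, forall k, (K <= k)%N -> P e (w_ k).
Proof.
move=> Pmono Qex PQ; pose s (j : nat) : R := j.+1%:R^-1.
have s0 j : 0 < s j by rewrite invr_gt0.
pose ok k j := exists w, Q k w /\ P (s j) w.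
have /choice[w_ Hw] k : exists w, Q k w /\ forall j, (j <= k)%N -> ok k j -> P (s j) w.
  have [[j0 [jk0 j0ok]]|none] := pselect (exists j, (j <= k)%N /\ ok k j); last first.
    have [w Qw] := Qex k; exists w; split=> // j jk jok; exfalso; apply: none.
    by exists j.
  have ex : exists j, (fun j => (j <= k)%N && `[< ok k j >]) j.
    by exists j0; rewrite jk0; exact/asboolP.
  have bd : forall j, (fun j => (j <= k)%N && `[< ok k j >]) j -> (j <= k)%N by move=> j /andP[].
  case: (ex_maxnP ex bd) => m /andP[mk /asboolP[w [Qw Pw]]] mmax.
  exists w; split=> // j jk jok; apply: (Pmono (s m)) => //.
  by rewrite /s lef_pV2 ?posrE// ler_nat ltnS mmax// jk; exact/asboolP.
exists w_; split=> [k|e e0]; first by have [] := Hw k.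
have [j sj] : exists j, s j <= e.
  have [m me] : exists m, e^-1 < m.+1%:R.
    exists (Num.truncn e^-1); apply: lt_le_trans (truncnS_gt _) _; exact: lexx.
  exists m; rewrite /s -[leRHS]invrK lef_pV2 ?posrE ?invr_gt0//; exact: ltW.
have [K HK] := PQ (s j) (s0 j); exists (maxn K j) => k; rewrite geq_max => /andP[Kk jk].
apply: (Pmono (s j)) => //; have [_] := Hw k; apply=> //.
exact: HK.
Qed.

(** Adding an affine function to the profile translates the set, so the origin may be placed inside
    it. [a] is the slope of the chord over [[- P, P]]; the height [mu] of the chord above [f 0]
    forces growth at the rate [mu / P] on both sides, and [b] takes care of the middle. *)
Lemma coercive_normalization (f : R -> R) (B P : R) : convex3 f -> 0 <= B ->
  (forall p q, `|f p - f q| <= B * `|p - q|) -> 1 <= P ->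
  2 * f 0 < f P + f (- P) ->
  exists a b c : R, 0 < c /\ forall p, c * (1 + `|p|) <= f p - (a * p - b).
Proof.
move=> cf B0 fB P1 fP; have P0 : 0 < P by lra.
pose mu := (f P + f (- P) - 2 * f 0) / 2; have mu0 : 0 < mu by rewrite /mu; lra.
pose a := (f P - f (- P)) / (2 * P).
have aP : a * P = (f P - f (- P)) / 2 by rewrite /a; field; rewrite gt_eqF.
have aB : `|a| * P <= B * P.
  rewrite -[X in _ * X <= _](gtr0_norm P0) -normrM aP.
  have := fB P (- P); rewrite (_ : P - - P = 2 * P); last by lra.
  have P2 : 0 < 2 * P by lra.
  rewrite (gtr0_norm P2) !ler_norml => /andP[? ?]; apply/andP; split; lra.
pose b := 2 * B * P + mu + mu / P - f 0.
exists a, b, (mu / P); split=> [|p]; first exact: divr_gt0.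
have BP : 0 <= B * P by rewrite mulr_ge0// ltW.
have mP : mu / P * P = mu by field; rewrite gt_eqF.
have muP : 0 <= mu * P by rewrite mulr_ge0// ltW.
have mP0 : 0 < mu / P by exact: divr_gt0.
have key x y : x * P <= y * P -> x <= y by rewrite ler_pM2r.
have [pP|Pp] := leP `|p| P.
  have := fB p 0; rewrite subr0 ler_norml => /andP[f1 f2].
  have f3 : B * `|p| <= B * P by rewrite ler_wpM2l.
  have f4 : `|a * p| <= `|a| * P by rewrite normrM ler_wpM2l.
  have f5 := ler_norm (a * p).
  have f6 : mu / P * `|p| <= mu / P * P by rewrite ler_pM2l.
  by rewrite /b; lra.
move: Pp; have [p0|p0] := ger0P p => Pp.
  have := cf 0 P p (ltW P0) (ltW Pp); rewrite subr0 => f1.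
  apply: key; rewrite /b.
  have f2 : (f P - f 0) * (p - P) = (mu + a * P) * (p - P) by rewrite /mu aP; lra.
  have f3 : mu / P * (1 + p) * P = mu + mu * p by rewrite mulrAC mP; lra.
  have f4 : mu / P * P = mu := mP.
  have f5 : 0 <= B * P * P by rewrite mulr_ge0// ltW.
  rewrite f3; have -> : (f p - (a * p - (2 * B * P + mu + mu / P - f 0))) * P =
    (f p - f 0) * P - a * P * p + 2 * (B * P * P) + mu * P + mu / P * P by lra.
  rewrite f4; have f6 : (f p - f P) * P = (f p - f 0) * P - (f P - f 0) * P by lra.
  have f7 : f P - f 0 = mu + a * P by rewrite /mu aP; lra.
  by move: f1 f6; rewrite f7; lra.
have Pp' : p <= - P by lra. have NP : - P <= 0 by lra.
have := cf p (- P) 0 Pp' NP; rewrite sub0r opprK => f1.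
apply: key; rewrite /b.
have f7 : f (- P) - f 0 = mu - a * P by rewrite /mu aP; lra.
have f3 : mu / P * (1 + - p) * P = mu - mu * p by rewrite mulrAC mP; lra.
have f5 : 0 <= B * P * P by rewrite mulr_ge0// ltW.
rewrite f3; have -> : (f p - (a * p - (2 * B * P + mu + mu / P - f 0))) * P =
    (f p - f 0) * P - a * P * p + 2 * (B * P * P) + mu * P + mu / P * P by lra.
rewrite mP; have f8 : (f (- P) - f p) * P = (f (- P) - f 0) * P - (f p - f 0) * P by lra.
have f9 : f 0 - f (- P) = - (mu - a * P) by lra.
by move: f1; rewrite f8 f9 f7; lra.
Qed.

End uniform_convergence.

(** * Existence of the limit profile *)

Section profile_existence.
Context {R : realType} {n : nat} (phi psi : 'rV[R]_n -> R) (E Z : 'rV[R]_n).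
Hypothesis hphi : is_norm phi.
Hypothesis hpsi : is_norm psi.
Hypothesis EE : dot E E = 1.
Hypothesis ZZ : dot Z Z = 1.
Hypothesis EZ : dot E Z = 0.
Implicit Types (p q x : R).

Lemma tension_convex : convex3 (tension phi E Z).
Proof.
move=> p q r pq qr; have rp : 0 <= r - p by lra.
have H : (r - p) *: nrm E Z q = (r - q) *: nrm E Z p + (q - p) *: nrm E Z r.
  rewrite /nrm !scalerBr !scalerA addrACA -scalerDl -opprD -scalerDl.
  by congr (_ *: _ - _ *: _); lra.
have : (r - p) * tension phi E Z q <=
    (r - q) * tension phi E Z p + (q - p) * tension phi E Z r.
  have := norm_triangle hphi ((r - q) *: nrm E Z p) ((q - p) *: nrm E Z r).
  rewrite -H !(normZ hphi) (ger0_norm rp) (ger0_norm (_ : 0 <= r - q)) ?subr_ge0//.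
  by rewrite (ger0_norm (_ : 0 <= q - p)) ?subr_ge0.
lra.
Qed.

Lemma tension_close (phi_ : nat -> 'rV[R]_n -> R) :
  {family compact, phi_ @ \oo --> phi} ->
  forall P e : R, 0 < e -> exists K, forall k, (K <= k)%N ->
    [/\ forall x, `|x| <= P -> `|tension (phi_ k) E Z x - tension phi E Z x| <= e,
        `|phi_ k E - phi E| <= e & `|phi_ k Z - phi Z| <= e].
Proof.
move=> /family_seq H P e e0; have [K HK] := H (`|Z| + `|P| * `|E| + `|E|) e e0.
have PE : 0 <= `|P| * `|E| by rewrite mulr_ge0.
exists K => k Kk; split=> [x xP||]; apply: HK => //.
- apply: le_trans (ler_normB _ _) _; rewrite normrZ.
  have : `|x| * `|E| <= `|P| * `|E|.
    by apply: ler_wpM2r => //; apply: le_trans xP (ler_norm _).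
  by have := normr_ge0 E; lra.
- by have := normr_ge0 Z; lra.
by have := normr_ge0 E; lra.
Qed.

Lemma profile_exists : exists (h : R -> R) (c A : R),
  [/\ 0 < c, forall p, c * (1 + `|p|) <= h p, forall p, h p <= A * (1 + `|p|) &
  forall phi_ : nat -> 'rV[R]_n -> R, (forall k, regular_norm (phi_ k)) ->
  {family compact, phi_ @ \oo --> phi} ->
  forall eps eta0 : R, 0 < eps -> 0 < eta0 -> exists K, forall k, (K <= k)%N ->
  exists (eta : R) (v v1 : R -> R), [/\ 0 < eta, eta <= eta0,
    forall p : R, is_derive p 1 v (v1 p),
    forall p : R, is_derive p 1 v1 (curvature (phi_ k) psi E Z p / (1 + eta * rho p)) &
    forall p, `|v p - h p| <= eps * h p]].
Proof.
have [[phi0 [r0 c0]]|none] := pselect (exists phi_ : nat -> 'rV[R]_n -> R,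
  (forall k, regular_norm (phi_ k)) /\ {family compact, phi_ @ \oo --> phi}); last first.
  (* Without any sequence of regular norms tending to [phi] the approximation clause is vacuous, and
     every coercive profile of linear growth serves. *)
  exists (fun p => 1 + `|p|), 1, 1; split=> // [p|p|phi_ rp cp].
  - by rewrite mul1r.
  - by rewrite mul1r.
  by exfalso; apply: none; exists phi_.
pose s := phi E; pose z := phi Z.
have s0 : 0 < s := norm_gt0 hphi (E_neq0 EE).
have z0 : 0 <= z := norm_ge0 hphi Z.
pose S := s + z + 1; have S0 : 0 <= S by rewrite /S; lra.
pose C := psi E + psi Z.
have C0 : 0 <= C by rewrite addr_ge0// (norm_ge0 hpsi).
pose B := 8 * C * S; have B0 : 0 <= B by rewrite mulr_ge0// mulr_ge0.
pose om := mobility psi E Z; pose g := tension phi E Z.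
have omC p : 0 <= om p <= C * (1 + `|p|) := mobility_bounds E Z hpsi p.
have omL p q : `|om p - om q| <= psi E * `|p - q| := nrm_lipschitz E Z p q hpsi.
have om0 p : 0 < om p := mobility_gt0 hpsi ZZ EZ p.
have half : 0 < 2^-1 :> R by rewrite invr_gt0.
have [K0 HK0] := tension_close c0 0 half.
(* Dropping [K0] terms bounds all norms at [E] and [Z] by the common constant [S]. *)
pose ph k := phi0 (k + K0)%N.
have phS k : ph k E <= S /\ ph k Z <= S.
  have [_] := HK0 (k + K0)%N (leq_addl _ _); rewrite !ler_norml -/(ph k).
  by move=> /andP[? ?] /andP[? ?]; rewrite /S /s /z; split; have := s0; have := z0; rewrite /s /z; lra.
have /choice[hk dk] k : exists h, datum om S B (tension (ph k) E Z) h.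
  have [h1 h2] := phS k; exact: (datum_exists (r0 (k + K0)%N) hpsi EE ZZ EZ h1 h2).
have gkg (P e : R) : 0 < e -> exists K, forall k, (K <= k)%N ->
    forall x, `|x| <= P -> `|tension (ph k) E Z x - g x| <= e.
  move=> e0; have [K HK] := tension_close c0 P e0; exists K => k Kk.
  by have [] := HK (k + K0)%N (leq_trans Kk (leq_addr _ _)).
pose f := hhat hk.
have fconv : convex3 f := hhat_convex omL omC om0 C0 S0 B0 dk gkg.
have fB p q : `|f p - f q| <= B * `|p - q| := hhat_lipschitz omL omC C0 S0 B0 dk gkg p q.
(* As [g p >= |p| s - z] and [g 0 = z], the midpoint inequality of [g] is strict at this
   distance. *)
pose P0 := Num.max 1 ((2 * z + 1) / s).
have P01 : 1 <= P0 by rewrite le_max lexx.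
have P0s : 2 * z + 1 <= P0 * s by rewrite -ler_pdivrMr// le_max lexx orbT.
have g0E : g 0 = z by rewrite /g /tension /nrm scale0r subr0.
have P0n : `|P0| = P0 by rewrite ger0_norm//; lra.
have nonaff : 2 * g 0 < g P0 + g (- P0).
  have := nrm_coercive E Z P0 hphi; have := nrm_coercive E Z (- P0) hphi.
  by rewrite normrN P0n g0E -!/(tension phi E Z _) -/s -/z -/g; lra.
have := hhat_nonaffine omL omC om0 C0 S0 B0 dk gkg P01 nonaff.
move=> /(coercive_normalization fconv B0 fB P01)[a [b [c [cpos hc]]]].
exists (fun p => f p - (a * p - b)), c, (`|f 0| + B + `|a| + `|b|); split=> // [p|].
  have := fB p 0; rewrite subr0 => /(le_trans (ler_norm _)) i1.
  have := ler_norm (f 0); have := ler_norm (- (a * p)); have := ler_norm b.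
  rewrite normrN normrM => i2 i3 i4; have := normr_ge0 p; have := normr_ge0 a.
  have : 0 <= (`|f 0| + `|b|) * `|p| by rewrite mulr_ge0// addr_ge0.
  lra.
move=> phi_ rp cp eps eta0 eps0 eta00.
(* The error [5 e (1 + |p|)] of [approx_two_sided] becomes [eps c (1 + |p|)], which is at most [eps]
   times the profile. *)
have e0 : 0 < eps * c / 5 by rewrite divr_gt0// mulr_gt0.
have gs p : `|p| * s - z <= g p := nrm_coercive E Z p hphi.
have g0z : g 0 <= z by rewrite g0E.
have [eta [P [dl [eta_gt0 etale P1 dl0 H]]]] :=
  approx_two_sided B0 C0 z0 fconv fB tension_convex g0z gs omC e0 eta00.
(* The limit was built from [phi0]; the data of the given sequence [phi_] are compared with it
   here. *)
have [dl' dl'0 Hc] := hhat_close omL omC C0 S0 B0 dk gkg P1 dl0.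
pose m := Num.min 2^-1 (Num.min dl dl').
have m0 : 0 < m by rewrite !lt_min half dl0 dl'0.
have m1 : m <= 2^-1 by rewrite ge_min lexx.
have m2 : m <= dl by rewrite !ge_min lexx orbT.
have m3 : m <= dl' by rewrite !ge_min lexx !orbT.
have [K HK] := tension_close cp (P + 1) m0.
exists K => k Kk; have [gk Ek Zk] := HK k Kk.
move: Ek Zk; rewrite !ler_norml => /andP[_ Ek] /andP[_ Zk].
have ES : phi_ k E <= S by rewrite /S /s; move: z0; rewrite /z; lra.
have ZS : phi_ k Z <= S by rewrite /S /z; move: s0; rewrite /s; lra.
have hpk : is_norm (phi_ k) by have [] := rp k.
have [u du] := datum_exists (rp k) hpsi EE ZZ EZ ES ZS.
have near p : `|p| <= P -> `|u p - f p| <= dl.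
  apply: (Hc _ _ du) => x xP; exact: le_trans (gk x xP) m3.
have [g1 [g2 [u1 [[dg dg1] g20 _ [dU dU1] [uB _]]]]] := du.
have tg p : is_derive p 1 (tension (phi_ k) E Z) (tension1 (phi_ k) E Z p) :=
  tension_derive (rp k) ZZ EZ p.
have tg1 p : is_derive p 1 (tension1 (phi_ k) E Z) (tension2 (phi_ k) E Z p) :=
  tension_derive2 (rp k) ZZ EZ p.
have g1E : g1 = tension1 (phi_ k) E Z.
  by apply/funext => p; rewrite -(@derive_val _ _ _ _ _ _ _ (dg p)) (@derive_val _ _ _ _ _ _ _ (tg p)).
have g2E : g2 = tension2 (phi_ k) E Z.
  apply/funext => p; rewrite -(@derive_val _ _ _ _ _ _ _ (dg1 p)) g1E.
  by rewrite (@derive_val _ _ _ _ _ _ _ (tg1 p)).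
have [] := H (tension (phi_ k) E Z) g1 g2 u u1 dg dg1 (fun p => ltW (g20 p)) _ dU dU1 uB.
- move=> p q; apply: le_trans (nrm_lipschitz E Z p q hpk) _.
  by apply: ler_wpM2r => //; rewrite /s; lra.
- by rewrite g2E; exact: (curvature_continuous (rp k) hpsi ZZ EZ).
- move=> p pP; split; last exact: near.
  by apply: le_trans (gk p _) m2; lra.
move=> v [v1 [dv dv1 vf]].
exists eta, (fun p => v p - (- b + a * p)), (fun p => v1 p - a); split=> //.
- by move=> p; exact: (derB (dv p) (der_aff (- b) a p)).
- move=> p; apply: der_eq (derB (dv1 p) (der_cst a p)) _.
  by rewrite subr0 g2E.
move=> p; rewrite (_ : _ - _ = v p - f p); last by lra.
apply: le_trans (vf p) _; have := ler_wpM2l (ltW eps0) (hc p).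
lra.
Qed.

End profile_existence.

(** * The translating level function solves the flow *)

Section translating_flow.
Context {R : realType} {n : nat} (phi psi : 'rV[R]_n -> R) (E Z : 'rV[R]_n).
Hypothesis n0 : (0 < n)%N.
Hypothesis hphi : is_norm phi.
Hypothesis hpsi : is_norm psi.
Hypothesis EE : dot E E = 1.
Hypothesis ZZ : dot Z Z = 1.
Hypothesis EZ : dot E Z = 0.
Variables (h : R -> R) (c A : R).
Hypothesis c0 : 0 < c.
Hypothesis hc : forall p, c * (1 + `|p|) <= h p.
Hypothesis hA : forall p, h p <= A * (1 + `|p|).

Local Notation U := (translating E Z h).
Local Notation lvl := (level_at E Z h (cst 1)).

Let one1 (p : R) : (0 : R) <= cst (1 : R) p <= 1 * (1 + `|p|).
Proof. by rewrite /= ler01 mul1r lerDl normr_ge0. Qed.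

Lemma translating_modulus : modulus ((n%:R * `|E| + n%:R * `|Z|) / c) U.
Proof.
have := @level_modulus R n E Z h (cst 1) c 1 1 (@posp R) 1 c0 ler01 ler01 hc one1
  (@posp_ge0 R) ler01 _.
case=> [s t|H1 H2]; first by rewrite mul1r; exact: posp_lipschitz.
split=> [x y s|e /H2[M M0 H]].
  by have := H1 x y s; rewrite /translating !mul1r.
by exists M => // x s t; have := H x s t; rewrite /translating !mul1r.
Qed.

Lemma translatingE x (t : R) : 0 <= t -> U x t = lvl x t - 1.
Proof. by move=> t0; rewrite /translating /posp max_l. Qed.

Lemma translating_unif_continuous : unif_continuous (U^~ 0).
Proof.
apply/unif_continuousP => e e0; have [L _] := translating_modulus.
set K := (_ / c) in L.
have K0 : 0 <= K.
  by rewrite /K divr_ge0 ?(ltW c0)// addr_ge0// mulr_ge0.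
have K1 : 0 < K + 1 by rewrite ltr_wpDl.
exists (e / (K + 1)) => /= [|[x y]]; first exact: divr_gt0.
rewrite -!ball_normE /ball_ /= ltr_pdivlMr// => xy.
apply: le_lt_trans (L x y 0) _; apply: le_lt_trans xy; rewrite mulrC.
by apply: ler_wpM2l => //; rewrite lerDl.
Qed.

Hypothesis approx : forall phi_ : nat -> 'rV[R]_n -> R,
  (forall k, regular_norm (phi_ k)) -> {family compact, phi_ @ \oo --> phi} ->
  forall eps eta0 : R, 0 < eps -> 0 < eta0 -> exists K, forall k, (K <= k)%N ->
  exists (eta : R) (v v1 : R -> R), [/\ 0 < eta, eta <= eta0,
    forall p : R, is_derive p 1 v (v1 p),
    forall p : R, is_derive p 1 v1 (curvature (phi_ k) psi E Z p / (1 + eta * rho p)) &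
    forall p, `|v p - h p| <= eps * h p].

(** The error controlled by [P e] is relative to [U + 1] and holds up to time [1 / e]; this suffices
    for uniform convergence on compact sets. *)
Lemma translating_solution : level_set_solution phi psi (U^~ 0) (unc U).
Proof.
split=> //.
  exact: continuous_subspaceT (modulus_continuous translating_modulus).
move=> phi_ rp cp.
pose Q k (w : 'rV[R]_n -> R -> R) :=
  viscosity_solution (phi_ k) psi (U^~ 0) (fun z => w z.1 z.2).
pose P (e : R) (w : 'rV[R]_n -> R -> R) := forall x t, 0 <= t -> t <= e^-1 ->
  `|w x t - U x t| <= e * (U x t + 1).
have U1 x t : 0 <= t -> 0 <= U x t + 1.
  move=> t0; rewrite translatingE// subrK ltW//.
  exact: (level_gt0 c0 ler01 hc one1).
have Pmono (e e' : R) w : 0 < e -> e <= e' -> P e w -> P e' w.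
  move=> e0 ee H x t t0 te; apply: le_trans (H x t t0 _) _.
    by apply: le_trans te _; rewrite lef_pV2 ?posrE// (lt_le_trans e0).
  by apply: ler_wpM2r => //; exact: U1.
(* Trapped solutions are available for large [k] only. For the other indices any viscosity solution
   will do: the paraboloid barriers alone produce one around the constant extension of the initial
   datum. *)
have Qex k : exists w, Q k w.
  have [L1 _] := translating_modulus; set L := (_ / c) in L1.
  have L0 : 0 <= L by rewrite /L divr_ge0 ?(ltW c0)// addr_ge0// mulr_ge0.
  have Lp : 0 < L + 1 by rewrite ltr_wpDl.
  have ULip x y : `|U x 0 - U y 0| <= (L + 1) * `|x - y|.
    by apply: le_trans (L1 x y 0) _; rewrite ler_wpM2r// lerDl.
  have NLip x y : `|(- U x 0) - (- U y 0)| <= (L + 1) * `|x - y| by rewrite -opprD normrN.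
  have [C C0 FC] := flow_scalar_bounded (rp k) hpsi.
  pose bl := barrier (U^~ 0) (L + 1) 0 C.
  pose bu x t := - barrier (fun x => - U x 0) (L + 1) 0 C x t.
  have blU x t : bl x t <= U x 0.
    have [t0|/ltW t0] := leP t 0; first by rewrite /bl (barrier_init 0 Lp C0 ULip x t0).
    by have := barrier_upper 0 Lp C0 ULip x t0; rewrite mul0r subr0.
  have Ubu x t : U x 0 <= bu x t.
    have [t0|/ltW t0] := leP t 0.
      by rewrite /bu (barrier_init 0 Lp C0 NLip x t0) opprK.
    by have := barrier_upper 0 Lp C0 NLip x t0; rewrite mul0r subr0 /bu lerNr.
  have := @perron_between R n (phi_ k) psi n0 (rp k) hpsi (U^~ 0) (fun x _ => U x 0) bl bu
    (L + 1) 0 Lp (lexx 0) ULip.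
  case=> [//|x t t0|x t|||x s t st|x t t0|x t t0|w [Qw _]].
  - by rewrite mul0r addr0 lexx.
  - by rewrite blU Ubu.
  - exact: (barrier_modulus Lp (lexx 0) C0 ULip).
  - exact: modulus_opp (barrier_modulus Lp (lexx 0) C0 NLip).
  - by rewrite lerN2; exact: (barrier_anti Lp (lexx 0) C0 NLip x st).
  - exact: (barrier_sub n0 (rp k) hpsi Lp (lexx 0) C0 FC ULip t0).
  - rewrite /super_at; have -> : (fun x t => - bu x t) =
        barrier (fun x => - U x 0) (L + 1) 0 C.
      by apply/funext => y; apply/funext => s; rewrite /bu opprK.
    exact: (barrier_sub n0 (rp k) hpsi Lp (lexx 0) C0 FC NLip t0).
  by exists w.
have PQ (e : R) : 0 < e -> exists K, forall k, (K <= k)%N -> exists w, Q k w /\ P e w.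
  move=> e0; pose f := Num.min 1 e.
  have f0 : 0 < f by rewrite lt_min ltr01.
  have f1 : f <= 1 by rewrite ge_min lexx.
  have fe : f <= e by rewrite ge_min lexx orbT.
  have dl0 : 0 < f / 8 by rewrite divr_gt0.
  have eta00 : 0 < f / 8 * c * f / 4 by rewrite divr_gt0// mulr_gt0// mulr_gt0.
  have [K HK] := approx rp cp dl0 eta00.
  exists K => k /HK[eta [v [v1 [eta0 etale dv dv1 vh]]]].
  have [w [Qw Pw]] := good_solution n0 (rp k) hpsi EE ZZ EZ c0 hc hA f0 f1 erefl
    eta0 etale dv dv1 vh.
  by exists w; split=> //; apply: (Pmono f).
have [w_ [Qw Pw]] := diagonal_selection Pmono Qex PQ.
exists (fun k => unc (w_ k)); split=> // K cK Kpos.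
have [M HM] : exists M : R, forall z, K z -> z.2 <= M /\ unc U z <= M.
  have [M [_ HM]] := compact_bounded cK.
  have cU : compact (unc U @` K).
    apply: continuous_compact => //; apply: continuous_subspaceT.
    exact: modulus_continuous translating_modulus.
  have [M' [_ HM']] := compact_bounded cU.
  pose b := Num.max (M + 1) (M' + 1).
  have b1 : M < b by rewrite lt_max ltrDl ltr01.
  have b2 : M' < b by rewrite lt_max ltrDl ltr01 orbT.
  exists b => z Kz; split.
    have := HM b b1 z Kz; rewrite /= [z]surjective_pairing pair_norm ge_max.
    by move=> /andP[_]; apply: le_trans; exact: ler_norm.
  by apply: le_trans (ler_norm _) _; apply: HM' => //; exists z.
apply/uniform_seqP => e e0.
pose b := `|M| + 1; have b0 : 0 < b by rewrite ltr_wpDl.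
have Mb : M <= b by apply: le_trans (ler_norm M) _; rewrite lerDl.
(* On [K] both the times and [U] are at most [b], so the relative error [f] is at most [e] in
   absolute terms and is valid up to [1 / f >= b]. *)
pose f := Num.min (e / (b + 1)) b^-1.
have bp : 0 < b + 1 by rewrite addr_gt0.
have f0 : 0 < f by rewrite lt_min divr_gt0//= invr_gt0.
have [m Hm] := Pw f f0; exists m => k mk [x t] Kz.
have [t1 U2] := HM _ Kz; have t0 : 0 <= t := Kpos _ Kz.
have tf : t <= f^-1.
  apply: le_trans (le_trans t1 Mb) _; rewrite -[leLHS]invrK lef_pV2 ?posrE ?invr_gt0//.
  by rewrite ge_min lexx orbT.
apply: le_trans (Hm k mk x t t0 tf) _.
have f2 : f * (b + 1) <= e by rewrite -ler_pdivlMr// ge_min lexx.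
apply: le_trans f2; apply: ler_wpM2l; first exact: ltW.
by rewrite lerD2r; exact: le_trans U2 Mb.
Qed.

Definition translating_set (t : R) : set 'rV[R]_n := [set q | lvl q t <= 1].

Lemma translating_boundary (t : R) : 0 <= t ->
  bd (translating_set t) = [set q | U q t = 0].
Proof.
move=> t0; rewrite /translating_set (boundary_level ZZ EZ c0 hc t0).
apply/seteqP; split=> q /=; rewrite translatingE//.
  by move=> /(level_eq1 ZZ EZ c0 hc q t0).2 ->; rewrite subrr.
by move=> /eqP; rewrite subr_eq0 => /eqP H; apply/(level_eq1 ZZ EZ c0 hc q t0).
Qed.

Lemma translating_is_flow : is_flow phi psi translating_set.
Proof.
exists (U^~ 0), (unc U); split.
- exact: translating_unif_continuous.
- by apply/seteqP; split=> q /=; rewrite translatingE// subr_le0.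
- exact: translating_boundary.
- exact: translating_solution.
exact: translating_boundary.
Qed.

Lemma boundary0 : bd (translating_set 0) = [set q | gauge E Z h q = 1].
Proof.
rewrite /translating_set (boundary_level ZZ EZ c0 hc (lexx 0)).
by apply/seteqP; split=> q /=; rewrite scale0r subr0.
Qed.

Lemma translating_translates (t : R) : 0 <= t ->
  bd (translating_set t) = [set q + t *: Z | q in bd (translating_set 0)].
Proof.
move=> t0; rewrite boundary0 /translating_set (boundary_level ZZ EZ c0 hc t0).
apply/seteqP; split=> [q /= H|_ [q /= H <-]]; last by rewrite /= addrK.
by exists (q - t *: Z); rewrite ?subrK.
Qed.

Lemma translating_hypersurface : complete_hypersurface (bd (translating_set 0)).
Proof.
have Gadd := gauge_add E Z c0 hc; have GZ := gaugeZ E Z c0 hc.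
have GM := gauge_bound E Z c0 hc; have M0 := gauge_const_gt0 E Z c0.
rewrite boundary0; split.
- exact: (boundary_nonempty E ZZ c0 hc).
- exact: (gauge_level_closed Gadd M0 GM).
by move=> q Gq; exact: (gauge_local_graph Gadd GZ M0 GM Gq).
Qed.

End translating_flow.

Theorem proposition3p5 (R : realType) (N : nat) (hN : (1 <= N)%N)
    (phi psi : 'rV[R]_(N + 1) -> R) (hphi : is_norm phi) (hpsi : is_norm psi)
    (e : 'rV[R]_N) (he : dot e e = 1) :
  exists (I : set R) (u : R -> R) (E : R -> set 'rV[R]_(N + 1)),
    [/\ is_interval I,
        @convex_function R R^o I u &
        complete_graphical_translator phi psi
          [set x | I (dot x e)] (fun x => u (dot x e)) E].
Proof.
have EE := horizontal_unit he; have ZZ := @vertical_unit R N.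
have EZ := horizontal_vertical e.
have [h [c [A [c0 hc hA approx]]]] := profile_exists hphi hpsi EE ZZ EZ.
have n0 : (0 < N + 1)%N by rewrite addn1.
exists (interval_of h), (profile h), (translating_set (horizontal e) (vertical) h).
split; [exact: interval_ofP|exact: (@profile_convex R h)|split].
- exact: (translating_is_flow n0 hpsi EE ZZ EZ c0 hc hA approx).
- move=> t t0; rewrite (translating_translates ZZ EZ c0 hc t0).
  by apply/seteqP; split=> _ [q Hq <-]; exists q => //; rewrite point_vertical.
- exact: (translating_hypersurface ZZ EZ c0 hc).
- rewrite openE => x /interval_of_open[r r0 Hr].
  pose b := N%:R * `|e| + 1; have b0 : 0 < b by rewrite ltr_wpDl// mulr_ge0.
  apply/(@near_normP _ _ x); exists (r / b) => [|y]; first exact: divr_gt0.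
  rewrite ltr_pdivlMr// => yx; apply: Hr; rewrite -dotBl.
  apply: le_lt_trans (abs_dot_le _ _) _; apply: le_lt_trans yx; rewrite /b.
  by have := normr_ge0 (y - x); lra.
(* The closed epigraph and the initial set are both [{gauge <= 1}]. *)
rewrite /full_graph (closure_epigraph e c0 hc); congr bd.
apply/seteqP; split=> q; rewrite /translating_set /=;
  have /= := level_le1 ZZ EZ c0 hc q (lexx 0); rewrite scale0r subr0 => H.
  by rewrite H.
by rewrite -H.
Qed.
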